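(* Assume that $u_0,u_1\in\mathbb R^2$ are nonzero vectors that are not parallel, that the operator $\mathtt{Dir}(x+iy,u_0,u_1,f)$ defined on $[0,T)$ satisfies conditions (A)–(C) of the context, and that this operator has a Hilbert–Schmidt inverse. Then the carousel point set $\mathcal{HC}(x+iy,u_0,u_1,f)$ is well defined and it is equal to the spectrum of $\mathtt{Dir}(x+iy,u_0,u_1,f)$.
   Context: Let $J=\begin{pmatrix}0&-1\\1&0\end{pmatrix}$, $0<T\le\infty$. For $x+iy:[0,T)\to\{\Im z>0\}$ and $f:[0,T)\to(0,\infty)$, $\mathtt{Dir}(x+iy,u_0,u_1,f)$ denotes the Dirac operator $$\tau v=R^{-1}Jv',\qquad R=\frac fy\begin{pmatrix}1&-x\\-x&x^2+y^2\end{pmatrix}$$ on functions $v:[0,T)\to\mathbb R^2$ with boundary conditions $u_0,u_1$. Only directions matter, and a nonzero vector $(a,b)^t$ is identified with the boundary point $a/b\in\mathbb R\cup\{\infty\}$ of the upper half plane. Conditions: (A) $R(t)$ is positive definite for all $t\in[0,T)$; (B) $R$ is measurable and $\|R\|,\|R^{-1}\|$ are locally bounded on $[0,T)$; (C) there is a nonzero $u_*\in\mathbb R^2$ with $\int_0^Tu_*^tRu_*\,ds<\infty$. $L^2_R$ is the Hilbert space with $\langle v,w\rangle_R=\int_0^Tv^tRw\,dt$. The operator is limit circle (at $T$) if $\|R\|$ is integrable on $[0,T)$, limit point otherwise. The domain on which $\tau$ is self-adjoint consists of the locally absolutely continuous $v\in L^2_R$ with $\tau v\in L^2_R$, $v(0)^tJu_0=0$,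 and, in the limit circle case, $\lim_{s\to T}v(s)^tJu_1=0$. In the limit point case, by convention $u_1$ is the vector $u_*$ from (C). The spectrum is that of the complexified operator. Normalizing $u_0^tJu_1=1$, the inverse is the integral operator on $L^2_R$ with kernel $(u_0u_1^t\mathbf 1(x<y)+u_1u_0^t\mathbf 1(x\ge y))R(y)$. Hyperbolic carousel: let $\gamma:[0,T)\to$ hyperbolic plane be measurable and locally bounded, $\eta_0\ne\eta_1$ boundary points, $f>0$ locally integrable on $[0,T)$. For $\lambda\in\mathbb R$ let the boundary point $r_\lambda(t)$, $r_\lambda(0)=\eta_0$, be rotated (hyperbolically) about $\gamma(t)$ continuously with rate $2\lambda f(t)$; in the Poincaré disk (via $U(z)=\frac{z-i}{z+i}$), $r_\lambda=e^{i\phi_\lambda}$ with $\phi_\lambda'=2f\lambda\frac{|e^{i\phi_\lambda}-\gamma|^2}{1-|\gamma|^2}$; in the half plane with $\gamma=x+iy$, $r_\lambda'=\lambda f\frac{y^2+(x-r_\lambda)^2}{y}$, continued through $\infty$. Let $N(\cdot)$ be the right-continuous version of $\lambda\mapsto\operatorname{sgn}(\lambda)\cdot|\{t\in[0,T):r_\lambda(t)=\eta_1\}|$. If $N$ is finite, $\mathcal{HC}(\gamma,\eta_0,\eta_1,f)$ is the set of points in $\mathbb R$ whose counting function is $N$; otherwise it is undefined. *)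

(* Defs.v *)
From HB Require Import structures.
From mathcomp Require Import all_boot all_order all_algebra.
From mathcomp Require Import all_classical all_reals all_analysis.
From mathcomp Require Import complex.

Set Implicit Arguments.
Unset Strict Implicit.
Unset Printing Implicit Defensive.

Import Order.TTheory GRing.Theory Num.Theory.
Import numFieldNormedType.Exports.

Local Open Scope classical_set_scope.
Local Open Scope ring_scope.
Local Open Scope complex_scope.

Section HalfOpenInterval.
Context {R : realType}.
Implicit Types T : \bar R.

Definition hointerval T : set R := [set t | 0 <= t /\ (t%:E < T)%E].

(* Neighbourhood filter of the right end point: s -> T from below (the -oo
   case is never used, since 0 < T). *)
Definition right_end T : set_system R :=
  match T with
  | r%:E => r^'-
  | _ => pinfty_nbhs R
  end.

Definition locally_bounded T (V : normedModType R) (g : R -> V) : Prop :=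
  forall b, hointerval T b ->
    exists M : R, forall t, 0 <= t <= b -> `|g t| <= M.

Definition abs_continuous (V : normedModType R) (a b : R) (g : R -> V) : Prop :=
  forall e : R, 0 < e -> exists2 d : R, 0 < d &
    forall (n : nat) (l r : 'I_n -> R),
      (forall i, [/\ a <= l i, l i <= r i & r i <= b]) ->
      trivIset [set: 'I_n] (fun i => `]l i, r i[%classic) ->
      \sum_(i < n) (r i - l i) < d ->
      \sum_(i < n) `|g (r i) - g (l i)| < e.

Definition loc_abs_continuous T (V : normedModType R) (g : R -> V) : Prop :=
  forall b, hointerval T b -> abs_continuous 0 b g.

Definition ae_on T (P : R -> Prop) : Prop :=
  {ae (@lebesgue_measure R), forall t, hointerval T t -> P t}.

End HalfOpenInterval.

Section Matrices.
Context {R : realType}.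

Definition mx22 (a b c d : R) : 'M[R]_2 :=
  \matrix_(i, j) if i == 0 then (if j == 0 then a else b)
                 else (if j == 0 then c else d).

Definition Jmx : 'M[R]_2 := mx22 0 (-1) 1 0.

Definition bform (A : 'M[R]_2) (v w : 'cV[R]_2) : R := (v^T *m A *m w) 0 0.

Definition pos_def (A : 'M[R]_2) : Prop :=
  A^T = A /\ forall v, v != 0 -> 0 < bform A v v.

Definition parallel (u v : 'cV[R]_2) : Prop :=
  exists a b : R, (a, b) != (0, 0) /\ a *: u = b *: v.

End Matrices.

Section DiracOperator.
Context {R : realType}.
Notation mu := (@lebesgue_measure R).
Implicit Types (T : \bar R) (W : R -> 'M[R]_2) (v w g : R -> 'cV[R]_2).
Implicit Types (u : 'cV[R]_2).

Definition dirac_weight (x y f : R -> R) (t : R) : 'M[R]_2 :=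
  (f t / y t) *: mx22 1 (- x t) (- x t) (x t ^+ 2 + y t ^+ 2).

Definition conditionA T W : Prop := forall t, hointerval T t -> pos_def (W t).

Definition conditionB T W : Prop :=
  [/\ forall i j, measurable_fun (hointerval T) (fun t => W t i j),
      locally_bounded T W & locally_bounded T (fun t => invmx (W t))].

Definition sqnorm T W v : \bar R :=
  (\int[mu]_(t in hointerval T) (bform (W t) (v t) (v t))%:E)%E.

Definition conditionC T W : Prop :=
  exists2 u, u != 0 & (sqnorm T W (fun=> u) < +oo)%E.

Definition limit_circle_case T W : Prop :=
  mu.-integrable (hointerval T) (fun t => (`|W t|)%:E).

Definition limit_point_case T W : Prop := ~ limit_circle_case T W.

(* L^2_R is handled through representatives: equality in L^2_R is equality
   almost everywhere on [0, T). *)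
Definition L2 T W v : Prop :=
  (forall i, measurable_fun (hointerval T) (fun t => v t i 0)) /\
  (sqnorm T W v < +oo)%E.

Definition inner T W v w : R :=
  \int[mu]_(t in hointerval T) bform (W t) (v t) (w t).

(* The graph of the self-adjoint realization: v is in the domain and g is a
   representative of tau v = W^-1 J v'. *)
Definition dirac_graph T W u0 u1 v g : Prop :=
  [/\ L2 T W v, L2 T W g, loc_abs_continuous T v,
      ae_on T (fun t => derivable v t 1 /\
                        g t = invmx (W t) *m (Jmx *m derive1 v t)) &
      ((v 0)^T *m Jmx *m u0) 0 0 = 0 /\
      (limit_circle_case T W ->
       ((v s)^T *m Jmx *m u1) 0 0 @[s --> right_end T] --> (0 : R))].

(* Orthonormal sequence with dense linear span. *)
Definition orthonormal_basis T W (e : nat -> R -> 'cV[R]_2) : Prop :=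
  [/\ forall n, L2 T W (e n),
      forall m n, inner T W (e m) (e n) = (m == n)%:R &
      forall v, L2 T W v -> forall eps : R, 0 < eps ->
        exists (n : nat) (c : 'I_n -> R),
          (sqnorm T W (fun t => v t - \sum_(k < n) c k *: e k t)%R < eps%:E)%E].

(* The operator is a bijection from its domain onto L^2_R, its inverse is
   bounded, and the squared norms of the images [w n] under the inverse of an
   orthonormal basis [e n] are summable. *)
Definition has_Hilbert_Schmidt_inverse T W u0 u1 : Prop :=
  [/\ forall v g, dirac_graph T W u0 u1 v g ->
        ae_on T (fun t => g t = 0) -> ae_on T (fun t => v t = 0),
      forall g, L2 T W g -> exists v, dirac_graph T W u0 u1 v g,
      exists C : R, forall v g, dirac_graph T W u0 u1 v g ->
        (sqnorm T W v <= C%:E * sqnorm T W g)%E &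
      exists e w : nat -> R -> 'cV[R]_2,
        [/\ orthonormal_basis T W e,
            forall n, dirac_graph T W u0 u1 (w n) (e n) &
            (\sum_(n <oo) sqnorm T W (w n) < +oo)%E]].

End DiracOperator.

Section ComplexifiedSpectrum.
Context {R : realType}.
Implicit Types (T : \bar R) (W : R -> 'M[R]_2) (u : 'cV[R]_2).
Implicit Types (v g : R -> 'cV[R[i]]_2).

Definition re_part v (t : R) : 'cV[R]_2 := map_mx (@complex.Re R) (v t).
Definition im_part v (t : R) : 'cV[R]_2 := map_mx (@complex.Im R) (v t).

Definition cL2 T W v : Prop := L2 T W (re_part v) /\ L2 T W (im_part v).

Definition csqnorm T W v : \bar R :=
  (sqnorm T W (re_part v) + sqnorm T W (im_part v))%E.

Definition cdirac_graph T W u0 u1 v g : Prop :=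
  dirac_graph T W u0 u1 (re_part v) (re_part g) /\
  dirac_graph T W u0 u1 (im_part v) (im_part g).

(* tau - z is a bijection from the domain onto the complexified L^2_R, with
   bounded inverse. *)
Definition resolvent_set T W u0 u1 : set R[i] := [set z |
  [/\ forall v g, cdirac_graph T W u0 u1 v g ->
        ae_on T (fun t => g t - z *: v t = 0) -> ae_on T (fun t => v t = 0),
      forall h, cL2 T W h -> exists v g, cdirac_graph T W u0 u1 v g /\
        ae_on T (fun t => g t - z *: v t = h t) &
      exists C : R, forall v g, cdirac_graph T W u0 u1 v g ->
        (csqnorm T W v <= C%:E * csqnorm T W (fun t => g t - z *: v t)%R)%E]].

Definition spectrum T W u0 u1 : set R[i] := ~` resolvent_set T W u0 u1.

End ComplexifiedSpectrum.

Section HyperbolicCarousel.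
Context {R : realType}.
Notation mu := (@lebesgue_measure R).
Implicit Types (T : \bar R) (gam : R -> R[i]) (f phi : R -> R).

(* Boundary of the upper half plane; [None] is the point at infinity. *)
Definition boundary : Type := option R.
Implicit Types eta : boundary.

Definition boundary_pt (u : 'cV[R]_2) : boundary :=
  if u 1 0 == 0 then None else Some (u 0 0 / u 1 0).

Definition cayley (z : R[i]) : R[i] := (z - (0 +i* 1)) / (z + (0 +i* 1)).

Definition cayley_boundary eta : R[i] :=
  if eta is Some r then cayley r%:C else 1.

Definition sqmod (z : R[i]) : R := complex.Re z ^+ 2 + complex.Im z ^+ 2.

Definition cis (a : R) : R[i] := cos a +i* sin a.

(* Local boundedness in the hyperbolic plane: the path stays in a hyperbolic
   ball, i.e. in a Euclidean ball of radius < 1 about 0 in the disk model. *)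
Definition carousel_data T gam eta0 eta1 f : Prop :=
  [/\ forall t, hointerval T t -> 0 < complex.Im (gam t),
      measurable_fun (hointerval T) (fun t => complex.Re (gam t)) /\
      measurable_fun (hointerval T) (fun t => complex.Im (gam t)),
      forall b, hointerval T b -> exists2 c : R, c < 1 &
        forall t, 0 <= t <= b -> sqmod (cayley (gam t)) <= c,
      eta0 <> eta1 &
      (forall t, hointerval T t -> 0 < f t) /\
      (forall b, hointerval T b -> mu.-integrable `[0, b] (fun t => (f t)%:E))].

(* [phi] is the angle, in the disk model, of the boundary point started at
   [eta0] and rotated about [gam] with rate [2 * l * f]. *)
Definition carousel_angle T gam eta0 f (l : R) phi : Prop :=
  [/\ cis (phi 0) = cayley_boundary eta0,
      loc_abs_continuous T (phi : R -> R^o) &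
      ae_on T (fun t => derivable (phi : R -> R^o) t 1 /\
        derive1 (phi : R -> R^o) t = 2 * f t * l * (sqmod (cis (phi t) - cayley (gam t))
                                   / (1 - sqmod (cayley (gam t)))))].

Definition signed_hits T eta1 (phi : R -> R -> R) (l : R) : \bar R :=
  ((Num.sg l)%:E *
   counting [set t | hointerval T t /\ cis (phi l t) = cayley_boundary eta1])%E.

(* [N] is the right-continuous version of the signed number of visits, which
   is in particular required to be finite. *)
Definition carousel_counting T gam eta0 eta1 f (N : R -> R) : Prop :=
  carousel_data T gam eta0 eta1 f /\
  exists phi : R -> R -> R,
    (forall l, carousel_angle T gam eta0 f l (phi l)) /\
    (forall l, signed_hits T eta1 phi m @[m --> l^'+] --> (N l)%:E).

(* HC(gam, eta0, eta1, f) is defined and equal to [L]. *)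
Definition carousel_point_set T gam eta0 eta1 f (L : set R) : Prop :=
  exists2 N : R -> R, carousel_counting T gam eta0 eta1 f N &
    forall a b, a < b -> counting (L `&` `]a, b]%classic) = (N b - N a)%:E.

End HyperbolicCarousel.

(* Main.v *)
Require Import Defs.
From mathcomp Require Import all_boot all_order all_algebra.
From mathcomp Require Import all_classical all_reals all_analysis.
From mathcomp Require Import measurable_realfun complex ring lra.

(** In the basis [u0], [uh] (with [uh] the multiple of [u1] such that [u0^T J uh = 1]) the
    operator becomes the canonical system [p' = - l (C p + B q)], [q' = l (A p + C q)], and
    its inverse has an explicit kernel.  Parseval's identity for the rows of this kernel
    turns the Hilbert-Schmidt condition into the integrability of
    [A t * \int_t^T B + B t * \int_0^t A].  Hence the inverse is a small perturbation of a
    finite-rank operator in a suitable weighted sup norm, the Fredholm alternative holds,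
    and the spectrum consists of the real eigenvalues.
    On the other side, twice the angle of the solution started at [u0] in the standard
    frame moves as the carousel does, so that the visits of [eta1] are the zeros of [p].
    The angle increases in time and in [l]; for [l > 0] each level of the form
    [pi / 2 + n pi] is reached before [T] exactly when [l] exceeds a threshold, and Picone's
    identity together with the tail estimates shows that the thresholds are precisely the
    positive eigenvalues, one for each level.  Negative [l] reduce to positive ones by
    changing the sign of [C]. *)

Set Implicit Arguments.
Unset Strict Implicit.
Unset Printing Implicit Defensive.

Import Order.TTheory GRing.Theory Num.Theory.
Import numFieldNormedType.Exports.

Local Open Scope classical_set_scope.
Local Open Scope ring_scope.

(** * Absolutely continuous functions *)

(** The obstacle is the end point [T]. In the limit point case the domain carries no condition
    there, yet the kernel formula and the eigenfunctions need the first coordinate [p] to tend to 0.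
    This is extracted from the boundedness of the inverse: the part of a source beyond [b] produces
    a function that is constant on [[0, b]], so its norm controls the value of [p] at [b]. One small
    quantity then drives both sides, the integral [kap b] of the density over [[b, T)]. Once
    [2 * l ^+ 2 * kap b < 1], a nontrivial solution with [l != 0] has at most one zero of [p] beyond
    [b]. Smallness of [kap] makes the number of visits finite, bounds the energy of truncated
    problems uniformly in the truncation point, and makes the inverse contract on the tail. Elements
    of the weighted space are pointwise representatives, and the kernel formula holds at every [t];
    this is what lets the resolvent be built in a weighted sup norm and its bounds be carried back
    to the energy norm. *)

Section RealInduction.
Context {R : realType}.

(** Real induction: the supremum of the points reachable from [a] is itself reachable and cannot lie
    below [b]. Locality is asked only for pairs straddling [x], which is what a derivative at [x]
    controls. *)
Lemma cousin (P : R -> R -> Prop) (a b : R) : a <= b ->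
  (forall x, a <= x <= b -> exists2 d, 0 < d &
    forall s t, a <= s <= x -> x <= t <= b -> x - d < s -> t < x + d -> P s t) ->
  (forall s t u, s <= t -> t <= u -> P s t -> P t u -> P s u) -> P a b.
Proof.
move=> ab loc tr.
pose S := [set t | a <= t <= b /\ P a t].
have Sa : S a.
  split; first by rewrite lexx.
  have [d d0 h] := loc a (introT andP (conj (lexx a) ab)).
  by apply: h; rewrite ?lexx//; lra.
have Sub : has_ubound S by exists b => t [/andP[]].
have hsS : has_sup S by split=> //; exists a.
set c := sup S.
have ac : a <= c by exact: ub_le_sup.
have cb : c <= b by apply: ge_sup; [exists a|move=> t [/andP[]]].
have [d d0 h] := loc c (introT andP (conj ac cb)).
have [s [/andP[as_ sb] Ps] cs] := sup_adherent d0 hsS.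
have sc : s <= c by apply: ub_le_sup => //; split=> //; rewrite as_.
have Pc : P a c.
  by apply: (tr _ _ _ as_ sc Ps); apply: h; rewrite ?as_ ?lexx//; lra.
have [bc|bc] := leP b c.
  by have -> : b = c by apply/eqP; rewrite eq_le bc.
pose t := Num.min b (c + d / 2).
have ct : c < t by rewrite lt_min bc ltrDl divr_gt0.
have tb : t <= b by rewrite ge_min lexx.
have td : t < c + d.
  by rewrite gt_min; apply/orP; right; rewrite ltrD2l; lra.
have St : S t.
  split; first by rewrite tb (ltW (le_lt_trans ac ct)).
  apply: (tr _ _ _ ac (ltW ct) Pc); apply: h; rewrite ?ac ?lexx ?tb ?(ltW ct)//.
  by rewrite ltrBlDr ltrDl.
by have := ub_le_sup Sub St; rewrite leNgt ct.
Qed.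

End RealInduction.

Section AbsoluteContinuity.
Context {R : realType}.
Notation mu := (@lebesgue_measure R).

(** Differential equations are understood in the sense of Carathéodory, and this predicate is how
    all of them are stated. *)
Definition acdi (a b : R) (f g : R -> R) : Prop :=
  abs_continuous a b (f : R -> R^o) /\
  {ae mu, forall t, a <= t <= b -> is_derive t (1 : R) f (g t)}.

(** Keeping the intervals ordered makes concatenation immediate and yields the disjointness demanded
    by absolute continuity. *)
Fixpoint chain (O : set R) (s t : R) (l : seq (R * R)) : Prop :=
  if l is (x, y) :: l' then
    [/\ s <= x, x <= y, `]x, y[%classic `<=` O & chain O y t l']
  else s <= t.

Lemma chain_le O s t l : chain O s t l -> s <= t.
Proof.
elim: l s => [//|[x y] l IH] s /= [sx xy _ /IH]; lra.
Qed.

Lemma chain_cat O s t u l l' : chain O s t l -> chain O t u l' ->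
  chain O s u (l ++ l').
Proof.
elim: l s => [|[x y] l IH] s /=.
  move=> st; case: l' => [|[x y] l'] /=; first lra.
  by move=> [tx xy xyO c]; split=> //; lra.
by move=> [sx xy xyO c] c'; split=> //; exact: IH.
Qed.

Lemma chain_mem O s t l x y : chain O s t l -> (x, y) \in l ->
  [/\ s <= x, x <= y & y <= t].
Proof.
elim: l s => [//|[x' y'] l IH] s /= [sx xy _ c]; rewrite inE => /orP[/eqP[-> ->]|xl].
  by split=> //; exact: chain_le c.
by have [] := IH _ c xl; split=> //; lra.
Qed.

Lemma chain_nth_lt O s t l i j : chain O s t l -> (i < j < size l)%N ->
  (nth (0, 0) l i).2 <= (nth (0, 0) l j).1.
Proof.
elim: l s i j => [|[x y] l IH] s i [|j]; rewrite ?ltn0 ?andbF//=.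
move=> [sx xy _ c]; case: i => [|i] /= H.
  have jl : (j < size l)%N by [].
  have : nth (0, 0) l j \in l by rewrite mem_nth.
  by case: (nth _ _ j) => u v /(chain_mem c)[].
by apply: (IH y i j c).
Qed.

Lemma chain_length O s t l : measurable O -> chain O s t l ->
  ((\sum_(i <- l) (i.2 - i.1))%:E <= mu (O `&` `[s, t]))%E.
Proof.
move=> mO; elim: l s => [|[x y] l IH] s /=.
  by move=> _; rewrite big_nil measure_ge0.
move=> [sx xy xyO c]; rewrite big_cons /= EFinD.
have yt := chain_le c.
apply: (@le_trans _ _ (mu `]x, y[ + mu (O `&` `]y, t]))%E).
  apply: leeD.
    by rewrite lebesgue_measure_itv/= lte_fin; case: ltP => //= yx; rewrite lee_fin; lra.
  apply: le_trans (IH _ c) _.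
  have -> : O `&` `[y, t] = (O `&` [set y]) `|` (O `&` `]y, t]).
    by rewrite -setIUr (@setU1itv _ _ (BRight t) y false) ?bnd_simp.
  rewrite measureU; first last.
  - apply/seteqP; split=> z //= [[_ ->] [_]]; rewrite in_itv/= ltxx//.
  - by apply: measurableI.
  - by apply: measurableI.
  rewrite (@subset_measure0 _ _ _ mu _ [set y]) ?add0e//.
  - by apply: measurableI.
  - exact: lebesgue_measure_set1.
rewrite -measureU; first last.
- apply/seteqP; split=> z //= []; rewrite !in_itv/= => /andP[_ zy] [_ /andP[yz _]].
  by lra.
- by apply: measurableI.
- by [].
apply: le_measure; rewrite ?inE//.
- by apply: measurableU => //; apply: measurableI.
- by apply: measurableI.
move=> z [zxy|[Oz]].
  split; first exact: xyO.
  by move: zxy; rewrite /= !in_itv/= => /andP[]; lra.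
by rewrite /= !in_itv/= => /andP[yz zt]; split=> //; apply/andP; split; lra.
Qed.

Lemma abs_continuous_chain (a b : R) (f : R -> R) :
  abs_continuous a b (f : R -> R^o) -> forall e, 0 < e ->
  exists2 d, 0 < d & forall O l, chain O a b l ->
    \sum_(i <- l) (i.2 - i.1) < d -> \sum_(i <- l) `|f i.2 - f i.1| < e.
Proof.
move=> acf e e0; have [d d0 h] := acf e e0; exists d => // O l c ld.
have := h (size l) (fun i => (nth (0, 0) l i).1) (fun i => (nth (0, 0) l i).2).
have E F : \sum_(i < size l) F (nth (0, 0) l i) = \sum_(i <- l) F i :> R.
  by rewrite [RHS](big_nth (0, 0)) big_mkord.
rewrite (E (fun i => i.2 - i.1)) (E (fun i => `|f i.2 - f i.1|)); apply=> //.
  move=> i; have : nth (0, 0) l i \in l by rewrite mem_nth.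
  by case: (nth _ _ i) => u v /(chain_mem c).
apply/trivIsetP => i j _ _ ij; apply/seteqP; split=> z //= [].
rewrite !in_itv/= => /andP[iz zi] /andP[jz zj].
have [lij|lji|/val_inj eij] := ltngtP i j; last by rewrite eij eqxx in ij.
  have := @chain_nth_lt _ _ _ _ i j c; rewrite lij ltn_ord => /(_ isT); lra.
have := @chain_nth_lt _ _ _ _ j i c; rewrite lji ltn_ord => /(_ isT); lra.
Qed.

(* The intervals of a chain inside a small neighbourhood [O] of the exceptional
   null set absorb the decrease of [f] at the bad points. *)
Lemma acd_nondecreasing (a b : R) (f g : R -> R) : a <= b ->
  abs_continuous a b (f : R -> R^o) ->
  {ae mu, forall t, a <= t <= b -> is_derive t (1 : R) f (g t) /\ 0 <= g t} ->
  f a <= f b.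
Proof.
move=> ab acf [N [mN N0 NP]].
apply/ler_addgt0Pr => e e0.
have e4 : 0 < e / 2 by lra.
have [d d0 hd] := abs_continuous_chain acf e4.
have Noo : (mu N < +oo)%E by rewrite [X in (X < _)%E]N0 ltry.
have [V [oV NV Vd]] := lebesgue_regularity_outer mN Noo d0.
have mV : measurable V by exact: open_measurable.
have muV : (mu V < d%:E)%E.
  apply: le_lt_trans Vd; rewrite -[X in (_ <= X)%E]add0e -N0 -measureU//.
    apply: le_measure; rewrite ?inE//.
    - by apply: measurableU => //; apply: measurableD.
    - by move=> z Vz; have [Nz|Nz] := pselect (N z); [left|right].
  - by apply: measurableD.
  - by rewrite setDE setICA setICr setI0.
pose k := e / (2 * (b - a + 1)).
have k0 : 0 < k by rewrite divr_gt0// mulr_gt0//; lra.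
(* The decrease of [f] is paid partly by the slope allowance [k], whose total [k * (b - a)] is at
   most [e / 2], partly by the variation over intervals inside [V]. The relation is transitive, so
   [cousin] reduces it to a neighbourhood of each point. *)
pose P s t := exists2 l, chain V s t l &
  f s - f t <= k * (t - s) + \sum_(i <- l) `|f i.2 - f i.1|.
have [] : P a b; last first.
  move=> l cl h.
  have := chain_length mV cl; set S := \sum_(i <- l) _ => Sl.
  have Sd : S < d.
    rewrite -lte_fin; apply: le_lt_trans muV; apply: le_trans Sl _.
    by apply: le_measure; rewrite ?inE//; apply: measurableI.
  have := hd V l cl Sd.
  have : k * (b - a) <= e / 2.
    rewrite /k mulrAC ler_pdivrMr; last by lra.
    by rewrite (_ : e / 2 * _ = e * (b - a) + e); [lra|field].
  move: h; lra.
apply: cousin => // [x xab|s t u st tu [l1 c1 h1] [l2 c2 h2]]; last first.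
  exists (l1 ++ l2); first exact: chain_cat c2.
  by rewrite big_cat/=; lra.
(* At a point of the null set no derivative is known: the whole step is charged to the single
   interval [(s, t)], which lies in [V]. *)
have [Nx|Nx] := pselect (N x).
  have := NV _ Nx => Vx.
  have /nbhs_ballP[r /= r0 rV] := open_nbhs_nbhs (conj oV Vx).
  exists r => // s t /andP[as_ sx] /andP[xt tb] xs tx.
  exists [:: (s, t)] => /=.
    split; rewrite ?lexx//; first lra.
    move=> z /=; rewrite in_itv/= => /andP[sz zt]; apply: rV.
    by rewrite /ball/= ltr_distlC; apply/andP; split; lra.
  rewrite big_seq1/=.
  have : 0 <= k * (t - s) by apply: mulr_ge0; lra.
  by have := ler_norm (- (f t - f s)); rewrite normrN; lra.
have [dfx gx] : is_derive x (1 : R) f (g x) /\ 0 <= g x.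
  by apply: contrapT => H; apply: Nx; apply: NP => /= /(_ xab).
have : h^-1 *: (f (h *: 1 + x) - f x) @[h --> 0^'] --> g x.
  by have [/cvg_ex[l hl] <-] := dfx; rewrite /derive (cvg_lim _ hl).
move=> /cvgrPdist_lt/(_ _ k0)[r /= r0 hr].
have slope y z : x - r < y -> y <= z -> z < x + r -> y = x \/ z = x ->
    f y - f z <= k * (z - y).
  move=> ry yz zr yzx.
  have [->|nyz] := eqVneq y z; first by rewrite !subrr mulr0.
  have {}yz : y < z by rewrite lt_neqAle nyz.
  have {}hr h : `|h| < r -> h != 0 -> - k < h^-1 * (f (h + x) - f x).
    move=> hr0 h0; have := hr h; rewrite /= sub0r normrN => /(_ hr0 h0).
    by rewrite /GRing.scale/= mulr1 => /ltr_normlP[]; lra.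
  case: yzx => [E|E]; subst.
    have : - k < (z - x)^-1 * (f (z - x + x) - f x).
      by apply: hr; [rewrite ltr_norml; apply/andP; split; lra|rewrite subr_eq0 gt_eqF].
    rewrite subrK mulrC ltr_pdivlMr ?subr_gt0//; lra.
  have : - k < (y - x)^-1 * (f (y - x + x) - f x).
    by apply: hr; [rewrite ltr_norml; apply/andP; split; lra|rewrite subr_eq0 lt_eqF].
  rewrite subrK mulrC ltr_ndivlMr ?subr_lt0//; lra.
exists r => // s t /andP[as_ sx] /andP[xt tb] xs tx.
exists [::] => /=; first lra.
rewrite big_nil addr0.
have := slope s x xs sx ltac:(lra) (or_intror erefl).
have := slope x t ltac:(lra) xt tx (or_introl erefl).
lra.
Qed.

End AbsoluteContinuity.

Notation acd := (acdi 0).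

Section AbsoluteContinuityAlgebra.
Context {R : realType}.
Notation mu := (@lebesgue_measure R).
Implicit Types (f g h F : R -> R) (a b c : R).

Lemma ae_imp (P Q : R -> Prop) : (forall t, P t -> Q t) ->
  {ae mu, forall t, P t} -> {ae mu, forall t, Q t}.
Proof. by move=> PQ; apply: filterS => //; exact: (ae_filter_ringOfSetsType mu). Qed.

Lemma ae_and (P Q : R -> Prop) : {ae mu, forall t, P t} -> {ae mu, forall t, Q t} ->
  {ae mu, forall t, P t /\ Q t}.
Proof. by apply: filterS2 => //; exact: (ae_filter_ringOfSetsType mu). Qed.

Lemma ae_imp2 (P Q S : R -> Prop) : (forall t, P t -> Q t -> S t) ->
  {ae mu, forall t, P t} -> {ae mu, forall t, Q t} -> {ae mu, forall t, S t}.
Proof. by move=> PQS p q; apply: ae_imp (ae_and p q) => t []; exact: PQS. Qed.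

Lemma ac_sub a b a' b' f : a <= a' -> b' <= b ->
  abs_continuous a b (f : R -> R^o) -> abs_continuous a' b' (f : R -> R^o).
Proof.
move=> aa bb acf e /acf[d d0 h]; exists d => // n l r lr; apply: h => i.
by have [la lri rb] := lr i; split=> //; [exact: le_trans la|exact: le_trans bb].
Qed.

Lemma ac_dominated_mod (V V' : normedModType R) a b (F : R -> V) (f g : R -> V') M :
  (forall s t, a <= s -> s <= t -> t <= b ->
    `|F t - F s| <= M * (`|f t - f s| + `|g t - g s|)) ->
  abs_continuous a b f -> abs_continuous a b g -> abs_continuous a b F.
Proof.
move=> dom acf acg e e0.
pose k := `|M| + 1.
have k0 : 0 < k by rewrite ltr_wpDl.
have ek : 0 < e / (2 * k) by rewrite divr_gt0// mulr_gt0.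
have [d1 d10 h1] := acf _ ek; have [d2 d20 h2] := acg _ ek.
exists (Num.min d1 d2); first by rewrite lt_min d10.
move=> n l r lr tr; rewrite lt_min => /andP[/(h1 _ _ _ lr tr) {}h1 /(h2 _ _ _ lr tr) {}h2].
apply: (@le_lt_trans _ _ (k * (\sum_(i < n) `|f (r i) - f (l i)| +
                              \sum_(i < n) `|g (r i) - g (l i)|))).
  rewrite -big_split/= mulr_sumr; apply: ler_sum => i _.
  have [al lri rb] := lr i; apply: le_trans (dom _ _ al lri rb) _.
  by rewrite ler_wpM2r ?addr_ge0// /k (le_trans (ler_norm _))// lerDl.
rewrite (_ : e = k * (e / (2 * k) + e / (2 * k))); last by field; rewrite gt_eqF.
by rewrite ltr_pM2l// ltrD.
Qed.

Lemma ac_dominated a b F f g M :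
  (forall s t, a <= s -> s <= t -> t <= b ->
    `|F t - F s| <= M * (`|f t - f s| + `|g t - g s|)) ->
  abs_continuous a b (f : R -> R^o) -> abs_continuous a b (g : R -> R^o) ->
  abs_continuous a b (F : R -> R^o).
Proof. exact: ac_dominated_mod. Qed.

Lemma ac_small a b f : abs_continuous a b (f : R -> R^o) -> forall e, 0 < e ->
  exists2 d, 0 < d & forall s t, a <= s -> s <= t -> t <= b -> t - s < d ->
    `|f t - f s| < e.
Proof.
move=> acf e /acf[d d0 h]; exists d => // s t as_ st tb std.
have := h 1%N (fun=> s) (fun=> t); rewrite !big_ord1; apply=> //.
by apply/trivIsetP => i j _ _; rewrite !ord1 eqxx.
Qed.

Lemma ac_continuous a b f : abs_continuous a b (f : R -> R^o) ->
  {within `[a, b], continuous f}.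
Proof.
move=> acf; apply/subspace_continuousP => x /=; rewrite in_itv/= => /andP[ax xb].
apply/cvgrPdist_lt => e e0.
have [d d0 h] := ac_small acf e0.
rewrite near_withinE; apply/nbhs_ballP; exists d => //= y; rewrite /ball/=.
move=> xyd; rewrite in_itv/= => /andP[ay yb].
have [xy|yx] := leP x y.
  by rewrite distrC; apply: h => //; rewrite -(ger0_norm (x := y - x)) ?subr_ge0// distrC.
by apply: h => //; [exact: ltW|rewrite -(ger0_norm (x := x - y)) ?subr_ge0// ltW].
Qed.

Lemma ac_measurable a b f : abs_continuous a b (f : R -> R^o) ->
  measurable_fun `[a, b] f.
Proof.
by move=> acf; apply: subspace_continuous_measurable_fun => //; exact: ac_continuous.
Qed.

Lemma ac_bounded a b f : abs_continuous a b (f : R -> R^o) ->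
  exists2 M, 0 < M & forall t, a <= t <= b -> `|f t| <= M.
Proof.
move=> acf; have [ab|ba] := leP a b; last first.
  by exists 1 => // t /andP[? ?]; lra.
have cf := ac_continuous acf.
have [c1 _ h1] := EVT_max ab cf; have [c2 _ h2] := EVT_min ab cf.
exists (Num.max `|f c1| `|f c2| + 1).
  by rewrite ltr_wpDl// le_max normr_ge0.
move=> t tab; have /h1 := tab; have /h2 := tab => m1 m2.
have : `|f t| <= Num.max `|f c1| `|f c2|.
  rewrite ler_norml lerNl !le_max; apply/andP; split; apply/orP.
    by right; rewrite -normrN (le_trans _ (ler_norm _))// lerN2.
  by left; rewrite (le_trans _ (ler_norm _)).
by move=> /le_trans; apply; rewrite lerDl.
Qed.

Lemma ae_neq c : {ae mu, forall t : R, t != c}.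
Proof.
exists [set c]; split=> //; first exact: lebesgue_measure_set1.
by move=> t /= /negP; rewrite negbK => /eqP.
Qed.

Lemma ae_itv_ex s t (P : R -> Prop) : s < t -> {ae mu, forall x, P x} ->
  exists2 x, s < x < t & P x.
Proof.
move=> st [N [mN N0 PN]]; apply: contrapT => H.
have : (mu `]s, t[ <= mu N)%E.
  apply: le_measure; rewrite ?inE// => x; rewrite /= in_itv/= => xst.
  by apply: PN => /= Px; apply: H; exists x.
rewrite [X in (_ <= X)%E]N0 lebesgue_measure_itv/= lte_fin st lee_fin; lra.
Qed.

Lemma acd_continuous a b f g : acdi a b f g -> {within `[a, b], continuous f}.
Proof. by move=> [/ac_continuous]. Qed.

Lemma acd_measurable a b f g : acdi a b f g -> measurable_fun `[a, b] f.
Proof. by move=> [/ac_measurable]. Qed.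

Lemma acd_bounded a b f g : acdi a b f g ->
  exists2 M, 0 < M & forall t, a <= t <= b -> `|f t| <= M.
Proof. by move=> [/ac_bounded]. Qed.

Lemma acd_ae a b f g h : acdi a b f g ->
  {ae mu, forall t, a <= t <= b -> g t = h t} -> acdi a b f h.
Proof.
move=> [acf d] gh; split=> //.
by apply: (ae_imp2 _ d gh) => {d gh} t d gh tb; rewrite -gh//; exact: d.
Qed.

Lemma acd_eq a b f g h : acdi a b f g -> (forall t, a <= t <= b -> g t = h t) ->
  acdi a b f h.
Proof. by move=> d gh; apply: acd_ae d _; exact: aeW. Qed.

Lemma acd_cst a b c : acdi a b (fun=> c) (fun=> 0).
Proof.
split; last by apply: aeW => t _; exact: is_derive_cst.
move=> e e0; exists 1 => // n l r _ _ _.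
by rewrite big1// => i _; rewrite subrr normr0.
Qed.

Lemma acd_id a b : acdi a b id (fun=> 1).
Proof.
split; last by apply: aeW => t _; exact: is_derive_id.
move=> e e0; exists e => // n l r lr _; under eq_bigr.
  by move=> i _; have [_ ? _] := lr i; rewrite -(ger0_norm (x := _ - _)) ?subr_ge0//; over.
by [].
Qed.

Lemma acdD a b f f' g g' : acdi a b f f' -> acdi a b g g' ->
  acdi a b (fun t => f t + g t) (fun t => f' t + g' t).
Proof.
move=> [acf df] [acg dg]; split; last first.
  apply: (ae_imp2 _ df dg) => {df dg} t df dg tb.
  by have := is_deriveD (df tb) (dg tb).
apply: (@ac_dominated _ _ _ f g 1) => // s t _ _ _.
by rewrite mul1r (_ : _ - _ = (f t - f s) + (g t - g s)) ?ler_normD//; ring.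
Qed.

Lemma acdM a b f f' g g' : acdi a b f f' -> acdi a b g g' ->
  acdi a b (fun t => f t * g t) (fun t => f' t * g t + f t * g' t).
Proof.
move=> [acf df] [acg dg]; split; last first.
  apply: (ae_imp2 _ df dg) => {df dg} t df dg tb.
  have := is_deriveM (df tb) (dg tb).
  by rewrite (_ : f' t * _ + _ = f t *: g' t + g t *: f' t)// /GRing.scale/=; ring.
have [M M0 hM] := ac_bounded acf; have [N N0 hN] := ac_bounded acg.
apply: (@ac_dominated _ _ _ f g (M + N)) => // s t s0 st tb.
rewrite (_ : _ - _ = g t * (f t - f s) + f s * (g t - g s)); last ring.
apply: le_trans (ler_normD _ _) _; rewrite !normrM mulrDr; apply: lerD.
  apply: ler_wpM2r => //; apply: le_trans (hN t _) _; last by rewrite lerDr ltW.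
  by rewrite tb (le_trans s0).
apply: ler_wpM2r => //; apply: le_trans (hM s _) _; last by rewrite lerDl ltW.
by rewrite s0 (le_trans st).
Qed.

Lemma acdZ a b c f f' : acdi a b f f' -> acdi a b (fun t => c * f t) (fun t => c * f' t).
Proof.
move=> df; apply: acd_eq (acdM (acd_cst a b c) df) _ => t _.
by rewrite mul0r add0r.
Qed.

Lemma acdN a b f f' : acdi a b f f' -> acdi a b (fun t => - f t) (fun t => - f' t).
Proof.
move=> df; have := acdZ (-1) df.
by under eq_fun do rewrite mulN1r; under [X in acdi _ _ _ X]eq_fun do rewrite mulN1r.
Qed.

Lemma acdB a b f f' g g' : acdi a b f f' -> acdi a b g g' ->
  acdi a b (fun t => f t - g t) (fun t => f' t - g' t).
Proof. by move=> df dg; exact: acdD df (acdN dg). Qed.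

(** [f] has bounded range, on which [h] is Lipschitz by the mean value theorem; hence [h'] has to be
    bounded only on bounded sets. *)
Lemma acd_comp a b h h' f g :
  (forall x, is_derive x (1 : R) h (h' x)) ->
  (forall M, exists L, forall x, `|x| <= M -> `|h' x| <= L) ->
  acdi a b f g -> acdi a b (h \o f) (fun t => h' (f t) * g t).
Proof.
move=> dh bh' [acf df]; split; last first.
  by apply: (ae_imp _ df) => {df} t df tb; exact: is_derive1_comp (df tb).
have [M M0 hM] := ac_bounded acf; have [L hL] := bh' M.
apply: (@ac_dominated _ _ _ f f `|L|) => // s t s0 st tb.
have lip x y : `|x| <= M -> `|y| <= M -> x < y -> `|h y - h x| <= L * `|y - x|.
  move=> xM yM xy.
  have [|z zxy ->] := @MVT _ h h' _ _ xy (fun z _ => dh z).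
    apply: continuous_subspaceT => z.
    by apply: differentiable_continuous; apply/derivable1_diffP; have [] := dh z.
  rewrite normrM ler_wpM2r//; apply: hL.
  move: zxy xM yM; rewrite in_itv/= !ler_norml => /andP[? ?] /andP[? ?] /andP[? ?].
  by apply/andP; split; lra.
have fs : `|f s| <= M by apply: hM; rewrite s0 (le_trans st).
have ft : `|f t| <= M by apply: hM; rewrite tb (le_trans s0).
apply: (@le_trans _ _ (`|L| * `|f t - f s|)); last first.
  by rewrite ler_wpM2l// lerDl.
apply: (@le_trans _ _ (L * `|f t - f s|)); last by rewrite ler_wpM2r// ler_norm.
have [E|ne] := eqVneq (f s) (f t); first by rewrite /= E !subrr normr0 mulr0.
have [?|?] := ltP (f s) (f t); first exact: lip.
by rewrite /= distrC [X in _ * X]distrC; apply: lip => //; rewrite lt_neqAle eq_sym ne.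
Qed.

Lemma acd_exp a b f g : acdi a b f g ->
  acdi a b (fun t => expR (f t)) (fun t => expR (f t) * g t).
Proof.
apply: (@acd_comp _ _ expR expR) => M.
exists (expR M) => x /(le_trans (ler_norm _)) xM.
by rewrite ger0_norm ?expR_ge0// ler_expR.
Qed.

Lemma acd_cos a b f g : acdi a b f g ->
  acdi a b (fun t => cos (f t)) (fun t => - sin (f t) * g t).
Proof.
apply: (@acd_comp _ _ cos (fun x => - sin x)) => M.
by exists 1 => x _; rewrite normrN ler_norml sin_geN1 sin_le1.
Qed.

Lemma acd_sin a b f g : acdi a b f g ->
  acdi a b (fun t => sin (f t)) (fun t => cos (f t) * g t).
Proof.
apply: (@acd_comp _ _ sin cos) => M.
by exists 1 => x _; rewrite ler_norml cos_geN1 cos_le1.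
Qed.

Lemma acd_ge0_le a b f g s t : acdi a b f g ->
  {ae mu, forall t, a <= t <= b -> 0 <= g t} ->
  a <= s -> s <= t -> t <= b -> f s <= f t.
Proof.
move=> [acf df] g0 s0 st tb; apply: (@acd_nondecreasing _ _ _ f g) => //.
  exact: ac_sub acf.
apply: (ae_imp2 _ df g0) => {df g0} x df g0 /andP[sx xt].
have xb : a <= x <= b by rewrite (le_trans s0)// (le_trans xt).
by split; [exact: df|exact: g0].
Qed.

Lemma acd_eq0_cst a b f g s t : acdi a b f g ->
  {ae mu, forall t, a <= t <= b -> g t = 0} ->
  a <= s <= b -> a <= t <= b -> f s = f t.
Proof.
move=> df g0.
suff H s' t' : a <= s' -> s' <= t' -> t' <= b -> f s' = f t'.
  move=> /andP[s0 sb] /andP[t0 tb]; have [st|/ltW ts] := leP s t; first exact: H.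
  by symmetry; exact: H.
move=> s0 st tb; apply/eqP; rewrite eq_le; apply/andP; split.
  apply: (acd_ge0_le df) => //.
  by apply: (ae_imp _ g0) => {g0} x g0 xb; rewrite g0.
rewrite -lerN2; apply: (acd_ge0_le (acdN df)) => //.
by apply: (ae_imp _ g0) => {g0} x g0 xb; rewrite g0// oppr0.
Qed.

(** Equality would make the monotone function [f] constant between [s] and [t], against the positive
    derivative at one interior point. *)
Lemma acd_gt0_lt a b f g s t : acdi a b f g ->
  {ae mu, forall t, a <= t <= b -> 0 < g t} ->
  a <= s -> s < t -> t <= b -> f s < f t.
Proof.
move=> df g0 s0 st tb.
have mono x y : a <= x -> x <= y -> y <= b -> f x <= f y.
  move=> x0 xy yb; apply: (acd_ge0_le df) => //.
  by apply: (ae_imp _ g0) => {g0} z g0 zb; exact/ltW/g0.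
rewrite ltNge; apply/negP => ts.
have [x /andP[sx xt] [dx gx]] := ae_itv_ex st (ae_and df.2 g0).
have xb : a <= x <= b by apply/andP; split; lra.
have {gx} := gx xb; have {}dx := dx xb.
have : is_derive x (1 : R) f 0.
  apply: (@near_eq_is_derive _ _ _ (fun=> f s)).
  have : \near x, s < x < t.
    by near=> y; apply/andP; split; near: y; [exact: lt_nbhsr|exact: lt_nbhsl].
  apply: filterS => y /andP[sy yt]; apply/eqP; rewrite eq_le mono//; [|lra|lra].
  by apply: le_trans ts; apply: mono; lra.
move=> d0; have -> : g x = 0.
  by have [_ <-] := dx; have [_ <-] := d0.
by rewrite ltxx.
Unshelve. all: by end_near. Qed.

Lemma acdV a b f f' : a <= b -> acdi a b f f' ->
  (forall t, a <= t <= b -> f t != 0) ->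
  acdi a b (fun t => (f t)^-1) (fun t => - f' t / f t ^+ 2).
Proof.
move=> ab [acf df] f0.
have cf : {within `[a, b], continuous (fun t => `|f t|)}.
  move=> x; apply: continuous_comp; first exact: (ac_continuous acf).
  exact: norm_continuous.
have [c cab hc] := EVT_min ab cf.
have m0 : 0 < `|f c| by rewrite normr_gt0 f0//; move: cab; rewrite in_itv.
split; last first.
  apply: (ae_imp _ df) => {}t {}df tb.
  have := is_deriveV (f0 t tb) (df tb).
  by rewrite (_ : - f' t / _ = - (f t) ^- 2 *: f' t)// /GRing.scale/= mulNr mulrC mulNr.
apply: (@ac_dominated _ _ _ f f (`|f c| ^- 2)) => // s t as_ st tb.
have sab : a <= s <= b by rewrite as_ (le_trans st).
have tab : a <= t <= b by rewrite tb (le_trans as_).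
have hs : `|f c| <= `|f s| by apply: hc; rewrite in_itv.
have ht : `|f c| <= `|f t| by apply: hc; rewrite in_itv.
have s0 := f0 s sab; have t0 := f0 t tab.
rewrite (_ : _ - _ = - (f t - f s) * (f s * f t)^-1); last by field; rewrite s0 t0.
rewrite normrM normrN mulrC; apply: ler_pM => //; last by rewrite lerDl.
have h : `|f c| ^+ 2 <= `|f s * f t| by rewrite normrM expr2; apply: ler_pM.
by rewrite normfV lef_pV2// posrE; [rewrite normr_gt0 mulf_neq0|exact: exprn_gt0].
Qed.

(** The product [f t * expR (- K * t)] is nonincreasing. *)
Lemma gronwall b f g K t : acd b f g ->
  {ae mu, forall t, 0 <= t <= b -> g t <= K * f t} ->
  0 <= t <= b -> f t <= f 0 * expR (K * t).
Proof.
move=> df gK /andP[t0 tb].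
have dF := acdM df (acd_exp (acdZ (- K) (acd_id 0 b))).
have : - (f 0 * expR (- K * 0)) <= - (f t * expR (- K * t)).
  apply: (acd_ge0_le (acdN dF)) => //.
  apply: (ae_imp _ gK) => x {}gK xb /=.
  rewrite mulr1 oppr_ge0 (_ : _ + _ = (g x - K * f x) * expR (- K * x)); last ring.
  by rewrite pmulr_lle0 ?expR_gt0// subr_le0 gK.
rewrite lerN2 mulr0 expR0 mulr1 mulNr expRN => H.
by rewrite -ler_pdivrMr ?expR_gt0.
Qed.

End AbsoluteContinuityAlgebra.

(** * Integrals over segments and their primitives *)

Section IntegralToolbox.
Context {R : realType}.
Notation mu := (@lebesgue_measure R).
Local Notation itg D f := (mu.-integrable D (EFin \o (f : R -> R))).
Implicit Types (f g h F : R -> R) (a b c : R) (D : set R).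

Lemma itg_measurable D f : itg D f -> measurable_fun D f.
Proof. by move=> /integrableP[/measurable_EFinP]. Qed.

Lemma Rintegral_EFin D f : measurable D -> itg D f ->
  (\int[mu]_(x in D) f x)%:E = (\int[mu]_(x in D) (f x)%:E)%E.
Proof. by move=> mD fi; rewrite /Rintegral fineK//; exact: integrable_fin_num. Qed.

Lemma itg_le D f g : measurable D -> measurable_fun D f -> itg D g ->
  (forall x, D x -> `|f x| <= g x) -> itg D f.
Proof.
move=> mD mf gi fg; apply: le_integrable gi => //; first exact/measurable_EFinP.
by move=> x Dx /=; rewrite lee_fin (le_trans (fg x Dx))// ler_norm.
Qed.

Lemma itg_norm D f : measurable D -> itg D f -> itg D (fun x => `|f x|).
Proof. by move=> mD fi; exact: integrable_norm fi. Qed.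

Lemma itgS D D' f : measurable D -> measurable D' -> D' `<=` D -> itg D f -> itg D' f.
Proof. by move=> mD mD' DD; exact: integrableS. Qed.

Lemma itgD D f g : measurable D -> itg D f -> itg D g -> itg D (fun x => f x + g x).
Proof. by move=> mD fi gi; exact: (@integrableD _ _ _ mu D mD _ _ fi gi). Qed.

Lemma itgB D f g : measurable D -> itg D f -> itg D g -> itg D (fun x => f x - g x).
Proof. by move=> mD fi gi; exact: (@integrableB _ _ _ mu D mD _ _ fi gi). Qed.

Lemma itgZ D f c : measurable D -> itg D f -> itg D (fun x => c * f x).
Proof. by move=> mD fi; exact: (@integrableZl _ _ _ mu D mD c _ fi). Qed.

Lemma itg_eq D f g : measurable D -> (forall x, D x -> f x = g x) -> itg D f -> itg D g.
Proof. by move=> mD fg; apply: eq_integrable => // x /set_mem Dx /=; rewrite fg. Qed.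

Lemma itg_cst D c : measurable D -> (mu D < +oo)%E -> itg D (fun=> c).
Proof.
move=> mD Doo; apply/integrableP; split; first exact/measurable_EFinP.
by rewrite /= integral_cst//; apply: lte_mul_pinfty.
Qed.

Lemma itg_bounded D f M : measurable D -> (mu D < +oo)%E -> measurable_fun D f ->
  (forall x, D x -> `|f x| <= M) -> itg D f.
Proof. by move=> mD Doo mf fM; apply: itg_le (itg_cst M mD Doo) _. Qed.

Lemma seg_fin a b : (mu `[a, b] < +oo)%E.
Proof. by rewrite lebesgue_measure_itv/=; case: ifP; rewrite ?ltry. Qed.

Lemma itg_seg_bounded a b f M : measurable_fun `[a, b] f ->
  (forall x, a <= x <= b -> `|f x| <= M) -> itg `[a, b] f.
Proof.
move=> mf fM; apply: (itg_bounded (M := M)) => //; exact: seg_fin.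
Qed.

Lemma Rintegral_ge0_subset D D' f : measurable D -> measurable D' -> D' `<=` D ->
  itg D f -> (forall x, D x -> 0 <= f x) ->
  \int[mu]_(x in D') f x <= \int[mu]_(x in D) f x.
Proof.
move=> mD mD' DD fi f0; rewrite -lee_fin !Rintegral_EFin//; last exact: itgS fi.
apply: ge0_subset_integral => //.
by have := itg_measurable fi => /measurable_EFinP.
Qed.

Lemma Rintegral_eq0 D f : (forall x, D x -> f x = 0) -> \int[mu]_(x in D) f x = 0.
Proof.
move=> f0; have -> : \int[mu]_(x in D) f x = \int[mu]_(x in D) 0.
  by apply: eq_Rintegral => x /set_mem /f0.
by rewrite /Rintegral integral0_eq.
Qed.

Lemma Rintegral_le D f g : measurable D -> itg D f -> itg D g ->
  (forall x, D x -> f x <= g x) -> \int[mu]_(x in D) f x <= \int[mu]_(x in D) g x.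
Proof. by move=> mD fi gi fg; exact: le_Rintegral. Qed.

Lemma Rintegral_norm_le D f g : measurable D -> measurable_fun D f -> itg D g ->
  (forall x, D x -> `|f x| <= g x) ->
  `|\int[mu]_(x in D) f x| <= \int[mu]_(x in D) g x.
Proof.
move=> mD mf gi fg; have fi := itg_le mD mf gi fg.
apply: (@le_trans _ _ (\int[mu]_(x in D) `|f x|)); first exact: le_normr_Rintegral.
by apply: Rintegral_le => //; exact: itg_norm.
Qed.

Lemma Rintegral_ae_eq D f g : measurable D -> measurable_fun D f ->
  measurable_fun D g -> {ae mu, forall x, D x -> f x = g x} ->
  \int[mu]_(x in D) f x = \int[mu]_(x in D) g x.
Proof.
move=> mD mf mg fg; congr fine; apply: ae_eq_integral => //; try exact/measurable_EFinP.
by apply: (ae_imp _ fg) => x h Dx; rewrite h.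
Qed.

Lemma Rintegral_setU2 D D1 D2 f : measurable D1 -> measurable D2 ->
  D = D1 `|` D2 -> D1 `&` D2 = set0 -> itg D f ->
  \int[mu]_(x in D) f x = \int[mu]_(x in D1) f x + \int[mu]_(x in D2) f x.
Proof.
move=> m1 m2 -> d fi; rewrite Rintegral_setU//.
by apply/disj_setPS; rewrite d.
Qed.

Lemma Rintegral_seg_split a s t f : a <= s -> s <= t -> itg `[a, t] f ->
  \int[mu]_(x in `[a, t]) f x =
  \int[mu]_(x in `[a, s]) f x + \int[mu]_(x in `]s, t]) f x.
Proof.
move=> as_ st fi; apply: Rintegral_setU2 => //.
- apply/seteqP; split=> x /=; rewrite !in_itv/=.
    by move=> /andP[ax xt]; have [xs|sx] := leP x s; [left|right]; apply/andP.
  by move=> [/andP[ax xs]|/andP[sx xt]]; apply/andP; split=> //; lra.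
- by apply/seteqP; split=> x //=; rewrite !in_itv/= => -[/andP[_ xs] /andP[sx _]]; lra.
Qed.

Lemma Rintegral_oc_norm_le s t f : itg `[s, t] f ->
  `|\int[mu]_(x in `]s, t]) f x| <= \int[mu]_(x in `]s, t[) `|f x|.
Proof.
move=> fi; have fi' : itg `]s, t] f by apply: itgS fi => //; exact: subset_itv_oc_cc.
rewrite Rintegral_itv_bndo_bndc; first exact: le_normr_Rintegral.
by apply: itg_norm => //; apply: itgS fi => //; exact: subset_itv_oo_cc.
Qed.

Lemma itg_patch D f : measurable D -> itg D f <-> itg setT (f \_ D).
Proof. by move=> mD; rewrite -restrict_EFin; exact: integrable_mkcond. Qed.

(** Absolute continuity of the integral as a set function, applied to the union of the intervals. *)
Lemma integral_ac b g c : itg `[0, b] g ->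
  abs_continuous 0 b ((fun t => c + \int[mu]_(x in `[0, t]) g x) : R -> R^o).
Proof.
move=> gi e e0.
pose G := g \_ `[0, b].
have Gi : itg setT G by apply: (iffLR (itg_patch _ _)).
have [d [d0 hd]] := integral_normr_continuous Gi e0.
exists d => // n l r lr tr ld.
pose U i := `]l i, r i[%classic : set R.
pose A := \big[setU/set0]_(i <- index_enum 'I_n) U i.
have mU i : measurable (U i) by exact: measurable_itv.
have mA : measurable A by apply: bigsetU_measurable.
have tU : trivIset [set` index_enum 'I_n] U.
  by apply: sub_trivIset tr.
have un : uniq (index_enum 'I_n) by exact: index_enum_uniq.
have nGi : itg setT (fun x => `|G x|) by exact: itg_norm.
have muA : (mu A < d%:E)%E.
  have := ge0_integral_bigsetU mu (f := cst 1%E) mU un tU.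
  rewrite -/A => /(_ (measurable_cst _) (fun _ _ => lee01)).
  rewrite integral_cst// mul1e => ->.
  rewrite (eq_bigr (fun i => (r i - l i)%:E)) ?sumEFin ?lte_fin// => i _.
  have -> : (\int[mu]_(x in U i) cst 1 x = mu (U i))%E
    by rewrite integral_cst; [rewrite -[RHS]mul1e|exact: mU].
  rewrite /U lebesgue_measure_itv/= lte_fin.
  by have [_ lri _] := lr i; case: ltP => // rl; congr EFin; lra.
apply: le_lt_trans (hd A mA muA).
rewrite -lee_fin Rintegral_EFin//; last exact: itgS nGi.
rewrite ge0_integral_bigsetU//=; last first.
  by apply: measurable_funTS; apply/measurable_EFinP; exact: itg_measurable nGi.
rewrite -sumEFin; apply: lee_sum => i _.
have [l0 lri rb] := lr i.
rewrite -Rintegral_EFin//; last exact: itgS nGi.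
rewrite lee_fin.
have gi' s t : 0 <= s -> t <= b -> itg `[s, t] g.
  move=> s0 tb; apply: itgS gi => // x /=; rewrite !in_itv/= => /andP[? ?].
  by apply/andP; split; lra.
rewrite (_ : _ - _ = \int[mu]_(x in `]l i, r i]) g x); last first.
  rewrite (Rintegral_seg_split (s := l i)) ?gi'//; ring.
apply: le_trans (Rintegral_oc_norm_le (gi' _ _ l0 rb)) _.
rewrite le_eqVlt; apply/orP; left; apply/eqP; apply: eq_Rintegral => x.
rewrite inE /= in_itv/= => /andP[lx xr]; rewrite /G patchE mem_set//= in_itv/=.
by apply/andP; split; lra.
Qed.

Lemma acd_integral b g c : itg `[0, b] g ->
  acd b (fun t => c + \int[mu]_(x in `[0, t]) g x) g.
Proof.
move=> gi; split; first exact: integral_ac.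
(* Lebesgue differentiation is applied to the extension of [g] by zero. The end points of [[0, b]],
   where the extension may break the derivative, are moved into the null set. *)
pose G := g \_ `[0, b].
have Gi : itg setT G by apply: (iffLR (itg_patch _ _)).
have := @FTC1 _ G (BLeft 0) (fun y => itgS measurableT (measurable_itv _) (@subsetT _ _) Gi)
  (integrable_locally_restrict (measurable_itv _) gi).
move=> /(ae_and (ae_and (ae_neq 0) (ae_neq b))); apply: ae_imp => t [[t0 tb] h] /andP[t0' tb'].
have {}t0 : 0 < t by rewrite lt_neqAle eq_sym t0.
have {}tb : t < b by rewrite lt_neqAle tb.
have [|dG eG] := h; first by first [exact: t0' | rewrite (@lte_fin R) | rewrite [X in is_true X]lteBSide].
have : is_derive t (1 : R) (fun t => c + \int[mu]_(x in `[0, t]) G x) (0 + g t).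
  apply: is_deriveD; apply: DeriveDef => //.
  by rewrite -derive1E eG /G patchE mem_set//= in_itv/= t0' tb'.
rewrite add0r; apply: near_eq_is_derive.
near=> y; congr (_ + _); apply: eq_Rintegral => x.
rewrite inE/= in_itv/= => /andP[x0 xy]; rewrite /G patchE mem_set//= in_itv/= x0/=.
by apply: le_trans xy _; apply: ltW; near: y; exact: lt_nbhsl.
Unshelve. all: by end_near. Qed.

Lemma acd_FTC b f g t : acd b f g -> itg `[0, b] g -> 0 <= t <= b ->
  f t = f 0 + \int[mu]_(x in `[0, t]) g x.
Proof.
move=> df gi /andP[t0 tb].
have d := acdB df (acd_integral (f 0) gi).
have := @acd_eq0_cst _ _ _ _ _ t 0 d (aeW _ (fun x _ => subrr _)).
rewrite t0 tb lexx (le_trans t0 tb) => /(_ isT isT).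
rewrite set_itv1 Rintegral_set1 addr0 subrr => /eqP.
by rewrite subr_eq0 => /eqP.
Qed.

End IntegralToolbox.

(** * Fixed points in weighted sup norms *)

Section Contraction.
Context {R : realType} {I : Type}.
Implicit Types (u v w : I -> R).

Lemma geometric_le_eq0 (x K rho : R) : 0 <= rho -> rho < 1 ->
  (forall n, `|x| <= rho ^+ n * K) -> x = 0.
Proof.
move=> r0 r1 xK; apply/eqP; rewrite -normr_le0.
have h : rho ^+ n * K @[n --> \oo] --> 0 * K.
  by apply: cvgMl; apply: cvg_expr; rewrite ger0_norm.
rewrite mul0r in h.
by apply: (ler_cvg_to (cvg_cst _) h) => //; apply: nearW.
Qed.

(** Banach's fixed point theorem for the distance [sup |u - v| / w], where [w] may vanish. The class
    [P] stands for regularity such as measurability: it has to be closed only under pointwise limits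
    that stay within a multiple of [w] of their first term. *)
Lemma contraction_fixpoint w (P : (I -> R) -> Prop) (S : (I -> R) -> I -> R) u0 M0 rho :
  (forall i, 0 <= w i) -> 0 <= rho -> rho < 1 -> 0 <= M0 ->
  (forall (u : nat -> I -> R) v M, (forall n, P (u n)) ->
    (forall n i, `|u n i - u 0%N i| <= M * w i) ->
    (forall i, u n i @[n --> \oo] --> v i) -> P v) ->
  (forall u, P u -> P (S u)) ->
  (forall u v M, P u -> P v -> (forall i, `|u i - v i| <= M * w i) ->
    forall i, `|S u i - S v i| <= rho * M * w i) ->
  P u0 -> (forall i, `|S u0 i - u0 i| <= M0 * w i) ->
  exists u, [/\ P u, forall i, S u i = u i &
    forall i, `|u i - u0 i| <= M0 / (1 - rho) * w i].
Proof.
move=> w0 r0 r1 M00 clP SP c Pu0 h0.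
pose u n := iter n S u0.
have Pu n : P (u n) by elim: n => //= n; exact: SP.
have du n : forall i, `|u n.+1 i - u n i| <= rho ^+ n * M0 * w i.
  elim: n => [|n IH] i; first by rewrite expr0 mul1r; exact: h0.
  by have := c _ _ _ (Pu n.+1) (Pu n) IH i; rewrite mulrA -exprS.
have r1' : 0 < 1 - rho by rewrite subr_gt0.
have uk n k i : `|u (n + k)%N i - u n i| <= rho ^+ n * (M0 / (1 - rho)) * w i.
  (* The induction on [k] keeps the exact partial sum of the geometric series; the weaker bound by
     the full sum would not be inductive. *)
  suff : `|u (n + k)%N i - u n i| <= rho ^+ n * (M0 * (1 - rho ^+ k) / (1 - rho)) * w i.
    move=> /le_trans; apply; rewrite ler_wpM2r// ler_wpM2l ?exprn_ge0//.
    rewrite ler_pM2r ?invr_gt0//; rewrite -[leRHS]mulr1 ler_wpM2l//.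
    by rewrite lerBlDr lerDl exprn_ge0.
  elim: k => [|k IH]; first by rewrite addn0 subrr normr0 expr0 subrr mulr0 mul0r mulr0 mul0r.
  rewrite addnS (_ : _ - _ = (u (n + k).+1 i - u (n + k)%N i) + (u (n + k)%N i - u n i)); last ring.
  apply: le_trans (ler_normD _ _) _; apply: le_trans (lerD (du _ _) IH) _.
  rewrite exprD exprSr le_eqVlt; apply/orP; left; apply/eqP.
  by field; rewrite subr_eq0 gt_eqF.
have cu i : cvgn (fun n => u n i).
  apply/cauchy_cvgP/cauchy_exP => e e0.
  have h : rho ^+ n * (M0 / (1 - rho) * w i) @[n --> \oo] --> (0 : R).
    rewrite -[X in _ --> X](mul0r (M0 / (1 - rho) * w i)); apply: cvgMl.
    by apply: cvg_expr; rewrite ger0_norm.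
  have /cvgrPdist_lt/(_ _ e0)[n _ hn] := h.
  exists (u n i); exists n => // m /= nm.
  rewrite /ball/= -(subnKC nm) distrC; apply: le_lt_trans (uk n (m - n)%N i) _.
  have := hn n (leqnn n); rewrite /= sub0r normrN mulrA; apply: le_lt_trans.
  exact: ler_norm.
pose v i := lim (u n i @[n --> \oo]).
have uv i : u n i @[n --> \oo] --> v i by exact: cu.
have uvb n i : `|v i - u n i| <= rho ^+ n * (M0 / (1 - rho)) * w i.
  have h : `|u m i - u n i| @[m --> \oo] --> `|v i - u n i|.
    by apply: cvg_norm; apply: cvgB => //; exact: cvg_cst.
  apply: (ler_cvg_to h (cvg_cst _)); exists n => // m /= nm.
  by rewrite -(subnKC nm).
have Pv : P v.
  by apply: (clP u v (M0 / (1 - rho))) => // n i; have := uk 0%N n i; rewrite add0n expr0 mul1r.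
exists v; split=> //; last by move=> i; have := uvb 0%N i; rewrite expr0 mul1r.
move=> i; apply/eqP; rewrite -subr_eq0; apply/eqP.
apply: (@geometric_le_eq0 _ (2 * (M0 / (1 - rho)) * w i) rho) => // n.
rewrite (_ : _ - _ = (S v i - S (u n) i) + (u n.+1 i - v i)); last by rewrite /u /=; ring.
apply: le_trans (ler_normD _ _) _.
have := c _ _ _ Pv (Pu n) (uvb n) i; have := uvb n.+1 i; rewrite distrC exprS.
set X := `|_|; set Y := `|_| => hX hY.
apply: le_trans (lerD hY hX) _.
rewrite (_ : _ + _ = rho * (rho ^+ n * (2 * (M0 / (1 - rho)) * w i))); last ring.
rewrite ler_piMl ?(ltW r1)// mulr_ge0 ?exprn_ge0// mulr_ge0//.
by rewrite mulr_ge0// divr_ge0// ltW.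
Qed.

End Contraction.

(** * Canonical systems *)

Section HalfOpen.
Context {R : realType}.
Notation mu := (@lebesgue_measure R).
Implicit Types (T : \bar R) (f g : R -> R).

Lemma hointerval_itv T :
  hointerval T = [set` Interval (BLeft 0) (if T is r%:E then BLeft r else
    if T is +oo%E then BInfty _ false else BInfty _ true)].
Proof.
apply/seteqP; split=> t; case: T => [r| |] //=; rewrite /hointerval/= in_itv/= ?lte_fin.
- by move=> [-> ->].
- by move=> [-> _].
- by move=> [_].
- by move=> /andP.
- by rewrite andbT => t0; split=> //; exact: ltry.
- by rewrite andbF.
Qed.

Lemma measurable_hointerval T : measurable (hointerval T).
Proof. by rewrite hointerval_itv; exact: measurable_itv. Qed.

Lemma hointerval_le T s t : hointerval T t -> 0 <= s -> s <= t -> hointerval T s.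
Proof.
move=> [t0 tT] s0 st; split=> //; apply: le_lt_trans tT.
by rewrite lee_fin.
Qed.

Lemma hointerval_seg T b : hointerval T b -> `[0, b] `<=` hointerval T.
Proof. by move=> bT t /=; rewrite in_itv/= => /andP[t0 tb]; exact: hointerval_le tb. Qed.

Lemma hointerval_gt T t : hointerval T t -> exists2 s, t < s & hointerval T s.
Proof.
move=> [t0 tT]; case: T tT => [r| |//]; rewrite ?lte_fin => tr.
  exists ((t + r) / 2); first lra.
  by split; [lra|rewrite lte_fin; lra].
by exists (t + 1); [lra|split; [lra|exact: ltry]].
Qed.

Lemma hointerval_seq T : (0 < T)%E -> exists2 b : nat -> R,
  (forall n, hointerval T (b n)) /\ (forall n m, (n <= m)%N -> b n <= b m) &
  forall t, hointerval T t -> exists n, t < b n.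
Proof.
case: T => [r| |//]; rewrite ?lte_fin => r0.
  exists (fun n => r - r / n.+1%:R).
    split=> [n|n m nm].
      split; last by rewrite lte_fin ltrBlDr ltrDl divr_gt0.
      by rewrite subr_ge0 ler_pdivrMr// ler_peMr ?ler1n// ltW.
    rewrite lerB// ler_pM2l// lef_pV2 ?posrE// ler_nat//.
  move=> t [t0]; rewrite lte_fin => tr.
  have rt : 0 < (r - t) by lra.
  exists (Num.truncn (r / (r - t))).
  rewrite ltrBrDl -ltrBrDr ltr_pdivrMr// mulrC -ltr_pdivrMr//.
  by apply: truncnS_gt.
exists (fun n => n%:R).
  by split=> [n|n m nm]; [split; [rewrite ler0n|exact: ltry]|rewrite ler_nat].
by move=> t _; exists (Num.truncn t).+1; exact: truncnS_gt.
Qed.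

Lemma measurable_on_hointerval T f : (0 < T)%E ->
  (forall b, hointerval T b -> measurable_fun `[0, b] f) ->
  measurable_fun (hointerval T) f.
Proof.
move=> /hointerval_seq[b [bT _] hb] mf.
have -> : hointerval T = \bigcup_n (`[0, b n]%classic : set R).
  apply/seteqP; split=> t.
    move=> tT; have [n tn] := hb _ tT; exists n => //=.
    by rewrite in_itv/= tT.1 ltW.
  by move=> [n _ /=] tn; exact: (hointerval_seg (bT n)).
by apply/measurable_fun_bigcup => // n; exact: mf.
Qed.

Lemma measurable_hointerval_seg T f b : hointerval T b ->
  measurable_fun (hointerval T) f -> measurable_fun `[0, b] f.
Proof.
by move=> bT; apply: measurable_funS;
  [exact: measurable_hointerval|exact: hointerval_seg].
Qed.

End HalfOpen.

Section CanonicalSystem.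
Context {R : realType}.
Notation mu := (@lebesgue_measure R).
Local Notation itg D f := (mu.-integrable D (EFin \o (f : R -> R))).

(** [A], [C], [B] are the entries of a symmetric positive definite weight. Bounding [A] and [B]
    locally also bounds [C], since [|C| <= (A + B) / 2]. *)
Record canonical_system (T : \bar R) (A B C : R -> R) : Prop := CanonicalSystem {
  cs_T : (0 < T)%E;
  cs_mA : measurable_fun (hointerval T) A;
  cs_mB : measurable_fun (hointerval T) B;
  cs_mC : measurable_fun (hointerval T) C;
  cs_A0 : forall t, hointerval T t -> 0 < A t;
  cs_B0 : forall t, hointerval T t -> 0 < B t;
  cs_C2 : forall t, hointerval T t -> C t ^+ 2 < A t * B t;
  cs_bd : forall b, hointerval T b ->
    exists M, forall t, 0 <= t <= b -> A t <= M /\ B t <= M }.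

Definition qform (A B C : R -> R) (t x y : R) : R :=
  A t * x ^+ 2 + 2 * C t * x * y + B t * y ^+ 2.

Definition solution T A B C (l : R) (p q : R -> R) : Prop :=
  forall b, hointerval T b ->
    acd b p (fun t => - l * (C t * p t + B t * q t)) /\
    acd b q (fun t => l * (A t * p t + C t * q t)).

(** The Prüfer angle: for [p = rho * cos th] and [q = rho * sin th] the equation of [th] does not
    involve [rho]. *)
Definition angle T A B C (th0 l : R) (th : R -> R) : Prop :=
  th 0 = th0 /\ forall b, hointerval T b ->
    acd b th (fun t => l * qform A B C t (cos (th t)) (sin (th t))).

Context {T : \bar R} {A B C : R -> R} (cs : canonical_system T A B C).
Local Notation D := (hointerval T).
Local Notation Q := (qform A B C).

Lemma cs_normC t : D t -> `|C t| <= (A t + B t) / 2.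
Proof.
move=> tD; have A0 := cs_A0 cs tD; have B0 := cs_B0 cs tD; have := cs_C2 cs tD.
move=> h; have s0 : 0 <= (A t + B t) / 2 by lra.
rewrite -ler_sqr ?nnegrE//.
rewrite real_normK ?num_real//; apply: le_trans (ltW h) _.
rewrite -subr_ge0 (_ : _ - _ = ((A t - B t) / 2) ^+ 2) ?sqr_ge0//; by field.
Qed.

Lemma qform_ge0 t x y : D t -> 0 <= Q t x y.
Proof.
move=> tD; have A0 := cs_A0 cs tD; have := cs_C2 cs tD; rewrite -subr_gt0 => h.
rewrite -(pmulr_rge0 _ A0).
rewrite (_ : _ * _ = (A t * x + C t * y) ^+ 2 + (A t * B t - C t ^+ 2) * y ^+ 2).
  by rewrite addr_ge0 ?sqr_ge0// mulr_ge0 ?sqr_ge0// ltW.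
by rewrite /qform; ring.
Qed.

Lemma qform_gt0 t x y : D t -> (x, y) != (0, 0) -> 0 < Q t x y.
Proof.
move=> tD xy; have A0 := cs_A0 cs tD; have := cs_C2 cs tD; rewrite -subr_gt0 => h.
rewrite -(pmulr_rgt0 _ A0).
rewrite (_ : _ * _ = (A t * x + C t * y) ^+ 2 + (A t * B t - C t ^+ 2) * y ^+ 2); last first.
  by rewrite /qform; ring.
have [y0|y0] := eqVneq y 0.
  rewrite y0 mulr0 addr0 expr0n/= mulr0 addr0 exprn_even_gt0//= mulf_neq0 ?(gt_eqF A0)//.
  by apply: contra_neq xy => ->; rewrite y0.
by rewrite ltr_wpDl ?sqr_ge0// mulr_gt0// exprn_even_gt0.
Qed.

(** Adding the nonnegative value of the form at [(x, - y)] cancels the mixed term. *)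
Lemma qform_le t x y : D t -> Q t x y <= 2 * (A t * x ^+ 2 + B t * y ^+ 2).
Proof.
move=> tD; have := qform_ge0 x (- y) tD; rewrite /qform; lra.
Qed.

Lemma qformD_le t x y x' y' : D t ->
  Q t (x + x') (y + y') <= 2 * (Q t x y + Q t x' y').
Proof.
move=> tD; have := qform_ge0 (x - x') (y - y') tD; rewrite /qform; lra.
Qed.

Lemma qform_cs_le t th : D t -> Q t (cos th) (sin th) <= 2 * (A t + B t).
Proof.
move=> tD; apply: le_trans (qform_le _ _ tD) _; rewrite ler_wpM2l//.
have A0 := cs_A0 cs tD; have B0 := cs_B0 cs tD.
have := cos2Dsin2 th; have := sqr_ge0 (cos th); have := sqr_ge0 (sin th).
nra.
Qed.

Lemma qform_cs_gt0 t th : D t -> 0 < Q t (cos th) (sin th).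
Proof.
move=> tD; apply: qform_gt0 => //; apply/eqP => -[c0 s0].
by have := cos2Dsin2 th; rewrite c0 s0 expr0n/= addr0 => /eqP; rewrite eq_sym oner_eq0.
Qed.

Lemma lipschitz1_cos_sin (x y : R) : `|cos x - cos y| <= `|x - y| /\ `|sin x - sin y| <= `|x - y|.
Proof.
wlog xy : x y / y < x => [H|].
  have [->|] := eqVneq x y; first by rewrite !subrr normr0.
  rewrite neq_lt => /orP[xy|yx]; last exact: H.
  have [h1 h2] := H _ _ xy.
  by split; rewrite distrC [leRHS]distrC.
split.
  have [|c _ ->] := @MVT _ cos (fun x => - sin x) _ _ xy (fun z _ => is_derive_cos z).
    by apply: continuous_subspaceT => z; exact: continuous_cos.
  by rewrite normrM ler_piMl// normrN ler_norml sin_geN1 sin_le1.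
have [|c _ ->] := @MVT _ sin cos _ _ xy (fun z _ => is_derive_sin z).
  by apply: continuous_subspaceT => z; exact: continuous_sin.
by rewrite normrM ler_piMl// ler_norml cos_geN1 cos_le1.
Qed.

Lemma lipschitz_mul (x x' y y' d : R) : `|x| <= 1 -> `|y'| <= 1 ->
  `|x - x'| <= d -> `|y - y'| <= d -> `|x * y - x' * y'| <= 2 * d.
Proof.
move=> x1 y1 xd yd.
rewrite (_ : _ - _ = x * (y - y') + (x - x') * y'); last ring.
apply: le_trans (ler_normD _ _) _; rewrite !normrM.
have : `|x| * `|y - y'| <= 1 * d by apply: ler_pM.
have : `|x - x'| * `|y'| <= d * 1 by apply: ler_pM.
lra.
Qed.

Lemma qform_cs_lipschitz t x y : D t ->
  `|Q t (cos x) (sin x) - Q t (cos y) (sin y)| <= 4 * (A t + B t) * `|x - y|.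
Proof.
move=> tD; have [hc hs] := lipschitz1_cos_sin x y.
have A0 := cs_A0 cs tD; have B0 := cs_B0 cs tD; have C0 := cs_normC tD.
have c1 z : `|cos z| <= 1 :> R by rewrite ler_norml cos_geN1 cos_le1.
have s1 z : `|sin z| <= 1 :> R by rewrite ler_norml sin_geN1 sin_le1.
have h1 := lipschitz_mul (c1 x) (c1 y) hc hc.
have h2 := lipschitz_mul (c1 x) (s1 y) hc hs.
have h3 := lipschitz_mul (s1 x) (s1 y) hs hs.
rewrite /qform (_ : _ - _ = A t * (cos x * cos x - cos y * cos y) +
   2 * C t * (cos x * sin x - cos y * sin y) + B t * (sin x * sin x - sin y * sin y)); last ring.
apply: le_trans (ler_normD _ _) _; rewrite normrM (gtr0_norm B0).
apply: le_trans (lerD (ler_normD _ _) (lexx _)) _; rewrite !normrM (gtr0_norm A0) (ger0_norm (ler0n _ 2)).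
have e1 := ler_wpM2l (ltW A0) h1; have e3 := ler_wpM2l (ltW B0) h3.
have : 2 * `|C t| * `|cos x * sin x - cos y * sin y| <= (A t + B t) * (2 * `|x - y|).
  by apply: ler_pM; rewrite ?mulr_ge0//; lra.
lra.
Qed.

Lemma cs_itg b : D b -> [/\ itg `[0, b] A, itg `[0, b] B & itg `[0, b] C].
Proof.
move=> bD; have [M hM] := cs_bd cs bD.
have sD x : 0 <= x <= b -> D x by move=> /andP[x0 xb]; exact: hointerval_le xb.
have mS (f : R -> R) : measurable_fun D f -> measurable_fun `[0, b] f by exact: (measurable_hointerval_seg bD).
split; apply: (@itg_seg_bounded _ _ _ _ M) => [|x xb].
- by apply: mS; exact: (cs_mA cs).
- by rewrite gtr0_norm ?(cs_A0 cs)//; [have [] := hM x xb|exact: sD].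
- by apply: mS; exact: (cs_mB cs).
- by rewrite gtr0_norm ?(cs_B0 cs)//; [have [] := hM x xb|exact: sD].
- by apply: mS; exact: (cs_mC cs).
- by apply: le_trans (cs_normC (sD _ xb)) _; have [] := hM x xb; lra.
Qed.

Lemma measurable_cos_sin E (u : R -> R) : measurable_fun E u ->
  measurable_fun E (fun t => cos (u t)) /\ measurable_fun E (fun t => sin (u t)).
Proof.
move=> mu_; split; apply: measurableT_comp => //; apply: continuous_measurable_fun.
  exact: continuous_cos.
exact: continuous_sin.
Qed.

Lemma measurable_qform E (x y : R -> R) : E `<=` D -> measurable E ->
  measurable_fun E x -> measurable_fun E y ->
  measurable_fun E (fun t => Q t (x t) (y t)).
Proof.
move=> ED mE mx my.
have mS (f : R -> R) : measurable_fun D f -> measurable_fun E f.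
  by apply: measurable_funS => //; exact: measurable_hointerval.
have mA := mS _ (cs_mA cs); have mB := mS _ (cs_mB cs); have mC := mS _ (cs_mC cs).
apply: measurable_funD; first apply: measurable_funD.
- by apply: measurable_funM => //; exact: measurable_funX.
- by apply: measurable_funM => //; apply: measurable_funM => //; exact: measurable_funM.
- by apply: measurable_funM => //; exact: measurable_funX.
Qed.

End CanonicalSystem.

Section MeasurableInverse.
Context {R : realType}.

(* At 0 the regularisations [x / (x ^+ 2 + e)] agree with the junk value of the inverse. *)
Lemma measurable_inv : measurable_fun [set: R] (GRing.inv : R -> R).
Proof.
have mh n : measurable_fun [set: R] (fun x : R => x / (x ^+ 2 + n.+1%:R^-1)).
  apply: continuous_measurable_fun => x.
  apply: cvgM; first exact: cvg_id.
  apply: cvgV; first by rewrite gt_eqF// ltr_wpDl ?sqr_ge0.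
  by apply: cvgD; [exact: exprn_continuous|exact: cvg_cst].
apply: (measurable_fun_cvg mh) => x _; have [->|x0] := eqVneq x 0.
  by under eq_fun do rewrite mul0r; rewrite invr0; exact: cvg_cst.
rewrite [X in _ --> X](_ : _ = x / (x ^+ 2 + 0)); last by field.
apply: cvgM; first exact: cvg_cst.
apply: cvgV; first by rewrite addr0 expf_neq0.
by apply: cvgD; [exact: cvg_cst|exact: cvg_harmonic].
Qed.

End MeasurableInverse.

(** * The Prüfer angle and its dependence on time and parameter *)

Section Angle.
Context {R : realType}.
Notation mu := (@lebesgue_measure R).
Local Notation itg D f := (mu.-integrable D (EFin \o (f : R -> R))).
Context {T : \bar R} {A B C : R -> R} (cs : canonical_system T A B C).
Local Notation D := (hointerval T).
Local Notation Q := (qform A B C).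

Lemma itg_mul_bounded E (f g : R -> R) M : measurable E -> itg E f ->
  measurable_fun E g -> (forall x, E x -> `|g x| <= M) -> itg E (fun x => f x * g x).
Proof.
move=> mE fi mg gM; apply: (itg_le mE _ (itgZ M mE (itg_norm mE fi))).
  by apply: measurable_funM => //; exact: itg_measurable fi.
by move=> x Ex; rewrite normrM mulrC ler_wpM2r// gM.
Qed.

Lemma D_0 : D 0.
Proof. by split=> //; exact: cs_T cs. Qed.

Lemma D_seg b x : D b -> 0 <= x <= b -> D x.
Proof. by move=> bD /andP[x0 xb]; exact: hointerval_le xb. Qed.

Lemma measurable_fun_seg (f : R -> R) b : D b ->
  measurable_fun D f -> measurable_fun `[0, b] f.
Proof. by move=> bD; exact: measurable_hointerval_seg. Qed.

Lemma itg_qform_cs u b : D b -> measurable_fun D u ->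
  itg `[0, b] (fun t => Q t (cos (u t)) (sin (u t))).
Proof.
move=> bD mu_; have [iA iB _] := cs_itg cs bD.
have [mc ms] := measurable_cos_sin (measurable_fun_seg bD mu_).
apply: (itg_le _ _ (itgZ 2 _ (itgD _ iA iB))) => //.
  by apply: (measurable_qform cs) => //; exact: hointerval_seg.
move=> x /=; rewrite in_itv/= => xb; have xD := D_seg bD xb.
by rewrite ger0_norm ?(qform_cs_le cs)// (qform_ge0 cs).
Qed.

Lemma angle_exists th0 l : exists th, angle T A B C th0 l th.
Proof.
(* Twice the Lipschitz bound of the right-hand side. Measured against [expR (\int ell)], the Picard
   map then contracts by [1 / 2] on the whole of [[0, T)] at once, without continuation from one
   interval to the next. *)
pose ell t := 8 * (`|l| + 1) * (A t + B t).
pose w1 t := expR (0 + \int[mu]_(x in `[0, t]) ell x).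
have ell0 t : D t -> 0 <= ell t.
  move=> tD; have A0 := cs_A0 cs tD; have B0 := cs_B0 cs tD.
  by rewrite mulr_ge0 ?addr_ge0 ?mulr_ge0 ?addr_ge0// ltW.
have iell b : D b -> itg `[0, b] ell.
  by move=> bD; have [iA iB _] := cs_itg cs bD; apply: itgZ => //; exact: itgD.
have dw b : D b -> acd b w1 (fun t => w1 t * ell t).
  by move=> bD; apply: acd_exp; exact: acd_integral (iell b bD).
have iw b : D b -> itg `[0, b] (fun t => ell t * w1 t).
  move=> bD; have [M _ hM] := acd_bounded (dw b bD).
  by apply: (itg_mul_bounded (M := M) _ (iell b bD) (acd_measurable (dw b bD))).
have wE t : D t -> \int[mu]_(x in `[0, t]) (ell x * w1 x) <= w1 t.
  move=> tD; have [t0 _] := tD.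
  have -> : w1 t = w1 0 + \int[mu]_(x in `[0, t]) (ell x * w1 x).
    apply: (@acd_FTC _ t); rewrite ?lexx ?t0//; last exact: iw.
    by apply: acd_eq (dw t tD) _ => x _; rewrite mulrC.
  by rewrite lerDr expR_ge0.
(* Weight and iterates are set to 0 outside [[0, T)], so that the bounds hold at every real
   index. *)
pose w : R -> R := w1 \_ D.
have wD t : D t -> w t = w1 t by move=> tD; rewrite /w patchE mem_set.
have wout t : ~ D t -> w t = 0 by move=> nD; rewrite /w patchE memNset.
pose S0 (u : R -> R) (t : R) : R := th0 + \int[mu]_(x in `[0, t]) (l * Q x (cos (u x)) (sin (u x))).
pose S (u : R -> R) : R -> R := S0 u \_ D.
have SD (u : R -> R) t : D t -> S u t = S0 u t by move=> tD; rewrite /S patchE mem_set.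
have Sout (u : R -> R) t : ~ D t -> S u t = 0 by move=> nD; rewrite /S patchE memNset.
have iQ (u : R -> R) b : D b -> measurable_fun D u ->
    itg `[0, b] (fun x => l * Q x (cos (u x)) (sin (u x))).
  by move=> bD mu_; apply: itgZ => //; exact: itg_qform_cs.
have dS (u : R -> R) b : D b -> measurable_fun D u ->
    acd b (S0 u) (fun x => l * Q x (cos (u x)) (sin (u x))).
  by move=> bD mu_; exact: acd_integral (iQ u b bD mu_).
have mS (u : R -> R) : measurable_fun D u -> measurable_fun D (S u).
  move=> mu_; apply: (measurable_on_hointerval (cs_T cs)) => b bD.
  apply: eq_measurable_fun (acd_measurable (dS u b bD mu_)).
  by move=> x; rewrite inE/= in_itv/= => xb; rewrite SD//; exact: D_seg xb.
have contr (u v : R -> R) M : measurable_fun D u -> measurable_fun D v ->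
    (forall i, `|u i - v i| <= M * w i) -> forall i, `|S u i - S v i| <= 1 / 2 * M * w i.
  move=> mu_ mv uv i.
  have M0 : 0 <= M.
    by rewrite -(pmulr_lge0 M (expR_gt0 (0 + \int[mu]_(x in `[0, 0]) ell x))) -/(w1 0) -wD ?(le_trans _ (uv 0))//; exact: D_0.
  have [iD|niD] := pselect (D i); last first.
    by rewrite !Sout// wout// subrr normr0 mulr0.
  rewrite !SD// wD// /S0 (_ : _ - _ = \int[mu]_(x in `[0, i]) (l * Q x (cos (u x)) (sin (u x))) -
    \int[mu]_(x in `[0, i]) (l * Q x (cos (v x)) (sin (v x)))); last ring.
  rewrite -RintegralB//; [|exact: iQ|exact: iQ].
  apply: (@le_trans _ _ (\int[mu]_(x in `[0, i]) (1 / 2 * M * (ell x * w1 x)))).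
    apply: Rintegral_norm_le => //.
    - by apply: measurable_funB; apply: itg_measurable; exact: iQ.
    - by apply: itgZ => //; exact: iw.
    move=> x /=; rewrite in_itv/= => xi; have xD := D_seg iD xi.
    rewrite -mulrBr normrM.
    have A0 := cs_A0 cs xD; have B0 := cs_B0 cs xD.
    have h := le_trans (qform_cs_lipschitz cs (u x) (v x) xD)
      (ler_wpM2l (mulr_ge0 (ler0n _ 4) (ltW (addr_gt0 A0 B0))) (uv x)).
    apply: (@le_trans _ _ ((`|l| + 1) * (4 * (A x + B x) * (M * w x)))).
      by apply: ler_pM => //; rewrite lerDl.
    by rewrite wD// /ell le_eqVlt; apply/orP; left; apply/eqP; field.
  rewrite RintegralZl//; last exact: iw.
  by rewrite ler_wpM2l ?wE// mulr_ge0.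
pose u0 : R -> R := (fun=> th0) \_ D.
have u0D t : D t -> u0 t = th0 by move=> tD; rewrite /u0 patchE mem_set.
have mu0 : measurable_fun D u0.
  apply: eq_measurable_fun (measurable_cst th0).
  by move=> x /set_mem xD; rewrite u0D.
have [||||||||i|u [mu_ Su _]] := @contraction_fixpoint _ _ w (fun u : R -> R => measurable_fun D u) S u0 1 (1 / 2) => //.
- move=> i; have [iD|niD] := pselect (D i); first by rewrite wD ?expR_ge0.
  by rewrite wout.
- lra.
- by move=> u v M mu_ _ uv; apply: (measurable_fun_cvg mu_) => x _; exact: uv.
- have [iD|niD] := pselect (D i); last first.
    by rewrite Sout// wout// /u0 patchE memNset// subrr normr0 mulr0.
  rewrite SD// wD// u0D// /S0 addrAC subrr add0r mul1r.
  apply: le_trans (wE i iD); apply: Rintegral_norm_le => //.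
  - by apply: itg_measurable; exact: iQ.
  - exact: iw.
  move=> x /=; rewrite in_itv/= => xi; have xD := D_seg iD xi.
  have w11 : 1 <= w1 x.
    rewrite -[leLHS]expR0 ler_expR add0r; apply: Rintegral_ge0 => y /=.
    by rewrite in_itv/= => yx; apply: ell0; exact: D_seg yx.
  apply: (@le_trans _ _ (ell x * 1)); last by rewrite ler_wpM2l// ell0.
  rewrite normrM mulr1 /ell (ger0_norm (qform_ge0 cs _ _ xD)) [8 * _]mulrC -mulrA.
  apply: ler_pM => //; [exact: (qform_ge0 cs)|by rewrite lerDl|].
  apply: le_trans (qform_cs_le cs _ xD) _.
  have A0 := cs_A0 cs xD; have B0 := cs_B0 cs xD; lra.
exists (S0 u); split.
  by rewrite /S0 set_itv1 Rintegral_set1 addr0.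
move=> b bD; apply: acd_eq (dS u b bD mu_) _ => t tb.
have tD := D_seg bD tb; by rewrite -[u t]Su SD.
Qed.

Lemma angle_acd th0 l th b : angle T A B C th0 l th -> D b ->
  acd b th (fun t => l * Q t (cos (th t)) (sin (th t))).
Proof. by move=> [_]; apply. Qed.

Lemma angle_measurable th0 l th : angle T A B C th0 l th -> measurable_fun D th.
Proof.
move=> ath; apply: (measurable_on_hointerval (cs_T cs)) => b bD.
exact: acd_measurable (angle_acd ath bD).
Qed.

(** Grönwall's lemma for [(th - th') ^+ 2 + (l - m) ^+ 2]: the added constant makes the differential
    inequality homogeneous. The Lipschitz bound is used with the parameter [l] alone, so [K] does
    not depend on [m]. *)
Lemma angle_dist b th0 l : D b -> exists2 K, 0 <= K & forall m th th',
  angle T A B C th0 l th -> angle T A B C th0 m th' ->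
  forall t, 0 <= t <= b -> (th t - th' t) ^+ 2 <= (l - m) ^+ 2 * K.
Proof.
move=> bD; have [M hM] := cs_bd cs bD.
have b0 : 0 <= b by case: bD.
have M0 : 0 <= M.
  by have [h _] := hM b ltac:(by rewrite b0 lexx); exact: le_trans (ltW (cs_A0 cs bD)) h.
pose K := 16 * `|l| * M + 4 * M.
have K0 : 0 <= K by rewrite addr_ge0// !mulr_ge0.
exists (expR (K * b)) => [|m th th' ath ath' t tb]; first exact: expR_ge0.
have d := acdB (angle_acd ath bD) (angle_acd ath' bD).
have df := acdD (acdM d d) (acd_cst 0 b ((l - m) ^+ 2)).
have := gronwall (K := K) df _ tb.
rewrite !ath.1 !ath'.1 subrr mul0r add0r => h.
apply: (@le_trans _ _ ((th t - th' t) * (th t - th' t) + (l - m) ^+ 2)).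
  by rewrite -expr2 lerDl sqr_ge0.
apply: (le_trans (h _)); last first.
  rewrite ler_wpM2l ?sqr_ge0// ler_expR ler_wpM2l//; by case/andP: tb.
apply: aeW => x xb; have xD := D_seg bD xb.
have [AM BM] := hM x xb.
have A0 := cs_A0 cs xD; have B0 := cs_B0 cs xD.
have hL := qform_cs_lipschitz cs (th x) (th' x) xD.
have hQ := qform_cs_le cs (th' x) xD.
have hQ0 := qform_ge0 cs (cos (th' x)) (sin (th' x)) xD.
set dl := th x - th' x; set q1 := Q x _ _; set q2 := Q x _ _.
rewrite -/dl -/q1 -/q2 in hL hQ hQ0.
have e1 : dl * (l * (q1 - q2)) <= 8 * `|l| * M * dl ^+ 2.
  apply: le_trans (ler_norm _) _; rewrite !normrM.
  have : `|l| * `|q1 - q2| <= `|l| * (8 * M * `|dl|).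
    by rewrite ler_wpM2l//; apply: le_trans hL _; rewrite ler_wpM2r//; lra.
  move=> /(ler_wpM2l (normr_ge0 dl)) /le_trans; apply.
  by rewrite -[dl ^+ 2]real_normK ?num_real// le_eqVlt; apply/orP; left; apply/eqP; ring.
have e2 : 2 * (dl * ((l - m) * q2)) <= 4 * M * (dl ^+ 2 + (l - m) ^+ 2).
  have q2M : q2 <= 4 * M by lra.
  apply: (@le_trans _ _ (q2 * (dl ^+ 2 + (l - m) ^+ 2))).
    rewrite -subr_ge0 (_ : _ - _ = q2 * (dl - (l - m)) ^+ 2); last ring.
    by rewrite mulr_ge0// sqr_ge0.
  by rewrite ler_wpM2r// addr_ge0 ?sqr_ge0.
have e3 : 0 <= 16 * `|l| * M * (l - m) ^+ 2 by rewrite mulr_ge0 ?sqr_ge0// !mulr_ge0.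
rewrite (_ : _ + _ = 2 * (dl * (l * (q1 - q2))) + 2 * (dl * ((l - m) * q2))); last by rewrite /dl; ring.
by rewrite /K -/dl; lra.
Qed.

Lemma angle_lt th0 l m th th' t : l < m ->
  angle T A B C th0 l th -> angle T A B C th0 m th' -> D t -> 0 < t -> th t < th' t.
Proof.
move=> lm ath ath' tD t0.
pose d x := th' x - th x.
pose q1 x := Q x (cos (th x)) (sin (th x)); pose q2 x := Q x (cos (th' x)) (sin (th' x)).
(* The difference satisfies [d' = k * d + (m - l) * q2] with [k] bounded, so the integrating factor
   [E] makes [d * E] strictly increasing. Where [d = 0] the inverse is 0, which is consistent
   because then [q1 = q2]. *)
pose k x := l * (q2 x - q1 x) * (d x)^-1.
have [M hM] := cs_bd cs tD.
have mth := measurable_fun_seg tD (angle_measurable ath).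
have mth' := measurable_fun_seg tD (angle_measurable ath').
have iq1 : itg `[0, t] q1 by apply: itg_qform_cs => //; exact: angle_measurable ath.
have iq2 : itg `[0, t] q2 by apply: itg_qform_cs => //; exact: angle_measurable ath'.
have ik : itg `[0, t] k.
  apply: (@itg_seg_bounded _ _ _ _ (`|l| * (8 * M))).
    apply: measurable_funM.
      by apply: measurable_funM => //; apply: measurable_funB; exact: itg_measurable.
    by apply: measurableT_comp; [exact: measurable_inv|exact: measurable_funB].
  move=> x xt; have xD := D_seg tD xt; have [AM BM] := hM x xt.
  have A0 := cs_A0 cs xD; have B0 := cs_B0 cs xD.
  have hL := qform_cs_lipschitz cs (th' x) (th x) xD.
  rewrite /k normrM normrM normfV -mulrA ler_wpM2l//.
  have [d0|d0] := eqVneq (d x) 0; first by rewrite d0 normr0 invr0 mulr0; lra.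
  rewrite ler_pdivrMr ?normr_gt0//; apply: le_trans hL _.
  by rewrite ler_wpM2r//; lra.
have dd := acdB (angle_acd ath' tD) (angle_acd ath tD).
have dE := acd_exp (acdN (acd_integral 0 ik)).
pose E x := expR (- (0 + \int[mu]_(y in `[0, x]) k y)).
have dF := acdM dd dE.
have : (th' 0 - th 0) * E 0 < (th' t - th t) * E t.
  apply: (acd_gt0_lt dF) => //; apply: aeW => x xt; have xD := D_seg tD xt.
  rewrite -/(q1 x) -/(q2 x) -/(d x) -/(E x).
  have -> : (m * q2 x - l * q1 x) * E x + d x * (E x * - k x) =
      E x * ((m - l) * q2 x + (l * (q2 x - q1 x) - d x * k x)) by ring.
  have -> : l * (q2 x - q1 x) - d x * k x = 0.
    rewrite /k; have [d0|d0] := eqVneq (d x) 0; last by field.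
    by rewrite /q1 /q2; move/eqP: d0; rewrite subr_eq0 => /eqP ->; ring.
  rewrite addr0 mulr_gt0 ?expR_gt0// mulr_gt0 ?subr_gt0//.
  exact: (qform_cs_gt0 cs).
by rewrite ath.1 ath'.1 subrr mul0r pmulr_lgt0 ?expR_gt0// subr_gt0.
Qed.

Lemma angle_increasing th0 l th s t : 0 < l -> angle T A B C th0 l th ->
  0 <= s -> s < t -> D t -> th s < th t.
Proof.
move=> l0 ath s0 st tD; apply: (acd_gt0_lt (angle_acd ath tD)) => //.
apply: aeW => x xt; rewrite mulr_gt0// (qform_cs_gt0 cs)//; exact: D_seg xt.
Qed.

End Angle.

(** * Linear solutions: continuous dependence, uniqueness and polar form *)

Section Solutions.
Context {R : realType}.
Notation mu := (@lebesgue_measure R).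
Local Notation itg D f := (mu.-integrable D (EFin \o (f : R -> R))).
Context {T : \bar R} {A B C : R -> R} (cs : canonical_system T A B C).
Local Notation D := (hointerval T).
Local Notation Q := (qform A B C).

Lemma solution_measurable l p q : solution T A B C l p q ->
  measurable_fun D p /\ measurable_fun D q.
Proof.
move=> s; split; apply: (measurable_on_hointerval (cs_T cs)) => b /s[dp dq].
  exact: acd_measurable dp.
exact: acd_measurable dq.
Qed.

Lemma solutionD l p q p' q' a a' : solution T A B C l p q -> solution T A B C l p' q' ->
  solution T A B C l (fun t => a * p t + a' * p' t) (fun t => a * q t + a' * q' t).
Proof.
move=> s s' b bD; have [dp dq] := s b bD; have [dp' dq'] := s' b bD; split.
  by apply: acd_eq (acdD (acdZ a dp) (acdZ a' dp')) _ => t _; ring.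
by apply: acd_eq (acdD (acdZ a dq) (acdZ a' dq')) _ => t _; ring.
Qed.

Lemma normM2_le (x y : R) : 2 * `|x * y| <= x ^+ 2 + y ^+ 2.
Proof.
rewrite normrM -subr_ge0 -(real_normK (num_real x)) -(real_normK (num_real y)).
by rewrite (_ : _ - _ = (`|x| - `|y|) ^+ 2) ?sqr_ge0//; ring.
Qed.

(* Growth of the squared distance to the solution [(p, q)] of parameter [l]: the
   forcing term is bounded through the fixed solution [(p, q)] only. *)
Lemma solution_dist b l p q : D b -> solution T A B C l p q ->
  exists2 K, 0 <= K & forall m p' q', `|m| <= `|l| + 1 -> solution T A B C m p' q' ->
    p' 0 = p 0 -> q' 0 = q 0 -> forall t, 0 <= t <= b ->
    (p' t - p t) ^+ 2 + (q' t - q t) ^+ 2 <= (m - l) ^+ 2 * K.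
Proof.
move=> bD s; have [dp dq] := s b bD.
have [M hM] := cs_bd cs bD.
have b0 : 0 <= b by case: bD.
have M0 : 0 <= M.
  by have [h _] := hM b ltac:(by rewrite b0 lexx); exact: le_trans (ltW (cs_A0 cs bD)) h.
have [N1 N10 hN1] := acd_bounded dp; have [N2 N20 hN2] := acd_bounded dq.
pose L := `|l| + 1; pose N := M * (N1 + N2).
have L0 : 0 <= L by rewrite addr_ge0.
have N0 : 0 <= N by rewrite mulr_ge0// addr_ge0 ?ltW.
pose K := 8 * L * M + 4 * N + 2 * N ^+ 2 + 4.
have K0 : 0 <= K by have := mulr_ge0 L0 M0; have := sqr_ge0 N; rewrite /K; lra.
exists (expR (K * b)) => [|m p' q' mL s' p0 q0 t tb]; first exact: expR_ge0.
have [dp' dq'] := s' b bD.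
have d1 := acdB dp' dp; have d2 := acdB dq' dq.
have df := acdD (acdD (acdM d1 d1) (acdM d2 d2)) (acd_cst 0 b ((m - l) ^+ 2)).
have := gronwall (K := K) df _ tb.
rewrite p0 q0 !subrr mul0r !add0r => h.
apply: (@le_trans _ _ ((p' t - p t) * (p' t - p t) + (q' t - q t) * (q' t - q t) + (m - l) ^+ 2)).
  by rewrite !expr2 lerDl -expr2 sqr_ge0.
apply: (le_trans (h _)); last first.
  rewrite ler_wpM2l ?sqr_ge0// ler_expR ler_wpM2l//; by case/andP: tb.
apply: aeW => x xb; have xD := D_seg bD xb.
have [AM BM] := hM x xb; have pN := hN1 x xb; have qN := hN2 x xb.
have A0 := cs_A0 cs xD; have B0 := cs_B0 cs xD; have CM : `|C x| <= M.
  by have := cs_normC cs xD; lra.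
set u := p' x - p x; set v := q' x - q x; set e := m - l.
set F := C x * p x + B x * q x; set G := A x * p x + C x * q x.
have bnd a1 a2 : `|a1| <= M -> `|a2| <= M -> `|a1 * p x + a2 * q x| <= N.
  move=> h1 h2; apply: le_trans (ler_normD _ _) _; rewrite !normrM /N mulrDr.
  by apply: lerD; apply: ler_pM.
have FN : `|F| <= N by apply: bnd => //; rewrite gtr0_norm.
have GN : `|G| <= N by apply: bnd => //; rewrite gtr0_norm.
have E1 : u * (- e * F) <= N * (u ^+ 2 + e ^+ 2).
  apply: le_trans (ler_norm _) _; rewrite (_ : u * _ = - F * (u * e)); last ring.
  rewrite normrM normrN; apply: ler_pM => //.
  by have := normM2_le u e; have := sqr_ge0 u; have := sqr_ge0 e; lra.
have E2 : v * (e * G) <= N * (v ^+ 2 + e ^+ 2).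
  apply: le_trans (ler_norm _) _; rewrite (_ : v * _ = G * (v * e)); last ring.
  rewrite normrM; apply: ler_pM => //.
  by have := normM2_le v e; have := sqr_ge0 v; have := sqr_ge0 e; lra.
have E3 : m * (C x * (v ^+ 2 - u ^+ 2) + (A x - B x) * (u * v)) <= 2 * L * M * (u ^+ 2 + v ^+ 2).
  apply: le_trans (ler_norm _) _; rewrite normrM (_ : 2 * L * M * _ = L * (2 * M * (u ^+ 2 + v ^+ 2))); last ring.
  apply: ler_pM => //; apply: le_trans (ler_normD _ _) _.
  have u2 := sqr_ge0 u; have v2 := sqr_ge0 v.
  have h1 : `|C x * (v ^+ 2 - u ^+ 2)| <= M * (u ^+ 2 + v ^+ 2).
    by rewrite normrM; apply: ler_pM => //; rewrite ler_norml; apply/andP; split; lra.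
  have h2 : `|(A x - B x) * (u * v)| <= M * (u ^+ 2 + v ^+ 2).
    rewrite normrM; apply: ler_pM => //; first by rewrite ler_norml; apply/andP; split; lra.
    by have := normM2_le u v; lra.
  by lra.
have LM := mulr_ge0 L0 M0; have NN := mulr_ge0 N0 N0.
have H1 := mulr_ge0 LM (sqr_ge0 e).
have H2 := mulr_ge0 N0 (sqr_ge0 u); have H3 := mulr_ge0 N0 (sqr_ge0 v).
have H4 := mulr_ge0 LM (addr_ge0 (sqr_ge0 u) (sqr_ge0 v)).
have H5 := mulr_ge0 NN (addr_ge0 (addr_ge0 (sqr_ge0 u) (sqr_ge0 v)) (sqr_ge0 e)).
have H6 := sqr_ge0 u; have H7 := sqr_ge0 v; have H8 := sqr_ge0 e.
have H9 := mulr_ge0 N0 (sqr_ge0 e).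
rewrite (_ : _ + 0 = 2 * (m * (C x * (v ^+ 2 - u ^+ 2) + (A x - B x) * (u * v))) +
   2 * (u * (- e * F)) + 2 * (v * (e * G))); last by rewrite /F /G /u /v /e; ring.
by rewrite /K -!expr2; lra.
Qed.

Lemma solution_unique l p q p' q' : solution T A B C l p q -> solution T A B C l p' q' ->
  p' 0 = p 0 -> q' 0 = q 0 -> forall t, D t -> p' t = p t /\ q' t = q t.
Proof.
move=> s s' p0 q0 t tD; have [K _ hK] := solution_dist tD s.
have t0 : 0 <= t <= t by rewrite lexx andbT; case: tD.
have := hK l p' q' ltac:(by rewrite lerDl) s' p0 q0 t t0.
rewrite subrr expr0n mul0r => h.
have h1 := sqr_ge0 (p' t - p t); have h2 := sqr_ge0 (q' t - q t).
have /eqP : (p' t - p t) ^+ 2 = 0 by lra.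
have /eqP : (q' t - q t) ^+ 2 = 0 by lra.
by rewrite !sqrf_eq0 !subr_eq0 => /eqP -> /eqP ->.
Qed.

(** Once the angle is known, the logarithm of the radius is the primitive of a known function;
    existence of solutions thus reduces to existence of the angle. *)
Lemma solution_polar th0 l th : angle T A B C th0 l th ->
  exists rho : R -> R, [/\ forall t, 0 < rho t, rho 0 = 1 &
    solution T A B C l (fun t => rho t * cos (th t)) (fun t => rho t * sin (th t))].
Proof.
move=> ath.
pose k t := l * (- C t * cos (th t) ^+ 2 + (A t - B t) * (cos (th t) * sin (th t)) +
                 C t * sin (th t) ^+ 2).
have ik b : D b -> itg `[0, b] k.
  move=> bD; have [M hM] := cs_bd cs bD.
  have mf (f : R -> R) : measurable_fun D f -> measurable_fun `[0, b] f by exact: measurable_fun_seg.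
  have mA := mf _ (cs_mA cs); have mB := mf _ (cs_mB cs); have mC := mf _ (cs_mC cs).
  have [mc ms] := measurable_cos_sin (mf _ (angle_measurable cs ath)).
  apply: itgZ => //; apply: (@itg_seg_bounded _ _ _ _ (4 * M)).
    apply: measurable_funD; first apply: measurable_funD.
    - by apply: measurable_funM; [exact: measurableT_comp|exact: measurable_funX].
    - by apply: measurable_funM; [exact: measurable_funB|exact: measurable_funM].
    - by apply: measurable_funM => //; exact: measurable_funX.
  move=> x xb; have xD := D_seg bD xb; have [AM BM] := hM x xb.
  have A0 := cs_A0 cs xD; have B0 := cs_B0 cs xD; have C0 := cs_normC cs xD.
  have c1 : `|cos (th x)| <= 1 :> R by rewrite ler_norml cos_geN1 cos_le1.
  have s1 : `|sin (th x)| <= 1 :> R by rewrite ler_norml sin_geN1 sin_le1.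
  have bnd a y z : `|a| <= M -> `|y| <= 1 -> `|z| <= 1 -> `|a * (y * z)| <= M.
    move=> ha hy hz; rewrite !normrM -[leRHS]mulr1; apply: ler_pM => //.
    by rewrite -[leRHS]mulr1; apply: ler_pM.
  rewrite !expr2; apply: le_trans (ler_normD _ _) _.
  have CM : `|C x| <= M by lra.
  have e1 : `|- C x * (cos (th x) * cos (th x))| <= M by apply: bnd; rewrite ?normrN.
  have e2 : `|(A x - B x) * (cos (th x) * sin (th x))| <= M.
    by apply: bnd => //; rewrite ler_norml; apply/andP; split; lra.
  have e3 : `|C x * (sin (th x) * sin (th x))| <= M by apply: bnd.
  have := ler_normD (- C x * (cos (th x) * cos (th x))) ((A x - B x) * (cos (th x) * sin (th x))).
  have : 0 <= M by lra.
  lra.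
pose rho t := expR (0 + \int[mu]_(x in `[0, t]) k x).
exists rho; split=> [t||b bD]; first exact: expR_gt0.
  by rewrite /rho set_itv1 Rintegral_set1 addr0 expR0.
have dr : acd b rho (fun t => rho t * k t) by apply: acd_exp; exact: acd_integral (ik b bD).
have dth := angle_acd ath bD.
have cs1 x : cos (th x) ^+ 2 = 1 - sin (th x) ^+ 2 by rewrite -(cos2Dsin2 (th x)); ring.
split.
  apply: acd_eq (acdM dr (acd_cos dth)) _ => x _; rewrite /k /qform.
  set s := sin _ in cs1 *; set c := cos _ in cs1 *.
  rewrite [LHS](_ : _ = - l * rho x * (c ^+ 2 + s ^+ 2) * (C x * c + B x * s)); last ring.
  by rewrite /c cs1 subrK; ring.
apply: acd_eq (acdM dr (acd_sin dth)) _ => x _; rewrite /k /qform.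
set s := sin _ in cs1 *; set c := cos _ in cs1 *.
rewrite [LHS](_ : _ = l * rho x * (c ^+ 2 + s ^+ 2) * (A x * c + C x * s)); last ring.
by rewrite /c cs1 subrK; ring.
Qed.

End Solutions.

(** * Integrals over tails of [[0, T)] and the Cauchy-Schwarz inequality *)

Section Tails.
Context {R : realType}.
Notation mu := (@lebesgue_measure R).
Local Notation itg D f := (mu.-integrable D (EFin \o (f : R -> R))).
Implicit Types (T : \bar R) (f g : R -> R).

Definition tail T (t : R) : set R := [set x | hointerval T x /\ t <= x].

Lemma tailE T t : tail T t = hointerval T `&` `[t, +oo[.
Proof.
by apply/seteqP; split=> x /=; rewrite in_itv/= andbT => -[].
Qed.

Lemma measurable_tail T t : measurable (tail T t).
Proof. by rewrite tailE; apply: measurableI => //; exact: measurable_hointerval. Qed.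

Lemma tail_sub T t : tail T t `<=` hointerval T.
Proof. by move=> x []. Qed.

Lemma tailS T s t : s <= t -> tail T t `<=` tail T s.
Proof. by move=> st x [xD tx]; split=> //; exact: le_trans tx. Qed.

Lemma itg_tail T f t : itg (hointerval T) f -> itg (tail T t) f.
Proof.
by apply: itgS; [exact: measurable_hointerval|exact: measurable_tail|exact: tail_sub].
Qed.

Lemma seg_sub_D T s t : hointerval T t -> 0 <= s -> `[s, t] `<=` hointerval T.
Proof.
move=> tD s0 x /=; rewrite in_itv/= => /andP[sx xt].
by apply: hointerval_le tD _ xt; exact: le_trans sx.
Qed.

Lemma itg_seg T f s t : hointerval T t -> 0 <= s -> itg (hointerval T) f -> itg `[s, t] f.
Proof.
by move=> tD s0; apply: itgS => //; [exact: measurable_hointerval|exact: seg_sub_D].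
Qed.

Lemma itg_seg_sub f a b s t : a <= s -> t <= b -> itg `[a, b] f -> itg `[s, t] f.
Proof.
move=> as_ tb; apply: itgS => // x /=; rewrite !in_itv/= => /andP[sx xt].
by rewrite (le_trans as_ sx) (le_trans xt tb).
Qed.

Lemma Rintegral_seg_cat f a s t : a <= s -> s <= t -> itg `[a, t] f ->
  \int[mu]_(x in `[a, t]) f x = \int[mu]_(x in `[a, s]) f x + \int[mu]_(x in `[s, t]) f x.
Proof.
move=> as_ st fi; rewrite (Rintegral_seg_split as_ st fi); congr (_ + _).
rewrite Rintegral_itv_obnd_cbnd//; apply: itgS fi => // x /=; rewrite !in_itv/= => /andP[sx ->].
by rewrite andbT (le_trans as_ (ltW sx)).
Qed.

Lemma Rintegral_D_split T f t : hointerval T t -> itg (hointerval T) f ->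
  \int[mu]_(x in hointerval T) f x =
  \int[mu]_(x in `[0, t]) f x + \int[mu]_(x in tail T t) f x.
Proof.
move=> tD fi; have [t0 _] := tD.
rewrite (@Rintegral_setU2 _ _ `[0, t[ (tail T t))//; last first.
- by apply/seteqP; split=> x //= []; rewrite in_itv/= => /andP[_ xt] [_ tx]; lra.
- apply/seteqP; split=> x /=; rewrite in_itv/=.
    move=> xD; have [xt|tx] := ltP x t; [left|by right].
    by case: xD => -> _.
  move=> [/andP[x0 xt]|[]//]; exact: hointerval_le (ltW xt).
- exact: measurable_tail.
congr (_ + _); rewrite Rintegral_itv_bndo_bndc//; apply: itgS (itg_seg tD (lexx 0) fi) => //.
exact: subset_itv_co_cc.
Qed.

Lemma Rintegral_tail_split T f s t : 0 <= s -> s <= t -> hointerval T t ->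
  itg (hointerval T) f ->
  \int[mu]_(x in tail T s) f x =
  \int[mu]_(x in `[s, t]) f x + \int[mu]_(x in tail T t) f x.
Proof.
move=> s0 st tD fi; have sD := hointerval_le tD s0 st.
have := Rintegral_D_split sD fi; rewrite (Rintegral_D_split tD fi).
rewrite (Rintegral_seg_cat s0 st (itg_seg tD (lexx 0) fi)); lra.
Qed.

Lemma acd_increment c f g s t : acd c f g -> itg `[0, c] g -> 0 <= s -> s <= t -> t <= c ->
  f t = f s + \int[mu]_(x in `[s, t]) g x.
Proof.
move=> df gi s0 st tc.
rewrite (acd_FTC df gi (t := t)) ?tc ?(le_trans s0)// (acd_FTC df gi (t := s)) ?s0 ?(le_trans st)//.
rewrite (Rintegral_seg_cat s0 st) ?addrA//; exact: itg_seg_sub gi.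
Qed.

Lemma hointerval_cvg T g : (0 < T)%E -> measurable_fun (hointerval T) g ->
  (forall x, hointerval T x -> 0 <= g x) ->
  exists2 b : nat -> R, forall n, hointerval T (b n) &
    (\int[mu]_(x in `[0%R, b n]) (g x)%:E)%E @[n --> \oo] -->
    (\int[mu]_(x in hointerval T) (g x)%:E)%E.
Proof.
move=> T0 mg g0; have [b [bT bm] hb] := hointerval_seq T0.
exists b => //.
have -> : hointerval T = \bigcup_n (`[0, b n]%classic : set R).
  apply/seteqP; split=> t.
    move=> tT; have [n tn] := hb _ tT; exists n => //=.
    by rewrite in_itv/= tT.1 ltW.
  by move=> [n _ /=] tn; exact: (hointerval_seg (bT n)).
apply: ge0_nondecreasing_set_cvg_integral => //.
- move=> n m nm; apply/subsetPset => x /=; rewrite !in_itv/= => /andP[-> xn]/=.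
  exact: le_trans (bm _ _ nm).
- by move=> n; apply/measurable_EFinP; exact: measurable_hointerval_seg mg.
- by move=> n x /(hointerval_seg (bT n)) xD; rewrite lee_fin g0.
Qed.

Lemma itg_exhaust T g M : (0 < T)%E -> measurable_fun (hointerval T) g ->
  (forall x, hointerval T x -> 0 <= g x) ->
  (forall b, hointerval T b -> (\int[mu]_(x in `[0%R, b]) (g x)%:E <= M%:E)%E) ->
  itg (hointerval T) g.
Proof.
move=> T0 mg g0 gM; have [b bT cvb] := hointerval_cvg T0 mg g0.
apply/integrableP; split; first exact/measurable_EFinP.
under eq_integral => x xD do rewrite /= ger0_norm ?(g0 _ (set_mem xD))//.
apply: (@le_lt_trans _ _ M%:E); last exact: ltry.
apply: (cvge_le _ cvb).
apply: nearW => n; exact: gM.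
Qed.

Lemma tail_small T g e : (0 < T)%E -> itg (hointerval T) g -> 0 < e ->
  exists2 b, hointerval T b & forall s, hointerval T s -> b <= s ->
    \int[mu]_(x in tail T s) `|g x| <= e.
Proof.
move=> T0 gi e0; have mD := measurable_hointerval T.
have ni := itg_norm mD gi.
have [b bT cvb] := hointerval_cvg T0 (itg_measurable ni) (fun _ _ => normr_ge0 _).
have cv : \int[mu]_(x in `[0, b n]) `|g x| @[n --> \oo] --> \int[mu]_(x in hointerval T) `|g x|.
  by apply: fine_cvg; rewrite fineK; [exact: cvb|exact: integrable_fin_num].
have /cvgrPdist_lt/(_ _ e0)[n _ /(_ n (leqnn n))/= hn] := cv.
exists (b n) => // s sD bs.
have s0 : 0 <= s by case: sD.
have := Rintegral_D_split sD ni; have := Rintegral_ge0_subset (D' := `[0, b n]) _ _ _ (itg_seg sD (lexx 0) ni) (fun _ _ => normr_ge0 _).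
move=> /(_ (measurable_itv _) (measurable_itv _)) h1 h2.
have : \int[mu]_(x in `[0, b n]) `|g x| <= \int[mu]_(x in `[0, s]) `|g x|.
  by apply: h1 => x /=; rewrite !in_itv/= => /andP[-> xb]; rewrite (le_trans xb).
by have := ltr_normlW hn; move: h2; clear; lra.
Qed.

(** The optimal choice is [e = x / a]. When [a = 0] the choice [e = (b + 1) / x] gives [x <= x / 2],
    which is absurd for positive [x]. *)
Lemma sqr_le_of_amgm (x a b : R) : 0 <= x -> 0 <= a -> 0 <= b ->
  (forall e, 0 < e -> x <= (e * a + b / e) / 2) -> x ^+ 2 <= a * b.
Proof.
move=> x0 a0 b0 h; have [->|xn0] := eqVneq x 0; first by rewrite expr0n/= mulr_ge0.
have {xn0}x0 : 0 < x by rewrite lt_neqAle eq_sym xn0.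
have [az|an0] := eqVneq a 0.
  have e0 : 0 < (b + 1) / x by rewrite divr_gt0// ltr_wpDl.
  have := h _ e0; rewrite az mulr0 add0r invf_div.
  rewrite (_ : b * _ / 2 = x * (b / (b + 1) / 2)); last by field; rewrite gt_eqF// ltr_wpDl.
  rewrite -{1}[x]mulr1 ler_pM2l// => H.
  have : b / (b + 1) <= 1 by rewrite ler_pdivrMr ?ltr_wpDl//; lra.
  lra.
have {an0}a0 : 0 < a by rewrite lt_neqAle eq_sym an0.
have := h _ (divr_gt0 x0 a0); rewrite divfK ?gt_eqF// => H.
have : x <= b / (x / a) by lra.
by rewrite ler_pdivlMr ?divr_gt0// mulrA ler_pdivrMr// -expr2 mulrC.
Qed.

(** Stated for a pointwise bound [f ^+ 2 <= g * h] because the integrands that occur, such as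
    [C * p + B * q], are values of the weight as a bilinear form. *)
Lemma cauchy_schwarz E f g h : measurable E -> measurable_fun E f ->
  itg E g -> itg E h -> (forall x, E x -> 0 <= g x) -> (forall x, E x -> 0 <= h x) ->
  (forall x, E x -> f x ^+ 2 <= g x * h x) ->
  itg E f /\ (\int[mu]_(x in E) f x) ^+ 2 <= \int[mu]_(x in E) g x * \int[mu]_(x in E) h x.
Proof.
move=> mE mf gi hi g0 h0 fgh.
have key e x : 0 < e -> E x -> `|f x| <= (e / 2) * g x + (2 * e)^-1 * h x.
  move=> e0 Ex; have gx := g0 x Ex; have hx := h0 x Ex.
  have r0 : 0 <= e / 2 * g x + (2 * e)^-1 * h x.
    by rewrite addr_ge0// mulr_ge0// ?divr_ge0 ?invr_ge0 ?mulr_ge0// ltW.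
  rewrite -ler_sqr ?nnegrE// real_normK ?num_real//; apply: le_trans (fgh x Ex) _.
  rewrite -subr_ge0 (_ : _ - _ = (e / 2 * g x - (2 * e)^-1 * h x) ^+ 2) ?sqr_ge0//.
  by field; rewrite gt_eqF.
have fi : itg E f.
  apply: itg_le (key 1 ^~ ltr01) => //.
  by apply: itgD => //; apply: itgZ.
split=> //; rewrite -(real_normK (num_real _)).
apply: sqr_le_of_amgm => //; [exact: Rintegral_ge0|exact: Rintegral_ge0|].
move=> e e0.
apply: (@le_trans _ _ (\int[mu]_(x in E) ((e / 2) * g x + (2 * e)^-1 * h x))).
  by apply: Rintegral_norm_le => //; [apply: itgD => //; exact: itgZ|move=> x; exact: key].
rewrite RintegralD//; [|exact: itgZ|exact: itgZ].
rewrite !RintegralZl// le_eqVlt; apply/orP; left; apply/eqP; field.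
by rewrite gt_eqF.
Qed.

End Tails.

(** * Tail estimates and eigenfunctions *)

Section TailEstimates.
Context {R : realType}.
Notation mu := (@lebesgue_measure R).
Local Notation itg D f := (mu.-integrable D (EFin \o (f : R -> R))).

Definition headint (A : R -> R) (t : R) : R := \int[mu]_(x in `[0, t]) A x.
Definition tailint T (B : R -> R) (t : R) : R := \int[mu]_(x in tail T t) B x.

(* [A t * tailint T B t + B t * headint A t] is the diagonal of the kernel of the
   squared inverse operator. *)
Definition hs_density T (A B : R -> R) (t : R) : R :=
  A t * tailint T B t + B t * headint A t.

(** The oscillation theory and the resolvent estimates see the operator only through these
    conditions. Integrability of [B] reflects the finite norm of [u1], that of the density the
    Hilbert-Schmidt hypothesis. *)
Record hs_system T (A B C : R -> R) : Prop := HsSystem {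
  hs_cs :> canonical_system T A B C;
  hs_iB : itg (hointerval T) B;
  hs_iH : itg (hointerval T) (hs_density T A B) }.

Section CauchySchwarz.
Context {T : \bar R} {A B C : R -> R} (cs : canonical_system T A B C).
Local Notation D := (hointerval T).
Local Notation Q := (qform A B C).
Local Notation AA := (headint A).
Local Notation BB := (tailint T B).
Local Notation H := (hs_density T A B).

Lemma AA_ge0 t : D t -> 0 <= AA t.
Proof.
move=> tD; apply: Rintegral_ge0 => x /=; rewrite in_itv/= => xt.
exact/ltW/(cs_A0 cs)/(D_seg tD xt).
Qed.

Lemma BB_ge0 t : 0 <= BB t.
Proof. by apply: Rintegral_ge0 => x [xD _]; exact/ltW/(cs_B0 cs). Qed.

Lemma AA_le s t : D t -> 0 <= s -> s <= t -> AA s <= AA t.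
Proof.
move=> tD s0 st; apply: Rintegral_ge0_subset => //.
- by move=> x /=; rewrite !in_itv/= => /andP[-> xs]; rewrite (le_trans xs).
- by have [] := cs_itg cs tD.
- by move=> x /=; rewrite in_itv/= => xt; exact/ltW/(cs_A0 cs)/(D_seg tD xt).
Qed.

Lemma hs_density_ge0 t : D t -> 0 <= H t.
Proof.
move=> tD; rewrite addr_ge0// mulr_ge0 ?BB_ge0 ?AA_ge0//; apply: ltW.
  exact: (cs_A0 cs).
exact: (cs_B0 cs).
Qed.

(** Cauchy-Schwarz for the form at time [t], applied to [(0, 1)] and [(x, y)]. *)
Lemma sqrB_le_qform t x y : D t -> (C t * x + B t * y) ^+ 2 <= B t * Q t x y.
Proof.
move=> tD; rewrite -subr_ge0 /qform.
rewrite [X in 0 <= X](_ : _ = (A t * B t - C t ^+ 2) * x ^+ 2); last ring.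
by rewrite mulr_ge0 ?sqr_ge0// subr_ge0; exact/ltW/(cs_C2 cs).
Qed.

Lemma sqrA_le_qform t x y : D t -> (A t * x + C t * y) ^+ 2 <= A t * Q t x y.
Proof.
move=> tD; rewrite -subr_ge0 /qform.
rewrite [X in 0 <= X](_ : _ = (A t * B t - C t ^+ 2) * y ^+ 2); last ring.
by rewrite mulr_ge0 ?sqr_ge0// subr_ge0; exact/ltW/(cs_C2 cs).
Qed.

Lemma measurable_lin E (a c p q : R -> R) : E `<=` D -> measurable E ->
  measurable_fun D a -> measurable_fun D c ->
  measurable_fun E p -> measurable_fun E q ->
  measurable_fun E (fun t => a t * p t + c t * q t).
Proof.
move=> ED mE ma mc mp mq.
have mS (f : R -> R) : measurable_fun D f -> measurable_fun E f.
  by apply: measurable_funS => //; exact: measurable_hointerval.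
by apply: measurable_funD; apply: measurable_funM => //; exact: mS.
Qed.

Lemma csB E p q : itg D B -> E `<=` D -> measurable E -> measurable_fun E p -> measurable_fun E q ->
  itg E (fun t => Q t (p t) (q t)) ->
  itg E (fun t => C t * p t + B t * q t) /\
  (\int[mu]_(t in E) (C t * p t + B t * q t)) ^+ 2 <=
  \int[mu]_(t in E) B t * \int[mu]_(t in E) Q t (p t) (q t).
Proof.
move=> iB ED mE mp mq iQ; apply: cauchy_schwarz => //.
- by apply: measurable_lin => //; [exact: (cs_mC cs)|exact: (cs_mB cs)].
- by apply: itgS iB => //; exact: measurable_hointerval.
- by move=> x /ED xD; exact/ltW/(cs_B0 cs).
- by move=> x /ED xD; exact: (qform_ge0 cs).
- by move=> x /ED xD; exact: sqrB_le_qform.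
Qed.

Lemma csA E p q : E `<=` D -> measurable E -> measurable_fun E p -> measurable_fun E q ->
  itg E A -> itg E (fun t => Q t (p t) (q t)) ->
  itg E (fun t => A t * p t + C t * q t) /\
  (\int[mu]_(t in E) (A t * p t + C t * q t)) ^+ 2 <=
  \int[mu]_(t in E) A t * \int[mu]_(t in E) Q t (p t) (q t).
Proof.
move=> ED mE mp mq iA iQ; apply: cauchy_schwarz => //.
- by apply: measurable_lin => //; [exact: (cs_mA cs)|exact: (cs_mC cs)].
- by move=> x /ED xD; exact/ltW/(cs_A0 cs).
- by move=> x /ED xD; exact: (qform_ge0 cs).
- by move=> x /ED xD; exact: sqrA_le_qform.
Qed.

End CauchySchwarz.

Context {T : \bar R} {A B C : R -> R} (hs : hs_system T A B C).
Let cs : canonical_system T A B C := hs.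
Local Notation D := (hointerval T).
Local Notation Q := (qform A B C).
Local Notation AA := (headint A).
Local Notation BB := (tailint T B).
Local Notation H := (hs_density T A B).

(** This dominates the squared Hilbert-Schmidt norm of the inverse restricted to [[b, T)]. *)
Definition kap (b : R) : R := \int[mu]_(x in tail T b) H x.

Lemma kap_ge0 b : 0 <= kap b.
Proof. by apply: Rintegral_ge0 => x [xD _]; exact: (hs_density_ge0 cs). Qed.

Lemma kap_small e : 0 < e -> exists2 b, D b & forall s, D s -> b <= s ->
  kap s <= e /\ BB s <= e.
Proof.
move=> e0; have [b1 b1D h1] := tail_small (cs_T cs) (hs_iH hs) e0.
have [b2 b2D h2] := tail_small (cs_T cs) (hs_iB hs) e0.
exists (Num.max b1 b2) => [|s sD]; first by case: (leP b1 b2).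
rewrite ge_max => /andP[s1 s2]; split.
  apply: le_trans (h1 s sD s1); apply: Rintegral_le.
  - exact: measurable_tail.
  - exact: itg_tail (hs_iH hs).
  - apply: itg_norm; [exact: measurable_tail|exact: itg_tail (hs_iH hs)].
  - by move=> x _; exact: ler_norm.
apply: le_trans (h2 s sD s2); apply: Rintegral_le.
- exact: measurable_tail.
- exact: itg_tail (hs_iB hs).
- apply: itg_norm; [exact: measurable_tail|exact: itg_tail (hs_iB hs)].
- by move=> x _; exact: ler_norm.
Qed.

(** [AA] is nondecreasing, so the summand [B x * AA x] of the density beyond [t] already suffices.
    The bound is what makes products of a first and a second component vanish at [T]. *)
Lemma AB_le_kap t : D t -> AA t * BB t <= kap t.
Proof.
move=> tD; have [t0 _] := tD; rewrite /tailint -RintegralZl; last 2 first.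
- exact: measurable_tail.
- exact: itg_tail (hs_iB hs).
apply: Rintegral_le.
- exact: measurable_tail.
- apply: itgZ; [exact: measurable_tail|exact: itg_tail (hs_iB hs)].
- exact: itg_tail (hs_iH hs).
move=> x [xD tx]; rewrite /hs_density mulrC ler_wpDl//.
  by rewrite mulr_ge0 ?(BB_ge0 cs)//; exact/ltW/(cs_A0 cs).
by rewrite ler_wpM2l ?(AA_le cs)//; exact/ltW/(cs_B0 cs).
Qed.

(** Cauchy-Schwarz bounds the deviation of [p] through [BB t] and that of [q] through [AA t];
    inserted in [qform_le] they produce the density. [Sp] and [Sm] stay abstract so that one proof
    serves a segment, with [p] anchored at its right end, and a whole tail, with [p] anchored at
    [T]. *)
Lemma tail_est (S : set R) (Sp Sm : R -> set R) p q p1 q1 l b : measurable S ->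
  S `<=` tail T b ->
  (forall t, S t -> [/\ measurable (Sp t), Sp t `<=` S & Sp t `<=` tail T t]) ->
  (forall t, S t -> [/\ measurable (Sm t), Sm t `<=` S & Sm t `<=` `[0, t]]) ->
  measurable_fun S p -> measurable_fun S q -> itg S (fun t => Q t (p t) (q t)) ->
  (forall t, S t -> p t = p1 + l * \int[mu]_(x in Sp t) (C x * p x + B x * q x)) ->
  (forall t, S t -> q t = q1 + l * \int[mu]_(x in Sm t) (A x * p x + C x * q x)) ->
  [/\ itg S (fun t => Q t (p t - p1) (q t - q1)),
    \int[mu]_(t in S) Q t (p t - p1) (q t - q1) <=
      2 * l ^+ 2 * kap b * \int[mu]_(t in S) Q t (p t) (q t),
    forall t, S t -> (p t - p1) ^+ 2 <= l ^+ 2 * (BB t * \int[mu]_(t in S) Q t (p t) (q t)) &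
    forall t, S t -> (q t - q1) ^+ 2 <= l ^+ 2 * (AA t * \int[mu]_(t in S) Q t (p t) (q t))].
Proof.
move=> mS Sb hp hm mp mq iQ ep eq_.
have SD : S `<=` D by apply: subset_trans Sb _; exact: tail_sub.
set I := \int[mu]_(t in S) Q t (p t) (q t).
have Q0 E : E `<=` S -> forall x, E x -> 0 <= Q x (p x) (q x).
  by move=> ES x /ES/SD xD; exact: (qform_ge0 cs).
have subI E : measurable E -> E `<=` S -> \int[mu]_(t in E) Q t (p t) (q t) <= I.
  by move=> mE ES; apply: Rintegral_ge0_subset => //; exact: Q0.
have I0 : 0 <= I by apply: Rintegral_ge0; exact: Q0.
have hpt t : S t -> (p t - p1) ^+ 2 <= l ^+ 2 * (BB t * I).
  move=> St; have [mSp SpS Spt] := hp t St.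
  rewrite ep// addrAC subrr add0r exprMn ler_wpM2l ?sqr_ge0//.
  have SpD : Sp t `<=` D by exact: subset_trans SpS SD.
  have [_ h] := csB cs (hs_iB hs) SpD mSp (measurable_funS mS SpS mp) (measurable_funS mS SpS mq) (itgS mS mSp SpS iQ).
  apply: le_trans h _; apply: ler_pM.
  - by apply: Rintegral_ge0 => x /SpD xD; exact/ltW/(cs_B0 cs).
  - by apply: Rintegral_ge0; exact: Q0.
  - apply: Rintegral_ge0_subset => //; [exact: measurable_tail|exact: itg_tail (hs_iB hs)|].
    by move=> x [xD _]; exact/ltW/(cs_B0 cs).
  - exact: subI.
have hqt t : S t -> (q t - q1) ^+ 2 <= l ^+ 2 * (AA t * I).
  move=> St; have [mSm SmS Smt] := hm t St; have tD := SD t St.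
  rewrite eq_// addrAC subrr add0r exprMn ler_wpM2l ?sqr_ge0//.
  have SmD : Sm t `<=` D by exact: subset_trans SmS SD.
  have [iA _ _] := cs_itg cs tD.
  have iA' : itg (Sm t) A by apply: itgS iA.
  have [_ h] := csA cs SmD mSm (measurable_funS mS SmS mp) (measurable_funS mS SmS mq) iA' (itgS mS mSm SmS iQ).
  apply: le_trans h _; apply: ler_pM.
  - by apply: Rintegral_ge0 => x /SmD xD; exact/ltW/(cs_A0 cs).
  - by apply: Rintegral_ge0; exact: Q0.
  - apply: Rintegral_ge0_subset => //.
    by move=> x /=; rewrite in_itv/= => xt; exact/ltW/(cs_A0 cs)/(D_seg tD xt).
  - exact: subI.
have iH : itg S H by apply: itgS (itg_tail b (hs_iH hs)) => //; exact: measurable_tail.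
have bnd t : S t -> Q t (p t - p1) (q t - q1) <= 2 * l ^+ 2 * I * H t.
  move=> St; have tD := SD t St; apply: le_trans (qform_le cs _ _ tD) _.
  have h1 := ler_wpM2l (ltW (cs_A0 cs tD)) (hpt t St).
  have h2 := ler_wpM2l (ltW (cs_B0 cs tD)) (hqt t St).
  by rewrite /hs_density; move: h1 h2; clear; lra.
have mQ' : measurable_fun S (fun t => Q t (p t - p1) (q t - q1)).
  by apply: (measurable_qform cs) => //; apply: measurable_funB.
have iQ' : itg S (fun t => Q t (p t - p1) (q t - q1)).
  apply: (itg_le mS mQ' (itgZ (2 * l ^+ 2 * I) mS iH)) => x Sx.
  by rewrite ger0_norm ?bnd// (qform_ge0 cs)//; exact: SD.
split=> //.
apply: le_trans (Rintegral_le mS iQ' (itgZ _ mS iH) bnd) _.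
have c0 : 0 <= 2 * l ^+ 2 * I by rewrite mulr_ge0// mulr_ge0// sqr_ge0.
rewrite RintegralZl// -[leRHS]mulrAC ler_wpM2l//.
apply: Rintegral_ge0_subset => //; [exact: measurable_tail|exact: itg_tail (hs_iH hs)|].
by move=> x [xD _]; exact: (hs_density_ge0 cs).
Qed.

Lemma itg_solution_seg l p q s t : solution T A B C l p q -> D t -> 0 <= s ->
  [/\ itg `[s, t] (fun x => Q x (p x) (q x)),
      itg `[s, t] (fun x => C x * p x + B x * q x) &
      itg `[s, t] (fun x => A x * p x + C x * q x)].
Proof.
move=> sol tD s0.
have [dp dq] := sol t tD; have [mp mq] := (acd_measurable dp, acd_measurable dq).
have [M M0 hM] := acd_bounded dp; have [N N0 hN] := acd_bounded dq.
have [iA iB iC] := cs_itg cs tD.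
have sub := itg_seg_sub s0 (lexx t).
have pp : itg `[0, t] (fun x => C x * p x + B x * q x).
  apply: itgD => //; first apply: (itg_mul_bounded (M := M)) => //.
  by apply: (itg_mul_bounded (M := N)).
have qq : itg `[0, t] (fun x => A x * p x + C x * q x).
  apply: itgD => //; first apply: (itg_mul_bounded (M := M)) => //.
  by apply: (itg_mul_bounded (M := N)).
split; apply: sub => //.
have : itg `[0, t] (fun x => (A x * p x + C x * q x) * p x + (C x * p x + B x * q x) * q x).
  apply: itgD => //; first apply: (itg_mul_bounded (M := M)) => //.
  by apply: (itg_mul_bounded (M := N)).
by apply: itg_eq => // x _; rewrite /qform; ring.
Qed.

Lemma solution_increment l p q s t : solution T A B C l p q -> D t -> 0 <= s -> s <= t ->
  p s = p t + l * \int[mu]_(x in `[s, t]) (C x * p x + B x * q x) /\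
  q t = q s + l * \int[mu]_(x in `[s, t]) (A x * p x + C x * q x).
Proof.
move=> sol tD s0 st; have [dp dq] := sol t tD.
have [_ i1 i2] := itg_solution_seg sol tD (lexx 0).
have [_ j1 j2] := itg_solution_seg sol tD s0.
rewrite (acd_increment dp (itgZ (- l) _ i1) s0 st (lexx t))// RintegralZl//.
rewrite (acd_increment dq (itgZ l _ i2) s0 st (lexx t))// RintegralZl//.
by split=> //; ring.
Qed.

Lemma seg_est l p q s t b : solution T A B C l p q -> D t -> 0 <= b -> b <= s -> s <= t ->
  itg `[s, t] (fun x => Q x (p x - p t) (q x - q s)) /\
  \int[mu]_(x in `[s, t]) Q x (p x - p t) (q x - q s) <=
    2 * l ^+ 2 * kap b * \int[mu]_(x in `[s, t]) Q x (p x) (q x).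
Proof.
move=> sol tD b0 bs st; have s0 := le_trans b0 bs.
have [iQ _ _] := itg_solution_seg sol tD s0.
have [dp dq] := sol t tD.
have subm (f : R -> R) : measurable_fun `[0, t] f -> measurable_fun `[s, t] f.
  apply: measurable_funS => // x /=; rewrite !in_itv/= => /andP[sx ->].
  by rewrite (le_trans s0).
have [] := @tail_est `[s, t] (fun x => `[x, t]%classic) (fun x => `[s, x]%classic) p q (p t) (q s) l b => //.
- move=> x /= xst; split; first exact: seg_sub_D xst.
  by move: xst; rewrite in_itv/= => /andP[sx _]; exact: le_trans sx.
- move=> x /=; rewrite in_itv/= => /andP[sx xt]; split=> //.
    by move=> y /=; rewrite !in_itv/= => /andP[xy ->]; rewrite (le_trans sx).
  move=> y /=; rewrite in_itv/= => /andP[xy yt]; split=> //.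
  by apply: hointerval_le tD _ yt; rewrite (le_trans s0)// (le_trans sx).
- move=> x /=; rewrite in_itv/= => /andP[sx xt]; split=> //.
    by move=> y /=; rewrite !in_itv/= => /andP[-> yx]; rewrite (le_trans yx).
  by move=> y /=; rewrite !in_itv/= => /andP[sy ->]; rewrite (le_trans s0).
- exact: subm (acd_measurable dp).
- exact: subm (acd_measurable dq).
- move=> x /=; rewrite in_itv/= => /andP[sx xt].
  by have [] := solution_increment sol tD (le_trans s0 sx) xt.
- move=> x /=; rewrite in_itv/= => /andP[sx xt].
  have xD : D x by apply: hointerval_le tD _ xt; exact: le_trans sx.
  by have [] := solution_increment sol xD s0 sx.
Qed.

Lemma qform_polar t x y q1 :
  Q t x (y - q1) = Q t x y - 2 * q1 * (C t * x + B t * y) + q1 ^+ 2 * B t.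
Proof. by rewrite /qform; ring. Qed.

Lemma seg_gt0 g s t : itg `[0, t] g -> (forall x, 0 <= x <= t -> 0 < g x) ->
  0 <= s -> s < t -> 0 < \int[mu]_(x in `[s, t]) g x.
Proof.
move=> gi g0 s0 st; have dg := acd_integral 0 gi.
have := acd_increment dg gi s0 (ltW st) (lexx t).
have ag : {ae mu, forall x, 0 <= x <= t -> 0 < g x} by exact: aeW.
have := acd_gt0_lt dg ag s0 st (lexx t).
by move=> + E; rewrite E ltrDl.
Qed.

Lemma polar_integral l p q s t q1 : solution T A B C l p q -> D t -> 0 <= s -> s <= t ->
  \int[mu]_(x in `[s, t]) Q x (p x) (q x - q1) =
  \int[mu]_(x in `[s, t]) Q x (p x) (q x) -
  2 * q1 * \int[mu]_(x in `[s, t]) (C x * p x + B x * q x) +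
  q1 ^+ 2 * \int[mu]_(x in `[s, t]) B x.
Proof.
move=> sol tD s0 st; have [iQ i1 _] := itg_solution_seg sol tD s0.
have iB : itg `[s, t] B by exact: itg_seg (hs_iB hs).
rewrite -!RintegralZl// -RintegralB//; last exact: itgZ.
rewrite -RintegralD//; first by apply: eq_Rintegral => x _; rewrite qform_polar.
  by apply: itgB => //; exact: itgZ.
exact: itgZ.
Qed.

Lemma solution_seg_gt0 l p q s t : solution T A B C l p q -> D t -> 0 <= s -> s < t ->
  (forall x, D x -> (p x, q x) != (0, 0)) ->
  0 < \int[mu]_(x in `[s, t]) Q x (p x) (q x).
Proof.
move=> sol tD s0 st nz; apply: seg_gt0 => //.
  by have [] := itg_solution_seg sol tD (lexx 0).
by move=> x xt; apply: (qform_gt0 cs); [|apply: nz]; exact: D_seg xt.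
Qed.

(** Expand the energy of [(p, q - q s)] over [[s, t]]. The cross term vanishes, since [q s = 0] or
    [l * \int (C p + B q) = p s - p t = 0], so the expansion is at least the energy of [(p, q)]; by
    [seg_est] it is also strictly smaller. *)
Lemma no_two_zeros l p q b s t : solution T A B C l p q -> l != 0 ->
  (forall x, D x -> (p x, q x) != (0, 0)) ->
  D t -> 0 <= b -> 2 * l ^+ 2 * kap b < 1 -> b <= s -> s < t ->
  p t = 0 -> p s = 0 \/ q s = 0 -> False.
Proof.
move=> sol l0 nz tD b0 k1 bs st pt ps; have s0 := le_trans b0 bs.
have [iQ' h] := seg_est sol tD b0 bs (ltW st).
have I0 := solution_seg_gt0 sol tD s0 st nz.
move: h; under eq_Rintegral do rewrite pt subr0.
rewrite (polar_integral _ sol tD s0 (ltW st)).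
have -> : 2 * q s * \int[mu]_(x in `[s, t]) (C x * p x + B x * q x) = 0.
  have [E _] := solution_increment sol tD s0 (ltW st).
  case: ps => [ps|->]; last by rewrite mulr0 mul0r.
  move: E; rewrite ps pt add0r => /esym/eqP; rewrite mulf_eq0 (negPf l0)/= => /eqP ->.
  by rewrite mulr0.
rewrite subr0 => h.
have B0 : 0 <= \int[mu]_(x in `[s, t]) B x.
  by apply: Rintegral_ge0 => x /(seg_sub_D tD s0) xD; exact/ltW/(cs_B0 cs).
have := mulr_ge0 (sqr_ge0 (q s)) B0.
have : 2 * l ^+ 2 * kap b * \int[mu]_(x in `[s, t]) Q x (p x) (q x) <
   1 * \int[mu]_(x in `[s, t]) Q x (p x) (q x) by rewrite ltr_pM2r.
move: h; clear; lra.
Qed.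

End TailEstimates.

(** * Eigenfunctions: behaviour near [T] and Picone's identity *)

Section Eigenfunctions.
Context {R : realType}.
Notation mu := (@lebesgue_measure R).
Local Notation itg D f := (mu.-integrable D (EFin \o (f : R -> R))).

(** The epsilon form of convergence at [T] treats finite and infinite [T] alike; [vanishes_at_endP]
    relates it to the filter [right_end]. *)
Definition vanishes_at_end (T : \bar R) (p : R -> R) : Prop :=
  forall e, 0 < e -> exists2 b, hointerval T b &
    forall t, hointerval T t -> b <= t -> `|p t| <= e.

Definition eigen T (A B C : R -> R) l p q : Prop :=
  [/\ solution T A B C l p q,
    itg (hointerval T) (fun t => qform A B C t (p t) (q t)) & vanishes_at_end T p].

Context {T : \bar R} {A B C : R -> R} (hs : hs_system T A B C).
Let cs : canonical_system T A B C := hs.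
Local Notation D := (hointerval T).
Local Notation Q := (qform A B C).
Local Notation AA := (headint A).
Local Notation BB := (tailint T B).
Local Notation H := (hs_density T A B).
Local Notation kap := (@kap R T A B).

Lemma eigen_itgB l p q : eigen T A B C l p q -> itg D (fun t => C t * p t + B t * q t).
Proof.
move=> [sol iQ _]; have [mp mq] := solution_measurable cs sol.
by have [] := csB hs (hs_iB hs) (@subset_refl _ _) (measurable_hointerval T) mp mq iQ.
Qed.

Lemma eigen_tail l p q t : eigen T A B C l p q -> D t ->
  p t = l * \int[mu]_(x in tail T t) (C x * p x + B x * q x).
Proof.
move=> ev tD; have iB := eigen_itgB ev; have [sol iQ vp] := ev.
have t0 : 0 <= t by case: tD.
apply/eqP; rewrite -subr_eq0 -normr_le0; apply/ler_addgt0Pr => e e0; rewrite add0r.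
have e1 : 0 < e / (1 + `|l|) by rewrite divr_gt0// ltr_wpDr.
have [b1 b1D h1] := tail_small (cs_T cs) iB e1.
have [b2 b2D h2] := vp _ e1.
have [s [sD [s1 [s2 ts]]]] : exists s, D s /\ (b1 <= s /\ b2 <= s /\ t <= s).
  exists (Num.max t (Num.max b1 b2)); rewrite !le_max !lexx !orbT; split=> //.
  by case: (leP t _) => // _; case: (leP b1 b2).
have [-> _] := solution_increment hs sol sD t0 ts.
rewrite (Rintegral_tail_split t0 ts sD iB) mulrDr opprD addrA addrK.
apply: le_trans (ler_normB _ _) _; rewrite normrM.
have h3 : `|\int[mu]_(x in tail T s) (C x * p x + B x * q x)| <= e / (1 + `|l|).
  apply: le_trans (h1 s sD s1); apply: Rintegral_norm_le => //.
  - exact: measurable_tail.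
  - by apply: itg_measurable; exact: itg_tail.
  - apply: itg_norm; [exact: measurable_tail|exact: itg_tail].
rewrite -[leRHS](_ : e / (1 + `|l|) + `|l| * (e / (1 + `|l|)) = e); last first.
  by field; rewrite gt_eqF// ltr_wpDr.
by apply: lerD (h2 s sD s2) _; rewrite ler_wpM2l.
Qed.

Lemma eigen_est l p q b : eigen T A B C l p q -> D b ->
  [/\ itg (tail T b) (fun x => Q x (p x) (q x - q b)),
    \int[mu]_(x in tail T b) Q x (p x) (q x - q b) <=
    2 * l ^+ 2 * kap b * \int[mu]_(x in tail T b) Q x (p x) (q x),
    forall t, tail T b t -> p t ^+ 2 <=
      l ^+ 2 * (BB t * \int[mu]_(x in tail T b) Q x (p x) (q x)) &
    forall t, tail T b t -> (q t - q b) ^+ 2 <=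
      l ^+ 2 * (AA t * \int[mu]_(x in tail T b) Q x (p x) (q x))].
Proof.
move=> ev bD; have [sol iQ vp] := ev; have b0 : 0 <= b by case: bD.
have [mp mq] := solution_measurable cs sol.
have mt : measurable (tail T b) by exact: measurable_tail.
have mS (f : R -> R) : measurable_fun D f -> measurable_fun (tail T b) f.
  by apply: measurable_funS; [exact: measurable_hointerval|exact: tail_sub].
have [] := @tail_est _ _ _ _ _ hs (tail T b) (fun t => tail T t) (fun t => `[b, t]%classic)
   p q 0 (q b) l b mt.
- by [].
- by move=> t [tD bt]; split=> //; [exact: measurable_tail|exact: tailS].
- move=> t [tD bt]; split=> //.
    move=> x /=; rewrite in_itv/= => /andP[bx xt]; split=> //.
    by apply: hointerval_le tD _ xt; exact: le_trans bx.
  by move=> x /=; rewrite !in_itv/= => /andP[bx ->]; rewrite (le_trans b0).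
- exact: mS.
- exact: mS.
- exact: itg_tail.
- by move=> t [tD _]; rewrite add0r; exact: eigen_tail.
- by move=> t [tD bt]; have [] := solution_increment hs sol tD b0 bt.
move=> h1 h2 h3 h4; split=> //.
- by apply: itg_eq h1 => // x _; rewrite subr0.
- by under eq_Rintegral do rewrite -[p _]subr0; exact: h2.
- by move=> t ht; have := h3 t ht; rewrite subr0.
Qed.

(** The expansion of [no_two_zeros], now over [[b, T)] with [p] anchored at [T]: the estimate forces
    the cross term [q b * \int (C p + B q)], which is [p b * q b / l], to be positive. Near [T] the
    components of an eigenfunction therefore have the same sign. *)
Lemma eigen_pq_gt0 l p q b : 0 < l -> eigen T A B C l p q -> D b ->
  (forall x, D x -> (p x, q x) != (0, 0)) -> 2 * l ^+ 2 * kap b < 1 -> 0 < p b * q b.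
Proof.
move=> l0 ev bD nz k1; have [sol iQ vp] := ev; have b0 : 0 <= b by case: bD.
have [iQ' h _ _] := eigen_est ev bD.
have mt : measurable (tail T b) by exact: measurable_tail.
have iQt : itg (tail T b) (fun x => Q x (p x) (q x)) by exact: itg_tail.
have iBt : itg (tail T b) (fun x => C x * p x + B x * q x).
  by apply: itg_tail; exact: eigen_itgB ev.
have iB : itg (tail T b) B by apply: itg_tail; exact: (hs_iB hs).
have E : \int[mu]_(x in tail T b) Q x (p x) (q x - q b) =
  \int[mu]_(x in tail T b) Q x (p x) (q x) -
  2 * q b * \int[mu]_(x in tail T b) (C x * p x + B x * q x) +
  q b ^+ 2 * \int[mu]_(x in tail T b) B x.
  rewrite -!RintegralZl// -RintegralB//; last exact: itgZ.
  rewrite -RintegralD//; first by apply: eq_Rintegral => x _; rewrite qform_polar.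
    by apply: itgB => //; exact: itgZ.
  exact: itgZ.
have I0 : 0 < \int[mu]_(x in tail T b) Q x (p x) (q x).
  have [s bs sD] := hointerval_gt bD.
  apply: lt_le_trans (solution_seg_gt0 hs sol sD b0 bs nz) _.
  apply: Rintegral_ge0_subset => //.
    move=> x /=; rewrite in_itv/= => /andP[bx xs]; split=> //.
    by apply: hointerval_le sD _ xs; exact: le_trans bx.
  by move=> x [xD _]; exact: (qform_ge0 cs).
have qB : 0 <= q b ^+ 2 * \int[mu]_(x in tail T b) B x.
  by rewrite mulr_ge0 ?sqr_ge0//; exact: (BB_ge0 hs).
rewrite (eigen_tail ev bD) -mulrA pmulr_rgt0//.
have := ltr_pM2r I0 (2 * l ^+ 2 * kap b) 1; rewrite k1 mul1r => k2.
by move: h k2 qB; rewrite E; move: I0; clear; lra.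
Qed.

(** [q] may grow like the square root of [AA], but [p] decays like that of [BB], and both [BB] and
    [AA * BB <= kap] tend to 0. *)
Lemma eigen_pq_vanishes l p q : eigen T A B C l p q -> vanishes_at_end T (fun t => p t * q t).
Proof.
move=> ev e e0; have [sol iQ vp] := ev.
have D0 := D_0 cs.
have [_ _ hp hq] := eigen_est ev D0.
set I := \int[mu]_(x in tail T 0) Q x (p x) (q x) in hp hq.
have I0 : 0 <= I by apply: Rintegral_ge0 => x [xD _]; exact: (qform_ge0 cs).
pose K := 2 * l ^+ 2 * I * (q 0 ^+ 2 + l ^+ 2 * I) + 1.
have K0 : 0 < K.
  have h1 := mulr_ge0 (sqr_ge0 l) I0; have h2 := sqr_ge0 (q 0).
  have := mulr_ge0 h1 (addr_ge0 h2 h1); rewrite /K; lra.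
have e2 : 0 < e ^+ 2 / K by rewrite divr_gt0// exprn_gt0.
have [b bD hb] := kap_small hs e2.
exists b => // t tD bt; have [k1 k2] := hb t tD bt.
have t0 : tail T 0 t by split=> //; case: tD.
rewrite -ler_sqr ?nnegrE//; last exact: ltW.
rewrite real_normK ?num_real// exprMn.
have hp2 := hp t t0.
have hq2 : q t ^+ 2 <= 2 * q 0 ^+ 2 + 2 * (l ^+ 2 * (AA t * I)).
  have := hq t t0; have := sqr_ge0 (q t - 2 * q 0); rewrite !expr2; lra.
apply: le_trans (ler_pM (sqr_ge0 _) (sqr_ge0 _) hp2 hq2) _.
have E1 := AB_le_kap hs tD.
rewrite [leLHS](_ : _ = 2 * l ^+ 2 * I * (q 0 ^+ 2 * BB t + l ^+ 2 * I * (AA t * BB t))); last ring.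
have LI : 0 <= l ^+ 2 * I by rewrite mulr_ge0// sqr_ge0.
have LI2 : 0 <= 2 * l ^+ 2 * I by rewrite -mulrA mulr_ge0.
apply: (@le_trans _ _ (2 * l ^+ 2 * I * ((q 0 ^+ 2 + l ^+ 2 * I) * (e ^+ 2 / K)))).
  rewrite ler_wpM2l// mulrDl; apply: lerD; rewrite ler_wpM2l ?sqr_ge0//.
  exact: le_trans E1 k1.
rewrite mulrA mulrA ler_pdivrMr// mulrC ler_wpM2l ?sqr_ge0// /K lerDl//.
Qed.

(* Picone's identity for two solutions, in the ratios [p / q] and [P / S]. *)
Lemma picone l m p q P S a t : 0 < l -> l < m ->
  solution T A B C l p q -> solution T A B C m P S -> D t -> 0 <= a -> a <= t ->
  (forall x, a <= x <= t -> S x != 0) ->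
  q a * (p a * S a - q a * P a) / S a <= q t * (p t * S t - q t * P t) / S t.
Proof.
move=> l0 lm sol sol' tD a0 at_ S0.
have [dp dq] := sol t tD; have [dP dS] := sol' t tD.
have sub f g : acd t f g -> acdi a t f g.
  move=> [acf df]; split; first exact: ac_sub acf.
  by apply: (ae_imp _ df) => x h /andP[ax xt]; apply: h; rewrite xt (le_trans a0).
have {}dp := sub _ _ dp; have {}dq := sub _ _ dq; have {}dP := sub _ _ dP.
have {}dS := sub _ _ dS.
have dF := acdM (acdM dq (acdB (acdM dp dS) (acdM dq dP))) (acdV at_ dS S0).
apply: (acd_ge0_le dF) => //; apply: aeW => x xat; have S0x := S0 x xat.
have xD : D x by case/andP: xat => ax xt; apply: hointerval_le tD _ xt; exact: le_trans ax.
rewrite [X in 0 <= X](_ : _ = (m - l) * (q x / S x) ^+ 2 * Q x (P x) (S x) +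
   l * (A x * (p x - q x * P x / S x) ^+ 2)); last by rewrite /qform; field.
apply: addr_ge0; last by rewrite mulr_ge0 ?(ltW l0)// mulr_ge0 ?sqr_ge0//; exact/ltW/(cs_A0 cs).
by rewrite mulr_ge0 ?(qform_ge0 cs)// mulr_ge0 ?sqr_ge0// subr_ge0 ltW.
Qed.

End Eigenfunctions.

(** * Oscillation and counting of eigenvalues *)

Section Levels.
Context {R : realType}.

(** For an angle that starts at 0 and increases, these are the values at which [p] vanishes. *)
Definition level (n : nat) : R := pi / 2 + n%:R * pi.

Lemma cos_sin_shift n (x : R) : cos (x + n%:R * pi) = (-1) ^+ n * cos x /\
  sin (x + n%:R * pi) = (-1) ^+ n * sin x.
Proof.
elim: n => [|n [IHc IHs]]; first by rewrite mul0r addr0 !mul1r.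
rewrite (_ : x + n.+1%:R * pi = (x + n%:R * pi) + pi); last by rewrite -natr1; ring.
by rewrite cosD (sinD _ pi) IHc IHs cospi sinpi exprS; split; ring.
Qed.

Lemma cos_level n : cos (level n) = 0.
Proof. by rewrite /level (cos_sin_shift n (pi / 2)).1 cos_pihalf mulr0. Qed.

Lemma level_gt0 n : 0 < level n.
Proof.
have p0 := pi_gt0 R; rewrite /level ltr_pwDl ?divr_gt0//.
by rewrite mulr_ge0// ltW.
Qed.

Lemma level_lt n m : (n < m)%N -> level n < level m.
Proof. by move=> nm; rewrite ltrD2l ltr_pM2r ?pi_gt0// ltr_nat. Qed.

Lemma levelS n : level n.+1 = level n + pi.
Proof. by rewrite /level -natr1; ring. Qed.

Lemma cos_eq0_level (x : R) : 0 <= x -> cos x = 0 -> exists n, x = level n.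
Proof.
move=> x0 cx; have p0 := pi_gt0 R.
have := truncn_itv (divr_ge0 x0 (ltW p0)); set n := Num.truncn _ => /andP[h1 h2].
exists n; pose y := x - n%:R * pi.
have xy : x = y + n%:R * pi by rewrite /y subrK.
have y0 : 0 <= y by rewrite subr_ge0 -ler_pdivlMr.
have y1 : y <= pi.
  by rewrite /y lerBlDr ltW// -[X in X + _]mul1r -mulrDl addrC natr1 -ltr_pdivrMr.
have cy : cos y = 0.
  have := (cos_sin_shift n y).1; rewrite -xy cx => /esym/eqP.
  by rewrite mulf_eq0 signr_eq0/= => /eqP.
rewrite xy /level; congr (_ + _); apply: cos_inj; rewrite ?in_itv/= ?y0 ?y1 ?cos_pihalf//.
by apply/andP; split; lra.
Qed.

End Levels.

Section Oscillation.
Context {R : realType}.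
Notation mu := (@lebesgue_measure R).
Local Notation itg D f := (mu.-integrable D (EFin \o (f : R -> R))).
Context {T : \bar R} {A B C : R -> R} (hs : hs_system T A B C).
Let cs : canonical_system T A B C := hs.
Local Notation D := (hointerval T).
Local Notation Q := (qform A B C).
Local Notation BB := (tailint T B).
Local Notation kap := (@kap R T A B).
Context {th : R -> R -> R} (hth : forall l, angle T A B C 0 l (th l)).

Definition reach l n : Prop := exists2 t, D t & th l t = level n.

Definition eigenvalue (l : R) : Prop :=
  exists p q, [/\ eigen T A B C l p q, p 0 = 1 & q 0 = 0].

(** A new visit enters through the end [T], so at the critical parameter the level is still missed
    inside [[0, T)]. This is why the right limit of the number of visits counts a critical parameter
    while the number itself does not. *)
Definition jump l n : Prop :=
  [/\ 0 < l, ~ reach l n & forall m, l < m -> reach m n].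

Lemma th0 l : th l 0 = 0.
Proof. by have [] := hth l. Qed.

Lemma polar l : exists p q rho, [/\ solution T A B C l p q, p 0 = 1, q 0 = 0,
  forall t, 0 < rho t & forall t, p t = rho t * cos (th l t) /\ q t = rho t * sin (th l t)].
Proof.
have [rho [r0 r1 sol]] := solution_polar cs (hth l).
exists (fun t => rho t * cos (th l t)), (fun t => rho t * sin (th l t)), rho.
by split=> //; rewrite r1 th0 ?cos0 ?sin0 mul1r.
Qed.

Lemma nontrivial l p q : solution T A B C l p q -> p 0 = 1 -> q 0 = 0 ->
  (forall x, D x -> (p x, q x) != (0, 0)) /\
  (forall x, D x -> p x = 0 <-> cos (th l x) = 0).
Proof.
move=> sol p0 q0; have [p' [q' [rho [sol' p0' q0' r0 E]]]] := polar l.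
have H x : D x -> p x = rho x * cos (th l x) /\ q x = rho x * sin (th l x).
  move=> xD; have [] := solution_unique cs sol' sol _ _ xD; rewrite ?p0 ?q0//.
  by move=> -> ->; exact: E.
split=> x xD; have [Ep Eq] := H x xD; have rx := r0 x.
  apply/eqP => -[px qx]; have := cos2Dsin2 (th l x).
  have /eqP : rho x * cos (th l x) = 0 by rewrite -Ep.
  have /eqP : rho x * sin (th l x) = 0 by rewrite -Eq.
  rewrite !mulf_eq0 gt_eqF//= => /eqP -> /eqP ->.
  by rewrite expr0n/= addr0 => /eqP; rewrite eq_sym oner_eq0.
rewrite Ep; split=> [/eqP|->]; last by rewrite mulr0.
by rewrite mulf_eq0 gt_eqF//= => /eqP.
Qed.

Lemma reach_ge l n t : D t -> level n <= th l t -> reach l n.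
Proof.
move=> tD lt; have [t0 _] := tD.
have [c cab E] := @IVT _ (th l) 0 t (level n) t0 (acd_continuous (angle_acd (hth l) tD)) ltac:(
  by rewrite th0 ge_min le_max lt ltW ?level_gt0 ?orbT).
by exists c => //; apply: D_seg tD _; move: cab; rewrite in_itv.
Qed.

Lemma reach_time_gt0 l n t : D t -> th l t = level n -> 0 < t.
Proof.
move=> [t0 _] E; rewrite lt_neqAle t0 andbT; apply/eqP => t00.
by move: E; rewrite -t00 th0 => /eqP; rewrite lt_eqF// level_gt0.
Qed.

Lemma reach_le l m n : l < m -> reach l n -> reach m n.
Proof.
move=> lm [t tD E]; apply: (reach_ge tD); rewrite -E ltW//.
exact: (angle_lt cs lm (hth l) (hth m) tD (reach_time_gt0 tD E)).
Qed.

Lemma reachS l n m : (n <= m)%N -> reach l m -> reach l n.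
Proof.
rewrite leq_eqVlt => /predU1P[->//|nm] [t tD E].
by apply: (reach_ge tD); rewrite E ltW// level_lt.
Qed.

(** An angle below [level n] at [b] that reached [level n.+1] would produce two zeros of [p] beyond
    [b]. *)
Lemma tail_reach l n b : 0 < l -> D b -> 2 * l ^+ 2 * kap b < 1 ->
  th l b < level n -> ~ reach l n.+1.
Proof.
move=> l0 bD k1 bn r1; have [t1 t1D E1] := r1.
have [p [q [rho [sol p0 q0 _ _]]]] := polar l.
have [nz pz] := nontrivial sol p0 q0.
have [t0 t0D E0] := reachS (leqnSn n) r1.
have b0 : 0 <= b by case: bD.
have bt : b < t0.
  rewrite ltNge; apply/negP => tb; have [t00 _] := t0D.
  move: tb; rewrite le_eqVlt => /predU1P[tb|tb]; first by move: bn; rewrite -tb E0 ltxx.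
  have := angle_increasing cs l0 (hth l) t00 tb bD; rewrite E0 => /lt_trans/(_ bn).
  by rewrite ltxx.
have tt : t0 < t1.
  rewrite ltNge; apply/negP; rewrite le_eqVlt => /predU1P[tb|tb].
    by have := level_lt (ltnSn n) (R := R); rewrite -E1 tb E0 ltxx.
  have [t10 _] := t1D.
  have := angle_increasing cs l0 (hth l) t10 tb t0D; rewrite E0 E1 => /ltW.
  by rewrite leNgt level_lt.
apply: (no_two_zeros hs sol (lt0r_neq0 l0) nz t1D b0 k1 (ltW bt) tt).
  by apply/pz => //; rewrite E1 cos_level.
by left; apply/pz => //; rewrite E0 cos_level.
Qed.

Lemma kap_lt1 l : exists2 b, D b & forall s, D s -> b <= s -> 2 * l ^+ 2 * kap s < 1.
Proof.
have e0 : 0 < 1 / (2 * l ^+ 2 + 1) / 2.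
  by rewrite divr_gt0// divr_gt0// ltr_wpDl// mulr_ge0// sqr_ge0.
have [b bD h] := kap_small hs e0; exists b => // s sD bs; have [k _] := h s sD bs.
have l2 : 0 <= 2 * l ^+ 2 by rewrite mulr_ge0// sqr_ge0.
apply: le_lt_trans (ler_wpM2l l2 k) _.
have l3 : 0 < 2 * l ^+ 2 + 1 by rewrite ltr_wpDl.
rewrite [ltLHS](_ : _ = 2 * l ^+ 2 / (2 * l ^+ 2 + 1) / 2); last by field; rewrite gt_eqF.
have : 2 * l ^+ 2 / (2 * l ^+ 2 + 1) <= 1 by rewrite ler_pdivrMr// mul1r lerDl.
lra.
Qed.

Lemma not_reach_ex l : 0 < l -> exists n, ~ reach l n.
Proof.
move=> l0; have [b bD /(_ b bD (lexx b)) k1] := kap_lt1 l.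
have p0 := pi_gt0 R.
have [n hn] : exists n, th l b < level n.
  exists (Num.truncn (`|th l b| / pi)).+1.
  have := truncnS_gt (`|th l b| / pi); rewrite ltr_pdivrMr// => h.
  apply: le_lt_trans (ler_norm _) _; apply: lt_trans h _.
  by rewrite /level ltr_pwDl ?divr_gt0.
by exists n.+1; exact: tail_reach hn.
Qed.

Lemma angle_close l t e : D t -> 0 < e -> exists2 d, 0 < d &
  forall m, `|m - l| < d -> `|th m t - th l t| < e.
Proof.
move=> tD e0; have [K K0 hK] := angle_dist cs 0 l tD.
have t0 : 0 <= t <= t by rewrite lexx andbT; case: tD.
exists (e / (K + 1)) => [|m ml]; first by rewrite divr_gt0// ltr_wpDl.
have h := hK m _ _ (hth l) (hth m) t t0.
rewrite -ltr_sqr ?nnegrE//; last exact: ltW.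
rewrite real_normK ?num_real// -[X in X < _]sqrrN opprB.
apply: le_lt_trans h _; apply: (@le_lt_trans _ _ ((l - m) ^+ 2 * (K + 1) ^+ 2)).
  by rewrite ler_wpM2l ?sqr_ge0// expr2; nra.
rewrite -exprMn -[X in X < _]real_normK ?num_real// ltr_sqr ?nnegrE//; last exact: ltW.
rewrite normrM (ger0_norm (x := K + 1)) ?addr_ge0// -ltr_pdivlMr ?ltr_wpDl//.
by rewrite distrC.
Qed.

(** The hitting time lies strictly before [T], and shortly afterwards the angle exceeds the level by
    a margin that survives a small decrease of the parameter. *)
Lemma reach_open l n : 0 < l -> reach l n -> exists2 m, 0 < m < l & reach m n.
Proof.
move=> l0 [t tD E]; have [s ts sD] := hointerval_gt tD.
have t0 : 0 <= t by case: tD.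
have lts := angle_increasing cs l0 (hth l) t0 ts sD.
have e0 : 0 < th l s - th l t by rewrite subr_gt0.
have [d d0 h] := angle_close l sD e0.
pose m := Num.max (l / 2) (l - d / 2).
have ml : m < l by rewrite gt_max; apply/andP; split; lra.
have m1 : l - d / 2 <= m by rewrite le_max lexx orbT.
exists m.
  by rewrite ml andbT lt_max; apply/orP; left; rewrite divr_gt0.
apply: (reach_ge sD); rewrite -E.
have : `|m - l| < d by rewrite ltr_norml; apply/andP; split; lra.
by move=> /h; rewrite ltr_norml => /andP[h1 _]; lra.
Qed.

(** The initial value [q 0 = 0] plays the part of the first zero in [no_two_zeros] with [b = s = 0],
    so for small parameters [p] has no zero at all. *)
Lemma no_reach_small : exists2 l, 0 < l & forall m n, 0 < m -> m <= l -> ~ reach m n.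
Proof.
have k0 := kap_ge0 hs 0.
(* As [m <= 1] gives [m ^+ 2 <= m], a linear bound on [m] ensures [2 * m ^+ 2 * kap 0 < 1]. *)
pose l := Num.min 1 (1 / (2 * kap 0 + 1) / 2).
have K1 : 0 < 2 * kap 0 + 1 by rewrite ltr_wpDl// mulr_ge0.
have l0 : 0 < l by rewrite lt_min ltr01/= divr_gt0// divr_gt0.
exists l => // m n m0 ml [t tD E].
have [p [q [rho [sol p0 q0 _ _]]]] := polar m.
have [nz pz] := nontrivial sol p0 q0.
have m1 : m <= 1 by apply: le_trans ml _; rewrite ge_min lexx.
have m2 : m <= 1 / (2 * kap 0 + 1) / 2 by apply: le_trans ml _; rewrite ge_min lexx orbT.
apply: (no_two_zeros hs sol (lt0r_neq0 m0) nz tD (lexx 0) _ (lexx 0) (reach_time_gt0 tD E)); last by right.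
  have : m * m <= m * 1 by rewrite ler_wpM2l// ltW.
  move: m2; rewrite -mulrA -invfM ler_pdivlMr ?mulr_gt0// expr2 => m2.
  by move: k0 K1 m1 m0 => *; nra.
by apply/pz => //; rewrite E cos_level.
Qed.

(** The infimum of the positive parameters reaching the level is positive by [no_reach_small] and
    not attained by [reach_open]. *)
Lemma jump_exists m n : 0 < m -> reach m n -> exists2 l, l < m & jump l n.
Proof.
move=> m0 mr; pose S := [set l | 0 < l /\ reach l n].
have [l1 l10 hl1] := no_reach_small.
have lS : lbound S l1.
  by move=> x [x0 rx]; rewrite leNgt; apply/negP => xl; exact: hl1 (ltW xl) rx.
have Sm : S m by [].
have hiS : has_inf S by split; [exists m|exists l1].
have l0 : 0 < inf S by apply: lt_le_trans l10 _; apply: lb_le_inf => //; exists m.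
have nr : ~ reach (inf S) n.
  move=> /(reach_open l0)[x /andP[x0 xl] rx].
  by have : inf S <= x by [apply: ge_inf; [exists l1|]]; rewrite leNgt xl.
exists (inf S).
  rewrite lt_neqAle; apply/andP; split; last by apply: ge_inf => //; exists l1.
  by apply/eqP => E; apply: nr; rewrite E.
split=> // x lx.
have xS : 0 < x - inf S by rewrite subr_gt0.
have [y [y0 ry] yx] := inf_adherent xS hiS.
by apply: reach_le ry; rewrite addrC subrK in yx.
Qed.

Lemma jump_lt_level l n b : jump l n -> D b -> th l b < level n.
Proof. by move=> [_ nr _] bD; rewrite ltNge; apply/negP => /(reach_ge bD). Qed.

(** For parameters slightly above [l] the angle at [b] is still below [level n] by continuity, so by
    [tail_reach] the level [n.+1] remains out of reach. *)
Lemma jump_unique l n k : jump l n -> jump l k -> n = k.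
Proof.
wlog nk : n k / (n < k)%N => [H|] jn jk.
  have [nk|kn|//] := ltngtP n k; first exact: H.
  by symmetry; exact: H.
exfalso; have [l0 nr rn] := jn; have [_ _ rk] := jk.
have [b bD /(_ b bD (lexx b)) k1] := kap_lt1 (l + 1).
have ltb := jump_lt_level jn bD.
have [d d0 h] := angle_close l bD (e := level n - th l b) ltac:(by rewrite subr_gt0).
pose m := l + Num.min d 1 / 2.
have md : 0 < Num.min d 1 by rewrite lt_min d0 ltr01.
have d1 : Num.min d 1 <= d by rewrite ge_min lexx.
have d2 : Num.min d 1 <= 1 by rewrite ge_min lexx orbT.
have lm : l < m by rewrite /m; lra.
have m0 : 0 < m by exact: lt_trans lm.
have : `|m - l| < d by rewrite /m addrAC subrr add0r gtr0_norm; lra.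
move=> /h/ltr_normlW hm.
apply: (@tail_reach m n b m0 bD); last exact: reachS (rk m lm).
  apply: le_lt_trans k1; rewrite ler_wpM2r ?(kap_ge0 hs)// ler_wpM2l//.
  by rewrite ler_sqr ?nnegrE; rewrite /m; lra.
lra.
Qed.

End Oscillation.

(** * Critical parameters are the positive eigenvalues *)

Section JumpsAreEigenvalues.
Context {R : realType}.
Notation mu := (@lebesgue_measure R).
Local Notation itg D f := (mu.-integrable D (EFin \o (f : R -> R))).
Context {T : \bar R} {A B C : R -> R} (hs : hs_system T A B C).
Let cs : canonical_system T A B C := hs.
Local Notation D := (hointerval T).
Local Notation Q := (qform A B C).
Local Notation BB := (tailint T B).
Local Notation kap := (@kap R T A B).
Context {th : R -> R -> R} (hth : forall l, angle T A B C 0 l (th l)).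
Local Notation reach := (@reach R T th).
Local Notation jump := (@jump R T th).
Local Notation eigenvalue := (@eigenvalue R T A B C).

(** Just above [l] the level is reached, but only after [s], where the angle is still below it. The
    solution then solves a problem truncated at [t] with [p' t = 0], and it stays close to the
    solution for [l] up to [s]. *)
Lemma approximate_jump l n p q s eta : jump l n -> solution T A B C l p q ->
  p 0 = 1 -> q 0 = 0 -> D s -> 0 < eta ->
  exists m p' q' t, [/\ l < m, m <= l + 1, solution T A B C m p' q', D t & s < t] /\
    p' t = 0 /\ forall x, 0 <= x <= s -> (p' x - p x) ^+ 2 + (q' x - q x) ^+ 2 <= eta.
Proof.
move=> jn sol p0 q0 sD eta0; have [l0 nr rn] := jn.
have ls := jump_lt_level hth jn sD.
have e0 : 0 < level n - th l s by rewrite subr_gt0.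
have [d d0 hd] := angle_close hs hth l sD e0.
have [K K0 hK] := solution_dist cs sD sol.
have K1 : 0 < K + 1 by rewrite ltr_wpDl.
(* The three bounds serve the angle at [s], the range [m <= l + 1], and the closeness, through
   [(r / 2) ^+ 2 * K <= r * (K + 1) <= eta]. *)
pose r := Num.min (Num.min d 1) (eta / (K + 1)).
have r0 : 0 < r by rewrite !lt_min d0 ltr01 divr_gt0.
have rd : r <= d by rewrite !ge_min lexx.
have r1 : r <= 1 by rewrite !ge_min lexx orbT.
have re : r <= eta / (K + 1) by rewrite !ge_min lexx orbT.
pose m := l + r / 2.
have lm : l < m by rewrite /m; lra.
have m1 : m <= l + 1 by rewrite /m; lra.
have mr : m - l = r / 2 by rewrite /m; lra.
have m0 : 0 < m by exact: lt_trans lm.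
have [p' [q' [rho [sol' p0' q0' _ _]]]] := polar hs hth m.
have [nz pz] := nontrivial hs hth sol' p0' q0'.
have [t tD E] := rn m lm.
exists m, p', q', t; split; first split=> //.
  rewrite ltNge; apply/negP; rewrite le_eqVlt => tS.
  have : th m t <= th m s.
    case/predU1P: tS => [->//|ts]; apply: ltW.
    by apply: (angle_increasing cs m0 (hth m) _ ts sD); case: tD.
  have : `|m - l| < d by rewrite mr gtr0_norm; lra.
  by move=> /hd/ltr_normlW; rewrite E; lra.
split; first by apply/pz => //; rewrite E cos_level.
move=> x xs; apply: le_trans (hK m p' q' _ sol' _ _ x xs) _; rewrite ?p0 ?q0//.
  by rewrite (gtr0_norm m0) (gtr0_norm l0).
rewrite mr; apply: (@le_trans _ _ (r * (K + 1))); last by rewrite -ler_pdivlMr.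
apply: ler_pM => //; rewrite ?sqr_ge0 ?lerDl// expr2.
have : r / 2 * (r / 2) <= 1 * (r / 2) by rewrite ler_wpM2r; lra.
lra.
Qed.

(** Splitting off the constant [q b] gives energy at most [2 * (1 / 4) * I + 2 * q b ^+ 2 * BB b],
    and the first term is absorbed. The resulting bound is independent of the truncation point
    [t]. *)
Lemma truncated_bound m p q b t : solution T A B C m p q -> D t -> 0 <= b -> b <= t ->
  2 * m ^+ 2 * kap b <= 1 / 4 -> p t = 0 ->
  \int[mu]_(x in `[b, t]) Q x (p x) (q x) <= 4 * q b ^+ 2 * BB b /\
  forall s, b <= s -> s <= t ->
    p s ^+ 2 <= m ^+ 2 * (BB s * (4 * q b ^+ 2 * BB b)).
Proof.
move=> sol tD b0 bt k1 pt; have [iQ _ _] := itg_solution_seg hs sol tD b0.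
have [iQ' h] := seg_est hs sol tD b0 (lexx b) bt.
set I := \int[mu]_(x in `[b, t]) Q x (p x) (q x) in h *.
have iB : itg `[b, t] B by exact: itg_seg (hs_iB hs).
have bD : D b by exact: hointerval_le bt.
have BBt s : b <= s -> s <= t -> \int[mu]_(x in `[s, t]) B x <= BB s.
  move=> bs st; apply: Rintegral_ge0_subset => //.
  - exact: measurable_tail.
  - move=> x /=; rewrite in_itv/= => /andP[sx xt]; split=> //.
    by apply: hointerval_le tD _ xt; rewrite (le_trans b0)// (le_trans bs).
  - by apply: itg_tail; exact: hs_iB hs.
  - by move=> x [xD _]; exact/ltW/(cs_B0 cs).
have I0 : 0 <= I.
  by apply: Rintegral_ge0 => x /(seg_sub_D tD b0) xD; exact: (qform_ge0 cs).
have IM : I <= 4 * q b ^+ 2 * BB b.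
  have : I <= \int[mu]_(x in `[b, t]) (2 * (Q x (p x - p t) (q x - q b)) + 2 * q b ^+ 2 * B x).
    apply: Rintegral_le => //.
      by apply: itgD => //; apply: itgZ.
    move=> x /(seg_sub_D tD b0) xD.
    have := qformD_le cs (p x - p t) (q x - q b) 0 (q b) xD; rewrite addr0 subrK pt subr0.
    by move=> /le_trans; apply; rewrite le_eqVlt; apply/orP; left; apply/eqP; rewrite /qform; ring.
  rewrite RintegralD//; [|exact: itgZ|exact: itgZ].
  rewrite !RintegralZl// => H1.
  have H2 := ler_wpM2l (mulr_ge0 (ler0n R 2) (sqr_ge0 (q b))) (BBt b (lexx b) bt).
  have H3 := ler_wpM2r I0 k1.
  by move: h H1 H2 H3; clear; lra.
split=> // s bs st; have s0 := le_trans b0 bs.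
have [-> _] := solution_increment hs sol tD s0 st.
rewrite pt add0r exprMn ler_wpM2l ?sqr_ge0//.
have [mp mq] := solution_measurable cs sol.
have sD : `[s, t] `<=` D by exact: seg_sub_D.
have mS (f : R -> R) : measurable_fun D f -> measurable_fun `[s, t] f.
  by apply: measurable_funS => //; exact: measurable_hointerval.
have iQs : itg `[s, t] (fun x => Q x (p x) (q x)) by exact: itg_seg_sub iQ.
have [_ h2] := csB hs (hs_iB hs) sD (measurable_itv _) (mS _ mp) (mS _ mq) iQs.
apply: le_trans h2 _; apply: ler_pM.
- by apply: Rintegral_ge0 => x /sD xD; exact/ltW/(cs_B0 cs).
- by apply: Rintegral_ge0 => x /sD xD; exact: (qform_ge0 cs).
- exact: BBt.
apply: le_trans IM; apply: Rintegral_ge0_subset => //.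
  by move=> x /=; rewrite !in_itv/= => /andP[sx ->]; rewrite (le_trans bs).
by move=> x /(seg_sub_D tD b0) xD; exact: (qform_ge0 cs).
Qed.

(** Solutions for parameters just above [l] vanish beyond any given [s], so [truncated_bound]
    controls their energy on [[b, s]] and their first component at [s] uniformly. Both bounds pass
    to the solution for [l], which is close to them on [[0, s]]. *)
Lemma jump_eigenvalue l n : jump l n -> eigenvalue l.
Proof.
move=> jn; have [l0 nr rn] := jn.
have [p [q [rho [sol p0 q0 _ _]]]] := polar hs hth l.
have [mp mq] := solution_measurable cs sol.
exists p, q; split=> //.
pose L := l + 1.
have L1 : 0 < L by rewrite /L; lra.
(* Chosen so that [2 * m ^+ 2 * kap b <= 1 / 4] for every [m] up to [L]. *)
have e0 : 0 < 1 / (8 * L ^+ 2) by rewrite divr_gt0// mulr_gt0// exprn_gt0.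
have [b bD /(_ b bD (lexx b))[hk _]] := kap_small hs e0.
have b0 : 0 <= b by case: bD.
have k1 m : l < m -> m <= L -> 2 * m ^+ 2 * kap b <= 1 / 4.
  move=> lm mL; apply: (@le_trans _ _ (2 * L ^+ 2 * (1 / (8 * L ^+ 2)))).
    apply: ler_pM => //; [by rewrite mulr_ge0// sqr_ge0|exact: (kap_ge0 hs)|].
    by rewrite ler_wpM2l// ler_sqr ?nnegrE; lra.
  by rewrite le_eqVlt; apply/orP; left; apply/eqP; field; rewrite gt_eqF.
(* Closeness with [eta <= 1] gives [q' b ^+ 2 <= 2 * q b ^+ 2 + 2], so this [M] serves all
   approximations. *)
pose M := 4 * (2 * q b ^+ 2 + 2) * BB b.
have M0 : 0 <= M.
  by rewrite mulr_ge0 ?(BB_ge0 hs)// mulr_ge0// addr_ge0// mulr_ge0// sqr_ge0.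
have key s eta : D s -> b <= s -> 0 < eta -> eta <= 1 ->
  exists p' q', [/\ forall x, 0 <= x <= s -> (p' x - p x) ^+ 2 + (q' x - q x) ^+ 2 <= eta,
     itg `[b, s] (fun x => Q x (p' x) (q' x)),
     \int[mu]_(x in `[b, s]) Q x (p' x) (q' x) <= M &
     p' s ^+ 2 <= L ^+ 2 * (BB s * M)].
  move=> sD bs eta0 eta1.
  have [m [p' [q' [t [[lm mL sol' tD st] [pt close]]]]]] := approximate_jump jn sol p0 q0 sD eta0.
  have bt : b <= t by rewrite (le_trans bs)// ltW.
  have [h1 h2] := truncated_bound sol' tD b0 bt (k1 m lm mL) pt.
  have [iQ' _ _] := itg_solution_seg hs sol' tD b0.
  have qM : 4 * q' b ^+ 2 * BB b <= M.
    rewrite /M ler_wpM2r ?(BB_ge0 hs)// ler_wpM2l//.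
    have := close b ltac:(by rewrite b0 bs); have := sqr_ge0 (p' b - p b).
    have := sqr_ge0 (q' b - 2 * q b); rewrite !expr2; lra.
  exists p', q'; split=> //.
  - by apply: itg_seg_sub iQ' => //; exact: ltW.
  - apply: le_trans qM; apply: le_trans h1; apply: Rintegral_ge0_subset => //.
      by move=> x /=; rewrite !in_itv/= => /andP[-> xs]; rewrite (le_trans xs)// ltW.
    by move=> x /(seg_sub_D tD b0) xD; exact: (qform_ge0 cs).
  - apply: le_trans (h2 s bs (ltW st)) _; apply: ler_pM.
    + exact: sqr_ge0.
    + by rewrite mulr_ge0 ?(BB_ge0 hs)// mulr_ge0 ?(BB_ge0 hs)// mulr_ge0// sqr_ge0.
    + by rewrite ler_sqr ?nnegrE /L; lra.
    + by rewrite ler_wpM2l// (BB_ge0 hs).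
have bound s : D s -> b <= s -> \int[mu]_(x in `[b, s]) Q x (p x) (q x) <= 2 * M + 1.
  move=> sD bs; have [iA iB _] := cs_itg cs sD.
  have iA' := itg_seg_sub b0 (lexx s) iA; have iB' := itg_seg_sub b0 (lexx s) iB.
  pose a := \int[mu]_(x in `[b, s]) (A x + B x).
  have a0 : 0 <= a.
    apply: Rintegral_ge0 => x /(seg_sub_D sD b0) xD; rewrite addr_ge0// ltW//.
      exact: (cs_A0 cs).
    exact: (cs_B0 cs).
  (* The form at the difference is at most [2 * eta * (A + B)]; doubled by [qformD_le] it integrates
     to [4 * eta * a <= 1]. *)
  pose eta := 1 / (4 * a + 1).
  have a1 : 0 < 4 * a + 1 by rewrite ltr_wpDl// mulr_ge0.
  have eta0 : 0 < eta by rewrite divr_gt0.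
  have eta1 : eta <= 1 by rewrite ler_pdivrMr// mul1r lerDr mulr_ge0.
  have ea : 4 * eta * a <= 1.
    by rewrite /eta [leLHS](_ : _ = 4 * a / (4 * a + 1)) ?ler_pdivrMr//; [lra|field; rewrite gt_eqF].
  have [p' [q' [close iQ' hM _]]] := key s eta sD bs eta0 eta1.
  have [iQ _ _] := itg_solution_seg hs sol sD b0.
  have iAB : itg `[b, s] (fun x => A x + B x) by exact: itgD.
  apply: (@le_trans _ _ (\int[mu]_(x in `[b, s]) (2 * Q x (p' x) (q' x) + 4 * eta * (A x + B x)))).
    apply: Rintegral_le => //; first by apply: itgD => //; exact: itgZ.
    move=> x xbs; have xD := seg_sub_D sD b0 xbs.
    have A0 := cs_A0 cs xD; have B0 := cs_B0 cs xD.
    have := qformD_le cs (p' x) (q' x) (p x - p' x) (q x - q' x) xD; rewrite !subrKC.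
    have h2 := qform_le cs (p x - p' x) (q x - q' x) xD.
    have hc : (p x - p' x) ^+ 2 + (q x - q' x) ^+ 2 <= eta.
      rewrite -(sqrrN (p x - p' x)) -(sqrrN (q x - q' x)) !opprB; apply: close.
      by move: xbs; rewrite /= in_itv/= => /andP[bx ->]; rewrite (le_trans b0).
    have s1 := sqr_ge0 (p x - p' x); have s2 := sqr_ge0 (q x - q' x).
    have h3 : A x * (p x - p' x) ^+ 2 <= A x * eta by rewrite ler_wpM2l; lra.
    have h4 : B x * (q x - q' x) ^+ 2 <= B x * eta by rewrite ler_wpM2l; lra.
    by move: h2 h3 h4; clear; lra.
  rewrite RintegralD//; [|exact: itgZ|exact: itgZ].
  rewrite !RintegralZl// -/a.
  by move: hM ea; clear; lra.
have pbound s : D s -> b <= s -> p s ^+ 2 <= 2 * (L ^+ 2 * (BB s * M)).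
  move=> sD bs; apply/ler_addgt0Pr => e e0'.
  pose eta := Num.min 1 (e / 2).
  have eta0 : 0 < eta by rewrite lt_min ltr01/= divr_gt0.
  have eta1 : eta <= 1 by rewrite ge_min lexx.
  have eta2 : eta <= e / 2 by rewrite ge_min lexx orbT.
  have [p' [q' [close _ _ hp]]] := key s eta sD bs eta0 eta1.
  have s0 : 0 <= s by case: sD.
  have := close s ltac:(by rewrite lexx andbT); have := sqr_ge0 (q' s - q s).
  have := sqr_ge0 (2 * p' s - p s); move: hp; rewrite !expr2; lra.
split=> //.
  have mQ : measurable_fun D (fun t => Q t (p t) (q t)).
    by apply: (measurable_qform cs) => //; exact: measurable_hointerval.
  apply: (itg_exhaust (M := \int[mu]_(x in `[0, b]) Q x (p x) (q x) + (2 * M + 1)) (cs_T cs) mQ).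
    by move=> x xD; exact: (qform_ge0 cs).
  move=> c cD; have [iQ _ _] := itg_solution_seg hs sol cD (lexx 0).
  rewrite -Rintegral_EFin// lee_fin.
  pose s := Num.max c b.
  have sD : D s by rewrite /s; case: (leP c b).
  have bs : b <= s by rewrite le_max lexx orbT.
  have cs' : c <= s by rewrite le_max lexx.
  have [iQs _ _] := itg_solution_seg hs sol sD (lexx 0).
  apply: (@le_trans _ _ (\int[mu]_(x in `[0, s]) Q x (p x) (q x))).
    apply: Rintegral_ge0_subset => //.
      by move=> x /=; rewrite !in_itv/= => /andP[-> xc]; rewrite (le_trans xc).
    by move=> x /(hointerval_seg sD) xD; exact: (qform_ge0 cs).
  by rewrite (Rintegral_seg_cat b0 bs iQs) lerD2l bound.
move=> e e0'; pose K := 2 * L ^+ 2 * M + 1.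
have K0 : 0 < K by rewrite ltr_wpDl// mulr_ge0// mulr_ge0// sqr_ge0.
have e2 : 0 < e ^+ 2 / K by rewrite divr_gt0// exprn_gt0.
have [c cD hc] := kap_small hs e2.
exists (Num.max b c); first by case: (leP b c).
move=> t tD; rewrite ge_max => /andP[bt ct]; have [_ k2] := hc t tD ct.
rewrite -ler_sqr ?nnegrE//; last exact: ltW.
rewrite real_normK ?num_real//; apply: le_trans (pbound t tD bt) _.
have LM : 0 <= 2 * L ^+ 2 * M by rewrite mulr_ge0// mulr_ge0// sqr_ge0.
rewrite (_ : 2 * _ = 2 * L ^+ 2 * M * BB t); last ring.
apply: le_trans (ler_wpM2l LM k2) _.
by rewrite mulrA ler_pdivrMr// mulrC ler_wpM2l ?sqr_ge0// /K lerDl.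
Qed.

(* If [m > l] missed the next level as well, both angles would stay in one open
   quadrant near the end, and Picone's nondecreasing positive quantity would be
   squeezed to 0 by [p * q]. *)
Lemma eigenvalue_jump l : 0 < l -> eigenvalue l -> exists n, jump l n.
Proof.
move=> l0 [p0' [q0' [ev p0 q0]]].
have [n nrn nmin] : exists2 n, ~ reach l n & forall k, (k < n)%N -> reach l k.
  have [N hN] := not_reach_ex hs hth l0.
  have ex : exists n, `[< ~ reach l n >] by exists N; exact/asboolP.
  exists (ex_minn ex); case: ex_minnP => n /asboolP nr hn //.
  move=> k kn; apply: contrapT => nk.
  by have := hn k (asboolT nk); rewrite leqNgt kn.
exists n; split=> // m lm; apply: contrapT => nrm.
have m0 := lt_trans l0 lm.
have [p [q [rho [sol pp qq r0 E]]]] := polar hs hth l.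
have {ev p0 q0 p0' q0'}ev : eigen T A B C l p q.
  have [s1 i1 v1] := ev.
  have eq t : D t -> p0' t = p t /\ q0' t = q t.
    by move=> tD; apply: (solution_unique cs sol s1); rewrite ?p0 ?q0.
  split=> //.
    by apply: itg_eq i1 => [|t tD]; [exact: measurable_hointerval|have [-> ->] := eq t tD].
  move=> e e0; have [b bD hb] := v1 e e0; exists b => // t tD bt.
  by have [<- _] := eq t tD; exact: hb.
have [P [S [rho' [sol' PP SS r0' E']]]] := polar hs hth m.
have [nz pz] := nontrivial hs hth sol pp qq.
have [b1 b1D k1] := kap_lt1 hs l.
have piR := pi_gt0 R.
(* Beyond [b2] the angle exceeds [level n - pi]: for [n = 0] this is [- pi / 2], below the initial
   angle; otherwise it is the previous level, which has been reached. *)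
have [b2 b2D hb2] : exists2 b, D b & forall t, D t -> b < t -> level n - pi < th l t.
  case: n nmin nrn nrm => [|n] nmin nrn nrm.
    exists 0 => [|t tD t0]; first exact: D_0 cs.
    have := angle_increasing cs l0 (hth l) (lexx 0) t0 tD; rewrite (th0 hth) /level mul0r addr0.
    lra.
  have [b bD E0] := nmin n (ltnSn n); exists b => // t tD bt; have [b0 _] := bD.
  by rewrite levelS addrK -E0; exact: (angle_increasing cs l0 (hth l) b0 bt tD).
pose c := Num.max b1 b2.
have cD : D c by rewrite /c; case: (leP b1 b2).
have [a ca aD] := hointerval_gt cD.
have [c0 _] := cD; have a0 : 0 <= a by apply: le_trans (ltW ca).
pose sh t := th l t - n%:R * pi; pose sh' t := th m t - n%:R * pi.
have quad t : D t -> a <= t -> [/\ 0 < sh t, sh t < sh' t & sh' t < pi / 2].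
  move=> tD at_; have ct : c < t := lt_le_trans ca at_.
  have t0 : 0 < t := le_lt_trans c0 ct.
  have h1 := hb2 t tD (le_lt_trans _ ct); rewrite le_max lexx orbT in h1.
  have {}h1 := h1 isT.
  have h2 := angle_lt cs lm (hth l) (hth m) tD t0.
  have h3 : th m t < level n by rewrite ltNge; apply/negP => /(reach_ge hth tD).
  have pq := eigen_pq_gt0 hs l0 ev tD nz (k1 t tD (le_trans _ (ltW ct))).
  rewrite le_max lexx in pq; have {}pq := pq isT.
  have pil : level n - pi = - (pi / 2) + n%:R * pi :> R by rewrite /level; field.
  have lo : - (pi / 2) < sh t by rewrite /sh ltrBrDr -pil.
  have mi : sh t < sh' t by rewrite /sh /sh' ltrD2r.
  have hi : sh' t < pi / 2 by rewrite /sh' ltrBlDr.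
  (* A shifted angle in []- pi / 2, 0]] would give [p t * q t <= 0], which [eigen_pq_gt0]
     excludes. *)
  split=> //; rewrite ltNge; apply/negP => shn.
  have [cE sE] := cos_sin_shift n (sh t); rewrite subrK in cE sE.
  have csh : 0 < cos (sh t) by apply: cos_gt0_pihalf; rewrite lo (lt_trans mi hi).
  have : 0 <= sin (- sh t) by apply: sin_ge0_pi; apply/andP; split; lra.
  rewrite sinN oppr_ge0 => ssh.
  have [Ep Eq] := E t; move: pq; rewrite Ep Eq cE sE.
  rewrite [X in 0 < X -> _](_ : _ = (rho t ^+ 2 * cos (sh t)) * ((-1) ^+ n * (-1) ^+ n * sin (sh t))); last by rewrite expr2; ring.
  rewrite -expr2 sqrr_sign mul1r pmulr_rgt0; first by rewrite ltNge ssh.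
  by rewrite mulr_gt0// exprn_gt0.
have vals t : D t -> a <= t -> [/\ S t != 0, 0 < P t / S t &
    q t * (p t * S t - q t * P t) / S t =
    rho t ^+ 2 * sin (sh' t - sh t) * sin (sh t) / sin (sh' t)].
  move=> tD at_; have [h1 h2 h3] := quad t tD at_.
  have [cE sE] := cos_sin_shift n (sh t); rewrite subrK in cE sE.
  have [cE' sE'] := cos_sin_shift n (sh' t); rewrite subrK in cE' sE'.
  have [Ep Eq] := E t; have [EP ES] := E' t.
  have s' : 0 < sin (sh' t) by apply: sin_gt0_pi; apply/andP; split; lra.
  have c' : 0 < cos (sh' t) by apply: cos_gt0_pihalf; apply/andP; split; lra.
  have n1 : (-1) ^+ n != 0 :> R by rewrite signr_eq0.
  have r1 := r0' t.
  split.
  - by rewrite ES sE' !mulf_neq0// gt_eqF.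
  - rewrite EP ES cE' sE' (_ : _ / _ = cos (sh' t) / sin (sh' t)) ?divr_gt0//.
    by field; rewrite n1 !gt_eqF.
  rewrite Ep Eq EP ES cE sE cE' sE' sinB.
  rewrite [RHS](_ : _ = ((-1) ^+ n) ^+ 2 * (rho t ^+ 2 * (sin (sh' t) * cos (sh t) - cos (sh' t) * sin (sh t)) * sin (sh t) / sin (sh' t))); last first.
    by rewrite sqrr_sign mul1r.
  by field; rewrite n1 !gt_eqF.
have [_ _ Ga] := vals a aD (lexx a).
have [h1 h2 h3] := quad a aD (lexx a).
have G0 : 0 < q a * (p a * S a - q a * P a) / S a.
  rewrite Ga divr_gt0//; last by apply: sin_gt0_pi; apply/andP; split; lra.
  rewrite mulr_gt0//; last by apply: sin_gt0_pi; apply/andP; split; lra.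
  rewrite mulr_gt0// ?exprn_gt0//; apply: sin_gt0_pi; apply/andP; split; lra.
have [b bD hb] := eigen_pq_vanishes hs ev (divr_gt0 G0 (ltr0n _ 2)).
pose t := Num.max a b.
have tD : D t by rewrite /t; case: (leP a b).
have at_ : a <= t by rewrite le_max lexx.
have bt : b <= t by rewrite le_max lexx orbT.
have [St PS _] := vals t tD at_.
have nzS x : a <= x <= t -> S x != 0.
  by move=> /andP[ax xt]; have [] := vals x (hointerval_le tD (le_trans a0 ax) xt) ax.
have H1 := picone hs l0 lm sol sol' tD a0 at_ nzS.
have H2 : q t * (p t * S t - q t * P t) / S t <= p t * q t.
  rewrite (_ : _ / _ = p t * q t - q t ^+ 2 * (P t / S t)); last by field.
  by rewrite gerBl mulr_ge0 ?sqr_ge0// ltW.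
have H3 := le_trans (ler_norm _) (hb t tD bt).
by move: H1 H2 H3 G0; clear; lra.
Qed.

End JumpsAreEigenvalues.

(** * The resolvent *)

Section Fredholm.
Context {R : realType} {I : Type} (w : I -> R) (X : (I -> R) -> Prop).
Context (S : (I -> R) -> I -> R) (n : nat) (ell : 'I_n -> (I -> R) -> R).
Context (f : 'I_n -> I -> R) (rho Lam : R).

Definition bounded_by (M : R) (u : I -> R) : Prop := forall i, `|u i| <= M * w i.

Definition lincomb (a : R) (u v : I -> R) : I -> R := fun i => a * u i + v i.

Context (w0 : forall i, 0 <= w i) (rho0 : 0 <= rho) (rho1 : rho < 1) (Lam0 : 0 <= Lam).
Context (X0 : X (fun=> 0)).
Context (Xlin : forall a u v, X u -> X v -> X (lincomb a u v)).
Context (Xbd : forall u, X u -> exists2 M, 0 <= M & bounded_by M u).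
Context (Xcl : forall (u : nat -> I -> R) v M, (forall n, X (u n)) ->
  (forall n i, `|u n i - u 0%N i| <= M * w i) ->
  (forall i, u n i @[n --> \oo] --> v i) -> X v).
Context (SX : forall u, X u -> X (S u)).
Context (Slin : forall a u v, X u -> X v -> S (lincomb a u v) = lincomb a (S u) (S v)).
Context (Sbd : forall u M, X u -> 0 <= M -> bounded_by M u -> bounded_by (rho * M) (S u)).
Context (fX : forall j, X (f j)).
Context (elllin : forall j a u v, X u -> X v ->
  ell j (lincomb a u v) = a * ell j u + ell j v).
Context (ellbd : forall j u M, X u -> 0 <= M -> bounded_by M u -> `|ell j u| <= Lam * M).

Let comb (c : 'I_n -> R) (g : 'I_n -> I -> R) (r : seq 'I_n) : I -> R :=
  foldr (fun j u => lincomb (c j) (g j) u) (fun=> 0) r.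

Let combE c g r i : comb c g r i = \sum_(j <- r) c j * g j i.
Proof.
elim: r => [|j r IH] /=; first by rewrite big_nil.
by rewrite big_cons /lincomb IH.
Qed.

Let combX c g r : (forall j, X (g j)) -> X (comb c g r).
Proof. by move=> gX; elim: r => [|j r IH] //=; exact: Xlin. Qed.

Let lincomb0 : S (fun=> 0) = (fun=> 0).
Proof.
have := Slin 1 X0 X0; rewrite (_ : lincomb 1 _ _ = (fun=> 0)); last first.
  by apply/funext => i; rewrite /lincomb mulr0 addr0.
move=> E; apply/funext => i; have := congr1 (fun h => h i) E; rewrite /lincomb; lra.
Qed.

Let combS c g r : (forall j, X (g j)) -> S (comb c g r) = comb c (fun j => S (g j)) r.
Proof.
move=> gX; elim: r => [|j r IH] /=; first exact: lincomb0.
by rewrite Slin ?IH//; exact: combX.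
Qed.

Let comb_ell k c g r : (forall j, X (g j)) ->
  ell k (comb c g r) = \sum_(j <- r) c j * ell k (g j).
Proof.
move=> gX; elim: r => [|j r IH] /=; last first.
  by rewrite big_cons elllin ?IH//; exact: combX.
rewrite big_nil; have := elllin k 1 X0 X0; rewrite (_ : lincomb 1 _ _ = (fun=> 0)); last first.
  by apply/funext => i; rewrite /lincomb mulr0 addr0.
lra.
Qed.

(** The bound must hold for every [M] that bounds [k], not only for the one that starts the
    iteration; it comes from iterating [u = k + S u] on a crude bound of [u]. *)
Let resolvent k : X k -> exists u, [/\ X u, forall i, u i = k i + S u i &
  forall M, 0 <= M -> bounded_by M k -> bounded_by (M / (1 - rho)) u].
Proof.
move=> kX; have [M0 M00 hM0] := Xbd kX.
have XB u v : X u -> X v -> X (fun i => u i - v i).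
  move=> uX vX; have := Xlin (-1) vX uX; congr X.
  by apply/funext => i; rewrite /lincomb mulN1r addrC.
have SB u v : X u -> X v -> forall i, S u i - S v i = S (fun i => u i - v i) i.
  move=> uX vX i; rewrite (_ : (fun i => u i - v i) = lincomb (-1) v u); last first.
    by apply/funext => x; rewrite /lincomb mulN1r addrC.
  by rewrite Slin// /lincomb mulN1r addrC.
have [|||||||||u [uX Eu _]] := @contraction_fixpoint _ _ w X (fun u i => k i + S u i) k (rho * M0) rho; try by [].
- exact: mulr_ge0.
- move=> u uX; have := Xlin 1 kX (SX uX); congr X.
  by apply/funext => x; rewrite /lincomb mul1r.
- move=> u v M uX vX uv i; rewrite opprD addrACA subrr add0r SB//.
  have [M1 M10 hM1] := Xbd (XB _ _ uX vX).
  have [M0'|M0'] := leP 0 M; first by apply: Sbd => //; exact: XB.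
  have z : bounded_by 0 (fun i => u i - v i).
    by move=> x; rewrite mul0r; apply: le_trans (uv x) _; rewrite nmulr_rle0.
  have := Sbd (XB _ _ uX vX) (lexx 0) z i; rewrite mulr0 mul0r => /le_trans; apply.
  have := le_trans (normr_ge0 _) (uv i); rewrite nmulr_rge0// => wi.
  by rewrite (_ : w i = 0) ?mulr0//; apply/eqP; rewrite eq_le wi w0.
- by move=> i; rewrite addrAC subrr add0r; exact: Sbd.
exists u; split=> // M M1 hM.
have r1 : 0 < 1 - rho by rewrite subr_gt0.
have [B B0 hB] := Xbd uX.
have step m : bounded_by (rho ^+ m * B + M / (1 - rho)) u.
  elim: m => [|m IH] i.
    rewrite expr0 mul1r; apply: le_trans (hB i) _; rewrite ler_wpM2r//.
    by rewrite lerDl divr_ge0// ltW.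
  rewrite -[u i]Eu; apply: le_trans (ler_normD _ _) _.
  have c0 : 0 <= rho ^+ m * B + M / (1 - rho).
    by apply: addr_ge0; [rewrite mulr_ge0 ?exprn_ge0|rewrite divr_ge0 ?(ltW r1)].
  apply: le_trans (lerD (hM i) (Sbd uX c0 IH i)) _.
  rewrite -mulrDl ler_wpM2r// exprS le_eqVlt; apply/orP; left; apply/eqP; field.
  by rewrite gt_eqF.
move=> i.
have h : (rho ^+ m * B + M / (1 - rho)) * w i @[m --> \oo] --> (0 * B + M / (1 - rho)) * w i.
  apply: cvgM; last exact: cvg_cst.
  apply: cvgD; last exact: cvg_cst.
  by apply: cvgM; [apply: cvg_expr; rewrite ger0_norm|exact: cvg_cst].
rewrite mul0r add0r in h.
by apply: (ler_cvg_to (cvg_cst _) h); apply: nearW => m; exact: step.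
Qed.

(* Neumann series for [S] and linear algebra for the finite-rank part. *)
Lemma fredholm :
  (forall u, X u -> (forall i, u i = S u i + \sum_(j < n) ell j u * f j i) ->
    forall i, u i = 0) ->
  exists2 K, 0 <= K & forall k M, X k -> 0 <= M -> bounded_by M k ->
    exists u, [/\ X u, forall i, u i = k i + S u i + \sum_(j < n) ell j u * f j i &
      bounded_by (K * M) u].
Proof.
move=> inj.
have /choice[G hG] : forall k, exists u, X k -> [/\ X u, forall i, u i = k i + S u i &
    forall M, 0 <= M -> bounded_by M k -> bounded_by (M / (1 - rho)) u].
  move=> k; have [kX|nX] := pselect (X k); last by exists k.
  by have [u hu] := resolvent kX; exists u.
(* A solution of the full equation is [G k] plus a combination of the [g j] whose coefficients are
   its own values under the functionals [ell]; this leaves a linear system with matrix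
   [1%:M - N]. *)
pose g j := G (f j).
have gX j : X (g j) by have [] := hG _ (fX j).
have gE j i : g j i = f j i + S (g j) i by have [_ h _] := hG _ (fX j); exact: h.
pose N : 'M[R]_n := \matrix_(j, i) ell i (g j).
pose Id := index_enum 'I_n.
have ellN (c : 'rV[R]_n) i : ell i (comb (fun j => c 0 j) g Id) = (c *m N) 0 i.
  by rewrite comb_ell// mxE; apply: eq_bigr => j _; rewrite mxE.
(* A row [c] annihilated by the matrix yields [u = \sum_j c_j g_j] with [ell j u = c_j], a solution
   of the homogeneous equation; injectivity gives [u = 0], hence [c = 0]. *)
have unitA : (1%:M - N) \in unitmx.
  rewrite -row_free_unit; apply: inj_row_free => c /eqP.
  rewrite mulmxBr mulmx1 subr_eq0 => /eqP cN.
  pose u := comb (fun j => c 0 j) g Id.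
  have uX : X u by exact: combX.
  have ellu i : ell i u = c 0 i by rewrite ellN -cN.
  have u0 : forall i, u i = 0.
    apply: inj => // i; rewrite {1}/u combE.
    rewrite (eq_bigr (fun j => c 0 j * f j i + c 0 j * S (g j) i)); last first.
      by move=> j _; rewrite gE mulrDr.
    rewrite big_split/= addrC; congr (_ + _); first by rewrite /u combS// combE.
    by apply: eq_bigr => j _; rewrite ellu.
  have uz : u = (fun=> 0) by apply/funext.
  apply/rowP => i; rewrite -ellu uz mxE.
  by have := @comb_ell i (fun=> 0) g [::] gX; rewrite big_nil.
pose A' := invmx (1%:M - N).
have /choice[Mf hMf] : forall j, exists M, 0 <= M /\ bounded_by M (f j).
  by move=> j; have [M M0 hM] := Xbd (fX j); exists M.
have r1 : 0 < 1 - rho by rewrite subr_gt0.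
pose K := (1 + \sum_(j < n) (\sum_(i < n) Lam * `|A' i j|) * Mf j) / (1 - rho).
have K1 : 0 <= 1 + \sum_(j < n) (\sum_(i < n) Lam * `|A' i j|) * Mf j.
  rewrite addr_ge0// sumr_ge0// => j _; rewrite mulr_ge0 ?(hMf j).1//.
  by rewrite sumr_ge0// => i _; rewrite mulr_ge0.
exists (K / (1 - rho) + K); first by rewrite addr_ge0 ?divr_ge0// ltW.
move=> k M kX M0 hM; have [hX hE hB] := hG k kX.
pose d : 'rV[R]_n := \row_i ell i (G k).
pose c := d *m A'.
have cE : d + c *m N = c.
  have : c *m (1%:M - N) = d by rewrite -mulmxA mulVmx// mulmx1.
  by rewrite mulmxBr mulmx1 => <-; rewrite subrK.
pose v := comb (fun j => c 0 j) g Id.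
have vX : X v by exact: combX.
pose u := lincomb 1 (G k) v.
have uX : X u by exact: Xlin.
have ellu i : ell i u = c 0 i.
  by rewrite /u elllin// mul1r /v ellN -[in RHS]cE !mxE.
exists u; split=> //.
  move=> i; rewrite {1}/u /lincomb mul1r hE /v combE.
  rewrite (eq_bigr (fun j => c 0 j * f j i + c 0 j * S (g j) i)); last first.
    by move=> j _; rewrite gE mulrDr.
  rewrite big_split/= /u Slin// /lincomb mul1r /v combS// combE.
  rewrite -!addrA; congr (_ + (_ + _)); rewrite addrC; congr (_ + _).
  by apply: eq_bigr => j _; rewrite -/v -/(lincomb 1 (G k) v) -/u ellu.
have hGk := hB M M0 hM.
have Mr0 : 0 <= M / (1 - rho) by rewrite divr_ge0// ltW.
have dM i : `|d 0 i| <= Lam * (M / (1 - rho)) by rewrite mxE; exact: ellbd.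
have cM j : `|c 0 j| <= (\sum_(i < n) Lam * `|A' i j|) * (M / (1 - rho)).
  rewrite mxE; apply: le_trans (ler_norm_sum _ _ _) _; rewrite mulr_suml; apply: ler_sum => i _.
  by rewrite normrM mulrAC ler_wpM2r.
move=> i; rewrite /u /lincomb mul1r; apply: le_trans (ler_normD _ _) _.
have hv : `|v i| <= (\sum_(j < n) (\sum_(i < n) Lam * `|A' i j|) * Mf j) / (1 - rho) * (M / (1 - rho)) * w i.
  rewrite /v combE; apply: le_trans (ler_norm_sum _ _ _) _.
  rewrite !mulr_suml; apply: ler_sum => j _; rewrite normrM.
  have [Mf0 hf] := hMf j; have [_ _ gB] := hG _ (fX j).
  apply: le_trans (ler_pM (normr_ge0 _) (normr_ge0 _) (cM j) (gB _ Mf0 hf i)) _.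
  by rewrite le_eqVlt; apply/orP; left; apply/eqP; ring.
apply: le_trans (lerD (hGk i) hv) _.
rewrite -mulrDl ler_wpM2r// /K.
set s := \sum_(j < n) _ in K1 *.
have s0 : 0 <= s.
  rewrite sumr_ge0// => j _; rewrite mulr_ge0 ?(hMf j).1//.
  by rewrite sumr_ge0// => i' _; rewrite mulr_ge0.
rewrite -subr_ge0 (_ : _ - _ = M / (1 - rho) ^+ 2 + M * s / (1 - rho)); last by field; rewrite gt_eqF.
by apply: addr_ge0; rewrite divr_ge0 ?sqr_ge0 ?(ltW r1)// mulr_ge0.
Qed.

End Fredholm.

(** * The inverse as an integral operator on representatives *)

Section InverseOperator.
Context {R : realType}.
Notation mu := (@lebesgue_measure R).
Local Notation itg D f := (mu.-integrable D (EFin \o (f : R -> R))).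
Context {T : \bar R} {A B C : R -> R} (hs : hs_system T A B C).
Let cs : canonical_system T A B C := hs.
Local Notation D := (hointerval T).
Local Notation Q := (qform A B C).
Local Notation AA := (headint A).
Local Notation BB := (tailint T B).
Local Notation H := (hs_density T A B).
Local Notation kap := (@kap R T A B).

(* A complex vector function is indexed by (imaginary part?, second coordinate?, time). *)
Local Notation I := (bool * bool * R)%type.
Implicit Types (u v g h : I -> R).

Definition linB u j t : R := C t * u (j, false, t) + B t * u (j, true, t).
Definition linA u j t : R := A t * u (j, false, t) + C t * u (j, true, t).
Definition energy u j : R := \int[mu]_(t in D) Q t (u (j, false, t)) (u (j, true, t)).

(** The inverse operator in coordinates. The first component is the integral over [[t, T)], written
    as a difference so that its absolute continuity in [t] is that of a primitive. *)
Definition Kop u (i : I) : R := let: (j, k, t) := i in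
  if k then \int[mu]_(x in `[0, t]) linA u j x
  else \int[mu]_(x in D) linB u j x - \int[mu]_(x in `[0, t]) linB u j x.

(** Multiplication by the complex number [a + i b] on pairs of a real and an imaginary part. *)
Definition zmul (a b : R) u (i : I) : R := let: (j, k, t) := i in
  a * u (j, k, t) + (if j then b else - b) * u (~~ j, k, t).

Definition cL2fun u : Prop :=
  (forall j k, measurable_fun D (fun t => u (j, k, t))) /\
  (forall j, itg D (fun t => Q t (u (j, false, t)) (u (j, true, t)))).

Let mD : measurable D := @measurable_hointerval R T.
Let iB : itg D B := hs_iB hs.

Lemma cL2_linB u j : cL2fun u -> itg D (linB u j) /\
  forall E, measurable E -> E `<=` D -> (\int[mu]_(t in E) linB u j t) ^+ 2 <=
    \int[mu]_(t in E) B t * energy u j.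
Proof.
move=> [mu_ iQ]; split.
  by have [] := csB hs (hs_iB hs) (@subset_refl _ _) mD (mu_ j false) (mu_ j true) (iQ j).
move=> E mE ED.
have mS (f : R -> R) : measurable_fun D f -> measurable_fun E f by exact: measurable_funS.
have [_ h] := csB hs (hs_iB hs) ED mE (mS _ (mu_ j false)) (mS _ (mu_ j true)) (itgS mD mE ED (iQ j)).
apply: le_trans h _; rewrite ler_wpM2l//.
  by apply: Rintegral_ge0 => x /ED xD; exact/ltW/(cs_B0 cs).
by apply: Rintegral_ge0_subset => // x xD; exact: (qform_ge0 cs).
Qed.

Lemma cL2_linA u j b : cL2fun u -> D b -> itg `[0, b] (linA u j) /\
  forall E, measurable E -> E `<=` `[0, b] -> (\int[mu]_(t in E) linA u j t) ^+ 2 <=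
    \int[mu]_(t in E) A t * energy u j.
Proof.
move=> [mu_ iQ] bD; have [iA _ _] := cs_itg cs bD.
have sD : `[0, b] `<=` D by exact: hointerval_seg.
have mS E (f : R -> R) : E `<=` D -> measurable_fun D f -> measurable_fun E f.
  by move=> ED; exact: measurable_funS.
split.
  have [] := csA hs sD (measurable_itv _) (mS _ _ sD (mu_ j false)) (mS _ _ sD (mu_ j true)) iA
    (itgS mD (measurable_itv _) sD (iQ j)); by [].
move=> E mE EB; have ED := subset_trans EB sD.
have iA' : itg E A by apply: itgS iA.
have [_ h] := csA hs ED mE (mS _ _ ED (mu_ j false)) (mS _ _ ED (mu_ j true)) iA' (itgS mD mE ED (iQ j)).
apply: le_trans h _; rewrite ler_wpM2l//.
  by apply: Rintegral_ge0 => x /ED xD; exact/ltW/(cs_A0 cs).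
by apply: Rintegral_ge0_subset => // x xD; exact: (qform_ge0 cs).
Qed.

Lemma energy_ge0 u j : 0 <= energy u j.
Proof. by apply: Rintegral_ge0 => x xD; exact: (qform_ge0 cs). Qed.

Lemma Kop_tail u j t : cL2fun u -> D t ->
  Kop u (j, false, t) = \int[mu]_(x in tail T t) linB u j x.
Proof.
move=> uL tD; have [iL _] := cL2_linB j uL.
by rewrite /Kop (Rintegral_D_split tD iL) addrAC subrr add0r.
Qed.

Lemma Kop_bound u j t : cL2fun u -> D t ->
  Kop u (j, false, t) ^+ 2 <= BB t * energy u j /\
  Kop u (j, true, t) ^+ 2 <= AA t * energy u j.
Proof.
move=> uL tD; split.
  rewrite Kop_tail//; have [_ h] := cL2_linB j uL; apply: h.
    exact: measurable_tail.
  exact: tail_sub.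
by have [_ h] := cL2_linA j uL tD; apply: h.
Qed.

Lemma Kop_acd u j b : cL2fun u -> D b ->
  acd b (fun t => Kop u (j, false, t)) (fun t => - linB u j t) /\
  acd b (fun t => Kop u (j, true, t)) (linA u j).
Proof.
move=> uL bD; have [iL _] := cL2_linB j uL; have [iLA _] := cL2_linA j uL bD; split.
  have := acd_integral (\int[mu]_(x in D) linB u j x) (itgZ (-1) (measurable_itv _) (itg_seg bD (lexx 0) iL)).
  have E t : 0 <= t <= b -> \int[mu]_(x in `[0, t]) (-1 * linB u j x) = - \int[mu]_(x in `[0, t]) linB u j x.
    move=> /andP[t0 tb]; rewrite RintegralZl ?mulN1r//.
    by apply: itg_seg iL => //; exact: hointerval_le tb.
  have := acdB (acd_cst 0 b (\int[mu]_(x in D) linB u j x)) (acd_integral 0 (itg_seg bD (lexx 0) iL)).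
  move=> h _; have {}h := acd_eq h (fun t _ => sub0r (linB u j t)).
  by move: h; under [X in acdi _ _ X]eq_fun do rewrite add0r.
by have := acd_integral 0 iLA; under [X in acdi _ _ X]eq_fun do rewrite add0r.
Qed.

Lemma Kop_measurable u j k : cL2fun u -> measurable_fun D (fun t => Kop u (j, k, t)).
Proof.
move=> uL; apply: (measurable_on_hointerval (cs_T cs)) => b bD.
have [h1 h2] := Kop_acd j uL bD.
by case: k; [exact: acd_measurable h2|exact: acd_measurable h1].
Qed.

Lemma linB_comb a u v j t : linB (lincomb a u v) j t = a * linB u j t + linB v j t.
Proof. by rewrite /linB /lincomb; ring. Qed.

Lemma linA_comb a u v j t : linA (lincomb a u v) j t = a * linA u j t + linA v j t.
Proof. by rewrite /linA /lincomb; ring. Qed.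

Lemma int_linB_comb E a u v j : measurable E -> E `<=` D -> cL2fun u -> cL2fun v ->
  \int[mu]_(t in E) linB (lincomb a u v) j t =
  a * \int[mu]_(t in E) linB u j t + \int[mu]_(t in E) linB v j t.
Proof.
move=> mE ED uL vL; have [iu _] := cL2_linB j uL; have [iv _] := cL2_linB j vL.
have {}iu := itgS mD mE ED iu; have {}iv := itgS mD mE ED iv.
rewrite -RintegralZl// -RintegralD//; last exact: itgZ.
by apply: eq_Rintegral => t _; rewrite linB_comb.
Qed.

Lemma int_linA_comb b a u v j : D b -> cL2fun u -> cL2fun v ->
  \int[mu]_(t in `[0, b]) linA (lincomb a u v) j t =
  a * \int[mu]_(t in `[0, b]) linA u j t + \int[mu]_(t in `[0, b]) linA v j t.
Proof.
move=> bD uL vL; have [iu _] := cL2_linA j uL bD; have [iv _] := cL2_linA j vL bD.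
rewrite -RintegralZl// -RintegralD//; last exact: itgZ.
by apply: eq_Rintegral => t _; rewrite linA_comb.
Qed.

Lemma zmul_comb a b c u v : zmul a b (lincomb c u v) = lincomb c (zmul a b u) (zmul a b v).
Proof. by apply/funext => -[[j k] t]; rewrite /zmul /lincomb; case: j => /=; ring. Qed.

Lemma cL2_comb a u v : cL2fun u -> cL2fun v -> cL2fun (lincomb a u v).
Proof.
move=> [mu_ iu] [mv iv].
have m j k : measurable_fun D (fun t => lincomb a u v (j, k, t)).
  by apply: measurable_funD => //; exact: measurable_funM.
split=> // j.
apply: (itg_le mD _ (itgD mD (itgZ (2 * a ^+ 2) mD (iu j)) (itgZ 2 mD (iv j)))).
  by apply: (measurable_qform cs).
move=> t tD; rewrite ger0_norm ?(qform_ge0 cs)//.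
have := qformD_le cs (a * u (j, false, t)) (a * u (j, true, t)) (v (j, false, t)) (v (j, true, t)) tD.
by move=> /le_trans; apply; rewrite le_eqVlt; apply/orP; left; apply/eqP; rewrite /qform; ring.
Qed.

Lemma cL2_zmul a b u : cL2fun u -> cL2fun (zmul a b u).
Proof.
move=> uL.
have [ms is_] : cL2fun (lincomb b (fun i : I => let: (j, k, t) := i in (if j then 1 else -1) * u (~~ j, k, t))
     (lincomb a u (fun=> 0))).
  apply: cL2_comb; last first.
    apply: cL2_comb => //; split=> [j k|j]; first exact: measurable_cst.
    apply: (itg_eq mD (f := fun=> 0)); first by move=> t _; rewrite /qform; ring.
    by apply: (itg_le mD _ iB) => // t tD; rewrite normr0; exact/ltW/(cs_B0 cs).
  have [m i] := uL; split=> [j k|j]; first by apply: measurable_funM.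
  by apply: itg_eq (i (~~ j)) => // t _; case: j; rewrite /qform; ring.
have E i : lincomb b (fun i : I => let: (j, k, t) := i in (if j then 1 else -1) * u (~~ j, k, t))
     (lincomb a u (fun=> 0)) i = zmul a b u i.
  by move: i => [[j k] t]; rewrite /lincomb /zmul; case: j => /=; ring.
split=> [j k|j].
  by have := ms j k; under eq_fun do rewrite E.
by have := is_ j; under [X in EFin \o X]eq_fun do rewrite !E.
Qed.

End InverseOperator.

Lemma measurable_ifD {R : realType} (E : set R) (b : R -> bool) (f g : R -> R) :
  measurable E -> measurable_fun E b -> measurable_fun E f -> measurable_fun E g ->
  measurable_fun E (fun x => if b x then f x else g x).
Proof.
move=> mE mb mf mg; apply: measurable_fun_if => //.
  by apply: measurable_funS mf => // x [].
by apply: measurable_funS mg => // x [].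
Qed.

(** * Splitting the inverse into a contraction and a finite-rank part *)

Section Resolvent.
Context {R : realType}.
Notation mu := (@lebesgue_measure R).
Local Notation itg D f := (mu.-integrable D (EFin \o (f : R -> R))).
Context {T : \bar R} {A B C : R -> R} (hs : hs_system T A B C).
Let cs : canonical_system T A B C := hs.
Local Notation D := (hointerval T).
Local Notation Q := (qform A B C).
Local Notation AA := (headint A).
Local Notation BB := (tailint T B).
Local Notation H := (hs_density T A B).
Local Notation kap := (@kap R T A B).
Local Notation I := (bool * bool * R)%type.
Local Notation linA := (@linA R A C).
Local Notation linB := (@linB R B C).
Local Notation Kop := (@Kop R T A B C).
Local Notation energy := (@energy R T A B C).
Local Notation cL2fun := (@cL2fun R T A B C).
Implicit Types (u v g h : I -> R).

Let mD : measurable D := @measurable_hointerval R T.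

Context (a b c : R) (cD : D c) (c0 : 0 < c).
Let N := `|a| + `|b| + 1.
Context (kc : 8 * N ^+ 2 * kap c <= 1).

Let N1 : 1 <= N. Proof. by rewrite /N lerDr addr_ge0. Qed.
Let N0 : 0 < N. Proof. exact: lt_le_trans ltr01 N1. Qed.

(** Relative to the weight, the integrands of [Kop (zmul a b u)] are at most [2 * N * (A t + B t)];
    doubling this bound gives the contraction constant [1 / 2]. *)
Let ell0 t := 4 * N * (A t + B t).
Let e t := expR (0 + \int[mu]_(x in `[0, t]) ell0 x).

Let iell d : D d -> itg `[0, d] ell0.
Proof. by move=> dD; have [iA iB _] := cs_itg cs dD; apply: itgZ => //; exact: itgD. Qed.

Let ell0_ge0 t : D t -> 0 <= ell0 t.
Proof.
move=> tD; rewrite mulr_ge0 ?mulr_ge0 ?(ltW N0)// addr_ge0// ltW//.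
  exact: (cs_A0 cs).
exact: (cs_B0 cs).
Qed.

Let e_acd d : D d -> acd d e (fun t => e t * ell0 t).
Proof. by move=> dD; apply: acd_exp; exact: acd_integral (iell dD). Qed.

Let e_ge1 t : D t -> 1 <= e t.
Proof.
move=> tD; rewrite -[leLHS]expR0 ler_expR add0r; apply: Rintegral_ge0 => y /=.
by rewrite in_itv/= => yx; apply: ell0_ge0; exact: D_seg yx.
Qed.

Let int_e t : D t -> itg `[0, t] (fun x => ell0 x * e x) /\
  \int[mu]_(x in `[0, t]) (ell0 x * e x) <= e t.
Proof.
move=> tD; have [M _ hM] := acd_bounded (e_acd tD).
have iw : itg `[0, t] (fun x => ell0 x * e x).
  by apply: (itg_mul_bounded (M := M) _ (iell tD) (acd_measurable (e_acd tD))).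
split=> //; have [t0 _] := tD.
have -> : e t = e 0 + \int[mu]_(x in `[0, t]) (ell0 x * e x).
  apply: (@acd_FTC _ t); rewrite ?lexx ?t0//.
  by apply: acd_eq (e_acd tD) _ => x _; rewrite mulrC.
by rewrite lerDr expR_ge0.
Qed.

(* Exponential weights make the Volterra part on [[0, c)] contractive; on the tail
   the weights are those of the range of the inverse operator. *)
Let w (i : I) : R := let: (j, k, t) := i in
  if t \in D then (if t < c then e t else if k then Num.sqrt (AA t) else Num.sqrt (BB t)) else 0.

Let w_ge0 i : 0 <= w i.
Proof.
by move: i => [[j k] t]; rewrite /w; do ?case: ifP => _ //; rewrite ?expR_ge0 ?sqrtr_ge0.
Qed.

Let wE j k t : D t -> w (j, k, t) =
  if t < c then e t else if k then Num.sqrt (AA t) else Num.sqrt (BB t).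
Proof. by move=> tD; rewrite /w mem_set. Qed.

Let wout j k t : ~ D t -> w (j, k, t) = 0.
Proof. by move=> tD; rewrite /w memNset. Qed.

Let X u := (forall j k, measurable_fun D (fun t => u (j, k, t))) /\
  exists2 M, 0 <= M & bounded_by w M u.

(** An integrable majorant: squaring the weights in [qform_le] gives [(A + B) * e ^+ 2] before [c]
    and exactly the density [A * BB + B * AA] beyond it. Thus the weighted sup norm controls the
    energy. *)
Let Gm t := if t < c then (A t + B t) * e t ^+ 2 else H t.

Let ec_mono t : D t -> t < c -> e t <= e c.
Proof.
move=> [t0 _] tc; rewrite ler_expR !add0r; apply: Rintegral_ge0_subset => //.
- by move=> x /=; rewrite !in_itv/= => /andP[-> xt]; rewrite (le_trans xt)// ltW.
- exact: iell.
- by move=> x /=; rewrite in_itv/= => xc; apply: ell0_ge0; exact: D_seg xc.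
Qed.

Let Gm_ge0 t : D t -> 0 <= Gm t.
Proof.
move=> tD; rewrite /Gm; case: ifP => _; last exact: (hs_density_ge0 hs).
by rewrite mulr_ge0 ?sqr_ge0// addr_ge0// ltW//; [exact: (cs_A0 cs)|exact: (cs_B0 cs)].
Qed.

Let measurable_lt_c : measurable_fun D (fun t : R => t < c).
Proof. by apply: measurable_fun_ltr. Qed.

Let measurable_e : measurable_fun D e.
Proof. by apply: (measurable_on_hointerval (cs_T cs)) => d /e_acd; exact: acd_measurable. Qed.

Let iGm : itg D Gm.
Proof.
have iAB : itg D ((fun t => A t + B t) \_ `[0, c]).
  have [iA iB _] := cs_itg cs cD.
  have := itgD (measurable_itv _) iA iB => /(itg_patch _ (measurable_itv _)).1.
  exact: itgS.
have mG : measurable_fun D Gm.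
  apply: measurable_ifD => //.
    apply: measurable_funM; last exact: measurable_funX.
    by apply: measurable_funD; [exact: (cs_mA cs)|exact: (cs_mB cs)].
  exact: itg_measurable (hs_iH hs).
apply: (itg_le mD mG (itgD mD (itgZ (e c ^+ 2) mD iAB) (hs_iH hs))) => t tD.
rewrite ger0_norm ?Gm_ge0// /Gm patchE; have [t0 _] := tD.
have A0 := cs_A0 cs tD; have B0 := cs_B0 cs tD.
case: ifP => tc.
  rewrite mem_set/=; last by rewrite in_itv/= t0 ltW.
  rewrite -[leLHS]addr0 lerD ?(hs_density_ge0 hs)// mulrC ler_wpM2r ?addr_ge0 ?(ltW A0) ?(ltW B0)//.
  by rewrite ler_sqr ?nnegrE ?expR_ge0// ec_mono.
rewrite lerDr mulr_ge0 ?sqr_ge0//; case: ifP => // _; by rewrite addr_ge0// ltW.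
Qed.

Let Gam : R := \int[mu]_(t in D) Gm t.

Let Gam_ge0 : 0 <= Gam.
Proof. by apply: Rintegral_ge0 => t tD; exact: Gm_ge0. Qed.

Let Q_bound M u j t : D t -> 0 <= M -> bounded_by w M u ->
  Q t (u (j, false, t)) (u (j, true, t)) <= 2 * M ^+ 2 * Gm t.
Proof.
move=> tD M0 uM; apply: le_trans (qform_le cs _ _ tD) _.
have A0 := cs_A0 cs tD; have B0 := cs_B0 cs tD.
have sq k : u (j, k, t) ^+ 2 <= M ^+ 2 * w (j, k, t) ^+ 2.
  rewrite -exprMn -real_normK ?num_real// ler_sqr ?nnegrE ?mulr_ge0//.
have h1 := ler_wpM2l (ltW A0) (sq false); have h2 := ler_wpM2l (ltW B0) (sq true).
move: h1 h2; rewrite !wE// /Gm; case: ifP => _ h1 h2; first by lra.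
move: h1 h2; rewrite !sqr_sqrtr ?(BB_ge0 hs) ?(AA_ge0 hs)// /hs_density; lra.
Qed.

Let X_cL2 u : X u -> cL2fun u.
Proof.
move=> [mu_ [M M0 uM]]; split=> // j.
apply: (itg_le mD _ (itgZ (2 * M ^+ 2) mD iGm)); first exact: (measurable_qform cs).
by move=> t tD; rewrite ger0_norm ?(qform_ge0 cs)//; exact: Q_bound.
Qed.

Let X_energy u j M : X u -> 0 <= M -> bounded_by w M u -> energy u j <= 2 * M ^+ 2 * Gam.
Proof.
move=> uX M0 uM; rewrite -RintegralZl//; apply: Rintegral_le => //.
- by have [_ h] := X_cL2 uX.
- exact: itgZ.
- by move=> t tD; exact: Q_bound.
Qed.

Let tail_energy u j M t : X u -> 0 <= M -> bounded_by w M u -> c <= t ->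
  forall E, measurable E -> E `<=` tail T c ->
  \int[mu]_(x in E) Q x (u (j, false, x)) (u (j, true, x)) <= 2 * M ^+ 2 * kap c.
Proof.
move=> uX M0 uM ct E mE Ec; have [_ iQ] := X_cL2 uX.
have cD' : tail T c `<=` D by exact: tail_sub.
have mc : measurable (tail T c) by exact: measurable_tail.
apply: (@le_trans _ _ (\int[mu]_(x in tail T c) Q x (u (j, false, x)) (u (j, true, x)))).
  apply: Rintegral_ge0_subset => //; first exact: itg_tail (iQ j).
  by move=> x [xD _]; exact: (qform_ge0 cs).
rewrite -RintegralZl//; last exact: itg_tail (hs_iH hs).
apply: Rintegral_le => //; first exact: itg_tail (iQ j).
  by apply: itgZ => //; exact: itg_tail (hs_iH hs).
move=> x [xD cx]; have := Q_bound j xD M0 uM.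
by rewrite /Gm ltNge cx.
Qed.

Let zX u : X u -> X (zmul a b u).
Proof.
move=> [m [M M0 uM]]; split.
  move=> j k; apply: measurable_funD; apply: measurable_funM => //.
exists (N * M) => [|[[j k] t]]; first by rewrite mulr_ge0// ltW.
rewrite /zmul; apply: le_trans (ler_normD _ _) _; rewrite !normrM.
have -> : `|if j then b else - b| = `|b| by case: j; rewrite ?normrN.
have h1 := ler_wpM2l (normr_ge0 a) (uM (j, k, t)).
have h2 := ler_wpM2l (normr_ge0 b) (uM (~~ j, k, t)).
have E : w (~~ j, k, t) = w (j, k, t) by [].
rewrite E in h2; apply: le_trans (lerD h1 h2) _.
have := mulr_ge0 M0 (w_ge0 (j, k, t)); rewrite /N; move: (w _) => z; lra.
Qed.

Let z_bound u M : 0 <= M -> bounded_by w M u -> bounded_by w (N * M) (zmul a b u).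
Proof.
move=> M0 uM [[j k] t].
rewrite /zmul; apply: le_trans (ler_normD _ _) _; rewrite !normrM.
have -> : `|if j then b else - b| = `|b| by case: j; rewrite ?normrN.
have h1 := ler_wpM2l (normr_ge0 a) (uM (j, k, t)).
have h2 := ler_wpM2l (normr_ge0 b) (uM (~~ j, k, t)).
have E : w (~~ j, k, t) = w (j, k, t) by [].
rewrite E in h2; apply: le_trans (lerD h1 h2) _.
have := mulr_ge0 M0 (w_ge0 (j, k, t)); rewrite /N; move: (w _) => z; lra.
Qed.

(** Before [c] the first component of [Kop] is the full integral minus an integral over [[0, t]];
    from [c] on the second one is the integral over [[0, c]] plus one over [[c, t]]. [alpha]
    collects these two constants for the real and the imaginary part, and [S] keeps the remainders,
    which contract. *)
Let alpha (x : bool * bool) u : R :=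
  if x.2 then \int[mu]_(t in `[0, c]) linA (zmul a b u) x.1 t
  else \int[mu]_(t in D) linB (zmul a b u) x.1 t.

Let fr (x : bool * bool) (i : I) : R := let: (j, k, t) := i in
  if (t \in D) && (j == x.1) && (k == x.2) && (if k then c <= t else t < c) then 1 else 0.

Let S u (i : I) : R := let: (j, k, t) := i in
  if t \in D then Kop (zmul a b u) (j, k, t) -
    (if (if k then c <= t else t < c) then alpha (j, k) u else 0) else 0.

Let S_sum u j k t : D t ->
  S u (j, k, t) + \sum_(x : bool * bool) alpha x u * fr x (j, k, t) = Kop (zmul a b u) (j, k, t).
Proof.
move=> tD; rewrite (bigD1 (j, k))//= big1 => [|[x1 x2] xn].
  rewrite /S /fr mem_set//= !eqxx/= addr0.
  by case: (if k then c <= t else t < c); rewrite ?mulr1 ?mulr0 ?subrK ?subr0 ?addr0.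
rewrite /fr mem_set//=; case: ifP; rewrite ?mulr0// => /andP[/andP[/eqP E1 /eqP E2] _].
by move: xn; rewrite E1 E2 eqxx.
Qed.

Let measurable_cond k : measurable_fun D (fun t : R => if k then c <= t else t < c).
Proof. by case: k; [exact: measurable_fun_ler|exact: measurable_fun_ltr]. Qed.

Let S_measurable u j k : X u -> measurable_fun D (fun t => S u (j, k, t)).
Proof.
move=> uX.
apply: (@eq_measurable_fun _ _ _ _ _ (fun t => Kop (zmul a b u) (j, k, t) -
    (if (if k then c <= t else t < c) then alpha (j, k) u else 0))).
  by move=> t tD; rewrite /S tD.
apply: measurable_funB; first by apply: (Kop_measurable hs); exact/X_cL2/zX.
by apply: measurable_ifD => //; exact: measurable_cond.
Qed.

Let half_sqrt (x y M : R) : 0 <= M -> 0 <= y -> x ^+ 2 <= y * (M ^+ 2 / 4) ->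
  `|x| <= 1 / 2 * M * Num.sqrt y.
Proof.
move=> M0 y0 h; rewrite -ler_sqr ?nnegrE ?mulr_ge0 ?sqrtr_ge0//.
rewrite real_normK ?num_real// !exprMn sqr_sqrtr//; apply: le_trans h _.
by rewrite le_eqVlt; apply/orP; left; apply/eqP; field.
Qed.

Let S_bound u M : X u -> 0 <= M -> bounded_by w M u -> bounded_by w (1 / 2 * M) (S u).
Proof.
move=> uX M0 uM [[j k] t]; have [tD|ntD] := pselect (D t); last first.
  by rewrite /S memNset// normr0 wout// mulr0.
have gX := zX uX; have gL := X_cL2 gX; have NM : 0 <= N * M by rewrite mulr_ge0// ltW.
have gM := z_bound M0 uM.
set g := zmul a b u in gX gL gM *.
have [iLB _] := cL2_linB hs j gL.
rewrite /S mem_set// wE// -/g.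
have [tc|ct] := ltP t c.
  have [ie he] := int_e tD.
  have key f (a1 a2 : R -> R) : measurable_fun `[0, t] f ->
      (forall x, 0 <= x <= t -> f x = a1 x * g (j, false, x) + a2 x * g (j, true, x)) ->
      (forall x, D x -> `|a1 x| <= A x + B x) -> (forall x, D x -> `|a2 x| <= A x + B x) ->
      `|\int[mu]_(x in `[0, t]) f x| <= 1 / 2 * M * e t.
    move=> mf fE h1 h2.
    apply: (@le_trans _ _ (\int[mu]_(x in `[0, t]) (1 / 2 * M * (ell0 x * e x)))).
      apply: Rintegral_norm_le => //; first exact: itgZ.
      move=> x /=; rewrite in_itv/= => xt; have xD := D_seg tD xt.
      have xc : x < c by case/andP: xt => _ xt; exact: le_lt_trans xt tc.
      have g1 := gM (j, false, x); have g2 := gM (j, true, x).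
      rewrite wE// xc in g1; rewrite wE// xc in g2.
      rewrite fE//; apply: le_trans (ler_normD _ _) _; rewrite !normrM.
      have := ler_pM (normr_ge0 _) (normr_ge0 _) (h1 x xD) g1.
      have := ler_pM (normr_ge0 _) (normr_ge0 _) (h2 x xD) g2.
      rewrite /ell0; move: `|_| `|_| `|_| `|_| => x1 x2 x3 x4; lra.
    by rewrite RintegralZl// ler_wpM2l ?mulr_ge0.
  have nC x : D x -> `|C x| <= A x + B x.
    move=> xD; have := cs_normC cs xD; have := cs_A0 cs xD; have := cs_B0 cs xD; lra.
  have [iLA _] := cL2_linA hs j gL tD.
  case: k => /=; rewrite ?(leNgt c) ?tc/=.
    rewrite subr0; apply: (key _ A C) => //; first exact: itg_measurable iLA.
    by move=> x xD; rewrite gtr0_norm ?(cs_A0 cs)// lerDl ltW ?(cs_B0 cs).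
  rewrite addrAC subrr add0r normrN; apply: (key _ C B) => //.
    by apply: itg_measurable; exact: itg_seg iLB.
  by move=> x xD; rewrite gtr0_norm ?(cs_B0 cs)// lerDr ltW ?(cs_A0 cs).
have t0 : 0 <= t by case: tD.
(* This is where [kc] enters: the energy bound of [tail_energy] for [zmul a b u] becomes the square
   of half the size [M]. *)
have k4 : 2 * (N * M) ^+ 2 * kap c <= M ^+ 2 / 4.
  have := ler_wpM2l (sqr_ge0 M) kc; rewrite exprMn; lra.
have mS E (f : R -> R) : measurable E -> E `<=` D -> measurable_fun D f -> measurable_fun E f.
  by move=> mE ED; exact: measurable_funS.
have [mg ig] := gL.
case: k => /=; rewrite ?ct ?(ltNge t) ?ct/=.
  apply: half_sqrt => //; first exact: (AA_ge0 hs).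
  have [iLA _] := cL2_linA hs j gL tD.
  rewrite /alpha /= (Rintegral_seg_cat (ltW c0) ct iLA) addrAC subrr add0r.
  have ctc : `[c, t] `<=` tail T c.
    move=> x /=; rewrite in_itv/= => /andP[cx xt]; split=> //.
    by apply: hointerval_le tD _ xt; exact: le_trans (ltW c0) cx.
  have ctD : `[c, t] `<=` D by apply: subset_trans ctc _; exact: tail_sub.
  have [iA _ _] := cs_itg cs tD.
  have [_ h] := csA hs ctD (measurable_itv _) (mS _ _ (measurable_itv _) ctD (mg j false))
    (mS _ _ (measurable_itv _) ctD (mg j true)) (itg_seg_sub (ltW c0) (lexx t) iA)
    (itgS mD (measurable_itv _) ctD (ig j)).
  apply: le_trans h _; apply: ler_pM.
  - by apply: Rintegral_ge0 => x /ctD xD; exact/ltW/(cs_A0 cs).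
  - by apply: Rintegral_ge0 => x /ctD xD; exact: (qform_ge0 cs).
  - apply: Rintegral_ge0_subset => //.
      by move=> x /=; rewrite !in_itv/= => /andP[cx ->]; rewrite (le_trans (ltW c0)).
    by move=> x /=; rewrite in_itv/= => xt; exact/ltW/(cs_A0 cs)/(D_seg tD xt).
  - by apply: le_trans k4; apply: (tail_energy j gX NM gM ct).
apply: half_sqrt => //; first exact: (BB_ge0 hs).
rewrite subr0 (Rintegral_D_split tD iLB) addrAC subrr add0r.
have mt : measurable (tail T t) by exact: measurable_tail.
have ttD : tail T t `<=` D by exact: tail_sub.
have [_ h] := csB hs (hs_iB hs) ttD mt (mS _ _ mt ttD (mg j false)) (mS _ _ mt ttD (mg j true))
  (itg_tail t (ig j)).
apply: le_trans h _; apply: ler_pM => //.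
- by apply: Rintegral_ge0 => x /ttD xD; exact/ltW/(cs_B0 cs).
- by apply: Rintegral_ge0 => x /ttD xD; exact: (qform_ge0 cs).
- by apply: le_trans k4; apply: (tail_energy j gX NM gM ct) => //; exact: tailS.
Qed.

Let Xlin x u v : X u -> X v -> X (lincomb x u v).
Proof.
move=> [mu_ [M M0 uM]] [mv [M' M0' vM]]; split.
  by move=> j k; apply: measurable_funD => //; exact: measurable_funM.
exists (`|x| * M + M') => [|i]; first by rewrite addr_ge0 ?mulr_ge0.
rewrite /lincomb; apply: le_trans (ler_normD _ _) _; rewrite normrM mulrDl -mulrA.
by rewrite lerD// ler_wpM2l.
Qed.

Let alpha_lin x y u v : X u -> X v -> alpha x (lincomb y u v) = y * alpha x u + alpha x v.
Proof.
move=> uX vX; have uL := X_cL2 (zX uX); have vL := X_cL2 (zX vX).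
rewrite /alpha zmul_comb; case: ifP => _.
  exact: (int_linA_comb hs).
exact: (int_linB_comb hs).
Qed.

Let S_lin x u v : X u -> X v -> S (lincomb x u v) = lincomb x (S u) (S v).
Proof.
move=> uX vX; have uL := X_cL2 (zX uX); have vL := X_cL2 (zX vX).
apply/funext => -[[j k] t]; rewrite /S {3}/lincomb /S.
have [tD|ntD] := pselect (D t); last by rewrite memNset// mulr0 addr0.
rewrite mem_set// alpha_lin// zmul_comb.
have -> : Kop (lincomb x (zmul a b u) (zmul a b v)) (j, k, t) =
    x * Kop (zmul a b u) (j, k, t) + Kop (zmul a b v) (j, k, t).
  rewrite /Kop; case: k; first exact: (int_linA_comb hs).
  rewrite !(int_linB_comb hs)//; first ring.
  exact: hointerval_seg.
case: (if k then _ else _); ring.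
Qed.

Let Lam : R := (1 + \int[mu]_(t in D) B t + AA c) * (1 + 2 * N ^+ 2 * Gam).

Let alpha_bound x u M : X u -> 0 <= M -> bounded_by w M u -> `|alpha x u| <= Lam * M.
Proof.
move=> uX M0 uM; have gX := zX uX; have gL := X_cL2 gX.
have NM : 0 <= N * M by rewrite mulr_ge0// ltW.
have gM := z_bound M0 uM.
have iB0 : 0 <= \int[mu]_(t in D) B t.
  by apply: Rintegral_ge0 => t tD; exact/ltW/(cs_B0 cs).
have A0 := AA_ge0 hs cD.
have hE := X_energy x.1 gX NM gM.
have E0 := energy_ge0 hs (zmul a b u) x.1.
pose Y := 2 * N ^+ 2 * Gam.
have Y0 : 0 <= Y by rewrite mulr_ge0// mulr_ge0// sqr_ge0.
pose Z := \int[mu]_(t in D) B t + AA c.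
have Z0 : 0 <= Z by rewrite addr_ge0.
have {}hE : energy (zmul a b u) x.1 <= Y * M ^+ 2 by move: hE; rewrite /Y exprMn; lra.
have h : alpha x u ^+ 2 <= Z * (Y * M ^+ 2).
  rewrite /alpha; case: ifP => _.
    have [_ h] := cL2_linA hs x.1 gL cD; apply: le_trans (h _ (measurable_itv _) (@subset_refl _ _)) _.
    by apply: ler_pM => //; rewrite /Z lerDr.
  have [_ h] := cL2_linB hs x.1 gL; apply: le_trans (h _ mD (@subset_refl _ _)) _.
  by apply: ler_pM => //; rewrite /Z lerDl.
have L0 : 0 <= Lam by rewrite /Lam -addrA -/Z -/Y mulr_ge0// addr_ge0.
rewrite -ler_sqr ?nnegrE ?(mulr_ge0 L0)//.
rewrite real_normK ?num_real//; apply: le_trans h _.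
rewrite /Lam -addrA -/Z -/Y exprMn mulrA ler_wpM2r ?sqr_ge0// exprMn.
apply: ler_pM => //; rewrite expr2.
  by have := mulr_ge0 Z0 Z0; move: (Z) Z0 => z z0; lra.
by have := mulr_ge0 Y0 Y0; move: (Y) Y0 => z z0; lra.
Qed.

Let AAc_gt0 : 0 < AA c.
Proof.
have [iA _ _] := cs_itg cs cD.
by apply: (seg_gt0 iA) => // x xc; apply: (cs_A0 cs); exact: D_seg xc.
Qed.

(** A constant in the first component is split off only before [c], where the weight is at least 1,
    since [Num.sqrt (BB t)] could not dominate it near [T]. In the second component the weight
    beyond [c] is at least [Num.sqrt (AA c) > 0]. *)
Let fr_X x : X (fr x).
Proof.
split.
  move=> j k.
  apply: (@eq_measurable_fun _ _ _ _ _ (fun t : R => if (if k then c <= t else t < c)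
     then ((j == x.1) && (k == x.2))%:R else 0 : R)).
    move=> t tD; rewrite /fr tD/=; case: (j == x.1); case: (k == x.2) => //=; by case: ifP.
  by apply: measurable_ifD => //; exact: measurable_cond.
have s0 : 0 < Num.sqrt (AA c) by rewrite sqrtr_gt0.
exists (1 + (Num.sqrt (AA c))^-1) => [|[[j k] t]].
  by rewrite addr_ge0// invr_ge0 ltW.
rewrite /fr; case: ifP => [|_]; last first.
  by rewrite normr0 mulr_ge0 ?w_ge0// addr_ge0// invr_ge0 ltW.
move=> /andP[/andP[/andP[/set_mem tD _] _]]; rewrite normr1 wE//.
have i0 : 0 <= (Num.sqrt (AA c))^-1 by rewrite invr_ge0 ltW.
case: k => [ct|tc].
  rewrite ltNge ct/=.
  have st : Num.sqrt (AA c) <= Num.sqrt (AA t).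
    by apply: ler_wsqrtr; apply: (AA_le hs) => //; exact: ltW.
  apply: (@le_trans _ _ ((Num.sqrt (AA c))^-1 * Num.sqrt (AA t))).
    by rewrite mulrC ler_pdivlMr// mul1r.
  by rewrite ler_wpM2r ?sqrtr_ge0// lerDr.
rewrite tc -[leLHS]mul1r; apply: ler_pM => //; last exact: e_ge1.
by rewrite lerDl.
Qed.

(** By [Kop_bound], [Kop h] has weighted size at most a constant times the square root of the energy
    of [h]; the alternative in the sup norm therefore returns a bound between energies. *)
Lemma weighted_fredholm :
  (forall u, cL2fun u -> (forall j k t, D t -> u (j, k, t) = Kop (zmul a b u) (j, k, t)) ->
    forall j k t, D t -> u (j, k, t) = 0) ->
  exists2 K, 0 <= K & forall h, cL2fun h -> exists u, [/\ cL2fun u,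
    forall j k t, D t -> u (j, k, t) = Kop h (j, k, t) + Kop (zmul a b u) (j, k, t) &
    forall j, energy u j <= K * (energy h false + energy h true)].
Proof.
move=> inj.
pose n := #|{: bool * bool}|.
have sumE u i : \sum_(m < n) alpha (enum_val m) u * fr (enum_val m) i =
    \sum_(x : bool * bool) alpha x u * fr x i.
  by rewrite (big_enum_val (fun x => alpha x u * fr x i)).
have Xcl (u : nat -> I -> R) v M : (forall n, X (u n)) ->
    (forall n i, `|u n i - u 0%N i| <= M * w i) ->
    (forall i, u n i @[n --> \oo] --> v i) -> X v.
  move=> uX uM uv; split.
    by move=> j k; apply: (measurable_fun_cvg (fun n => (uX n).1 j k)) => t _; exact: uv.
  have [_ [M0 M00 hM0]] := uX 0%N.
  exists (`|M| + M0) => [|i]; first by rewrite addr_ge0.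
  have hn : `|u n i| @[n --> \oo] --> `|v i| by apply: cvg_norm; exact: uv.
  apply: (ler_cvg_to hn (cvg_cst _)); apply: nearW => m.
  rewrite -(subrK (u 0%N i) (u m i)); apply: le_trans (ler_normD _ _) _; rewrite mulrDl.
  by apply: lerD => //; apply: le_trans (uM m i) _; rewrite ler_wpM2r// ler_norm.
have SX u : X u -> X (S u).
  move=> uX; split; first by move=> j k; exact: S_measurable.
  have [_ [M M0 uM]] := uX; exists (1 / 2 * M); first by rewrite mulr_ge0.
  exact: S_bound.
have X0 : X (fun=> 0).
  split; first by move=> j k; exact: measurable_cst.
  by exists 0 => // i; rewrite normr0 mul0r.
have Xbd u : X u -> exists2 M, 0 <= M & bounded_by w M u by case.
have Lam0 : 0 <= Lam.
  have iB0 : 0 <= \int[mu]_(t in D) B t.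
    by apply: Rintegral_ge0 => t tD; exact/ltW/(cs_B0 cs).
  apply: mulr_ge0; rewrite addr_ge0 ?(AA_ge0 hs) ?addr_ge0//.
  by rewrite mulr_ge0// mulr_ge0// sqr_ge0.
have r0 : 0 <= 1 / 2 :> R by lra.
have r1 : 1 / 2 < 1 :> R by lra.
have [|K K0 hK] := @fredholm R I w X S n (fun m => alpha (enum_val m)) (fun m => fr (enum_val m))
  (1 / 2) Lam w_ge0 r0 r1 Lam0 X0 Xlin Xbd Xcl SX S_lin S_bound (fun m => fr_X (enum_val m))
  (fun m => @alpha_lin (enum_val m)) (fun m => @alpha_bound (enum_val m)).
  move=> u uX uE [[j k] t]; have [tD|ntD] := pselect (D t); last first.
    rewrite uE sumE /S memNset// add0r big1// => x _.
    by rewrite /fr memNset//= mulr0.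
  apply: (inj u (X_cL2 uX)) => // {j k tD}j k {}t tD.
  by rewrite uE sumE S_sum.
pose cst := (1 + Num.sqrt (BB 0) + Num.sqrt (AA c)) ^+ 2.
exists (2 * K ^+ 2 * cst * Gam); first by rewrite !mulr_ge0 ?sqr_ge0.
move=> h hL; have [mh ih] := hL.
pose E := energy h false + energy h true.
have E0 : 0 <= E by rewrite addr_ge0 ?(energy_ge0 hs).
pose k (i : I) := if i.2 \in D then Kop h i else 0.
pose s := 1 + Num.sqrt (BB 0) + Num.sqrt (AA c).
have s1 := sqrtr_ge0 (BB 0); have s2 := sqrtr_ge0 (AA c).
have s0 : 0 <= s by rewrite /s; lra.
pose M := s * Num.sqrt E.
have M0 : 0 <= M by rewrite mulr_ge0 ?sqrtr_ge0.
have kM : bounded_by w M k.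
  move=> [[j kk] t]; have [tD|ntD] := pselect (D t); last first.
    by rewrite /k memNset// normr0 mulr_ge0 ?w_ge0.
  rewrite wE// (_ : k _ = Kop h (j, kk, t)); last by rewrite /k mem_set.
  have Ej : energy h j <= E.
    by rewrite /E; case: j; rewrite ?lerDl ?lerDr (energy_ge0 hs).
  have [h1 h2] := Kop_bound hs j hL tD.
  have t0 : 0 <= t by case: tD.
  have sq x y : 0 <= y -> x ^+ 2 <= y * energy h j -> `|x| <= Num.sqrt y * Num.sqrt E.
    move=> y0 xy; rewrite -ler_sqr ?nnegrE ?mulr_ge0 ?sqrtr_ge0//.
    rewrite real_normK ?num_real// exprMn !sqr_sqrtr//.
    by apply: le_trans xy _; rewrite ler_wpM2l.
  have hx : `|Kop h (j, kk, t)| <= (if kk then Num.sqrt (AA t) else Num.sqrt (BB t)) * Num.sqrt E.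
    case: kk; first by apply: sq h2; exact: (AA_ge0 hs).
    by apply: sq h1; exact: (BB_ge0 hs).
  apply: le_trans hx _; rewrite /M mulrAC ler_wpM2r ?sqrtr_ge0//.
  have [tc|ct] := ltP t c.
    rewrite -[leLHS]mulr1; apply: ler_pM; [by case: kk; rewrite sqrtr_ge0| by []| |exact: e_ge1].
    case: kk.
      apply: (@le_trans _ _ (Num.sqrt (AA c))); last by rewrite /s; lra.
      by apply: ler_wsqrtr; apply: (AA_le hs) => //; exact: ltW.
    apply: (@le_trans _ _ (Num.sqrt (BB 0))); last by rewrite /s; lra.
    apply: ler_wsqrtr; apply: Rintegral_ge0_subset; [exact: measurable_tail|exact: measurable_tail| | |].
    - exact: tailS.
    - by apply: itg_tail; exact: (hs_iB hs).
    - by move=> x [xD _]; exact/ltW/(cs_B0 cs).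
  case: kk; rewrite -[leLHS]mul1r ler_wpM2r ?sqrtr_ge0//; rewrite /s; lra.
have kX : X k.
  split; last by exists M.
  move=> j kk; apply: eq_measurable_fun (Kop_measurable hs j kk hL).
  by move=> t tD; rewrite /k /= tD.
have [u [uX uE uM]] := hK k M kX M0 kM.
exists u; split; first exact: X_cL2.
  move=> j kk t tD; rewrite uE sumE -addrA S_sum// /k /= mem_set//.
move=> j; apply: le_trans (X_energy j uX (mulr_ge0 K0 M0) uM) _.
rewrite -/E /M !exprMn sqr_sqrtr// /cst -/s le_eqVlt; apply/orP; left; apply/eqP; ring.
Qed.

End Resolvent.

(** * Counting visits and eigenvalues *)

Section CountingImages.
Context {R : realType} {U : choiceType}.

Lemma counting_image (e : nat -> U) n (S : set U) :
  (forall i j, (i < n)%N -> (j < n)%N -> e i = e j -> i = j) ->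
  S = e @` `I_n -> counting S = (n%:R : R)%:E.
Proof.
move=> inj SE.
have cS : (S #= `I_n)%card.
  rewrite SE; apply: inj_card_eq => i j /set_mem ni /set_mem nj; exact: inj.
rewrite /counting asboolT; last by apply/finite_setP; exists n.
by rewrite (card_fset_set cS).
Qed.

(** The bijection is given as a relation, because visits and eigenvalues are tied to levels by a
    property rather than by a function. *)
Lemma counting_bij (s0 : U) n (S : set U) (f : U -> nat -> Prop) :
  (forall s, S s -> exists2 i, (i < n)%N & f s i) ->
  (forall i, (i < n)%N -> exists2 s, S s & f s i) ->
  (forall s i j, f s i -> f s j -> i = j) ->
  (forall s t i, S s -> S t -> f s i -> f t i -> s = t) ->
  counting S = (n%:R : R)%:E.
Proof.
move=> hS hn fun_ inj.
have /choice[e he] : forall i, exists s, (i < n)%N -> S s /\ f s i.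
  move=> i; have [ni|ni] := ltnP i n; last by exists s0.
  by have [s Ss fs] := hn i ni; exists s.
apply: (@counting_image e).
  move=> i j ni nj E; have [_ fi] := he i ni; have [_ fj] := he j nj.
  by rewrite E in fi; exact: fun_ fi fj.
apply/seteqP; split=> [s Ss|_ [i ni <-]]; last by have [] := he i ni.
have [i ni fs] := hS s Ss; exists i => //.
by have [Si fi] := he i ni; exact: inj fi fs.
Qed.

End CountingImages.

Section PositiveCount.
Context {R : realType}.
Context {T : \bar R} {A B C : R -> R} (hs : hs_system T A B C).
Let cs : canonical_system T A B C := hs.
Local Notation D := (hointerval T).

(** Phrased through normalised solutions instead of angles, which makes the reflection of [C] and
    [l] visible and the comparison with the carousel independent of the frame. *)
Definition hits (A' B' C' : R -> R) (l : R) : set R := [set t | D t /\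
  exists p q, [/\ solution T A' B' C' l p q, p 0 = 1, q 0 = 0 & p t = 0]].

(* Numbers of levels reached: [k l] counts the hits of parameter [l], and [N l] is the
   right limit of [k] at [l]. *)
Lemma positive_count : exists (k N : R -> nat) (jmp : R -> nat -> Prop),
  [/\ forall l, 0 < l -> counting (hits A B C l) = ((k l)%:R : R)%:E,
      forall l, 0 <= l -> exists2 m0, l < m0 & forall m, l < m -> m < m0 -> k m = N l,
      forall l, 0 < l -> exists2 m0, 0 < m0 < l & forall m, m0 < m -> m < l -> k m = k l,
      N 0 = 0%N &
      [/\ forall l n m, jmp l n -> jmp l m -> n = m,
          forall l m n, jmp l n -> jmp m n -> l = m,
          forall l, 0 < l -> (@eigenvalue R T A B C l <-> exists n, jmp l n),
          forall l n, jmp l n -> [/\ 0 < l, forall a, 0 < a -> (n < k a)%N = (l < a) &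
             forall a, 0 <= a -> (n < N a)%N = (l <= a)] &
          (forall a n, 0 < a -> (n < k a)%N -> exists l, jmp l n) /\
          (forall a n, 0 <= a -> (n < N a)%N -> exists l, jmp l n)]].
Proof.
have /choice[th hth] : forall l, exists th, angle T A B C 0 l th.
  by move=> l; exact: angle_exists cs 0 l.
pose rc := @reach R T th.
have minP (P : nat -> Prop) : (forall n m, (n <= m)%N -> P m -> P n) -> (exists n, ~ P n) ->
    exists K, forall n, P n <-> (n < K)%N.
  move=> dec [n0 hn0].
  have ex : exists n, `[< ~ P n >] by exists n0; exact/asboolP.
  exists (ex_minn ex); case: ex_minnP => K /asboolP nK hK n; split.
    by move=> Pn; rewrite ltnNge; apply/negP => Kn; apply: nK; exact: dec Pn.
  move=> nK'; apply: contrapT => nP.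
  by have := hK n (asboolT nP); rewrite leqNgt nK'.
have /choice[k hk] : forall l, exists K, 0 < l -> forall n, rc l n <-> (n < K)%N.
  move=> l; have [l0|l0] := ltP 0 l; last by exists 0%N.
  have [K hK] := minP (rc l) (fun n m nm => reachS hth nm) (not_reach_ex hs hth l0).
  by exists K.
have /choice[N hN] : forall l, exists K, 0 <= l -> forall n, (forall m, l < m -> rc m n) <-> (n < K)%N.
  move=> l; have [l0|l0] := leP 0 l; last by exists 0%N.
  have [||K hK] := minP (fun n => forall m, l < m -> rc m n); last by exists K.
    by move=> n m nm H x lx; exact: (reachS hth nm (H x lx)).
  have l1 : 0 < l + 1 by rewrite ltr_wpDl.
  have [n hn] := not_reach_ex hs hth l1; exists n => H; apply: hn; apply: H.
  by rewrite ltrDl.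
pose jmp l n := @jump R T th l n.
have jk l n : jmp l n -> forall a, 0 < a -> (n < k a)%N = (l < a).
  move=> [l0 nr rn] a a0; apply/idP/idP.
    move=> /(hk a a0 n) ra; rewrite ltNge; apply/negP; rewrite le_eqVlt => /predU1P[E|al].
      by apply: nr; rewrite -E.
    by apply: nr; exact: (reach_le hs hth al ra).
  by move=> la; apply/(hk a a0 n); exact: rn.
have jN l n : jmp l n -> forall a, 0 <= a -> (n < N a)%N = (l <= a).
  move=> [l0 nr rn] a a0; apply/idP/idP.
    move=> /(hN a a0 n) ra; rewrite leNgt; apply/negP => al.
    exact/nr/ra.
  by move=> la; apply/(hN a a0 n) => m am; apply: rn; exact: le_lt_trans am.
have jex a n : 0 < a -> (n < k a)%N -> exists l, jmp l n.
  move=> a0 /(hk a a0 n) ra; have [l _ jl] := jump_exists hs hth a0 ra; by exists l.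
have jexN a n : 0 <= a -> (n < N a)%N -> exists l, jmp l n.
  move=> a0 /(hN a a0 n) ra; have a1 : 0 < a + 1 by rewrite ltr_wpDl.
  apply: (jex (a + 1)) => //; apply/(hk _ a1 n); apply: ra; by rewrite ltrDl.
exists k, N, jmp; split.
- move=> l l0; have l00 : l != 0 by rewrite gt_eqF.
  apply: (counting_bij 0 (f := fun t n => th l t = level n)).
  + move=> t [tD [p [q [sol p0 q0 pt]]]].
    have [_ pz] := nontrivial hs hth sol p0 q0.
    have t0 : 0 <= t by case: tD.
    have thp : 0 <= th l t.
      rewrite -(th0 hth l); move: t0; rewrite le_eqVlt => /predU1P[<-//|t0].
      by apply: ltW; exact: (angle_increasing cs l0 (hth l)).
    have [n En] := cos_eq0_level thp ((pz t tD).1 pt).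
    by exists n => //; apply/(hk l l0 n); exists t.
  + move=> n /(hk l l0 n)[t tD E]; exists t => //; split=> //.
    have [p [q [rho [sol p0 q0 _ _]]]] := polar hs hth l.
    have [_ pz] := nontrivial hs hth sol p0 q0.
    by exists p, q; split=> //; apply/pz => //; rewrite E cos_level.
  + move=> t i j -> E; have [ij|ji|//] := ltngtP i j.
      by have := level_lt ij (R := R); rewrite E ltxx.
    by have := level_lt ji (R := R); rewrite E ltxx.
  + move=> s t i [sD _] [tD _] E1 E2; have [st|ts|//] := ltgtP s t.
      have := angle_increasing cs l0 (hth l) _ st tD; rewrite E1 E2 ltxx.
      by case: sD => s0 _ /(_ s0).
    have := angle_increasing cs l0 (hth l) _ ts sD; rewrite E1 E2 ltxx.
    by case: tD => t0 _ /(_ t0).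
- move=> l l0.
  have [m0 lm0 nm0] : exists2 m0, l < m0 & ~ rc m0 (N l).
    apply: contrapT => H; have := ltnn (N l) => /negP; apply.
    apply/(hN l l0 (N l)) => m lm; apply: contrapT => nr; apply: H; by exists m.
  exists m0 => // m lm mm0.
  have mp : 0 < m by exact: le_lt_trans lm.
  apply/eqP; rewrite eqn_leq; apply/andP; split.
    rewrite leqNgt; apply/negP => /(hk m mp (N l)) r; apply: nm0.
    exact: (reach_le hs hth mm0 r).
  rewrite leqNgt; apply/negP => h.
  have := ltnn (k m) => /negP; apply; apply/(hk m mp (k m)).
  by apply: ((hN l l0 (k m)).2 h).
- move=> l l0.
  have mono m : 0 < m -> m < l -> (k m <= k l)%N.
    move=> mp ml; rewrite leqNgt; apply/negP => /(hk m mp (k l)) r.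
    have := ltnn (k l) => /negP; apply; apply/(hk l l0 (k l)).
    exact: (reach_le hs hth ml r).
  case E : (k l) => [|n].
    exists (l / 2); first by apply/andP; split; lra.
    move=> m m1 m2; apply/eqP; rewrite -leqn0 -E; apply: mono => //.
    by apply: lt_trans m1; rewrite divr_gt0.
  have rn : rc l n by apply/(hk l l0 n); rewrite E.
  have [m0 /andP[m00 m0l] rm] := reach_open hs hth l0 rn.
  exists m0; first by rewrite m00.
  move=> m m1 m2; have mp := lt_trans m00 m1.
  apply/eqP; rewrite eqn_leq -{1}E mono//=.
  apply/(hk m mp n); exact: (reach_le hs hth m1 rm).
- apply/eqP; rewrite -leqn0 leqNgt; apply/negP => h.
  have [l1 l10 hl1] := no_reach_small hs hth.
  by apply: (hl1 l1 0%N l10 (lexx l1)); apply: ((hN 0 (lexx 0) 0%N).2 h).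
split=> //.
- by move=> l n m; exact: (jump_unique hs hth).
- move=> l m n j1 j2; have [lm|ml|//] := ltgtP l m.
    by have [_ nr _] := j2; exfalso; apply: nr; case: j1 => _ _; apply.
  by have [_ nr _] := j1; exfalso; apply: nr; case: j2 => _ _; apply.
- move=> l l0; split; first exact: (eigenvalue_jump hs hth l0).
  by move=> [n jn]; exact: (jump_eigenvalue hs hth jn).
- by move=> l n jn; split; [case: jn|exact: jk|exact: jN].
Qed.

End PositiveCount.

Section Reflection.
Context {R : realType} {T : \bar R} {A B C : R -> R}.
Notation mu := (@lebesgue_measure R).

Lemma hs_system_opp : hs_system T A B C -> hs_system T A B (fun t => - C t).
Proof.
move=> [[T0 mA mB mC A0 B0 C2 bd] iB iH]; split=> //; split=> //.
- exact: measurableT_comp.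
- by move=> t tD; rewrite sqrrN; exact: C2.
Qed.

Lemma solution_opp l p q : solution T A B C l p q ->
  solution T A B (fun t => - C t) (- l) p (fun t => - q t).
Proof.
move=> sol b bD; have [dp dq] := sol b bD; split.
  by apply: acd_eq dp _ => t _; ring.
by apply: acd_eq (acdN dq) _ => t _; ring.
Qed.

Lemma eigenvalue_opp l : @eigenvalue R T A B C l -> @eigenvalue R T A B (fun t => - C t) (- l).
Proof.
move=> [p [q [[sol iQ vp] p0 q0]]]; exists p, (fun t => - q t); split=> //; last by rewrite q0 oppr0.
split=> //; first exact: solution_opp.
apply: itg_eq iQ => [|t _]; first exact: measurable_hointerval.
by rewrite /qform; ring.
Qed.

End Reflection.

Section Counting.
Context {R : realType}.
Context {T : \bar R} {A B C : R -> R} (hs : hs_system T A B C).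
Let nC := fun t => - C t.

Let nCK : (fun t => - nC t) = C.
Proof. by apply/funext => t; rewrite opprK. Qed.

Let eigen_oppE l : @eigenvalue R T A B nC (- l) <-> @eigenvalue R T A B C l.
Proof.
split=> [h|]; last exact: eigenvalue_opp.
by have := eigenvalue_opp h; rewrite opprK -/nC nCK.
Qed.

Let hits_oppE l : hits (T := T) A B nC (- l) = hits (T := T) A B C l.
Proof.
apply/seteqP; split=> t [tD [p [q [sol p0 q0 pt]]]]; split=> //; exists p, (fun t => - q t).
  by split=> //; [have := solution_opp sol; rewrite opprK -/nC nCK|rewrite q0 oppr0].
by split=> //; [exact: solution_opp|rewrite q0 oppr0].
Qed.

(** For [l = 0] the first component is constantly 1. *)
Lemma eigenvalue0F : ~ @eigenvalue R T A B C 0.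
Proof.
move=> [p [q [[sol _ vp] p0 q0]]].
have [b bD hb] := vp (1 / 2) ltac:(lra).
have b0 : 0 <= b by case: bD.
have [dp _] := sol b bD.
have := acd_eq0_cst (s := b) (t := 0) dp.
have z : {ae lebesgue_measure, forall t, 0 <= t <= b -> - 0 * (C t * p t + B t * q t) = 0}.
  by apply: aeW => t _; rewrite oppr0 mul0r.
move=> /(_ z); rewrite !lexx b0 => /(_ isT isT); rewrite p0 => E.
by have := hb b bD (lexx b); rewrite E normr1; lra.
Qed.

Lemma eigenvalue_counting : exists N : R -> R,
  (forall l, ((Num.sg m)%:E * counting (hits (T := T) A B C m))%E @[m --> l^'+] --> (N l)%:E) /\
  forall a b, a < b ->
    counting ([set l | @eigenvalue R T A B C l] `&` `]a, b]%classic) = (N b - N a)%:E.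
Proof.
have [k [N [jmp [hk hN hl N0 [jf ji je jc [jex jexN]]]]]] := positive_count hs.
have [k' [N' [jmp' [hk' hN' hl' N0' [jf' ji' je' jc' [jex' jexN']]]]]] :=
  positive_count (hs_system_opp hs).
rewrite -/nC in hk' hl' hN' N0' jf' ji' je' jc' jex' jexN'.
(* The two signs differ: a right limit at [l < 0] is a left limit at [- l] for the reflected system,
   where [k'] is left-continuous. Hence [k'] appears there instead of [N']. *)
pose Nf (l : R) : R := if 0 <= l then (N l)%:R else - (k' (- l))%:R.
exists Nf; split.
  move=> l; rewrite /Nf; have [l0|l0] := leP 0 l.
    have [m0 lm0 h] := hN l l0.
    apply: cvg_near_cst; near=> m.
    have lm : l < m by near: m; exact: nbhs_right_gt.
    have mm0 : m < m0 by near: m; exact: nbhs_right_lt.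
    have mp : 0 < m by exact: le_lt_trans lm.
    by rewrite gtr0_sg// mul1e hk// h.
  have nl0 : 0 < - l by rewrite oppr_gt0.
  have [m0 /andP[m00 m0l] h] := hl' (- l) nl0.
  apply: cvg_near_cst; near=> m.
  have lm : l < m by near: m; exact: nbhs_right_gt.
  have mm0 : m < - m0 by near: m; apply: nbhs_right_lt; lra.
  have mn : m < 0 by lra.
  rewrite ltr0_sg// -hits_oppE hk' ?oppr_gt0// h; [|lra|lra].
  by rewrite -EFinM mulN1r.
move=> a b ab; rewrite /Nf.
have pos (l : R) : @eigenvalue R T A B C l -> 0 <= l -> exists n, jmp l n.
  move=> el; rewrite le_eqVlt => /predU1P[E|l0]; last exact/(je l l0).
  by exfalso; apply: eigenvalue0F; rewrite E.
have neg (l : R) : @eigenvalue R T A B C l -> l < 0 -> exists n, jmp' (- l) n.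
  by move=> el l0; apply/(je' (- l)); [rewrite oppr_gt0|apply/eigen_oppE].
have jev l n : jmp l n -> @eigenvalue R T A B C l.
  by move=> jn; have [l0 _ _] := jc l n jn; apply/(je l l0); exists n.
have jev' l n : jmp' l n -> @eigenvalue R T A B C (- l).
  move=> jn; have [l0 _ _] := jc' l n jn; apply/eigen_oppE; rewrite opprK.
  by apply/(je' l l0); exists n.
have [b0|b0] := leP 0 b; have [a0|a0] := leP 0 a.
- have Nab : (N a <= N b)%N.
    rewrite leqNgt; apply/negP => h; have [l jl] := jexN a (N b) a0 h.
    have [_ _ hl2] := jc l _ jl; have := hl2 a a0; have := hl2 b b0; rewrite h ltnn.
    by move=> /esym /negbT; rewrite -ltNge => h1 /esym h2; have := lt_trans (le_lt_trans h2 ab) h1; rewrite ltxx.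
  rewrite -natrB//.
  apply: (counting_bij 0 (f := fun l n => jmp l (n + N a)%N)).
  + move=> l [el]; rewrite /= in_itv/= => /andP[al lb].
    have [n jn] := pos l el (le_trans a0 (ltW al)).
    have [_ _ h] := jc l n jn; have := h a a0; have := h b b0.
    rewrite lb leNgt al /= => h1 /negbT; rewrite -leqNgt => h2.
    exists (n - N a)%N; last by rewrite subnK.
    by rewrite ltn_sub2rE.
  + move=> i; rewrite ltn_subRL addnC => h; have [l jl] := jexN b _ b0 h.
    exists l => //; split; first exact: jev jl.
    have [_ _ h2] := jc l _ jl; have := h2 b b0; have := h2 a a0.
    rewrite h ltnNge leq_addl /= in_itv/= => /esym/negbT; rewrite -ltNge => -> /esym ->//.
  + by move=> l i j h1 h2; apply/eqP; rewrite -(eqn_add2r (N a)); apply/eqP; exact: jf h1 h2.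
  + by move=> l m i _ _; exact: ji.
- pose K := k' (- a).
  have na : 0 < - a by rewrite oppr_gt0.
  rewrite opprK -natrD.
  (* The first [N b] indices enumerate the eigenvalues in []0, b]], the following [K] ones those in
     []a, 0[]; 0 itself is not an eigenvalue. *)
  apply: (counting_bij 0 (f := fun l n => if (n < N b)%N then jmp l n else jmp' (- l) (n - N b)%N)).
  + move=> l [el]; rewrite /= in_itv/= => /andP[al lb].
    have [l0|l0] := leP 0 l.
      have [n jn] := pos l el l0; have [_ _ h] := jc l n jn; have := h b b0; rewrite lb => nb.
      by exists n; rewrite ?nb// (leq_trans nb)// leq_addr.
    have [n jn] := neg l el l0; have [_ h _] := jc' _ n jn; have := h _ na; rewrite ltrN2 al => nk.
    exists (N b + n)%N; first by rewrite ltn_add2l.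
    by rewrite ltnNge leq_addr/= addKn.
  + move=> i ik; have [ib|bi] := ltnP i (N b).
      have [l jl] := jexN b _ b0 ib; exists l => //; split; first exact: jev jl.
      have [l0 _ h] := jc l _ jl; have := h b b0; rewrite ib /= in_itv/= => <-.
      by rewrite (lt_trans a0 l0).
    have ik' : (i - N b < k' (- a))%N by rewrite ltn_subLR.
    have [l jl] := jex' _ _ na ik'; exists (- l); last by rewrite opprK.
    split; first exact: jev' jl.
    have [l0 h _] := jc' l _ jl; have := h _ na; rewrite ik' /= in_itv/= => /esym la.
    by rewrite ltrNr la /= (le_trans _ b0)// oppr_le0 ltW.
  + move=> l i j; case: ltnP => ib; case: ltnP => jb.
    * exact: jf.
    * move=> h1 h2; have [l1 _ _] := jc _ _ h1; have [l2 _ _] := jc' _ _ h2.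
      by move: l2; rewrite oppr_gt0 ltNge ltW.
    * move=> h1 h2; have [l1 _ _] := jc' _ _ h1; have [l2 _ _] := jc _ _ h2.
      by move: l1; rewrite oppr_gt0 ltNge ltW.
    * move=> h1 h2; have := jf' _ _ _ h1 h2 => E.
      by rewrite -(subnK ib) -(subnK jb) E.
  + move=> l m i _ _; case: ltnP => _; first exact: ji.
    by move=> h1 h2; have := ji' _ _ _ h1 h2 => /oppr_inj.
- by have := lt_le_trans (lt_le_trans b0 a0) (ltW ab); rewrite ltxx.
- have na : 0 < - a by rewrite oppr_gt0. have nb : 0 < - b by rewrite oppr_gt0.
  have kab : (k' (- b) <= k' (- a))%N.
    rewrite leqNgt; apply/negP => h; have [l jl] := jex' _ _ nb h.
    have [_ h1 _] := jc' l _ jl; have := h1 _ nb; have := h1 _ na; rewrite h ltnn.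
    move=> /esym/negbT; rewrite -leNgt => h2 /esym h3.
    by have := le_lt_trans h2 h3; rewrite ltrN2 ltNge ltW.
  rewrite opprK addrC -natrB//.
  apply: (counting_bij 0 (f := fun l n => jmp' (- l) (n + k' (- b))%N)).
  + move=> l [el]; rewrite /= in_itv/= => /andP[al lb].
    have [n jn] := neg l el (le_lt_trans lb b0).
    have [_ h _] := jc' _ n jn; have := h _ na; have := h _ nb.
    rewrite !ltrN2 al ltNge lb /= => /negbT; rewrite -leqNgt => h1 h2.
    exists (n - k' (- b))%N; last by rewrite subnK.
    by rewrite ltn_sub2rE.
  + move=> i; rewrite ltn_subRL addnC => h; have [l jl] := jex' _ _ na h.
    exists (- l); last by rewrite opprK.
    split; first exact: jev' jl.
    have [_ h2 _] := jc' l _ jl; have := h2 _ na; have := h2 _ nb.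
    rewrite h ltnNge leq_addl /= in_itv/= => /esym/negbT; rewrite -leNgt => h3 /esym h4.
    by rewrite ltrNr h4 /= lerNl.
  + by move=> l i j h1 h2; apply/eqP; rewrite -(eqn_add2r (k' (- b))); apply/eqP; exact: jf' h1 h2.
  + by move=> l m i _ _ h1 h2; have := ji' _ _ _ h1 h2 => /oppr_inj.
Unshelve. all: by end_near. Qed.

End Counting.

(** * Solving the resolvent equation away from the eigenvalues *)

Section ResolventSet.
Context {R : realType}.
Notation mu := (@lebesgue_measure R).
Local Notation itg D f := (mu.-integrable D (EFin \o (f : R -> R))).
Context {T : \bar R} {A B C : R -> R} (hs : hs_system T A B C).
Let cs : canonical_system T A B C := hs.
Local Notation D := (hointerval T).
Local Notation Q := (qform A B C).
Local Notation AA := (headint A).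
Local Notation BB := (tailint T B).
Local Notation kap := (@kap R T A B).
Local Notation I := (bool * bool * R)%type.
Local Notation linA := (@linA R A C).
Local Notation linB := (@linB R B C).
Local Notation Kop := (@Kop R T A B C).
Local Notation energy := (@energy R T A B C).
Local Notation cL2fun := (@cL2fun R T A B C).
Implicit Types (u v g h : I -> R).

Lemma Kop_0 u j : Kop u (j, true, 0) = 0.
Proof. by rewrite /Kop set_itv1 Rintegral_set1. Qed.

Lemma Kop_vanishes u j : cL2fun u -> vanishes_at_end T (fun t => Kop u (j, false, t)).
Proof.
move=> uL e e0.
have e1 : 0 < e ^+ 2 / (energy u j + 1) by rewrite divr_gt0 ?exprn_gt0// ltr_wpDl ?(energy_ge0 hs).
have [b bD hb] := kap_small hs e1; exists b => // t tD bt.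
have [_ h] := hb t tD bt; have [h1 _] := Kop_bound hs j uL tD.
rewrite -ler_sqr ?nnegrE//; last exact: ltW.
rewrite real_normK ?num_real//; apply: le_trans h1 _.
have E0 := energy_ge0 hs u j.
apply: (@le_trans _ _ (e ^+ 2 / (energy u j + 1) * energy u j)); first by rewrite ler_wpM2r.
by rewrite mulrAC ler_pdivrMr ?ltr_wpDl// ler_wpM2l ?sqr_ge0// lerDl.
Qed.

Lemma Kop_comb a u v j k t : D t -> cL2fun u -> cL2fun v ->
  Kop (lincomb a u v) (j, k, t) = a * Kop u (j, k, t) + Kop v (j, k, t).
Proof.
move=> tD uL vL; have mD := @measurable_hointerval R T.
case: k; first by rewrite /Kop (int_linA_comb hs).
rewrite !(Kop_tail hs)//; last exact: cL2_comb.
by rewrite (int_linB_comb hs)//; [exact: measurable_tail|exact: tail_sub].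
Qed.

Lemma Kop_energy0 u j k t : cL2fun u -> energy u j = 0 -> D t -> Kop u (j, k, t) = 0.
Proof.
move=> uL E0 tD; have [] := Kop_bound hs j uL tD; rewrite E0 !mulr0 => h1 h2.
have z (x : R) : x ^+ 2 <= 0 -> x = 0.
  by move=> h; apply/eqP; rewrite -sqrf_eq0 eq_le h sqr_ge0.
by case: k; exact: z.
Qed.

(* Wronskian of the real and the imaginary part: its derivative is [b] times the
   energy density, and it vanishes at both ends. *)
Let wronskian u t := Kop u (false, false, t) * Kop u (true, true, t) -
  Kop u (false, true, t) * Kop u (true, false, t).

Let wronskian_vanishes u : cL2fun u -> vanishes_at_end T (wronskian u).
Proof.
move=> uL e e0.
pose M := energy u false * energy u true.
have M0 : 0 <= M by rewrite mulr_ge0// (energy_ge0 hs).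
have e1 : 0 < (e / 2) ^+ 2 / (M + 1) by rewrite divr_gt0 ?exprn_gt0 ?divr_gt0// ltr_wpDl.
have [b bD hb] := kap_small hs e1; exists b => // t tD bt.
have [h _] := hb t tD bt; have hk := le_trans (AB_le_kap hs tD) h.
have [f1 f2] := Kop_bound hs false uL tD; have [t1 t2] := Kop_bound hs true uL tD.
have pr (x y : R) : x ^+ 2 * y ^+ 2 <= (AA t * BB t) * M -> `|x * y| <= e / 2.
  move=> xy; rewrite -ler_sqr ?nnegrE//; last by rewrite divr_ge0// ltW.
  rewrite real_normK ?num_real// exprMn; apply: le_trans xy _.
  apply: (@le_trans _ _ ((e / 2) ^+ 2 / (M + 1) * M)); first by rewrite ler_wpM2r.
  by rewrite mulrAC ler_pdivrMr ?ltr_wpDl// ler_wpM2l ?sqr_ge0// lerDl.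
rewrite /wronskian; apply: le_trans (ler_normB _ _) _.
rewrite [leRHS](splitr e); apply: lerD; apply: pr.
  apply: le_trans (ler_pM (sqr_ge0 _) (sqr_ge0 _) f1 t2) _.
  by rewrite le_eqVlt; apply/orP; left; apply/eqP; rewrite /M; ring.
apply: le_trans (ler_pM (sqr_ge0 _) (sqr_ge0 _) f2 t1) _.
by rewrite le_eqVlt; apply/orP; left; apply/eqP; rewrite /M; ring.
Qed.

Lemma nonreal_energy0 a b u : b != 0 -> cL2fun u ->
  (forall j k t, D t -> u (j, k, t) = Kop (zmul a b u) (j, k, t)) ->
  forall j, energy u j = 0.
Proof.
move=> b0 uL uE; have zL := cL2_zmul hs a b uL; have [mu_ iQ] := uL.
have mD := @measurable_hointerval R T.
pose F t := Q t (u (false, false, t)) (u (false, true, t)) + Q t (u (true, false, t)) (u (true, true, t)).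
have iF : itg D F by apply: itgD.
have wE t : D t -> wronskian (zmul a b u) t = b * \int[mu]_(x in `[0, t]) F x.
  move=> tD; have t0 : 0 <= t by case: tD.
  have [pr qr] := Kop_acd hs false zL tD; have [pi qi] := Kop_acd hs true zL tD.
  have dW := acdB (acdM pr qi) (acdM qr pi).
  have dW' : acd t (wronskian (zmul a b u)) (fun x => b * F x).
    apply: acd_eq dW _ => x xt; have xD := D_seg tD xt.
    rewrite -!uE// /linA /linB /zmul /= /F /qform; ring.
  have iF' : itg `[0, t] F by exact: itg_seg iF.
  rewrite (acd_FTC dW' (itgZ b (measurable_itv _) iF')) ?t0 ?lexx//.
  by rewrite {1}/wronskian !Kop_0 mulr0 mul0r subrr add0r RintegralZl.
have F0 t : D t -> 0 <= F t by move=> tD; rewrite addr_ge0// (qform_ge0 cs).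
suff IF : \int[mu]_(x in D) F x = 0.
  move: IF; rewrite RintegralD// => /eqP; rewrite paddr_eq0 ?(energy_ge0 hs)//.
  by move=> /andP[/eqP e1 /eqP e2] [].
apply/eqP; rewrite -normr_le0; apply/ler_addgt0Pr => e e0; rewrite add0r.
have e2 : 0 < e / 2 by rewrite divr_gt0.
have nb : 0 < `|b| by rewrite normr_gt0.
have e3 : 0 < e / 2 * `|b| by rewrite mulr_gt0.
have [b1 b1D h1] := tail_small (cs_T cs) iF e2.
have [b2 b2D h2] := wronskian_vanishes zL e3.
have [t [tD [bt1 bt2]]] : exists t, D t /\ b1 <= t /\ b2 <= t.
  by exists (Num.max b1 b2); rewrite !le_max !lexx orbT; split=> //; case: (leP b1 b2).
rewrite (Rintegral_D_split tD iF); apply: le_trans (ler_normD _ _) _.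
rewrite [leRHS](splitr e); apply: lerD.
  by have := h2 t tD bt2; rewrite wE// normrM mulrC ler_pM2r.
apply: le_trans (h1 t tD bt1); apply: Rintegral_norm_le => //.
- exact: measurable_tail.
- by apply: itg_measurable; exact: itg_tail.
- by apply: itg_norm; [exact: measurable_tail|exact: itg_tail].
Qed.

(** For nonreal parameters the energy vanishes, and [Kop] of a function without energy is 0. For
    real ones each part of [u] is a solution with [q 0 = 0]: it is zero if [p 0 = 0], and divided by
    [p 0] it would otherwise be an eigenfunction. *)
Lemma resolvent_injective a b u : b != 0 \/ ~ @eigenvalue R T A B C a -> cL2fun u ->
  (forall j k t, D t -> u (j, k, t) = Kop (zmul a b u) (j, k, t)) ->
  forall j k t, D t -> u (j, k, t) = 0.
Proof.
move=> bne uL uE j k t tD; have zL := cL2_zmul hs a b uL.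
have [mu_ iQ] := uL; have mD := @measurable_hointerval R T.
have [b0|b0] := eqVneq b 0; last first.
  have E0 := nonreal_energy0 b0 uL uE.
  rewrite uE// Kop_energy0//; apply/eqP; rewrite eq_le energy_ge0// andbT.
  apply: (@le_trans _ _ (2 * a ^+ 2 * energy u j + 2 * b ^+ 2 * energy u (~~ j))).
    rewrite /energy -!RintegralZl// -RintegralD//; [|exact: itgZ|exact: itgZ].
    apply: Rintegral_le => //; first by have [_] := zL; apply.
      by apply: itgD => //; exact: itgZ.
    move=> x xD.
    apply: le_trans (qformD_le cs (a * u (j, false, x)) (a * u (j, true, x))
      ((if j then b else - b) * u (~~ j, false, x)) ((if j then b else - b) * u (~~ j, true, x)) xD) _.
    by rewrite le_eqVlt; apply/orP; left; apply/eqP; rewrite /qform; case: j => /=; ring.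
  by rewrite !E0 !mulr0 addr0.
have zE i : zmul a b u i = a * u i.
  by move: i => [[i1 i2] x]; rewrite b0 /zmul oppr0; case: i1; rewrite mul0r addr0.
pose p x := Kop (zmul a b u) (j, false, x); pose q x := Kop (zmul a b u) (j, true, x).
have sol : solution T A B C a p q.
  move=> c cD; have [dp dq] := Kop_acd hs j zL cD.
  split; [apply: acd_eq dp _|apply: acd_eq dq _] => x xc; have xD := D_seg cD xc;
    rewrite /linA /linB !zE /p /q -!uE//; ring.
have q0 : q 0 = 0 by exact: Kop_0.
have vp : vanishes_at_end T p by exact: Kop_vanishes.
have iQp : itg D (fun x => Q x (p x) (q x)).
  by apply: itg_eq (iQ j) => // x xD; rewrite /p /q -!uE.
have [p0|p0] := eqVneq (p 0) 0.
  have sol0 := solutionD 0 0 sol sol.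
  have [] := solution_unique cs sol0 sol _ _ tD; rewrite ?p0 ?q0 ?mul0r ?addr0//.
  by move=> pt qt; rewrite uE//; case: k.
case: bne => [|ne]; first by rewrite b0 eqxx.
exfalso; apply: ne; pose r := (p 0)^-1.
exists (fun x => r * p x + 0 * p x), (fun x => r * q x + 0 * q x); split.
- split; first exact: (solutionD r 0 sol sol).
    apply: (itg_eq mD (f := fun x => r ^+ 2 * Q x (p x) (q x))); last exact: itgZ.
    by move=> x _; rewrite /qform; ring.
  move=> e e0; have r0 : 0 < `|r| by rewrite normr_gt0 invr_eq0.
  have [c cD hc] := vp (e / `|r|) (divr_gt0 e0 r0); exists c => // x xD cx.
  by rewrite mul0r addr0 normrM mulrC -ler_pdivlMr//; exact: hc.
- by rewrite mul0r addr0 mulVf.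
- by rewrite q0 !mulr0 addr0.
Qed.

Theorem resolvent_solve a b : b != 0 \/ ~ @eigenvalue R T A B C a -> exists2 K, 0 <= K &
  forall h, cL2fun h -> exists u, [/\ cL2fun u,
    forall j k t, D t -> u (j, k, t) = Kop (lincomb 1 h (zmul a b u)) (j, k, t) &
    forall j, energy u j <= K * (energy h false + energy h true)].
Proof.
move=> ne; pose N := `|a| + `|b| + 1.
have N0 : 0 < N by rewrite ltr_wpDl// addr_ge0.
have e0 : 0 < (8 * N ^+ 2)^-1 by rewrite invr_gt0 mulr_gt0// exprn_gt0.
have [c1 c1D hc] := kap_small hs e0.
have [c c1c cD] := hointerval_gt c1D.
have c0 : 0 < c by apply: le_lt_trans c1c; case: c1D.
have kc : 8 * N ^+ 2 * kap c <= 1.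
  have [h _] := hc c cD (ltW c1c).
  rewrite mulrC -ler_pdivlMr ?mulr_gt0 ?exprn_gt0//; by rewrite div1r.
have [K K0 hK] := weighted_fredholm hs cD c0 kc (fun u uL uE => resolvent_injective ne uL uE).
exists K => // h hL; have [u [uL uE uK]] := hK h hL.
exists u; split=> // j k t tD.
by rewrite uE// Kop_comb ?mul1r//; exact: cL2_zmul.
Qed.

End ResolventSet.

(** * The Dirac operator as a canonical system *)

Section PlaneVectors.
Context {R : realType}.
Implicit Types (u v w : 'cV[R]_2) (M : 'M[R]_2).

Lemma sum2E (F : 'I_2 -> R) : \sum_(i < 2) F i = F 0 + F 1.
Proof.
by rewrite !big_ord_recl big_ord0 addr0; congr (_ + F _); apply: val_inj.
Qed.

Lemma ord2P (P : 'I_2 -> Prop) : P 0 -> P 1 -> forall i, P i.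
Proof.
move=> P0 P1 [[|[|//]] h]; first by rewrite (_ : Ordinal h = 0)//; apply: val_inj.
by rewrite (_ : Ordinal h = 1)//; apply: val_inj.
Qed.

Lemma cV2P u v : u 0 0 = v 0 0 -> u 1 0 = v 1 0 -> u = v.
Proof. by move=> h0 h1; apply/matrixP => i j; rewrite ord1; elim/ord2P: i. Qed.

Definition wedge v w : R := v 1 0 * w 0 0 - v 0 0 * w 1 0.

Lemma wedgeE v w : (v^T *m Jmx *m w) 0 0 = wedge v w.
Proof. by rewrite !mxE sum2E !mxE !sum2E !mxE /= /wedge; ring. Qed.

Lemma bformE M v w : bform M v w =
  v 0 0 * (M 0 0 * w 0 0 + M 0 1 * w 1 0) + v 1 0 * (M 1 0 * w 0 0 + M 1 1 * w 1 0).
Proof. by rewrite /bform !mxE sum2E !mxE !sum2E !mxE; ring. Qed.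

Lemma mulmx2E M v i : (M *m v) i 0 = M i 0 * v 0 0 + M i 1 * v 1 0.
Proof. by rewrite !mxE sum2E. Qed.

Lemma wedge_parallel u v : u != 0 -> v != 0 -> wedge u v = 0 -> parallel u v.
Proof.
move=> u0 v0 /eqP; rewrite subr_eq0 => /eqP uv.
have [v00|v00] := eqVneq (v 0 0) 0.
  have v10 : v 1 0 != 0 by apply: contra_neq v0 => h; apply: cV2P; rewrite ?v00 ?h mxE.
  exists (v 1 0), (u 1 0); split.
    by apply: contra_neq v10 => -[].
  by apply: cV2P; rewrite !mxE// ?uv mulrC// -uv mulrC.
exists (v 0 0), (u 0 0); split.
  by apply: contra_neq v00 => -[].
by apply: cV2P; rewrite !mxE mulrC// uv.
Qed.

Lemma pos_def_entries M : pos_def M -> M 0 1 = M 1 0.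
Proof. by move=> [ME _]; rewrite -{1}ME mxE. Qed.

Lemma pos_def_unit M : pos_def M -> M \in unitmx.
Proof.
move=> [MT Mp]; rewrite -row_free_unit -kermx_eq0; apply/eqP/row_matrixP => i.
rewrite row0; set r := row i _; apply/eqP; apply: contraT => r0.
have rM : r *m M = 0.
  by have := mulmx_ker M; rewrite /r -row_mul => ->; rewrite row0.
have : 0 < bform M r^T r^T.
  by apply: Mp; apply: contra_neq r0 => h; rewrite -[r]trmxK h trmx0.
by rewrite /bform trmxK rM mul0mx mxE ltxx.
Qed.

Lemma normr_entry_le (m n : nat) (M : 'M[R]_(m, n)) i j : `|M i j| <= `|M|.
Proof. by rewrite [leRHS]/Num.Def.normr/= mx_normrE; exact: (le_bigmax _ _ (i, j)). Qed.

Lemma normr_cV2_le v : `|v| <= `|v 0 0| + `|v 1 0|.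
Proof.
rewrite [leLHS]/Num.Def.normr/= mx_normrE; apply: bigmax_le; first by rewrite addr_ge0.
by move=> [i j] _ /=; rewrite ord1; elim/ord2P: i; rewrite ?lerDl ?lerDr.
Qed.

Lemma ac_cV2 a b (v : R -> 'cV[R]_2) : abs_continuous a b v <->
  abs_continuous a b ((fun t => v t 0 0) : R -> R^o) /\
  abs_continuous a b ((fun t => v t 1 0) : R -> R^o).
Proof.
split=> [acv|[ac0 ac1]].
  split; apply: (ac_dominated_mod (M := 1) _ acv acv) => s t _ _ _; rewrite mul1r.
    by apply: (@le_trans _ _ `|v t - v s|); rewrite ?lerDl//; have := normr_entry_le (v t - v s) 0 0; rewrite !mxE.
  by apply: (@le_trans _ _ `|v t - v s|); rewrite ?lerDl//; have := normr_entry_le (v t - v s) 1 0; rewrite !mxE.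
pose V : R -> R^o := fun t => v t 0 0.
move=> e e0; have e2 : 0 < e / 2 by rewrite divr_gt0.
have [d1 d10 h1] := ac0 _ e2; have [d2 d20 h2] := ac1 _ e2.
exists (Num.min d1 d2); first by rewrite lt_min d10.
move=> n l r lr tr; rewrite lt_min => /andP[/(h1 _ _ _ lr tr) {}h1 /(h2 _ _ _ lr tr) {}h2].
rewrite [ltRHS](splitr e); apply: le_lt_trans (ltrD h1 h2).
rewrite -big_split/=; apply: ler_sum => i _.
by apply: le_trans (normr_cV2_le _) _; rewrite !mxE.
Qed.

Lemma derive_cV2 (v : R -> 'cV[R]_2) t :
  derivable v t 1 <-> derivable ((fun s => v s 0 0) : R -> R^o) t 1 /\ derivable ((fun s => v s 1 0) : R -> R^o) t 1.
Proof.
split=> [/derivable_mxP h|[h0 h1]]; first by split; exact: h.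
by apply/derivable_mxP => i j; rewrite ord1; elim/ord2P: i.
Qed.

Lemma derive1_cV2 (v : R -> 'cV[R]_2) t i : derivable v t 1 ->
  (derive1 v t) i 0 = derive1 ((fun s => v s i 0) : R -> R^o) t.
Proof. by move=> dv; rewrite !derive1E derive_mx// mxE. Qed.

End PlaneVectors.

Lemma itg_ltyP {R : realType} (E : set R) (f : R -> R) : measurable E -> measurable_fun E f ->
  (forall x, E x -> 0 <= f x) ->
  (lebesgue_measure.-integrable E (EFin \o f) <->
   (\int[lebesgue_measure]_(x in E) (f x)%:E < +oo)%E).
Proof.
move=> mE mf f0; have E1 : (\int[lebesgue_measure]_(x in E) `|(f x)%:E| =
    \int[lebesgue_measure]_(x in E) (f x)%:E)%E.
  by apply: eq_integral => x /set_mem xE; rewrite gee0_abs// lee_fin f0.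
split=> [/integrableP[_]|h]; first by rewrite /= E1.
by apply/integrableP; split; [exact/measurable_EFinP|rewrite /= E1].
Qed.

Lemma normr_le_add {R : realType} (a b c : R) : 0 <= a -> 0 <= b ->
  0 <= 2 * (1 * c) + (a + b) -> 0 <= 2 * (-1 * c) + (a + b) -> `|c| <= a + b.
Proof. by move=> a0 b0 h1 h2; rewrite ler_norml; apply/andP; split; lra. Qed.

(** * Coordinates with respect to [u0] and [uh] *)

Section DiracCoordinates.
Context {R : realType}.
Notation mu := (@lebesgue_measure R).
Local Notation itg D f := (mu.-integrable D (EFin \o (f : R -> R))).
Context {T : \bar R} {W : R -> 'M[R]_2} {u0 u1 : 'cV[R]_2} (T0 : (0 < T)%E)
  (cA : conditionA T W) (cB : conditionB T W) (d0 : wedge u0 u1 != 0).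
Local Notation D := (hointerval T).
Implicit Types (v w : 'cV[R]_2).

Definition dual_vector (a b : 'cV[R]_2) := (wedge a b)^-1 *: b.
Local Notation uh := (dual_vector u0 u1).
Let uhE i : uh i 0 = (wedge u0 u1)^-1 * u1 i 0. Proof. by rewrite mxE. Qed.

(* [v = fst_coord v *: u0 + snd_coord v *: uh]. *)
Definition fst_coord v : R := wedge v uh.
Definition snd_coord v : R := wedge u0 v.
Local Notation pc := fst_coord.
Local Notation qc := snd_coord.

Definition coefA t : R := bform (W t) u0 u0.
Definition coefB t : R := bform (W t) uh uh.
Definition coefC t : R := bform (W t) u0 uh.
Local Notation A := coefA.
Local Notation B := coefB.
Local Notation C := coefC.
Local Notation Q := (qform A B C).

Lemma wedge_uh : u0 1 0 * uh 0 0 - u0 0 0 * uh 1 0 = 1.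
Proof. by rewrite !uhE; move: d0; rewrite /wedge => h; field. Qed.

Let combE a b (x y : 'cV[R]_2) i : (a *: x + b *: y) i 0 = a * x i 0 + b * y i 0.
Proof. by rewrite [LHS]mxE [X in X + _ = _]mxE [X in _ + X = _]mxE. Qed.

Lemma coordsK v : v = pc v *: u0 + qc v *: uh.
Proof.
have h := wedge_uh.
apply: cV2P; rewrite combE /fst_coord /snd_coord /wedge.
  by transitivity (v 0 0 * 1); [ring|rewrite -h; ring].
by transitivity (v 1 0 * 1); [ring|rewrite -h; ring].
Qed.

Lemma coordsE a b : pc (a *: u0 + b *: uh) = a /\ qc (a *: u0 + b *: uh) = b.
Proof.
have h := wedge_uh; rewrite /fst_coord /snd_coord /wedge !combE; split.
  by transitivity (a * 1); [rewrite -h; ring|ring].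
by transitivity (b * 1); [rewrite -h; ring|ring].
Qed.

Lemma bform_coords t v w : D t -> bform (W t) v w =
  A t * (pc v * pc w) + C t * (pc v * qc w + qc v * pc w) + B t * (qc v * qc w).
Proof.
move=> tD; have s := pos_def_entries (cA tD).
rewrite {1}(coordsK v) {1}(coordsK w) /coefA /coefB /coefC !bformE s.
by rewrite !combE; ring.
Qed.

Lemma qform_coords t v : D t -> bform (W t) v v = Q t (pc v) (qc v).
Proof. by move=> tD; rewrite bform_coords// /qform; ring. Qed.

Lemma bform_l0 t w : D t -> bform (W t) u0 w = A t * pc w + C t * qc w.
Proof.
move=> tD; have [p q] := coordsE 1 0; rewrite scale1r scale0r addr0 in p q.
by rewrite bform_coords// p q; ring.
Qed.

Lemma bform_l1 t w : D t -> bform (W t) uh w = C t * pc w + B t * qc w.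
Proof.
move=> tD; have [p q] := coordsE 0 1; rewrite scale1r scale0r add0r in p q.
by rewrite bform_coords// p q; ring.
Qed.

Lemma coordsP v w : pc v = pc w -> qc v = qc w -> v = w.
Proof. by move=> p q; rewrite (coordsK v) (coordsK w) p q. Qed.

Let u0_neq0 : u0 != 0.
Proof. by apply: contra_neq d0 => ->; rewrite /wedge !mxE; ring. Qed.

Let uh_neq0 : uh != 0.
Proof.
apply/eqP => h; have := wedge_uh; rewrite h !mxE !mulr0 subrr => /esym/eqP.
by rewrite oner_eq0.
Qed.

Let mW (v w : 'cV[R]_2) : measurable_fun D (fun t => bform (W t) v w).
Proof.
have [m _ _] := cB.
under eq_fun do rewrite bformE.
by apply: measurable_funD; apply: measurable_funM => //; apply: measurable_funD;
  apply: measurable_funM.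
Qed.

Lemma bform_le (M : 'M[R]_2) v :
  `|bform M v v| <= (`|v 0 0| + `|v 1 0|) ^+ 2 * `|M|.
Proof.
have e i j := normr_entry_le M i j.
have a (x y m : R) : `|m| <= `|M| -> `|x * (m * y)| <= `|x| * (`|M| * `|y|).
  by move=> h; rewrite !normrM ler_wpM2l// ler_wpM2r.
rewrite bformE !mulrDr.
apply: le_trans (ler_normD _ _) _.
apply: le_trans (lerD (ler_normD _ _) (ler_normD _ _)) _.
apply: le_trans (lerD (lerD (a _ _ _ (e 0 0)) (a _ _ _ (e 0 1))) (lerD (a _ _ _ (e 1 0)) (a _ _ _ (e 1 1)))) _.
by rewrite le_eqVlt; apply/orP; left; apply/eqP; ring.
Qed.

Lemma dirac_canonical_system : canonical_system T A B C.
Proof.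
split=> //; [exact: mW|exact: mW|exact: mW| | | |].
- by move=> t tD; apply: (cA tD).2.
- by move=> t tD; apply: (cA tD).2.
- move=> t tD; have At : 0 < A t by apply: (cA tD).2.
  (* On this vector the form takes the value [A * (A * B - C ^+ 2)], so positivity yields the
     determinant condition. *)
  have : 0 < bform (W t) (- C t *: u0 + A t *: uh) (- C t *: u0 + A t *: uh).
    apply: (cA tD).2; apply: contraTneq At => h.
    by have [_ <-] := coordsE (- C t) (A t); rewrite h /snd_coord /wedge !mxE !mulr0 subrr ltxx.
  rewrite qform_coords//; have [-> ->] := coordsE (- C t) (A t).
  rewrite [ltRHS](_ : _ = A t * (A t * B t - C t ^+ 2)); last by rewrite /qform; ring.
  by rewrite pmulr_rgt0// subr_gt0.
- have [_ lb _] := cB.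
  move=> b bD; have [M hM] := lb b bD.
  exists (((`|u0 0 0| + `|u0 1 0|) ^+ 2 + (`|uh 0 0| + `|uh 1 0|) ^+ 2) * M) => t tb.
  have M0 : 0 <= M by apply: le_trans (hM t tb).
  split; apply: le_trans (ler_norm _) _; apply: le_trans (bform_le _ _) _;
    apply: ler_pM; rewrite ?sqr_ge0// ?hM//; rewrite ?lerDl ?lerDr sqr_ge0//.
Qed.
Let cs := dirac_canonical_system.
Let mD : measurable D := @measurable_hointerval R T.

Lemma measurable_coords (v : R -> 'cV[R]_2) :
  (forall i, measurable_fun D (fun t => v t i 0)) <->
  measurable_fun D (fun t => pc (v t)) /\ measurable_fun D (fun t => qc (v t)).
Proof.
split=> [m|[mp mq] i].
  split; rewrite /fst_coord /snd_coord /wedge; apply: measurable_funB; apply: measurable_funM => //.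
under eq_fun => t do rewrite (coordsK (v t)) combE.
by apply: measurable_funD; apply: measurable_funM => //.
Qed.

Lemma sqnormE (v : R -> 'cV[R]_2) :
  sqnorm T W v = (\int[mu]_(t in D) (Q t (pc (v t)) (qc (v t)))%:E)%E.
Proof. by apply: eq_integral => t /set_mem tD; rewrite qform_coords. Qed.

Lemma L2E (v : R -> 'cV[R]_2) : L2 T W v <->
  [/\ measurable_fun D (fun t => pc (v t)), measurable_fun D (fun t => qc (v t)) &
      itg D (fun t => Q t (pc (v t)) (qc (v t)))].
Proof.
have h : measurable_fun D (fun t => pc (v t)) -> measurable_fun D (fun t => qc (v t)) ->
  itg D (fun t => Q t (pc (v t)) (qc (v t))) <-> (sqnorm T W v < +oo)%E.
  move=> mp mq; rewrite sqnormE; apply: itg_ltyP => //.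
    exact: (measurable_qform cs).
  by move=> x xD; exact: (qform_ge0 cs).
split=> [[/measurable_coords[mp mq] fin]|[mp mq iQ]].
  by split=> //; apply/h.
by split; [exact/measurable_coords|apply/h].
Qed.

Lemma sqnorm_Rintegral (v : R -> 'cV[R]_2) : L2 T W v ->
  sqnorm T W v = (\int[mu]_(t in D) Q t (pc (v t)) (qc (v t)))%:E.
Proof. by move=> /L2E[_ _ iQ]; rewrite sqnormE Rintegral_EFin. Qed.

Lemma sqnorm_cst_itg u : (sqnorm T W (fun=> u) < +oo)%E ->
  itg D (fun t => bform (W t) u u).
Proof.
move=> h; apply/itg_ltyP => // t tD; rewrite qform_coords//; exact: (qform_ge0 cs).
Qed.

Lemma measurable_normW : measurable_fun D (fun t => `|W t|).
Proof.
have [m _ _] := cB.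
have E (M : 'M[R]_2) : `|M| = Num.max (Num.max `|M 0 0| `|M 0 1|) (Num.max `|M 1 0| `|M 1 1|).
  apply/eqP; rewrite eq_le; apply/andP; split.
    rewrite [leLHS]/Num.Def.normr/= mx_normrE; apply: bigmax_le; first by rewrite !le_max normr_ge0.
    by move=> [i j] _ /=; elim/ord2P: i; elim/ord2P: j; rewrite !le_max lexx ?orbT.
  by rewrite !ge_max !normr_entry_le.
under eq_fun do rewrite E.
by do !apply: measurable_maxr; apply: measurableT_comp.
Qed.

(** In both cases [u1] has finite norm: either the norm of the weight is integrable, or the
    convention of the limit point case says so directly. *)
Lemma itg_coefB : limit_circle_case T W \/ (sqnorm T W (fun=> u1) < +oo)%E -> itg D B.
Proof.
case=> [lc|u1L].
  apply: (itg_le mD (mW _ _) (itgZ ((`|uh 0 0| + `|uh 1 0|) ^+ 2) mD lc)) => t tD.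
  exact: bform_le.
apply: (itg_eq mD _ (itgZ ((wedge u0 u1)^-1 ^+ 2) mD (sqnorm_cst_itg u1L))) => t tD.
by rewrite /coefB !bformE !uhE; ring.
Qed.

(** Integrability of the form at [u0] and [uh] extends to every constant vector by [qformD_le],
    hence to the trace of the weight, and the entries of a positive definite matrix are bounded by
    its trace. *)
Lemma limit_circle_coefA : itg D A -> itg D B -> limit_circle_case T W.
Proof.
move=> iA iB.
have e v : itg D (fun t => bform (W t) v v).
  apply: (itg_le mD (mW _ _) (itgZ 2 mD (itgD mD (itgZ (pc v ^+ 2) mD iA) (itgZ (qc v ^+ 2) mD iB)))).
  move=> t tD; rewrite qform_coords// ger0_norm ?(qform_ge0 cs)//.
  have := qformD_le cs (pc v) 0 0 (qc v) tD; rewrite addr0 add0r => /le_trans; apply.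
  by rewrite le_eqVlt; apply/orP; left; apply/eqP; rewrite /qform; ring.
pose e0 : 'cV[R]_2 := \col_i (i == 0)%:R; pose e1 : 'cV[R]_2 := \col_i (i == 1)%:R.
have iW i : itg D (fun t => W t i i).
  elim/ord2P: i; [apply: (itg_eq mD _ (e e0))|apply: (itg_eq mD _ (e e1))] => t tD;
  by rewrite bformE !mxE /=; ring.
apply: (itg_le mD measurable_normW (itgZ 2 mD (itgD mD (iW 0) (iW 1)))) => t tD.
have s := pos_def_entries (cA tD).
have W0 i : 0 <= W t i i.
  have e_ne (j : 'I_2) : (\col_i (i == j)%:R : 'cV[R]_2) != 0.
    by apply/eqP => /matrixP/(_ j 0); rewrite !mxE eqxx => /eqP; rewrite oner_eq0.
  elim/ord2P: i; [have := (cA tD).2 e0 (e_ne 0)|have := (cA tD).2 e1 (e_ne 1)];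
    rewrite bformE !mxE /= => h; apply: ltW; lra.
have off x y : (x = 1 \/ x = -1) -> y = W t 0 1 -> 0 <= 2 * (x * y) + (W t 0 0 + W t 1 1).
  move=> hx ->; have nz : (\col_i (if i == 0 then 1 else x) : 'cV[R]_2) != 0.
    by apply/eqP => /matrixP/(_ 0 0); rewrite !mxE => /eqP; rewrite oner_eq0.
  have := (cA tD).2 _ nz; rewrite bformE !mxE /= -s => /ltW.
  by case: hx => ->; lra.
have h1 := off 1 _ (or_introl erefl) erefl; have h2 := off (-1) _ (or_intror erefl) erefl.
have W01 : `|W t 0 1| <= W t 0 0 + W t 1 1.
  exact: normr_le_add (W0 0) (W0 1) h1 h2.
rewrite ger0_norm// [leLHS]/Num.Def.normr/= mx_normrE; apply: bigmax_le.
  by rewrite mulr_ge0// addr_ge0.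
have s0 : W t 0 0 + W t 1 1 <= 2 * (W t 0 0 + W t 1 1).
  by rewrite ler_peMl ?addr_ge0// ler1n.
move=> [i j] _ /=; apply: le_trans s0; elim/ord2P: i; elim/ord2P: j => //.
- by rewrite ger0_norm// lerDl.
- by rewrite -s.
- by rewrite ger0_norm// lerDr.
Qed.

End DiracCoordinates.

Lemma vanishes_at_endP {R : realType} (T : \bar R) (f : R -> R) : (0 < T)%E ->
  vanishes_at_end T f <-> (f s @[s --> right_end T] --> (0 : R)).
Proof.
case: T => [r| |//] T0; rewrite /right_end; split.
- move=> vf; apply/cvgrPdist_le => e e0; have [b [b0 br] hb] := vf e e0.
  rewrite lte_fin in br; near=> t; rewrite sub0r normrN; apply: hb.
    split; last by rewrite lte_fin; near: t; exact: nbhs_left_lt.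
    by apply: le_trans b0 _; apply: ltW; near: t; exact: nbhs_left_gt.
  by apply: ltW; near: t; exact: nbhs_left_gt.
- move=> /cvgrPdist_le vf e e0; have [d /= d0 hd] := vf e e0.
  rewrite lte_fin in T0.
  exists (Num.max 0 (r - d / 2)).
    by split; [rewrite le_max lexx|rewrite lte_fin gt_max T0 /= ltrBlDr ltrDl divr_gt0].
  move=> t [t0 tr]; rewrite lte_fin in tr; rewrite ge_max => /andP[_ rt].
  have := hd t; rewrite sub0r normrN /ball/=; apply => //.
  by rewrite ger0_norm ?subr_ge0 ?(ltW tr)//; lra.
- move=> vf; apply/cvgrPdist_le => e e0; have [b [b0 br] hb] := vf e e0.
  near=> t; rewrite sub0r normrN; have bt : b <= t by near: t; exact: nbhs_pinfty_ge.
  by apply: hb => //; split; [exact: le_trans bt|exact: ltry].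
- move=> /cvgrPdist_le vf e e0; have [M [Mr hM]] := vf e e0.
  exists (Num.max 0 (M + 1)); first by split; [rewrite le_max lexx|exact: ltry].
  move=> t _; rewrite ge_max => /andP[_ Mt].
  by have := hM t; rewrite sub0r normrN; apply; apply: lt_le_trans Mt; rewrite ltrDl.
Unshelve. all: by end_near. Qed.

Lemma is_derive_lin {R : realType} (f g : R -> R) (x y t f' g' : R) :
  is_derive t (1 : R) f f' -> is_derive t (1 : R) g g' ->
  is_derive t (1 : R) (fun s => x * f s + y * g s) (x * f' + y * g').
Proof. by move=> df dg; exact: (is_deriveD (is_deriveZ x df) (is_deriveZ y dg)). Qed.

(** * The graph of the operator in coordinates *)

Section DiracGraph.
Context {R : realType}.
Notation mu := (@lebesgue_measure R).
Local Notation itg D f := (mu.-integrable D (EFin \o (f : R -> R))).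
Context {T : \bar R} {W : R -> 'M[R]_2} {u0 u1 : 'cV[R]_2} (T0 : (0 < T)%E)
  (cA : conditionA T W) (cB : conditionB T W) (d0 : wedge u0 u1 != 0).
Local Notation D := (hointerval T).
Local Notation uh := (dual_vector u0 u1).
Local Notation pc := (@fst_coord R u0 u1).
Local Notation qc := (@snd_coord R u0).
Local Notation A := (@coefA R W u0).
Local Notation B := (@coefB R W u0 u1).
Local Notation C := (@coefC R W u0 u1).
Local Notation Q := (qform A B C).
Let cs : canonical_system T A B C := dirac_canonical_system T0 cA cB d0.
Let mD : measurable D := @measurable_hointerval R T.

Lemma ae_onP (P : R -> Prop) : ae_on T P <->
  forall b, D b -> {ae mu, forall t, 0 <= t <= b -> P t}.
Proof.
split=> [h b bD|h].
  by apply: (ae_imp _ h) => t hP tb; apply: hP; exact: D_seg tb.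
have [b [bD _] hb] := hointerval_seq T0.
apply: (ae_imp _ (ae_foralln (fun n => h (b n) (bD n)))) => t hP tD.
have [n tn] := hb t tD; apply: (hP n); by rewrite (ltW tn) andbT; case: tD.
Qed.

Lemma ac_coords a b (v : R -> 'cV[R]_2) : abs_continuous a b v <->
  abs_continuous a b ((fun t => pc (v t)) : R -> R^o) /\
  abs_continuous a b ((fun t => qc (v t)) : R -> R^o).
Proof.
have lin (f g h : R -> R^o) x y : (forall t, h t = x * f t + y * g t) ->
  abs_continuous a b f -> abs_continuous a b g -> abs_continuous a b h.
  move=> hE; apply: (ac_dominated (M := `|x| + `|y|)) => s t _ _ _.
  rewrite !hE (_ : _ - _ = x * (f t - f s) + y * (g t - g s)); last by ring.
  apply: le_trans (ler_normD _ _) _; rewrite !normrM mulrDr.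
  by apply: lerD; rewrite ler_wpM2r// ?lerDl ?lerDr.
rewrite ac_cV2; split=> -[h0 h1]; split.
- by apply: (lin _ _ _ (- uh 1 0) (uh 0 0) _ h0 h1) => t; rewrite /fst_coord /wedge; ring.
- by apply: (lin _ _ _ (u0 1 0) (- u0 0 0) _ h0 h1) => t; rewrite /snd_coord /wedge; ring.
- apply: (lin _ _ _ (u0 0 0) (uh 0 0) _ h0 h1) => t.
  by rewrite {1}(coordsK d0 (v t)) [LHS]mxE [X in X + _ = _]mxE [X in _ + X = _]mxE; ring.
- apply: (lin _ _ _ (u0 1 0) (uh 1 0) _ h0 h1) => t.
  by rewrite {1}(coordsK d0 (v t)) [LHS]mxE [X in X + _ = _]mxE [X in _ + X = _]mxE; ring.
Qed.

(** The relation [W g = J v'] is tested against [u0] and [uh], on which [J v'] pairs to the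
    derivative of the second coordinate and to minus that of the first. *)
Lemma dirac_derive (v : R -> 'cV[R]_2) (g : 'cV[R]_2) t : D t ->
  (derivable v t 1 /\ g = invmx (W t) *m (Jmx *m derive1 v t)) <->
  is_derive t (1 : R) (fun s => pc (v s)) (- (C t * pc g + B t * qc g)) /\
  is_derive t (1 : R) (fun s => qc (v s)) (A t * pc g + C t * qc g).
Proof.
move=> tD; have Wu := pos_def_unit (cA tD).
rewrite -(bform_l0 cA d0)// -(bform_l1 cA d0)//.
have eqW w : g = invmx (W t) *m (Jmx *m w) <->
    bform (W t) u0 g = qc w /\ bform (W t) uh g = - pc w.
  have J0 : (Jmx *m w) 0 0 = - w 1 0 by rewrite mulmx2E !mxE /=; ring.
  have J1 : (Jmx *m w) 1 0 = w 0 0 by rewrite mulmx2E !mxE /=; ring.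
  have bE u : bform (W t) u g = u 0 0 * (W t *m g) 0 0 + u 1 0 * (W t *m g) 1 0.
    by rewrite bformE !mulmx2E.
  split=> [gE|[]].
    by rewrite !bE gE mulKVmx// J0 J1 /snd_coord /fst_coord /wedge; split; ring.
  rewrite !bE /snd_coord /fst_coord /wedge => h0 h1.
  have d := wedge_uh d0.
  have -> : g = invmx (W t) *m (W t *m g) by rewrite mulKmx.
  congr (_ *m _); apply: cV2P; rewrite ?J0 ?J1.
    move: h0 h1; set a := (W t *m g) 0 0; set c := (W t *m g) 1 0 => h0 h1.
    transitivity (a * (u0 1 0 * uh 0 0 - u0 0 0 * uh 1 0)); first by rewrite d mulr1.
    transitivity ((u0 1 0 * (uh 0 0 * a + uh 1 0 * c)) - uh 1 0 * (u0 0 0 * a + u0 1 0 * c)); first by ring.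
    rewrite h0 h1; transitivity (- w 1 0 * (u0 1 0 * uh 0 0 - u0 0 0 * uh 1 0)); first by ring.
    by rewrite d mulr1.
  move: h0 h1; set a := (W t *m g) 0 0; set c := (W t *m g) 1 0 => h0 h1.
  transitivity (c * (u0 1 0 * uh 0 0 - u0 0 0 * uh 1 0)); first by rewrite d mulr1.
  transitivity (uh 0 0 * (u0 0 0 * a + u0 1 0 * c) - u0 0 0 * (uh 0 0 * a + uh 1 0 * c)); first by ring.
  rewrite h0 h1; transitivity (w 0 0 * (u0 1 0 * uh 0 0 - u0 0 0 * uh 1 0)); first by ring.
  by rewrite d mulr1.
have wdE : derivable v t 1 -> is_derive t (1 : R) (fun s => pc (v s)) (pc (derive1 v t)) /\
    is_derive t (1 : R) (fun s => qc (v s)) (qc (derive1 v t)).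
  move=> dv; have [dv0 dv1] := (derive_cV2 v t).1 dv.
  have i0 : is_derive t (1 : R) ((fun s => v s 0 0) : R -> R^o) (derive1 v t 0 0).
    by apply: DeriveDef => //; rewrite derive1_cV2// derive1E.
  have i1 : is_derive t (1 : R) ((fun s => v s 1 0) : R -> R^o) (derive1 v t 1 0).
    by apply: DeriveDef => //; rewrite derive1_cV2// derive1E.
  have hp := is_derive_lin (- uh 1 0) (uh 0 0) i0 i1.
  have hq := is_derive_lin (u0 1 0) (- u0 0 0) i0 i1.
  split; [rewrite (_ : (fun s => pc (v s)) = (fun s => - uh 1 0 * v s 0 0 + uh 0 0 * v s 1 0))|
          rewrite (_ : (fun s => qc (v s)) = (fun s => u0 1 0 * v s 0 0 + - u0 0 0 * v s 1 0))];
    try by apply/funext => s; rewrite /fst_coord /snd_coord /wedge; ring.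
    by rewrite /fst_coord /wedge (_ : _ - _ = - uh 1 0 * derive1 v t 0 0 + uh 0 0 * derive1 v t 1 0)//; ring.
  by rewrite /snd_coord /wedge (_ : _ - _ = u0 1 0 * derive1 v t 0 0 + - u0 0 0 * derive1 v t 1 0)//; ring.
split=> [[dv /eqW[-> ->]]|[dp dq]]; first by rewrite opprK; exact: wdE.
have dv : derivable v t 1.
  have vE i : (fun s => v s i 0) = (fun s => u0 i 0 * pc (v s) + uh i 0 * qc (v s)).
    apply/funext => s; rewrite {1}(coordsK d0 (v s)) [LHS]mxE [X in X + _ = _]mxE.
    by rewrite [X in _ + X = _]mxE; ring.
  apply/derive_cV2; rewrite !vE; split.
    by have [] := is_derive_lin (u0 0 0) (uh 0 0) dp dq.
  by have [] := is_derive_lin (u0 1 0) (uh 1 0) dp dq.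
split=> //; apply/eqW; have [dp' dq'] := wdE dv.
have [_ <-] := dp'; have [_ <-] := dq'; have [_ ->] := dp; have [_ ->] := dq.
by rewrite opprK.
Qed.

Lemma dirac_acdP (v g : R -> 'cV[R]_2) :
  loc_abs_continuous T v /\ ae_on T (fun t => derivable v t 1 /\
      g t = invmx (W t) *m (Jmx *m derive1 v t)) <->
    forall b, D b ->
      acd b (fun t => pc (v t)) (fun t => - (C t * pc (g t) + B t * qc (g t))) /\
      acd b (fun t => qc (v t)) (fun t => A t * pc (g t) + C t * qc (g t)).
Proof.
rewrite ae_onP; split=> [[acv dv] b bD|h].
    have [ap aq] := (ac_coords 0 b v).1 (acv b bD).
    by split; split=> //; apply: (ae_imp _ (dv b bD)) => t ht tb;
      have [] := (dirac_derive v (g t) (D_seg bD tb)).1 (ht tb).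
  split=> b bD; have [[ap dp] [aq dq]] := h b bD; first exact/ac_coords.
  by apply: (ae_imp2 _ dp dq) => t hp hq tb; apply/(dirac_derive _ _ (D_seg bD tb)); split; auto.
Qed.

(** Pairing through [J] with [u0] reads off the second coordinate, with [u1] a multiple of the
    first; the boundary conditions become [q = 0] at 0 and, in the limit circle case, [p] tending to
    0 at [T]. *)
Lemma dirac_graph_coords (v g : R -> 'cV[R]_2) : dirac_graph T W u0 u1 v g <->
  [/\ L2 T W v, L2 T W g,
    forall b, D b ->
      acd b (fun t => pc (v t)) (fun t => - (C t * pc (g t) + B t * qc (g t))) /\
      acd b (fun t => qc (v t)) (fun t => A t * pc (g t) + C t * qc (g t)),
    qc (v 0) = 0 & limit_circle_case T W -> vanishes_at_end T (fun t => pc (v t))].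
Proof.
have qE : ((v 0)^T *m Jmx *m u0) 0 0 = - qc (v 0).
  by rewrite wedgeE /snd_coord /wedge; ring.
have pE s : ((v s)^T *m Jmx *m u1) 0 0 = wedge u0 u1 * pc (v s).
  rewrite wedgeE /fst_coord /wedge /dual_vector !mxE; move: d0; rewrite /wedge => h.
  by field.
have bcE : (((v s)^T *m Jmx *m u1) 0 0 @[s --> right_end T] --> (0 : R)) <->
    vanishes_at_end T (fun t => pc (v t)).
  under eq_fun do rewrite pE; rewrite -(vanishes_at_endP _ T0); split.
    move=> h e e0; have dp : 0 < `|wedge u0 u1| by rewrite normr_gt0.
    have [b bD hb] := h _ (mulr_gt0 dp e0); exists b => // t tD bt.
    by have := hb t tD bt; rewrite normrM ler_pM2l.
  move=> h e e0; have dp : 0 < `|wedge u0 u1| by rewrite normr_gt0.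
  have [b bD hb] := h _ (divr_gt0 e0 dp); exists b => // t tD bt.
  by rewrite normrM mulrC -ler_pdivlMr//; exact: hb.
have dE := dirac_acdP v g.
rewrite /dirac_graph qE; split=> [[vL gL acv dv [/eqP q0 bc]]|[vL gL h q0 bc]].
  by split=> //; [exact/dE|apply/eqP; rewrite -oppr_eq0|move=> /bc/bcE].
have [acv dv] := dE.2 h; split=> //; split; first by rewrite q0 oppr0.
by move=> /bc/bcE.
Qed.

End DiracGraph.

(** * The inner product and best approximation by orthonormal sums *)

Section InnerProduct.
Context {R : realType}.
Notation mu := (@lebesgue_measure R).
Local Notation itg D f := (mu.-integrable D (EFin \o (f : R -> R))).
Context {T : \bar R} {W : R -> 'M[R]_2} {u0 u1 : 'cV[R]_2} (T0 : (0 < T)%E)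
  (cA : conditionA T W) (cB : conditionB T W) (d0 : wedge u0 u1 != 0).
Local Notation D := (hointerval T).
Local Notation uh := (dual_vector u0 u1).
Local Notation pc := (@fst_coord R u0 u1).
Local Notation qc := (@snd_coord R u0).
Local Notation A := (@coefA R W u0).
Local Notation B := (@coefB R W u0 u1).
Local Notation C := (@coefC R W u0 u1).
Local Notation Q := (qform A B C).
Let cs : canonical_system T A B C := dirac_canonical_system T0 cA cB d0.
Let mD : measurable D := @measurable_hointerval R T.
Implicit Types (v w g : R -> 'cV[R]_2).

Lemma fst_coord_lin a (x y : 'cV[R]_2) : pc (a *: x + y) = a * pc x + pc y.
Proof. by rewrite /fst_coord /wedge !mxE; ring. Qed.

Lemma snd_coord_lin a (x y : 'cV[R]_2) : qc (a *: x + y) = a * qc x + qc y.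
Proof. by rewrite /snd_coord /wedge !mxE; ring. Qed.

Lemma fst_coord0 : pc 0 = 0. Proof. by rewrite /fst_coord /wedge !mxE; ring. Qed.
Lemma snd_coord0 : qc 0 = 0. Proof. by rewrite /snd_coord /wedge !mxE; ring. Qed.

Lemma fst_coordZ a (x : 'cV[R]_2) : pc (a *: x) = a * pc x.
Proof. by have := fst_coord_lin a x 0; rewrite !addr0 fst_coord0 addr0. Qed.

Lemma snd_coordZ a (x : 'cV[R]_2) : qc (a *: x) = a * qc x.
Proof. by have := snd_coord_lin a x 0; rewrite !addr0 snd_coord0 addr0. Qed.

Lemma L2_lin a v w : L2 T W v -> L2 T W w -> L2 T W (fun t => a *: v t + w t).
Proof.
move=> /(L2E T0 cA cB d0)[mp mq iQ] /(L2E T0 cA cB d0)[mp' mq' iQ']; apply/(L2E T0 cA cB d0).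
have m1 : measurable_fun D (fun t => pc (a *: v t + w t)).
  by under eq_fun do rewrite fst_coord_lin; apply: measurable_funD => //; exact: measurable_funM.
have m2 : measurable_fun D (fun t => qc (a *: v t + w t)).
  by under eq_fun do rewrite snd_coord_lin; apply: measurable_funD => //; exact: measurable_funM.
split=> //; apply: (itg_le mD _ (itgZ 2 mD (itgD mD (itgZ (a ^+ 2) mD iQ) iQ'))).
  exact: (measurable_qform cs).
move=> t tD; rewrite ger0_norm ?(qform_ge0 cs)// fst_coord_lin snd_coord_lin.
apply: le_trans (qformD_le cs _ _ _ _ tD) _.
by rewrite le_eqVlt; apply/orP; left; apply/eqP; rewrite /qform; ring.
Qed.

Lemma L2_0 : L2 T W (fun=> 0).
Proof.
apply/(L2E T0 cA cB d0); rewrite fst_coord0 snd_coord0; split=> //.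
apply: (itg_eq mD (f := fun=> 0)) => [t _|]; first by rewrite /qform; ring.
exact: integrable0.
Qed.

Lemma L2B v w : L2 T W v -> L2 T W w -> L2 T W (fun t => v t - w t).
Proof.
move=> vL wL; have := L2_lin (-1) wL vL.
by under eq_fun do rewrite scaleN1r addrC.
Qed.

Lemma itg_bform v w : L2 T W v -> L2 T W w -> itg D (fun t => bform (W t) (v t) (w t)).
Proof.
move=> vL wL; have [mp mq iQ] := (L2E T0 cA cB d0 _).1 vL.
have [mp' mq' iQ'] := (L2E T0 cA cB d0 _).1 wL.
have [_ _ iS] := (L2E T0 cA cB d0 _).1 (L2_lin 1 vL wL).
apply: (itg_eq mD _ (itgZ (1 / 2) mD (itgB mD (itgB mD iS iQ) iQ'))) => t tD.
rewrite fst_coord_lin snd_coord_lin (bform_coords cA d0)// /qform; by field.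
Qed.

Lemma innerC v w : inner T W v w = inner T W w v.
Proof.
apply: eq_Rintegral => t /set_mem tD; rewrite !(bform_coords cA d0)//; ring.
Qed.

Lemma inner_lin a v v' w : L2 T W v -> L2 T W v' -> L2 T W w ->
  inner T W (fun t => a *: v t + v' t) w = a * inner T W v w + inner T W v' w.
Proof.
move=> vL vL' wL; rewrite /inner -RintegralZl//; last exact: itg_bform.
rewrite -RintegralD//; [|apply: itgZ => //; exact: itg_bform|exact: itg_bform].
apply: eq_Rintegral => t /set_mem tD.
rewrite !(bform_coords cA d0)// fst_coord_lin snd_coord_lin; ring.
Qed.

Lemma inner0 w : inner T W (fun=> 0) w = 0.
Proof.
apply: Rintegral_eq0 => t tD; rewrite (bform_coords cA d0)// fst_coord0 snd_coord0; ring.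
Qed.

Lemma L2_sum n (c : 'I_n -> R) (e : nat -> R -> 'cV[R]_2) (r : seq 'I_n) :
  (forall k, L2 T W (e k)) -> L2 T W (fun t => \sum_(k <- r) c k *: e k t).
Proof.
move=> eL; elim: r => [|k r IH]; first by under eq_fun do rewrite big_nil; exact: L2_0.
by under eq_fun do rewrite big_cons; exact: L2_lin.
Qed.

Lemma inner_sum n (c : 'I_n -> R) (e : nat -> R -> 'cV[R]_2) (r : seq 'I_n) w :
  (forall k, L2 T W (e k)) -> L2 T W w ->
  inner T W (fun t => \sum_(k <- r) c k *: e k t) w = \sum_(k <- r) c k * inner T W (e k) w.
Proof.
move=> eL wL; elim: r => [|k r IH].
  by under [X in inner _ _ X]eq_fun do rewrite big_nil; rewrite big_nil inner0.
under [X in inner _ _ X]eq_fun do rewrite big_cons.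
by rewrite inner_lin//; [rewrite IH big_cons|exact: L2_sum].
Qed.

Lemma sqnorm_inner v : L2 T W v -> sqnorm T W v = (inner T W v v)%:E.
Proof.
move=> vL; rewrite /sqnorm /inner Rintegral_EFin//; exact: itg_bform.
Qed.

(** The two sides differ by the sum of the squares [(c k - inner T W h (e k)) ^+ 2]. *)
Lemma inner_subr_ge h n (c : 'I_n -> R) (e : nat -> R -> 'cV[R]_2) :
  (forall k, L2 T W (e k)) -> (forall m k, inner T W (e m) (e k) = (m == k)%:R) ->
  L2 T W h ->
  inner T W h h - \sum_(k < n) inner T W h (e k) ^+ 2 <=
  inner T W (fun t => h t - \sum_(k < n) c k *: e k t) (fun t => h t - \sum_(k < n) c k *: e k t).
Proof.
move=> eL orth hL; pose s t := \sum_(k < n) c k *: e k t.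
have sL : L2 T W s by exact: L2_sum.
have subE w : L2 T W w -> inner T W (fun t => h t - s t) w = inner T W h w - inner T W s w.
  move=> wL; have := inner_lin (-1) sL hL wL.
  by under [X in inner _ _ X]eq_fun do rewrite scaleN1r addrC; move=> ->; ring.
have hsL := L2B hL sL.
rewrite -/s subE// ![inner _ _ _ (fun t => h t - s t)]innerC !subE//.
rewrite [inner T W s h]innerC [inner T W h s]innerC !inner_sum//.
have ssE : \sum_(k < n) c k * inner T W (e k) s = \sum_(k < n) c k ^+ 2.
  apply: eq_bigr => k _.
  rewrite innerC inner_sum// (bigD1 k)//= orth eqxx big1 ?addr0 ?mulr1//.
  by move=> j jk; rewrite orth val_eqE (negbTE jk) mulr0.
rewrite -/s ssE opprB -subr_ge0.
have -> : \sum_(k < n) c k * inner T W (e k) h = \sum_(k < n) c k * inner T W h (e k).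
  by apply: eq_bigr => k _; rewrite innerC.
have := @sumr_ge0 R _ (index_enum 'I_n) xpredT (fun k => (c k - inner T W h (e k)) ^+ 2)
  (fun k _ => sqr_ge0 _).
have -> : \sum_(k < n) (c k - inner T W h (e k)) ^+ 2 = \sum_(k < n) c k ^+ 2 -
    2 * \sum_(k < n) c k * inner T W h (e k) + \sum_(k < n) inner T W h (e k) ^+ 2.
  rewrite mulr_sumr -sumrB -big_split; apply: eq_bigr => k _ /=; ring.
move=> /le_trans; apply; rewrite le_eqVlt; apply/orP; left; apply/eqP; ring.
Qed.

End InnerProduct.

(** * The kernel of the inverse *)

Section DiracKernel.
Context {R : realType}.
Notation mu := (@lebesgue_measure R).
Local Notation itg D f := (mu.-integrable D (EFin \o (f : R -> R))).
Context {T : \bar R} {W : R -> 'M[R]_2} {u0 u1 : 'cV[R]_2} (T0 : (0 < T)%E)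
  (cA : conditionA T W) (cB : conditionB T W) (d0 : wedge u0 u1 != 0).
Local Notation D := (hointerval T).
Local Notation uh := (dual_vector u0 u1).
Local Notation pc := (@fst_coord R u0 u1).
Local Notation qc := (@snd_coord R u0).
Local Notation A := (@coefA R W u0).
Local Notation B := (@coefB R W u0 u1).
Local Notation C := (@coefC R W u0 u1).
Local Notation Q := (qform A B C).
Local Notation AA := (headint A).
Local Notation BB := (tailint T B).
Local Notation G := (dirac_graph T W u0 u1).
Let cs : canonical_system T A B C := dirac_canonical_system T0 cA cB d0.
Let mD : measurable D := @measurable_hointerval R T.
Let graphP := dirac_graph_coords T0 cA d0.
Let L2P := L2E T0 cA cB d0.
Context (iB : itg D B).
Implicit Types (v w g : R -> 'cV[R]_2).

Lemma dirac_graphB v w g h : G v g -> G w h -> G (fun t => v t - w t) (fun t => g t - h t).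
Proof.
have pB (x y : 'cV[R]_2) : pc (x - y) = pc x - pc y.
  by rewrite addrC -scaleN1r fst_coord_lin mulN1r addrC.
have qB (x y : 'cV[R]_2) : qc (x - y) = qc x - qc y.
  by rewrite addrC -scaleN1r snd_coord_lin mulN1r addrC.
move=> /graphP[vL gL dv v0 bv] /graphP[wL hL dw w0 bw]; apply/graphP; split.
- exact: (L2B T0 cA cB d0).
- exact: (L2B T0 cA cB d0).
- move=> b bD; have [dp dq] := dv b bD; have [dp' dq'] := dw b bD.
  under eq_fun do rewrite pB; under [X in _ /\ acdi _ _ X _]eq_fun do rewrite qB.
  split; [apply: acd_eq (acdB dp dp') _|apply: acd_eq (acdB dq dq') _] => t _; rewrite pB qB; ring.
- by rewrite qB v0 w0 subrr.
- move=> lc e e0; have e2 : 0 < e / 2 by rewrite divr_gt0.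
  have [b1 b1D h1] := bv lc _ e2; have [b2 b2D h2] := bw lc _ e2.
  exists (Num.max b1 b2) => [|t tD]; first by case: (leP b1 b2).
  rewrite ge_max => /andP[t1 t2]; rewrite pB; apply: le_trans (ler_normB _ _) _.
  by rewrite [leRHS](splitr e); apply: lerD; [exact: h1|exact: h2].
Qed.

Lemma L2_truncate g E : measurable E -> L2 T W g -> L2 T W (fun t => \1_E t *: g t).
Proof.
move=> mE /L2P[mp mq iQ]; apply/L2P.
have mI : measurable_fun D (\1_E : R -> R) by exact: measurable_indic.
have m1 : measurable_fun D (fun t => pc (\1_E t *: g t)).
  by under eq_fun do rewrite fst_coordZ; exact: measurable_funM.
have m2 : measurable_fun D (fun t => qc (\1_E t *: g t)).
  by under eq_fun do rewrite snd_coordZ; exact: measurable_funM.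
split=> //; apply: (itg_le mD _ iQ); first exact: (measurable_qform cs).
move=> t tD; rewrite ger0_norm ?(qform_ge0 cs)// fst_coordZ snd_coordZ indicE.
case: (t \in E); rewrite ?mul1r// !mul0r [leLHS](_ : _ = 0) ?(qform_ge0 cs)//.
by rewrite /qform; ring.
Qed.

Lemma acdi_shift a b (f g : R -> R) : 0 <= a -> acd b f g -> acdi a b f g.
Proof.
move=> a0 [acf df]; split; first exact: ac_sub acf.
by apply: (ae_imp _ df) => x h /andP[ax xt]; apply: h; rewrite xt (le_trans a0).
Qed.

(* A nonzero constant first coordinate near [T] would make [A] integrable, hence the
   limit circle case, in which the boundary condition forces it to vanish. *)
Lemma compact_source v g b : D b -> G v g -> (forall t, D t -> b <= t -> g t = 0) ->
  forall t, D t -> b <= t -> pc (v t) = 0.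
Proof.
move=> bD /graphP[vL gL dv v0 bv] gz; have [mp mq iQ] := (L2P _).1 vL.
have b0 : 0 <= b by case: bD.
have cst t : D t -> b <= t -> pc (v t) = pc (v b) /\ qc (v t) = qc (v b).
  move=> tD bt; have [dp dq] := dv t tD.
  have z (F : R -> R -> R -> R) : (forall x, F x 0 0 = 0) ->
      {ae mu, forall x, b <= x <= t -> F x (pc (g x)) (qc (g x)) = 0}.
    move=> F0; apply: aeW => x /andP[bx xt].
    rewrite gz ?fst_coord0 ?snd_coord0//; exact: hointerval_le tD (le_trans b0 bx) xt.
  split.
    apply: (acd_eq0_cst (acdi_shift b0 dp) (z (fun x p q => - (C x * p + B x * q)) _)).
    - by move=> x; rewrite !mulr0 addr0 oppr0.
    - by rewrite bt lexx.
    - by rewrite bt lexx.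
  apply: (acd_eq0_cst (acdi_shift b0 dq) (z (fun x p q => A x * p + C x * q) _)).
  - by move=> x; rewrite !mulr0 addr0.
  - by rewrite bt lexx.
  - by rewrite bt lexx.
suff p0 : pc (v b) = 0 by move=> t tD bt; have [-> _] := cst t tD bt.
apply/eqP; apply: contraT => pn0; set p := pc (v b) in pn0; set q := qc (v b).
have iA : itg D A.
  have [iAb _ _] := cs_itg cs bD.
  have /(itgS measurableT mD (@subsetT _ _)) iAb' := (itg_patch A (measurable_itv `[0, b])).1 iAb.
  (* Beyond [b] the coordinates are the constants [p] and [q]; writing [(p, 0)] as
     [(p, q) + (0, - q)] gives [p ^+ 2 * A <= 2 * (Q + q ^+ 2 * B)] with [Q] the integrable energy
     density of [v]. *)
  apply: (itg_le mD (cs_mA cs) (itgD mD iAb' (itgZ (2 / p ^+ 2) mD (itgD mD iQ (itgZ (q ^+ 2) mD iB))))).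
  move=> t tD; have A0 := cs_A0 cs tD; have B0 := cs_B0 cs tD; rewrite (gtr0_norm A0).
  have R0 : 0 <= 2 / p ^+ 2 * (Q t (pc (v t)) (qc (v t)) + q ^+ 2 * B t).
    rewrite mulr_ge0 ?divr_ge0 ?sqr_ge0// addr_ge0 ?(qform_ge0 cs)// mulr_ge0 ?sqr_ge0//.
    exact: ltW.
  rewrite /patch; have [tb|bt] := leP t b.
    rewrite mem_set ?lerDl//= in_itv/= tb andbT; by case: tD.
  rewrite memNset ?add0r; last by rewrite /= in_itv/= => /andP[_]; rewrite leNgt bt.
  have [-> ->] := cst t tD (ltW bt); rewrite -/p -/q mulrAC ler_pdivlMr ?exprn_even_gt0//.
  have := qformD_le cs p q 0 (- q) tD; rewrite addr0 subrr.
  rewrite /qform !mulr0 expr0n/= !mulr0 !addr0 !add0r sqrrN mulrA mulrDr.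
  by move=> h; apply: le_trans h _; rewrite le_eqVlt; apply/orP; left; apply/eqP; ring.
have lc := limit_circle_coefA T0 cA cB d0 iA iB.
case/negP: pn0; rewrite -normr_le0; apply/ler_addgt0Pr => e e0; rewrite add0r.
have [c cD hc] := bv lc e e0; pose s := Num.max b c.
have sD : D s by rewrite /s; case: (leP b c).
rewrite /p; have [<- _] := cst s sD ltac:(by rewrite le_max lexx).
by apply: hc => //; rewrite le_max lexx orbT.
Qed.

Context (hs_surj : forall g, L2 T W g -> exists v, G v g)
  (hs_bd : exists K : R, forall v g, G v g -> (sqnorm T W v <= K%:E * sqnorm T W g)%E).

Lemma graph_seg v g b : D b -> G v g -> [/\ itg D (fun t => C t * pc (g t) + B t * qc (g t)),
  itg `[0, b] (fun t => A t * pc (g t) + C t * qc (g t)) &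
  forall s t, 0 <= s -> s <= t -> t <= b ->
   pc (v s) = pc (v t) + \int[mu]_(x in `[s, t]) (C x * pc (g x) + B x * qc (g x)) /\
   qc (v t) = qc (v s) + \int[mu]_(x in `[s, t]) (A x * pc (g x) + C x * qc (g x))].
Proof.
move=> bD /graphP[vL /L2P[mp mq iQ] dv _ _].
have iL : itg D (fun t => C t * pc (g t) + B t * qc (g t)).
  by have [] := csB cs iB (@subset_refl _ _) mD mp mq iQ.
have sD : `[0, b] `<=` D := hointerval_seg bD.
have [iAb _ _] := cs_itg cs bD.
have iM : itg `[0, b] (fun t => A t * pc (g t) + C t * qc (g t)).
  have mS (f : R -> R) : measurable_fun D f -> measurable_fun `[0, b] f.
    exact: measurable_funS.
  by have [] := csA cs sD (measurable_itv _) (mS _ mp) (mS _ mq) iAb (itgS mD (measurable_itv _) sD iQ).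
split=> // s t s0 st tb; have [dp dq] := dv b bD.
split; last exact: (acd_increment dq).
have iL' := itg_seg bD (lexx 0) iL.
have dp' : acd b (fun x => - pc (v x)) (fun x => C x * pc (g x) + B x * qc (g x)).
  by apply: acd_eq (acdN dp) _ => x _; rewrite opprK.
have := acd_increment dp' iL' s0 st tb; move: (\int[mu]_(x in _) _) => I h.
by rewrite -[pc (v s)]opprK; apply/eqP; rewrite -subr_eq0; move: h => /eqP; rewrite -subr_eq0 => /eqP h;
  apply/eqP; rewrite -[RHS]h; ring.
Qed.

(** Subtract the solution whose source is [g] cut off at [b]. The difference has its source in
    [[b, T)], so on [[0, b]] it is constant, with second coordinate 0 and, by [compact_source],
    first coordinate [pc (v b)]. Its squared norm is at least the left-hand side, and the bounded
    inverse controls it by the tail of [g]. *)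
Lemma end_defect : exists2 K : R, 0 <= K & forall v g b, G v g -> D b ->
  pc (v b) ^+ 2 * AA b <= K * \int[mu]_(x in tail T b) Q x (pc (g x)) (qc (g x)).
Proof.
have [K0 hK] := hs_bd; exists `|K0| => // v g b Gv bD.
have [vL gL dv v0 bv] := (graphP _ _).1 Gv; have b0 : 0 <= b by case: bD.
have [_ _ iQg] := (L2P _).1 gL.
pose gb t := \1_`[0, b[ t *: g t.
have gbL : L2 T W gb by apply: L2_truncate => //; exact: measurable_itv.
have [vb Gb] := hs_surj gbL.
have gb_in t : 0 <= t -> t < b -> gb t = g t.
  by move=> t0 tb; rewrite /gb indicE mem_set ?scale1r//= in_itv/= t0 tb.
have gb_out t : b <= t -> gb t = 0.
  by move=> bt; rewrite /gb indicE memNset ?scale0r//= in_itv/= ltNge bt andbF.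
have Gw := dirac_graphB Gv Gb.
set w := (fun t => v t - vb t) in Gw; set h := (fun t => g t - gb t) in Gw.
have [wL hL dw w0 _] := (graphP _ _).1 Gw.
have [_ _ iQw] := (L2P _).1 wL; have [_ _ iQh] := (L2P _).1 hL.
have h_in t : 0 <= t -> t < b -> h t = 0 by move=> t0 tb; rewrite /h gb_in// subrr.
have h_out t : b <= t -> h t = g t by move=> bt; rewrite /h gb_out// subr0.
have hz (F : R -> R -> R -> R) : (forall x, F x 0 0 = 0) ->
    {ae mu, forall x, 0 <= x <= b -> F x (pc (h x)) (qc (h x)) = 0}.
  move=> F0; apply: (ae_imp _ (ae_neq b)) => x xb /andP[x0 xb'].
  by rewrite h_in ?fst_coord0 ?snd_coord0// lt_neqAle xb.
have wE t : 0 <= t <= b -> pc (w t) = pc (v b) /\ qc (w t) = 0.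
  move=> tb; have [dp dq] := dw b bD.
  have pb : pc (w b) = pc (v b).
    have := fst_coord_lin (u0 := u0) (u1 := u1) (-1) (vb b) (v b).
    rewrite (compact_source bD Gb (fun t _ => gb_out t))// mulr0 add0r => <-.
    by rewrite scaleN1r addrC.
  split.
    rewrite -pb; apply: (acd_eq0_cst dp (hz (fun x p q => - (C x * p + B x * q)) _)) => //.
      by move=> x; rewrite !mulr0 addr0 oppr0.
    by rewrite b0 lexx.
  rewrite -w0; apply: (acd_eq0_cst dq (hz (fun x p q => A x * p + C x * q) _)) => //.
    by move=> x; rewrite !mulr0 addr0.
  by rewrite b0 lexx.
have E1 : \int[mu]_(x in D) Q x (pc (h x)) (qc (h x)) =
    \int[mu]_(x in tail T b) Q x (pc (g x)) (qc (g x)).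
  rewrite Rintegral_mkcond [RHS]Rintegral_mkcond; apply: eq_Rintegral => x _.
  rewrite /patch; have [xD|xD] := pselect (D x); last first.
    by rewrite !memNset// => -[].
  rewrite (mem_set xD); have [bx|xb] := leP b x.
    by rewrite mem_set ?h_out.
  rewrite memNset; last by case; rewrite leNgt xb.
  rewrite h_in ?fst_coord0 ?snd_coord0//.
    by rewrite /qform !expr0n/= !mulr0 !addr0.
  by case: xD.
have := hK _ _ Gw; rewrite (sqnorm_Rintegral T0 cA cB d0 wL) (sqnorm_Rintegral T0 cA cB d0 hL) E1.
rewrite -EFinM lee_fin => hKw.
apply: le_trans (le_trans hKw _); last first.
  rewrite ler_wpM2r ?ler_norm//; apply: Rintegral_ge0 => x [xD _]; exact: (qform_ge0 cs).
have sD : `[0, b] `<=` D := hointerval_seg bD.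
apply: (@le_trans _ _ (\int[mu]_(x in `[0, b]) Q x (pc (w x)) (qc (w x)))).
  rewrite /headint -RintegralZl//; last by have [] := cs_itg cs bD.
  rewrite le_eqVlt; apply/orP; left; apply/eqP; apply: eq_Rintegral => x /set_mem /=.
  by rewrite in_itv/= => /wE[-> ->]; rewrite /qform; ring.
by apply: Rintegral_ge0_subset => // x xD; exact: (qform_ge0 cs).
Qed.

(** The second formula is the increment from 0. In the first one the increment up to [b] leaves the
    term [pc (v b)], which [end_defect] sends to 0 because [AA b] stays away from 0; this covers the
    limit point case, where the domain imposes nothing at [T]. *)
Lemma graph_kernel v g t : G v g -> D t ->
  pc (v t) = \int[mu]_(x in tail T t) (C x * pc (g x) + B x * qc (g x)) /\
  qc (v t) = \int[mu]_(x in `[0, t]) (A x * pc (g x) + C x * qc (g x)).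
Proof.
move=> Gv tD; have t0 : 0 <= t by case: tD.
have [vL gL dv v0 bv] := (graphP _ _).1 Gv; have [mp mq iQ] := (L2P _).1 gL.
have [iL iM inc] := graph_seg tD Gv; split; last first.
  by have [_ ->] := inc 0 t (lexx 0) t0 (lexx t); rewrite v0 add0r.
have [K K0 hK] := end_defect.
have [b1 b10 b1D] := hointerval_gt (D_0 cs).
have A1 : 0 < AA b1.
  apply: (seg_gt0 (t := b1)) => //; first by have [] := cs_itg cs b1D.
  by move=> x xb; exact/(cs_A0 cs)/(D_seg b1D xb).
apply/eqP; rewrite -subr_eq0 -normr_le0; apply/ler_addgt0Pr => e e0; rewrite add0r.
have e2 : 0 < e / 2 by rewrite divr_gt0.
(* Divided by [AA b1], the bound of [end_defect] at this tail size gives [|pc (v b)| <= e / 2]. *)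
have e3 : 0 < (e / 2) ^+ 2 * AA b1 / (K + 1).
  by rewrite divr_gt0 ?ltr_wpDl// mulr_gt0 ?exprn_gt0.
have [b2 b2D h2] := tail_small T0 iQ e3.
have [b3 b3D h3] := tail_small T0 iL e2.
pose b := Num.max (Num.max t b1) (Num.max b2 b3).
have Dm (x y : R) : D x -> D y -> D (Num.max x y) by case: (leP x y).
have bD : D b by rewrite /b; apply: (Dm); apply: (Dm).
have tb : t <= b by rewrite /b !le_max lexx.
have [_ _ incb] := graph_seg bD Gv.
have [-> _] := incb t b t0 tb (lexx b).
rewrite (Rintegral_tail_split t0 tb bD iL) opprD addrA addrK.
apply: le_trans (ler_normB _ _) _; rewrite [leRHS](splitr e); apply: lerD; last first.
  apply: le_trans (h3 b bD ltac:(by rewrite /b !le_max lexx !orbT)).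
  apply: Rintegral_norm_le => //; first exact: measurable_tail.
  - by apply: itg_measurable; exact: itg_tail.
  - by apply: itg_norm; [exact: measurable_tail|exact: itg_tail].
have hb := hK v g b Gv bD.
have h2b := h2 b bD ltac:(by rewrite /b !le_max lexx !orbT).
have h2c : \int[mu]_(x in tail T b) Q x (pc (g x)) (qc (g x)) <= (e / 2) ^+ 2 * AA b1 / (K + 1).
  apply: le_trans h2b; apply: Rintegral_le; first exact: measurable_tail.
  - exact: itg_tail.
  - by apply: itg_norm; [exact: measurable_tail|exact: itg_tail].
  - by move=> x _; exact: ler_norm.
have A1b : AA b1 <= AA b.
  by apply: (AA_le cs bD (ltW b10)); rewrite /b !le_max lexx !orbT.
rewrite -ler_sqr ?nnegrE//; last exact: ltW.
rewrite real_normK ?num_real// -(ler_pM2r A1).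
apply: (@le_trans _ _ (pc (v b) ^+ 2 * AA b)); first by rewrite ler_wpM2l ?sqr_ge0.
apply: le_trans hb _.
apply: (@le_trans _ _ (K * ((e / 2) ^+ 2 * AA b1 / (K + 1)))); first by rewrite ler_wpM2l.
rewrite mulrA ler_pdivrMr ?ltr_wpDl// [leLHS]mulrC ler_wpM2l ?lerDl//.
by rewrite mulr_ge0 ?sqr_ge0// ltW.
Qed.

End DiracKernel.

(** * From the Hilbert-Schmidt norm to the integrable density *)

Section HilbertSchmidt.
Context {R : realType}.
Notation mu := (@lebesgue_measure R).
Local Notation itg D f := (mu.-integrable D (EFin \o (f : R -> R))).

Lemma Rintegral_glue (T : \bar R) t (f1 f2 : R -> R) : hointerval T t ->
  itg `[0, t] f1 -> itg (hointerval T) f2 ->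
  itg (hointerval T) (fun x => if x < t then f1 x else f2 x) /\
  \int[mu]_(x in hointerval T) (if x < t then f1 x else f2 x) =
    \int[mu]_(x in `[0, t]) f1 x + \int[mu]_(x in tail T t) f2 x.
Proof.
move=> tD i1 i2; have mD := @measurable_hointerval R T.
have mt : measurable (tail T t) by exact: measurable_tail.
have st : (`[0%R, t[%classic : set R) `<=` `[0, t].
  by move=> x /=; rewrite !in_itv/= => /andP[-> /ltW].
have i1' : itg `[0, t[ f1 by apply: itgS i1.
have j1 : itg (hointerval T) (f1 \_ `[0, t[).
  by apply: itgS (@subsetT _ _) _ => //; exact: (itg_patch _ _).1.
have j2 : itg (hointerval T) (f2 \_ (tail T t)).
  by apply: itgS (@subsetT _ _) _ => //; apply: (itg_patch _ mt).1; exact: itg_tail.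
have E x : hointerval T x ->
    (f1 \_ `[0, t[) x + (f2 \_ (tail T t)) x = if x < t then f1 x else f2 x.
  move=> xD; rewrite /patch; have [xt|tx] := ltP x t.
    rewrite mem_set ?memNset ?addr0//=; first by case; rewrite leNgt xt.
    by rewrite in_itv/= xt andbT; case: xD.
  by rewrite memNset ?mem_set ?add0r//= in_itv/= ltNge tx andbF.
split; first by apply: itg_eq (itgD mD j1 j2).
rewrite -(Rintegral_itv_bndo_bndc i1').
have -> : \int[mu]_(x in `[0, t[) f1 x = \int[mu]_(x in hointerval T) (f1 \_ `[0, t[) x.
  rewrite Rintegral_mkcond [RHS]Rintegral_mkcond; apply: eq_Rintegral => x _.
  rewrite /patch; case: ifP => xt; [rewrite mem_set//|by case: ifP].
  by apply: (hointerval_seg tD); apply: st; exact: set_mem.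
have -> : \int[mu]_(x in tail T t) f2 x = \int[mu]_(x in hointerval T) (f2 \_ (tail T t)) x.
  rewrite Rintegral_mkcond [RHS]Rintegral_mkcond; apply: eq_Rintegral => x _.
  rewrite /patch; case: ifP => xt; [rewrite mem_set//|by case: ifP].
  by apply: tail_sub; exact: set_mem xt.
by rewrite -RintegralD//; apply: eq_Rintegral => x /set_mem xD; rewrite E.
Qed.

Context {T : \bar R} {W : R -> 'M[R]_2} {u0 u1 : 'cV[R]_2} (T0 : (0 < T)%E)
  (cA : conditionA T W) (cB : conditionB T W) (d0 : wedge u0 u1 != 0).
Local Notation D := (hointerval T).
Local Notation uh := (dual_vector u0 u1).
Local Notation pc := (@fst_coord R u0 u1).
Local Notation qc := (@snd_coord R u0).
Local Notation A := (@coefA R W u0).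
Local Notation B := (@coefB R W u0 u1).
Local Notation C := (@coefC R W u0 u1).
Local Notation Q := (qform A B C).
Local Notation AA := (headint A).
Local Notation BB := (tailint T B).
Local Notation G := (dirac_graph T W u0 u1).
Let cs : canonical_system T A B C := dirac_canonical_system T0 cA cB d0.
Let mD : measurable D := @measurable_hointerval R T.
Let L2P := L2E T0 cA cB d0.
Context (iB : itg D B).

(** Density of the span supplies a good approximation, and replacing its coefficients by the Fourier
    ones can only improve it. *)
Lemma parseval_le (e : nat -> R -> 'cV[R]_2) h (eps : R) : orthonormal_basis T W e ->
  L2 T W h -> 0 < eps ->
  exists n, inner T W h h <= eps + \sum_(k < n) inner T W h (e k) ^+ 2.
Proof.
move=> [eL orth dense] hL e0; have [n [c hc]] := dense h hL eps e0.
have sL : L2 T W (fun t => h t - \sum_(k < n) c k *: e k t).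
  by apply: (L2B T0 cA cB d0) => //; exact: (L2_sum T0 cA cB d0).
move: hc; rewrite (sqnorm_inner T0 cA cB d0)// lte_fin => hc.
exists n; rewrite -lerBlDr; apply: le_trans (ltW hc).
exact: (inner_subr_ge T0 cA cB d0).
Qed.

(* Parseval's identity for [alpha *: uh] on [[t, T)] and [beta *: u0] on [[0, t)]. *)
Lemma kernel_rows (e w : nat -> R -> 'cV[R]_2) t (al be eps : R) : orthonormal_basis T W e ->
  (forall n, pc (w n t) = \int[mu]_(x in tail T t) (C x * pc (e n x) + B x * qc (e n x)) /\
             qc (w n t) = \int[mu]_(x in `[0, t]) (A x * pc (e n x) + C x * qc (e n x))) ->
  D t -> 0 < eps ->
  exists n, al ^+ 2 * BB t + be ^+ 2 * AA t <=
    eps + \sum_(k < n) (al * pc (w k t) + be * qc (w k t)) ^+ 2.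
Proof.
move=> eB wE tD e0; pose h x : 'cV[R]_2 := (if x < t then be else 0) *: u0 + (if x < t then 0 else al) *: uh.
have hp x : pc (h x) = if x < t then be else 0 by have [] := coordsE d0 (if x < t then be else 0) (if x < t then 0 else al).
have hq x : qc (h x) = if x < t then 0 else al by have [] := coordsE d0 (if x < t then be else 0) (if x < t then 0 else al).
have [iA _ _] := cs_itg cs tD.
have [i1 E1] := Rintegral_glue tD (itgZ (be ^+ 2) (measurable_itv `[0, t]) iA) (itgZ (al ^+ 2) mD iB).
have mif (a b : R) : measurable_fun D (fun x => if x < t then a else b).
  by apply: measurable_ifD => //; apply: measurable_fun_ltr.
have QE x : D x -> (if x < t then be ^+ 2 * A x else al ^+ 2 * B x) = Q x (pc (h x)) (qc (h x)).
  by move=> xD; rewrite hp hq /qform; case: ifP => _; ring.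
have hL : L2 T W h.
  apply/L2P; split.
  - by under eq_fun do rewrite hp; exact: mif.
  - by under eq_fun do rewrite hq; exact: mif.
  - exact: (itg_eq mD QE i1).
have hh : inner T W h h = al ^+ 2 * BB t + be ^+ 2 * AA t.
  rewrite -RintegralZl//; last 2 first.
  - exact: measurable_tail.
  - exact: itg_tail.
  rewrite -RintegralZl// addrC -E1; apply: eq_Rintegral => x /set_mem xD.
  by rewrite QE// (qform_coords cA d0).
have [eL _ _] := eB.
have he k : inner T W h (e k) = al * pc (w k t) + be * qc (w k t).
  have [mp mq iQ] := (L2P _).1 (eL k).
  have [iL _] := csB cs iB (@subset_refl _ _) mD mp mq iQ.
  have sD : `[0, t] `<=` D := hointerval_seg tD.
  have mS (f : R -> R) : measurable_fun D f -> measurable_fun `[0, t] f.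
    exact: measurable_funS.
  have [iM _] := csA cs sD (measurable_itv _) (mS _ mp) (mS _ mq) iA (itgS mD (measurable_itv _) sD iQ).
  have [_ E2] := Rintegral_glue tD (itgZ be (measurable_itv `[0, t]) iM) (itgZ al mD iL).
  have [-> ->] := wE k.
  rewrite -RintegralZl//; last 2 first.
  - exact: measurable_tail.
  - exact: itg_tail.
  rewrite -[be * _]RintegralZl// addrC -E2; apply: eq_Rintegral => x /set_mem xD.
  by rewrite (bform_coords cA d0)// hp hq; case: ifP => _; ring.
have [n hn] := parseval_le eB hL e0; exists n; rewrite -hh.
by under eq_bigr do rewrite -he.
Qed.

(** Complete the square: [Q = A * (p + C / A * q) ^+ 2 + (B - C ^+ 2 / A) * q ^+ 2]. [kernel_rows]
    applies to each of the two linear forms, and the weighted sum of the results is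
    [A * BB + B * AA]. *)
Lemma density_le_series (e w : nat -> R -> 'cV[R]_2) t : orthonormal_basis T W e ->
  (forall n, pc (w n t) = \int[mu]_(x in tail T t) (C x * pc (e n x) + B x * qc (e n x)) /\
             qc (w n t) = \int[mu]_(x in `[0, t]) (A x * pc (e n x) + C x * qc (e n x))) ->
  D t -> ((hs_density T A B t)%:E <= \sum_(n <oo) (Q t (pc (w n t)) (qc (w n t)))%:E)%E.
Proof.
move=> eB wE tD; have A0 := cs_A0 cs tD; have B0 := cs_B0 cs tD; have C2 := cs_C2 cs tD.
apply/lee_addgt0Pr => eps e0.
(* The two estimates are weighted by [A] and [B - C ^+ 2 / A], whose sum is at most [A + B]. *)
pose d := eps / (A t + B t).
have dp : 0 < d by rewrite divr_gt0// addr_gt0.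
have [n1 h1] := kernel_rows 1 (C t / A t) eB wE tD dp.
have [n2 h2] := kernel_rows 0 1 eB wE tD dp.
pose n := maxn n1 n2.
have mono m (x y z : R) : (m <= n)%N ->
    z <= d + \sum_(k < m) (x * pc (w k t) + y * qc (w k t)) ^+ 2 ->
    z <= d + \sum_(k < n) (x * pc (w k t) + y * qc (w k t)) ^+ 2.
  move=> mn h; apply: le_trans h _; rewrite lerD2l.
  rewrite (big_ord_widen n (fun k => (x * pc (w k t) + y * qc (w k t)) ^+ 2) mn).
  by rewrite [leRHS](bigID (fun i : 'I_n => (i < m)%N))/= lerDl sumr_ge0// => k _; rewrite sqr_ge0.
have {}h1 := mono _ _ _ _ (leq_maxl _ _) h1.
have {}h2 := mono _ _ _ _ (leq_maxr _ _) h2.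
apply: (@le_trans _ _ ((\sum_(0 <= k < n) (Q t (pc (w k t)) (qc (w k t)))%:E)%R + eps%:E)%E); last first.
  by apply: leeD => //; apply: nneseries_lim_ge => k _ _; rewrite lee_fin (qform_ge0 cs).
rewrite sumEFin -EFinD lee_fin big_mkord.
pose c := B t - C t ^+ 2 / A t.
have c0 : 0 <= c by rewrite subr_ge0 ler_pdivrMr// mulrC ltW.
have k1 := ler_wpM2l (ltW A0) h1; have k2 := ler_wpM2l c0 h2.
have S : \sum_(k < n) Q t (pc (w k t)) (qc (w k t)) =
    A t * (\sum_(k < n) (1 * pc (w k t) + C t / A t * qc (w k t)) ^+ 2) +
    c * (\sum_(k < n) (0 * pc (w k t) + 1 * qc (w k t)) ^+ 2).
  rewrite !mulr_sumr -big_split; apply: eq_bigr => k _ /=; rewrite /qform /c.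
  by field; rewrite gt_eqF.
have E : hs_density T A B t = A t * (1 ^+ 2 * BB t + (C t / A t) ^+ 2 * AA t) +
    c * (0 ^+ 2 * BB t + 1 ^+ 2 * AA t).
  by rewrite /hs_density /c; field; rewrite gt_eqF.
rewrite E; apply: le_trans (lerD k1 k2) _.
rewrite !mulrDr addrACA -S addrC lerD2l -mulrDl.
apply: (@le_trans _ _ ((A t + B t) * d)); last by rewrite /d mulrC divfK// gt_eqF// addr_gt0.
rewrite ler_wpM2r ?(ltW dp)// lerD2l /c gerBl divr_ge0 ?sqr_ge0//; exact: ltW.
Qed.

Lemma measurable_hs_density : measurable_fun D (hs_density T A B).
Proof.
apply: (measurable_on_hointerval T0) => b bD; have [iA iB' _] := cs_itg cs bD.
have mS (f : R -> R) : measurable_fun D f -> measurable_fun `[0, b] f.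
  by apply: measurable_funS => //; exact: hointerval_seg.
have mA := acd_measurable (acd_integral 0 iA); have mB := acd_measurable (acd_integral 0 iB').
apply: measurable_funD; apply: measurable_funM; [exact: (mS _ (cs_mA cs))| |exact: (mS _ (cs_mB cs))|].
  have m1 : measurable_fun `[0, b] (fun t => \int[mu]_(x in D) B x - (0 + \int[mu]_(x in `[0, t]) B x)).
    by apply: measurable_funB => //; exact: measurable_cst.
  apply: eq_measurable_fun m1 => t; rewrite inE/= in_itv/= => tb.
  by rewrite (Rintegral_D_split (D_seg bD tb) iB) add0r addrAC subrr add0r.
by apply: eq_measurable_fun mA => t _; rewrite add0r.
Qed.

Theorem dirac_hs_system : has_Hilbert_Schmidt_inverse T W u0 u1 -> hs_system T A B C.
Proof.
move=> [_ surj bd [e [w [eB ew wS]]]]; split=> //.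
have wE t : D t -> forall n,
    pc (w n t) = \int[mu]_(x in tail T t) (C x * pc (e n x) + B x * qc (e n x)) /\
    qc (w n t) = \int[mu]_(x in `[0, t]) (A x * pc (e n x) + C x * qc (e n x)).
  by move=> tD n; exact: (graph_kernel T0 cA cB d0 iB surj bd (ew n) tD).
have mQ n : measurable_fun D (fun t => Q t (pc (w n t)) (qc (w n t))).
  have [wL _ _ _ _] := ew n; have [mp mq _] := (L2P _).1 wL.
  exact: (measurable_qform cs).
apply/itg_ltyP => //; first exact: measurable_hs_density.
  by move=> x xD; exact: (hs_density_ge0 cs).
apply: le_lt_trans wS.
have -> : (\sum_(n <oo) sqnorm T W (w n) =
    \int[mu]_(t in D) \sum_(n <oo) (Q t (pc (w n t)) (qc (w n t)))%:E)%E.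
  rewrite integral_nneseries//; last 2 first.
  - by move=> n; apply/measurable_EFinP; exact: mQ.
  - by move=> n x xD; rewrite lee_fin (qform_ge0 cs).
  by apply: eq_eseriesr => n _; rewrite (sqnormE cA d0).
apply: ge0_le_integral => //.
- by move=> x xD; rewrite lee_fin (hs_density_ge0 cs).
- by apply/measurable_EFinP; exact: measurable_hs_density.
- apply: (ge0_emeasurable_sum (P := xpredT)) => [n x xD _|n _].
    by rewrite lee_fin (qform_ge0 cs).
  by apply/measurable_EFinP; exact: mQ.
- by move=> x xD; exact: (density_le_series eB (wE x xD) xD).
Qed.

End HilbertSchmidt.

(** * The spectrum *)

Section Spectrum.
Context {R : realType}.
Notation mu := (@lebesgue_measure R).
Local Notation itg D f := (mu.-integrable D (EFin \o (f : R -> R))).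
Context {T : \bar R} {W : R -> 'M[R]_2} {u0 u1 : 'cV[R]_2} (T0 : (0 < T)%E)
  (cA : conditionA T W) (cB : conditionB T W) (d0 : wedge u0 u1 != 0).
Local Notation D := (hointerval T).
Local Notation uh := (dual_vector u0 u1).
Local Notation pc := (@fst_coord R u0 u1).
Local Notation qc := (@snd_coord R u0).
Local Notation A := (@coefA R W u0).
Local Notation B := (@coefB R W u0 u1).
Local Notation C := (@coefC R W u0 u1).
Local Notation Q := (qform A B C).
Local Notation G := (dirac_graph T W u0 u1).
Local Notation cG := (cdirac_graph T W u0 u1).
Local Notation I := (bool * bool * R)%type.
Local Notation linA := (@linA R A C).
Local Notation linB := (@linB R B C).
Local Notation Kop := (@Kop R T A B C).
Local Notation energy := (@energy R T A B C).
Local Notation cL2fun := (@cL2fun R T A B C).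
Let cs : canonical_system T A B C := dirac_canonical_system T0 cA cB d0.
Let mD : measurable D := @measurable_hointerval R T.
Let graphP := dirac_graph_coords T0 cA d0.
Let L2P := L2E T0 cA cB d0.
Context (hs : hs_system T A B C).
Let iB : itg D B := hs_iB hs.
Context (hs_surj : forall g, L2 T W g -> exists v, G v g)
  (hs_bd : exists K : R, forall v g, G v g -> (sqnorm T W v <= K%:E * sqnorm T W g)%E).
Implicit Types (v g : R -> 'cV[R[i]]_2) (u h : I -> R).

Definition coord_fun v (i : I) : R := let: (j, k, t) := i in
  let x := (if j then im_part v else re_part v) t in if k then qc x else pc x.
Local Notation idx := coord_fun.

Definition fun_of_coords u t : 'cV[R[i]]_2 := \col_i
  ((u (false, false, t) * u0 i 0 + u (false, true, t) * uh i 0) +i*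
   (u (true, false, t) * u0 i 0 + u (true, true, t) * uh i 0))%C.
Local Notation mk := fun_of_coords.

Let combE a b (x y : 'cV[R]_2) i : (a *: x + b *: y) i 0 = a * x i 0 + b * y i 0.
Proof. by rewrite [LHS]mxE [X in X + _ = _]mxE [X in _ + X = _]mxE. Qed.

Lemma coord_funK u : idx (mk u) = u.
Proof.
apply/funext => -[[j k] t]; rewrite /coord_fun.
have -> : (if j then im_part (mk u) else re_part (mk u)) t =
    u (j, false, t) *: u0 + u (j, true, t) *: uh.
  by apply: cV2P; rewrite combE; case: j; rewrite !mxE.
by have [p q] := coordsE d0 (u (j, false, t)) (u (j, true, t)); case: k.
Qed.

Lemma cL2E v : cL2 T W v <-> cL2fun (idx v).
Proof.
split=> [[/L2P[m1 m2 i1] /L2P[m3 m4 i2]]|[m i]].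
  by split=> [[] []|[]].
split; apply/L2P; split.
- exact: (m false false).
- exact: (m false true).
- exact: (i false).
- exact: (m true false).
- exact: (m true true).
- exact: (i true).
Qed.

Lemma csqnormE v : cL2 T W v ->
  csqnorm T W v = (energy (idx v) false + energy (idx v) true)%:E.
Proof.
by move=> [rL iL]; rewrite /csqnorm !(sqnorm_Rintegral T0 cA cB d0).
Qed.

Lemma coord_fun_eq0 v t : v t = 0 <-> forall j k, idx v (j, k, t) = 0.
Proof.
split=> [v0 j k|h].
  rewrite /coord_fun (_ : (if j then im_part v else re_part v) t = 0).
    by case: k; rewrite ?fst_coord0 ?snd_coord0.
  by apply/matrixP => i i'; case: j; rewrite !mxE v0 mxE.
have z j : (if j then im_part v else re_part v) t = 0.
  by apply: (coordsP d0); rewrite ?fst_coord0 ?snd_coord0; [exact: (h j false)|exact: (h j true)].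
have zr := z false; have zi := z true.
apply/matrixP => i i'; rewrite mxE; apply/eqP; rewrite eq_complex /=.
by move/matrixP/(_ i i'): zr; move/matrixP/(_ i i'): zi; rewrite !mxE => -> ->; rewrite eqxx.
Qed.

Lemma coord_fun_sub (z : R[i]) v g :
  idx (fun t => g t - z *: v t) = lincomb (-1) (zmul (complex.Re z) (complex.Im z) (idx v)) (idx g).
Proof.
apply/funext => -[[j k] t]; rewrite /lincomb /zmul /coord_fun.
have E : (if j then im_part (fun t => g t - z *: v t) else re_part (fun t => g t - z *: v t)) t =
    (- complex.Re z) *: (if j then im_part v else re_part v) t +
    ((- (if j then complex.Im z else - complex.Im z)) *: (if ~~ j then im_part v else re_part v) t +
     (if j then im_part g else re_part g) t).
  apply/matrixP => i i'; case: j; rewrite !mxE /=; case: z => a b;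
    case: (v t i i') => x y; case: (g t i i') => x' y' /=; ring.
by rewrite E; case: k; rewrite ?fst_coord_lin ?snd_coord_lin; ring.
Qed.

Lemma cgraph_kernel v g : cG v g -> [/\ cL2fun (idx v), cL2fun (idx g) &
  forall j k t, D t -> idx v (j, k, t) = Kop (idx g) (j, k, t)].
Proof.
move=> [Gr Gi]; have [vrL grL _ _ _] := Gr; have [viL giL _ _ _] := Gi.
have gL : cL2fun (idx g) by apply/cL2E.
split=> //; first by apply/cL2E.
move=> j k t tD.
have [r1 r2] := graph_kernel T0 cA cB d0 iB hs_surj hs_bd Gr tD.
have [i1 i2] := graph_kernel T0 cA cB d0 iB hs_surj hs_bd Gi tD.
case: k; last by rewrite (Kop_tail hs)//; case: j.
by case: j.
Qed.

Lemma kernel_cgraph h : cL2fun h -> cL2fun (Kop h) -> cG (mk (Kop h)) (mk h).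
Proof.
move=> hL kL.
have vL : cL2 T W (mk (Kop h)) by apply/cL2E; rewrite coord_funK.
have gL : cL2 T W (mk h) by apply/cL2E; rewrite coord_funK.
have kE j k t : (if k then qc else pc) ((if j then im_part (mk (Kop h)) else re_part (mk (Kop h))) t) = Kop h (j, k, t).
  by rewrite -[X in _ = X (j, k, t)]coord_funK; case: k.
have hE j k t : (if k then qc else pc) ((if j then im_part (mk h) else re_part (mk h)) t) = h (j, k, t).
  by rewrite -[X in _ = X (j, k, t)]coord_funK; case: k.
have main j : L2 T W ((if j then im_part (mk (Kop h)) else re_part (mk (Kop h)))) ->
    L2 T W ((if j then im_part (mk h) else re_part (mk h))) ->
    G (if j then im_part (mk (Kop h)) else re_part (mk (Kop h)))
      (if j then im_part (mk h) else re_part (mk h)).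
  move=> vL' gL'; apply/graphP; split=> //.
  - move=> b bD; have [dp dq] := Kop_acd hs j hL bD.
    have pE := kE j false; have qE := kE j true; have pE' := hE j false; have qE' := hE j true.
    under eq_fun do rewrite pE; under [X in _ /\ acdi _ _ X _]eq_fun do rewrite qE.
    split; [apply: acd_eq dp _|apply: acd_eq dq _] => t _;
      by rewrite pE' qE' /linA /linB.
  - by rewrite (kE j true) Kop_0.
  - move=> _; have pE := kE j false; have := Kop_vanishes hs j hL.
    by move=> h0 e e0; have [b bD hb] := h0 e e0; exists b => // t tD bt; rewrite pE; exact: hb.
by case: vL => ? ?; case: gL => ? ?; split; [exact: (main false)|exact: (main true)].
Qed.

Lemma Kop_ae u h : cL2fun u -> cL2fun h ->
  {ae mu, forall t, D t -> forall j k, u (j, k, t) = h (j, k, t)} ->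
  forall j k t, D t -> Kop u (j, k, t) = Kop h (j, k, t).
Proof.
move=> uL hL uh_ j k t tD; have [iu _] := cL2_linB hs j uL; have [ih _] := cL2_linB hs j hL.
case: k; last first.
  rewrite !(Kop_tail hs)//; apply: Rintegral_ae_eq.
  - exact: measurable_tail.
  - by apply: itg_measurable; exact: itg_tail.
  - by apply: itg_measurable; exact: itg_tail.
  - by apply: (ae_imp _ uh_) => x hx [xD _]; rewrite /linB !(hx xD).
have [iu' _] := cL2_linA hs j uL tD; have [ih' _] := cL2_linA hs j hL tD.
rewrite /Kop; apply: Rintegral_ae_eq => //; [exact: itg_measurable|exact: itg_measurable|].
by apply: (ae_imp _ uh_) => x hx /(hointerval_seg tD) xD; rewrite /linA !(hx xD).
Qed.

Lemma cL2fun_eq u h : cL2fun h -> (forall j k t, D t -> u (j, k, t) = h (j, k, t)) -> cL2fun u.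
Proof.
move=> [m i] E; split=> [j k|j].
  by apply: eq_measurable_fun (m j k) => t /set_mem tD; rewrite E.
by apply: (itg_eq mD _ (i j)) => t tD; rewrite !E.
Qed.

Lemma resolvent_setI (z : R[i]) :
  complex.Im z != 0 \/ ~ @eigenvalue R T A B C (complex.Re z) -> resolvent_set T W u0 u1 z.
Proof.
set a := complex.Re z; set b := complex.Im z => ne.
(* With [h = g - z v] the kernel formula reads [v = K (h + z v)], the equation solved by
   [resolvent_solve]. *)
have resid v g : cG v g -> forall j k t, D t -> idx v (j, k, t) =
    Kop (lincomb 1 (idx (fun t => g t - z *: v t)) (zmul a b (idx v))) (j, k, t).
  move=> Gvg; have [vL gL E] := cgraph_kernel Gvg => j k t tD; rewrite E//.
  congr (Kop _ _); apply/funext => i; rewrite coord_fun_sub /lincomb -/a -/b; ring.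
have rL v g : cG v g -> cL2fun (idx (fun t => g t - z *: v t)).
  move=> Gvg; have [vL gL E] := cgraph_kernel Gvg; rewrite coord_fun_sub.
  by apply: (cL2_comb hs) => //; exact: (cL2_zmul hs).
have [K K0 hK] := resolvent_solve hs ne.
split.
- move=> v g Gvg r0; apply: aeW => t tD; apply/coord_fun_eq0 => j k.
  have [vL gL E] := cgraph_kernel Gvg.
  apply: (resolvent_injective hs ne vL) => // {j k t tD}j k t tD.
  rewrite E//; apply: Kop_ae => //; first exact: (cL2_zmul hs).
  apply: (ae_imp _ r0) => x h xD {}j {}k.
  have := (coord_fun_eq0 (fun t => g t - z *: v t) x).1 (h xD) j k.
  by rewrite coord_fun_sub /lincomb mulN1r addrC => /eqP; rewrite subr_eq0 => /eqP.
- move=> h /cL2E hL; have [u [uL uE _]] := hK _ hL.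
  pose s := lincomb 1 (idx h) (zmul a b u).
  have sL : cL2fun s by apply: (cL2_comb hs) => //; exact: (cL2_zmul hs).
  have kL : cL2fun (Kop s) by apply: (cL2fun_eq uL) => j k t tD; rewrite uE.
  exists (mk (Kop s)), (mk s); split; first exact: kernel_cgraph.
  apply: aeW => t tD; apply/eqP; rewrite -subr_eq0; apply/eqP.
  pose r t := mk s t - z *: mk (Kop s) t.
  suff /coord_fun_eq0 : forall j k, idx (fun t => r t - 1 *: h t) (j, k, t) = 0 by rewrite scale1r.
  move=> j k; rewrite coord_fun_sub.
  have -> : idx r = lincomb (-1) (zmul a b (Kop s)) s by rewrite /r coord_fun_sub !coord_funK.
  have kE j' : Kop s (j', k, t) = u (j', k, t) by rewrite uE.
  have sE : s (j, k, t) = 1 * idx h (j, k, t) + zmul a b u (j, k, t) by [].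
  change (-1 * zmul 1 0 (idx h) (j, k, t) +
    (-1 * zmul a b (Kop s) (j, k, t) + s (j, k, t)) = 0).
  by rewrite sE /zmul !kE; case: (j); ring.
- exists (2 * K) => v g Gvg; have [vL gL E] := cgraph_kernel Gvg.
  have hL := rL v g Gvg; have [u [uL uE uK]] := hK _ hL.
  (* By injectivity [v] is the solution already constructed, so its energy bound transfers; the
     factor 2 in [2 * K] adds the real and the imaginary part. *)
  have vE j k t : D t -> idx v (j, k, t) = u (j, k, t).
    move=> tD; pose dl := lincomb (-1) u (idx v).
    have dL : cL2fun dl by apply: (cL2_comb hs).
    suff : dl (j, k, t) = 0.
      by rewrite /dl /lincomb mulN1r addrC => /eqP; rewrite subr_eq0 => /eqP.
    apply: (resolvent_injective hs ne dL) => // {j k t tD}j k t tD.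
    have zuL := cL2_zmul hs a b uL; have zvL := cL2_zmul hs a b vL.
    rewrite /dl {1}/lincomb uE// (resid v g)// zmul_comb.
    rewrite !(Kop_comb hs)//; ring.
  have eE j : energy (idx v) j = energy u j.
    by apply: eq_Rintegral => t /set_mem tD; rewrite !vE.
  have vL' : cL2 T W v by apply/cL2E.
  have hL' : cL2 T W (fun t => g t - z *: v t) by apply/cL2E.
  rewrite (csqnormE vL') (csqnormE hL') -EFinM lee_fin !eE.
  apply: le_trans (lerD (uK false) (uK true)) _.
  by rewrite le_eqVlt; apply/orP; left; apply/eqP; ring.
Qed.

Lemma eigenvalue_spectrum (l : R) : @eigenvalue R T A B C l -> spectrum T W u0 u1 l%:C%C.
Proof.
move=> [p [q [[sol iQ vp] p0 q0]]] [inj _ _].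
have [mp mq] := solution_measurable cs sol.
pose u (i : I) : R := let: (j, k, t) := i in if j then 0 else if k then q t else p t.
have uL : cL2fun u.
  split=> [[] k|[]].
  - exact: measurable_cst.
  - by case: k.
  - apply: (itg_eq mD (f := fun=> 0)) => [t _|]; first by rewrite /u /qform; ring.
    exact: integrable0.
  - exact: iQ.
have vE j k t : (if k then qc else pc) ((if j then im_part (mk u) else re_part (mk u)) t) = u (j, k, t).
  by rewrite -[X in _ = X (j, k, t)]coord_funK; case: k.
have [rL iL] : cL2 T W (mk u) by apply/cL2E; rewrite coord_funK.
pose g t := l%:C%C *: mk u t.
have reg t : re_part g t = l *: re_part (mk u) t.
  by apply: cV2P; rewrite !mxE /=; ring.
have img t : im_part g t = l *: im_part (mk u) t.
  by apply: cV2P; rewrite !mxE /=; ring.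
have gr : G (re_part (mk u)) (re_part g).
  apply/graphP; split=> //.
  - have := L2_lin T0 cA cB d0 l rL (L2_0 T0 cA cB d0).
    by under eq_fun do rewrite addr0 -reg.
  - move=> b bD; have [dp dq] := sol b bD.
    have pE := vE false false; have qE := vE false true; rewrite /= in pE qE.
    under eq_fun do rewrite pE; under [X in _ /\ acdi _ _ X _]eq_fun do rewrite qE.
    split; [apply: acd_eq dp _|apply: acd_eq dq _] => t _;
      rewrite reg fst_coordZ snd_coordZ pE qE; ring.
  - by rewrite (vE false true) /= q0.
  - by move=> _ e e0; have [b bD hb] := vp e e0; exists b => // t tD bt; rewrite (vE false false); exact: hb.
have gi : G (im_part (mk u)) (im_part g).
  have i0 : im_part (mk u) = fun=> 0.
    by apply/funext => t; apply: cV2P; rewrite !mxE /=; ring.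
  have i1 : im_part g = fun=> 0 by apply/funext => t; rewrite img i0 scaler0.
  rewrite i0 i1; apply/graphP; split.
  - exact: (L2_0 T0 cA cB d0).
  - exact: (L2_0 T0 cA cB d0).
  - move=> b bD; rewrite fst_coord0 snd_coord0.
    by split; apply: acd_eq (acd_cst 0 b 0) _ => t _; rewrite !mulr0 addr0 ?oppr0.
  - by rewrite snd_coord0.
  - move=> _ e e0; exists 0; first exact: (D_0 cs).
    by move=> t _ _; rewrite fst_coord0 normr0 ltW.
have v0 := inj _ _ (conj gr gi) (aeW _ (fun t _ => subrr _)).
(* Injectivity only says that the eigenfunction vanishes almost everywhere. As [p 0 = 1] and [p] is
   continuous, a point close to 0 where it vanishes gives the contradiction. *)
have [b b0 bD] := hointerval_gt (D_0 cs).
have [[acp _] _] := sol b bD.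
have [d d0' hd] := ac_small acp (e := 1 / 2) ltac:(lra).
have s0 : 0 < Num.min b d by rewrite lt_min b0.
have [x /andP[x0 xs] hx] := ae_itv_ex s0 v0.
move: xs; rewrite lt_min => /andP[xb xd].
have xD : D x by apply: hointerval_le bD (ltW x0) (ltW xb).
have := hd 0 x (lexx 0) (ltW x0) (ltW xb); rewrite subr0 p0 => /(_ xd).
have /(coord_fun_eq0 _ x).1/(_ false false) := hx xD.
rewrite coord_funK /u => ->; rewrite sub0r normrN normr1; lra.
Qed.

Theorem spectrumE : spectrum T W u0 u1 = [set l%:C%C | l in [set l | @eigenvalue R T A B C l]].
Proof.
apply/seteqP; split=> [z zs|_ [l el <-]]; last exact: eigenvalue_spectrum.
have [b0|b0] := eqVneq (complex.Im z) 0; last by exfalso; apply: zs; apply: resolvent_setI; left.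
have [el|nel] := pselect (@eigenvalue R T A B C (complex.Re z)); last first.
  by exfalso; apply: zs; apply: resolvent_setI; right.
by exists (complex.Re z) => //; case: z b0 {zs el} => a b /= ->.
Qed.

End Spectrum.

(** * The hyperbolic carousel *)

Section CayleyTransform.
Context {R : realType}.
Implicit Types (x y a r : R) (u : 'cV[R]_2).

Lemma cayleyE x y : 0 < y + 1 -> cayley (x +i* y)%C =
  ((x ^+ 2 + y ^+ 2 - 1) / (x ^+ 2 + (y + 1) ^+ 2) +i* (- 2 * x / (x ^+ 2 + (y + 1) ^+ 2)))%C.
Proof.
move=> y0; have n0 : x ^+ 2 + (y + 1) ^+ 2 != 0.
  by rewrite gt_eqF// ltr_wpDl ?sqr_ge0// exprn_gt0.
rewrite /cayley; set z := (X in _ / X).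
have z0 : z != 0.
  rewrite /z eq_complex /= negb_and; apply/orP; right; by rewrite gt_eqF.
apply: (mulIf z0); rewrite mulfVK// /z; apply/eqP; rewrite eq_complex /=.
by apply/andP; split; apply/eqP; field.
Qed.

Lemma sqmod_cayley x y : 0 < y ->
  1 - sqmod (cayley (x +i* y)%C) = 4 * y / (x ^+ 2 + (y + 1) ^+ 2).
Proof.
move=> y0; have y1 : 0 < y + 1 by rewrite ltr_wpDl ?ltW.
have n0 : x ^+ 2 + (y + 1) ^+ 2 != 0.
  by rewrite gt_eqF// ltr_wpDl ?sqr_ge0// exprn_gt0.
by rewrite cayleyE// /sqmod /=; field.
Qed.

(* The rotation speed in the disk is the value of [f / y * [[1, -x], [-x, x^2 + y^2]]] at
   [(cos (a / 2), - sin (a / 2))]. *)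
Lemma rotation_speed x y f (a : R) : 0 < y ->
  f * (sqmod (cis (a *+ 2) - cayley (x +i* y)%C) / (1 - sqmod (cayley (x +i* y)%C))) =
  f / y * (cos a ^+ 2 + 2 * x * cos a * sin a + (x ^+ 2 + y ^+ 2) * sin a ^+ 2).
Proof.
move=> y0; have y1 : 0 < y + 1 by rewrite ltr_wpDl ?ltW.
have n0 : x ^+ 2 + (y + 1) ^+ 2 != 0.
  by rewrite gt_eqF// ltr_wpDl ?sqr_ge0// exprn_gt0.
have yn0 : y != 0 by rewrite gt_eqF.
have c2 : cos a ^+ 2 = 1 - sin a ^+ 2 by rewrite -(cos2Dsin2 a) addrK.
rewrite sqmod_cayley// cayleyE// /sqmod /cis /= cos_mulr2n sin_mulr2n.
move: c2; move: (cos a) (sin a) => c s c2.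
move nE : (x ^+ 2 + (y + 1) ^+ 2) n0 => n n0.
have -> : (c ^+ 2 *+ 2 - 1 - (x ^+ 2 + y ^+ 2 - 1) / n) ^+ 2 + (c * s *+ 2 - - 2 * x / n) ^+ 2 =
   4 * y / n * ((c ^+ 2 + 2 * x * c * s + (x ^+ 2 + y ^+ 2) * s ^+ 2) / y); last first.
  by field; rewrite n0 yn0.
have -> : (c * s *+ 2 - - 2 * x / n) ^+ 2 = 4 * c ^+ 2 * s ^+ 2 + 8 * c * s * x / n + 4 * x ^+ 2 / n ^+ 2.
  by field.
have x2 : x ^+ 2 = n - (y + 1) ^+ 2 by rewrite -nE; ring.
by rewrite c2 x2; field; rewrite ?n0 ?yn0.
Qed.

(** The condition says that [u] has the direction [(cos a, - sin a)], whose boundary point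
    [- cos a / sin a] is mapped by the Cayley transform to the unit complex number of angle
    [2 a]. *)
Lemma cis_boundary u a : u != 0 ->
  cis (a *+ 2) = cayley_boundary (boundary_pt u) <-> cos a * u 1 0 + sin a * u 0 0 = 0.
Proof.
move=> u0; have c2 : cos a ^+ 2 = 1 - sin a ^+ 2 by rewrite -(cos2Dsin2 a) addrK.
rewrite /cis cos_mulr2n sin_mulr2n; move: c2; move: (cos a) (sin a) => c s c2.
rewrite /boundary_pt; case: eqVneq => [u10|u10] /=.
  have u00 : u 0 0 != 0 by apply: contra_neq u0 => h; apply: cV2P; rewrite mxE.
  rewrite u10 mulr0 add0r; split.
    move=> /eqP; rewrite eq_complex /= => /andP[/eqP h _].
    have /eqP : s ^+ 2 = 0 by move: h; rewrite c2 -mulr_natl; lra.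
    by rewrite sqrf_eq0 => /eqP ->; rewrite mul0r.
  move=> /eqP; rewrite mulf_eq0 (negbTE u00) orbF => /eqP s0.
  apply/eqP; rewrite eq_complex /= c2 s0 mulr0 mul0rn eqxx andbT; apply/eqP; ring.
set r := u 0 0 / u 1 0; have uE : u 0 0 = r * u 1 0 by rewrite /r divfK.
have n0 : r ^+ 2 + 1 != 0 by rewrite gt_eqF// ltr_wpDl ?sqr_ge0.
rewrite uE; have -> : c * u 1 0 + s * (r * u 1 0) = (c + r * s) * u 1 0 by ring.
rewrite cayleyE ?add0r// expr0n expr1n/= addr0.
split=> [/eqP|/eqP].
  rewrite eq_complex /= => /andP[/eqP h1 /eqP h2].
  suff /eqP : (c + r * s) ^+ 2 = 0 by rewrite sqrf_eq0 => /eqP ->; rewrite mul0r.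
  have h3 : c * s = - r / (r ^+ 2 + 1).
    by apply: (mulfI (x := 2)); rewrite ?pnatr_eq0// mulr_natl h2; field.
  have h4 : s ^+ 2 = 1 / (r ^+ 2 + 1).
    apply: (mulfI (x := -2)); rewrite ?oppr_eq0 ?pnatr_eq0//.
    transitivity ((c ^+ 2 *+ 2 - 1) - 1); first by rewrite c2 -mulr_natl; ring.
    by rewrite h1; field.
  rewrite (_ : (c + r * s) ^+ 2 = c ^+ 2 + 2 * r * (c * s) + r ^+ 2 * s ^+ 2); last by ring.
  by rewrite c2 h3 h4; field.
rewrite mulf_eq0 (negbTE u10) orbF addr_eq0 => /eqP cE.
have s2 : s ^+ 2 = 1 / (r ^+ 2 + 1).
  apply: (mulIf n0); rewrite mul1r mulVf//.
  by transitivity (c ^+ 2 + s ^+ 2); [rewrite cE; ring|rewrite c2; ring].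
apply/eqP; rewrite eq_complex /=; apply/andP; split; apply/eqP.
  by rewrite c2 s2 -mulr_natl; field.
rewrite cE -mulr_natl; transitivity (- 2 * r * s ^+ 2); first by ring.
by rewrite s2; field.
Qed.

Lemma boundary_angle u : u != 0 -> exists a, cos a * u 1 0 + sin a * u 0 0 = 0.
Proof.
move=> u0; have [u00|u00] := eqVneq (u 0 0) 0.
  by exists (pi / 2); rewrite u00 cos_pihalf mul0r mulr0 addr0.
exists (atan (- u 1 0 / u 0 0)); set a := atan _.
have c0 : cos a != 0.
  by rewrite gt_eqF// cos_gt0_pihalf// atan_gtNpi2 atan_ltpi2.
have : tan a = - u 1 0 / u 0 0 by rewrite /a atanK.
by rewrite /tan => /(congr1 (fun x => x * cos a)); rewrite divfK// => ->; field.
Qed.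

Lemma boundary_pt_neq u v : u != 0 -> v != 0 -> wedge u v != 0 -> boundary_pt u <> boundary_pt v.
Proof.
move=> u0 v0 w0 E; case/eqP: w0; move: E; rewrite /boundary_pt /wedge.
case: eqVneq => [->|u1]; case: eqVneq => [->|v1] //; first by rewrite mul0r mulr0 subrr.
move=> [] /(congr1 (fun x => x * u 1 0 * v 1 0)); rewrite divfK// => E.
by rewrite E; field.
Qed.

End CayleyTransform.

(** * A locally finite set is determined by its counts *)

Section CountingDetermines.
Context {R : realType}.
Implicit Types (L : set R) (N : R -> R).

Lemma counting_eq0 (S : set R) : counting S = 0%E :> \bar R -> S = set0.
Proof.
rewrite /counting; case: asboolP => // fS [] /eqP; rewrite pnatr_eq0 finmap.cardfs_eq0 => /eqP.
exact: fset_set_set0.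
Qed.

Lemma counting_fin (S : set R) (c : R) : counting S = c%:E -> finite_set S.
Proof. by rewrite /counting; case: asboolP. Qed.

(** A point [l] of [L] outside [L'] has a window []a, l]] free of the finitely many points of [L']
    in []l - 1, l]]; the common count of this window would be 0. *)
Lemma counting_subset L L' N :
  (forall a b, a < b -> counting (L `&` `]a, b]%classic) = (N b - N a)%:E) ->
  (forall a b, a < b -> counting (L' `&` `]a, b]%classic) = (N b - N a)%:E) ->
  L `<=` L'.
Proof.
move=> hL hL' l Ll; apply: contrapT => nL'.
pose F := L' `&` `]l - 1, l]%classic.
have fF : finite_set F by apply: (counting_fin (hL' (l - 1) l _)); lra.
have oF : open (~` F).
  apply: closed_openC; move: F fF; apply/accessible_finite_set_closed.
  by apply: hausdorff_accessible; exact: Rhausdorff.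
have [e /= e0 he] : nbhs l (~` F) by apply: open_nbhs_nbhs; split=> // -[].
pose a := l - Num.min (e / 2) (1 / 2).
have m0 : 0 < Num.min (e / 2) (1 / 2) by rewrite lt_min !divr_gt0.
have al : a < l by rewrite /a ltrBlDr ltrDl.
have E0 : L' `&` `]a, l]%classic = set0.
  apply/seteqP; split=> // t [L't]; rewrite /= in_itv/= => /andP[at_ tl].
  have m1 : Num.min (e / 2) (1 / 2) <= e / 2 by rewrite ge_min lexx.
  have m2 : Num.min (e / 2) (1 / 2) <= 1 / 2 by rewrite ge_min lexx orbT.
  have tF : F t.
    split=> //; rewrite /= in_itv/= tl andbT; move: at_; rewrite /a; lra.
  apply: (he t _ tF); rewrite /ball/= ger0_norm ?subr_ge0//.
  by move: at_; rewrite /a; lra.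
have : counting (L `&` `]a, l]%classic) = 0%E :> \bar R.
  by rewrite hL// -hL'// E0 /counting asboolT ?fset_set0//; exact: finite_set0.
move=> /counting_eq0/seteqP[] /(_ l) + _; apply; split=> //.
by rewrite /= in_itv/= al lexx.
Qed.

End CountingDetermines.

(** * The carousel of a Dirac operator *)

Section Carousel.
Context {R : realType}.
Notation mu := (@lebesgue_measure R).
Local Notation itg D f := (mu.-integrable D (EFin \o (f : R -> R))).
Context {T : \bar R} {x y f : R -> R} {u0 u1 : 'cV[R]_2} (T0 : (0 < T)%E).
Local Notation D := (hointerval T).
Local Notation W := (dirac_weight x y f).
Context (yf : forall t, D t -> 0 < y t /\ 0 < f t)
  (cA : conditionA T W) (cB : conditionB T W) (d0 : wedge u0 u1 != 0).
Local Notation gam := (fun t => (x t +i* y t)%C).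
Local Notation pc := (@fst_coord R u0 u1).
Local Notation qc := (@snd_coord R u0).
Local Notation A := (@coefA R W u0).
Local Notation B := (@coefB R W u0 u1).
Local Notation C := (@coefC R W u0 u1).
Let cs : canonical_system T A B C := dirac_canonical_system T0 cA cB d0.
Let mD : measurable D := @measurable_hointerval R T.

Let u0_neq0 : u0 != 0.
Proof. by apply: contra_neq d0 => ->; rewrite /wedge !mxE; ring. Qed.

Let u1_neq0 : u1 != 0.
Proof. by apply: contra_neq d0 => ->; rewrite /wedge !mxE; ring. Qed.

Let WE t : [/\ W t 0 0 = f t / y t, W t 0 1 = - (f t / y t * x t),
  W t 1 0 = - (f t / y t * x t) & W t 1 1 = f t / y t * (x t ^+ 2 + y t ^+ 2)].
Proof. by rewrite /dirac_weight !mxE /= mulr1 mulrN. Qed.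

(** In the standard frame [wedge e0 e1 = -1], so the coordinates of [v] are [v 0 0] and [- v 1 0].
    This sign matches the direction [(cos a, - sin a)] of [cis_boundary]. *)
Let e0 : 'cV[R]_2 := \col_i (i == 0)%:R.
Let e1 : 'cV[R]_2 := \col_i (i == 1)%:R.
Let de : wedge e0 e1 = -1.
Proof. by rewrite /wedge !mxE /=; ring. Qed.
Let de0 : wedge e0 e1 != 0.
Proof. by rewrite de oppr_eq0 oner_eq0. Qed.
Let pe v : @fst_coord R e0 e1 v = v 0 0.
Proof. by rewrite /fst_coord /dual_vector de /wedge !mxE /= invrN1; ring. Qed.
Let qe v : @snd_coord R e0 v = - v 1 0.
Proof. by rewrite /snd_coord /wedge !mxE /=; ring. Qed.
Local Notation Ae := (@coefA R W e0).
Local Notation Be := (@coefB R W e0 e1).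
Local Notation Ce := (@coefC R W e0 e1).
Let cse : canonical_system T Ae Be Ce := dirac_canonical_system T0 cA cB de0.

Let QeE t c s : qform Ae Be Ce t c s =
  f t / y t * (c ^+ 2 + 2 * x t * c * s + (x t ^+ 2 + y t ^+ 2) * s ^+ 2).
Proof.
have [w00 w01 w10 w11] := WE t.
rewrite /qform /coefA /coefB /coefC /dual_vector de !bformE w00 w01 w10 w11 !mxE /= invrN1.
by ring.
Qed.

(** In either frame the coordinate equations express the same vector equation [J v' = l W v],
    through which the change of frame passes. *)
Lemma solution_frame l (v : R -> 'cV[R]_2) :
  solution T Ae Be Ce l (fun t => @fst_coord R e0 e1 (v t)) (fun t => @snd_coord R e0 (v t)) ->
  solution T A B C l (fun t => pc (v t)) (fun t => qc (v t)).
Proof.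
move=> sol; have := (dirac_acdP T0 cA de0 v (fun t => l *: v t)).2.
have h : forall b, D b ->
   acd b (fun t => @fst_coord R e0 e1 (v t))
    (fun t => - (Ce t * @fst_coord R e0 e1 (l *: v t) + Be t * @snd_coord R e0 (l *: v t))) /\
   acd b (fun t => @snd_coord R e0 (v t))
    (fun t => Ae t * @fst_coord R e0 e1 (l *: v t) + Ce t * @snd_coord R e0 (l *: v t)).
  move=> b bD; have [dp dq] := sol b bD.
  by split; [apply: acd_eq dp _|apply: acd_eq dq _] => t _; rewrite fst_coordZ snd_coordZ; ring.
move=> /(_ h)/(dirac_acdP T0 cA d0) h' b bD; have [dp dq] := h' b bD.
by split; [apply: acd_eq dp _|apply: acd_eq dq _] => t _; rewrite fst_coordZ snd_coordZ; ring.
Qed.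

Let speedE t l phi : D t ->
  2 * f t * l * (sqmod (cis phi - cayley (gam t)) / (1 - sqmod (cayley (gam t)))) =
  2 * (l * qform Ae Be Ce t (cos (phi / 2)) (sin (phi / 2))).
Proof.
move=> tD; have [y0 _] := yf tD; have := rotation_speed (x t) (f t) (phi / 2) y0.
rewrite mulr2n -splitr -QeE => <-; ring.
Qed.

Lemma carousel_angleP eta l phi : carousel_angle T gam eta f l phi <->
  cis (phi 0) = cayley_boundary eta /\ forall b, D b ->
    acd b phi (fun t => 2 * (l * qform Ae Be Ce t (cos (phi t / 2)) (sin (phi t / 2)))).
Proof.
split=> [[h0 ac]|[h0 h]].
  move=> /(ae_onP T0) dphi; split=> // b bD; split; first exact: ac.
  apply: (ae_imp _ (dphi b bD)) => t ht tb; have [dr] := ht tb.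
  rewrite speedE; last exact: D_seg tb.
  by move=> <-; apply: DeriveDef => //; rewrite derive1E.
split=> //; first by move=> b bD; have [] := h b bD.
apply/(ae_onP T0) => b bD; have [_ dphi] := h b bD.
apply: (ae_imp _ dphi) => t ht tb; have [dr E] := ht tb.
by rewrite speedE; [rewrite derive1E|exact: D_seg tb].
Qed.

Lemma carousel_angle_exists l (u : 'cV[R]_2) : u != 0 ->
  exists phi, carousel_angle T gam (boundary_pt u) f l phi.
Proof.
move=> un0; have [a ha] := boundary_angle un0.
have [th [th0 dth]] := angle_exists cse a l.
exists (fun t => 2 * th t); apply/carousel_angleP; split.
  by rewrite th0 mulr_natl; apply/cis_boundary.
move=> b bD; apply: acd_eq (acdZ 2 (dth b bD)) _ => t _.
by rewrite (_ : 2 * th t / 2 = th t)//; field.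
Qed.

(** Half the carousel angle is the Prüfer angle of some [v] in the standard frame. Starting at the
    point of [u0] means [qc (v 0) = 0], and visiting that of [u1] means that [v t] is parallel to
    [u1], that is [pc (v t) = 0]; dividing by [pc (v 0)] gives the normalised solution. *)
Lemma carousel_hits l phi : carousel_angle T gam (boundary_pt u0) f l phi ->
  [set t | D t /\ cis (phi t) = cayley_boundary (boundary_pt u1)] = @hits R T A B C l.
Proof.
move=> /carousel_angleP[h0 dphi]; pose th t := phi t / 2.
have thE t : phi t = th t *+ 2 by rewrite /th mulr2n -splitr.
have ath : angle T Ae Be Ce (th 0) l th.
  split=> // b bD; apply: acd_eq (_ : acd b th (fun t => 2^-1 * (2 * (l * qform Ae Be Ce t (cos (th t)) (sin (th t)))))) _.
    have := acdZ 2^-1 (dphi b bD); rewrite (_ : (fun t => 2^-1 * phi t) = th)//.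
    by apply/funext => t; rewrite mulrC.
  by move=> t _; rewrite mulKf// pnatr_eq0.
have [rho [rp r0 sol]] := solution_polar cse ath.
pose v t : 'cV[R]_2 := (rho t * cos (th t)) *: e0 + (- (rho t * sin (th t))) *: e1.
have v0 t : v t 0 0 = rho t * cos (th t) by rewrite !mxE /=; ring.
have v1 t : v t 1 0 = - (rho t * sin (th t)) by rewrite !mxE /=; ring.
have {}sol : solution T A B C l (fun t => pc (v t)) (fun t => qc (v t)).
  apply: solution_frame.
  rewrite (_ : (fun t => _) = (fun t => rho t * cos (th t))); last by apply/funext => t; rewrite pe v0.
  rewrite (_ : (fun t => snd_coord _) = (fun t => rho t * sin (th t)))//.
  by apply/funext => t; rewrite qe v1 opprK.
have q0 : qc (v 0) = 0.
  move: h0; rewrite thE => /(cis_boundary _ u0_neq0) h.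
  rewrite /snd_coord /wedge v0 v1.
  by transitivity (rho 0 * (cos (th 0) * u0 1 0 + sin (th 0) * u0 0 0)); [ring|rewrite h mulr0].
have pE t : pc (v t) = - rho t / wedge u0 u1 * (cos (th t) * u1 1 0 + sin (th t) * u1 0 0).
  by rewrite /fst_coord /dual_vector {1}/wedge v0 v1 !mxE; ring.
have p0 : pc (v 0) != 0.
  apply/eqP => p0; have vz : v 0 = 0 by rewrite (coordsK d0 (v 0)) p0 q0 !scale0r addr0.
  have c0 : cos (th 0) = 0.
    by have := v0 0; rewrite vz mxE r0 mul1r => <-.
  have s0 : sin (th 0) = 0.
    by have := v1 0; rewrite vz mxE r0 mul1r => /esym/eqP; rewrite oppr_eq0 => /eqP.
  by have := cos2Dsin2 (th 0); rewrite c0 s0 expr0n addr0 => /esym/eqP; rewrite oner_eq0.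
pose k := (pc (v 0))^-1.
have solk := solutionD k 0 sol sol.
have hitE t : cis (phi t) = cayley_boundary (boundary_pt u1) <-> pc (v t) = 0.
  rewrite thE (cis_boundary _ u1_neq0) pE; split=> [->|/eqP]; first by rewrite mulr0.
  by rewrite mulf_eq0 mulf_eq0 oppr_eq0 (gt_eqF (rp t)) invr_eq0 (negbTE d0) => /eqP.
apply/seteqP; split=> t [tD].
  move=> /hitE pt; split=> //; exists (fun t => k * pc (v t) + 0 * pc (v t)), (fun t => k * qc (v t) + 0 * qc (v t)).
  by split=> //; rewrite ?q0 ?pt ?mul0r ?mulr0 ?addr0// mulVf.
move=> [p [q [sol' p0' q0' pt]]]; split=> //; apply/hitE.
have [] := solution_unique cs sol' solk _ _ tD.
- by rewrite p0' mul0r addr0 mulVf.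
- by rewrite q0' q0 !mulr0 addr0.
move=> /eqP + _; rewrite pt mul0r addr0 mulf_eq0 invr_eq0 (negbTE p0) => /eqP //.
Qed.

Lemma dirac_carousel_data : carousel_data T gam (boundary_pt u0) (boundary_pt u1) f.
Proof.
have [mW lb lb'] := cB.
(* [f] is the square root of the determinant of the weight, [x = - W01 / W00] and [y = f / W00];
   measurability of all three follows from that of the entries. *)
have fE t : D t -> f t = Num.sqrt (W t 0 0 * W t 1 1 - W t 0 1 * W t 1 0).
  move=> tD; have [y0 f0] := yf tD; have [-> -> -> ->] := WE t.
  rewrite [X in Num.sqrt X](_ : _ = f t ^+ 2); first by rewrite sqrtr_sqr gtr0_norm.
  by field; rewrite gt_eqF.
have minv (g : R -> R) : measurable_fun D g -> measurable_fun D (fun t => (g t)^-1).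
  by move=> mg; apply: measurableT_comp mg; exact: measurable_inv.
have mf : measurable_fun D f.
  have m : measurable_fun D (fun t => Num.sqrt (W t 0 0 * W t 1 1 - W t 0 1 * W t 1 0)).
    apply: (measurableT_comp (f := @Num.sqrt R)).
      by apply: continuous_measurable_fun; exact: sqrt_continuous.
    by apply: measurable_funB; exact: measurable_funM.
  by apply: eq_measurable_fun m => t /set_mem tD; rewrite -fE.
have W00 t : D t -> 0 < W t 0 0.
  by move=> tD; have [-> _ _ _] := WE t; have [? ?] := yf tD; rewrite divr_gt0.
have fs t : D t -> 2 * f t <= W t 0 0 + W t 1 1.
  move=> tD; have [-> _ _ ->] := WE t; have [y0 f0] := yf tD.
  rewrite -subr_ge0 (_ : _ - _ = f t / y t * (x t ^+ 2 + (y t - 1) ^+ 2)).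
    by rewrite mulr_ge0 ?addr_ge0 ?sqr_ge0//; exact/ltW/divr_gt0.
  by field; rewrite gt_eqF.
split.
- by move=> t tD /=; have [] := yf tD.
- split=> /=.
    have m : measurable_fun D (fun t => - W t 0 1 * (W t 0 0)^-1).
      by apply: measurable_funM; [exact: measurableT_comp|exact: minv].
    apply: eq_measurable_fun m => t /set_mem tD; have [-> -> _ _] := WE t.
    by have [y0 f0] := yf tD; field; rewrite !gt_eqF.
  have m : measurable_fun D (fun t => f t * (W t 0 0)^-1).
    by apply: measurable_funM => //; exact: minv.
  apply: eq_measurable_fun m => t /set_mem tD; have [-> _ _ _] := WE t.
  by have [y0 f0] := yf tD; field; rewrite !gt_eqF.
- move=> b bD; have [M hM] := lb b bD; have [M' hM'] := lb' b bD.
  pose N := `|M| + 1; pose N' := `|M'| + 1.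
  have N0 : 0 < N by rewrite ltr_wpDl. have N'0 : 0 < N' by rewrite ltr_wpDl.
  exists (1 - (N * N')^-1); first by rewrite gtrBl invr_gt0 mulr_gt0.
  move=> t tb; have tD := D_seg bD tb; have [y0 f0] := yf tD.
  have eM i : W t i i <= N.
    apply: le_trans (ler_norm _) _; apply: le_trans (normr_entry_le _ _ _) _.
    by apply: le_trans (hM t tb) _; rewrite /N (le_trans (ler_norm _))// lerDl.
  have eM' i : invmx (W t) i i <= N'.
    apply: le_trans (ler_norm _) _; apply: le_trans (normr_entry_le _ _ _) _.
    by apply: le_trans (hM' t tb) _; rewrite /N' (le_trans (ler_norm _))// lerDl.
  have WV := mulmxV (pos_def_unit (cA tD)).
  have [w00 w01 w10 w11] := WE t.
  have ent i j : W t i 0 * invmx (W t) 0 j + W t i 1 * invmx (W t) 1 j = (i == j)%:R.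
    have mulE (M1 M2 : 'M[R]_2) : (M1 *m M2) i j = M1 i 0 * M2 0 j + M1 i 1 * M2 1 j.
      by rewrite !mxE sum2E.
    by rewrite -mulE WV [LHS]mxE.
  have f2 : W t 0 0 * W t 1 1 - W t 0 1 * W t 1 0 = f t ^+ 2.
    by rewrite w00 w01 w10 w11; field; rewrite gt_eqF.
  have V0 : f t ^+ 2 * invmx (W t) 0 0 = W t 1 1.
    have h1 := ent 0 0; have h2 := ent 1 0; rewrite /= in h1 h2.
    transitivity (W t 1 1 * (W t 0 0 * invmx (W t) 0 0 + W t 0 1 * invmx (W t) 1 0) -
      W t 0 1 * (W t 1 0 * invmx (W t) 0 0 + W t 1 1 * invmx (W t) 1 0)); first by rewrite -f2; ring.
    by rewrite h1 h2; ring.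
  have V1 : f t ^+ 2 * invmx (W t) 1 1 = W t 0 0.
    have h1 := ent 0 1; have h2 := ent 1 1; rewrite /= in h1 h2.
    transitivity (W t 0 0 * (W t 1 0 * invmx (W t) 0 1 + W t 1 1 * invmx (W t) 1 1) -
      W t 1 0 * (W t 0 0 * invmx (W t) 0 1 + W t 0 1 * invmx (W t) 1 1)); first by rewrite -f2; ring.
    by rewrite h1 h2; ring.
  have fN' : 1 <= f t * N'.
    have := fs t tD; rewrite -V0 -V1 => h.
    have h' : f t * 2 <= f t * (2 * (f t * N')).
      apply: le_trans (_ : f t ^+ 2 * N' + f t ^+ 2 * N' <= _); last first.
        by rewrite le_eqVlt; apply/orP; left; apply/eqP; ring.
      rewrite mulrC; apply: le_trans h _.
      by apply: lerD; rewrite ler_wpM2l ?sqr_ge0.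
    by move: h'; rewrite (ler_pM2l f0); lra.
  (* One minus the squared modulus is [4 f / (W00 + W11 + 2 f)]. The bound on the weight gives
     [W00 + W11 <= 2 N], that on its inverse gives [1 <= f * N'] because [f ^+ 2] is the
     determinant, and [2 f <= W00 + W11]. *)
  have -> : sqmod (cayley (gam t)) = 1 - (1 - sqmod (cayley (gam t))) by ring.
  rewrite sqmod_cayley// lerD2l lerN2.
  have -> : 4 * y t / (x t ^+ 2 + (y t + 1) ^+ 2) = 4 * f t / (W t 0 0 + W t 1 1 + 2 * f t).
    have y1 : 0 < y t + 1 by rewrite ltr_wpDl ?ltW.
    have n0 : x t ^+ 2 + (y t + 1) ^+ 2 != 0 by rewrite gt_eqF// ltr_wpDl ?sqr_ge0// exprn_gt0.
    have -> : W t 0 0 + W t 1 1 + 2 * f t = f t / y t * (x t ^+ 2 + (y t + 1) ^+ 2).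
      by rewrite w00 w11; field; rewrite gt_eqF.
    by field; rewrite n0 !gt_eqF.
  have s0 := fs t tD.
  have s1 : 0 < W t 0 0 + W t 1 1 + 2 * f t by move: s0 f0; lra.
  rewrite ler_pdivlMr// mulrC ler_pdivrMr ?mulr_gt0//.
  apply: (@le_trans _ _ (4 * N * 1)); first by move: s0 (eM 0) (eM 1); lra.
  rewrite (_ : 4 * f t * (N * N') = 4 * N * (f t * N')); last by ring.
  by rewrite ler_wpM2l// mulr_ge0// ltW.
- exact: boundary_pt_neq.
- split; first by move=> t /yf[].
  move=> b bD; have [M hM] := lb b bD.
  apply: (itg_seg_bounded (M := M)); first exact: (measurable_hointerval_seg bD).
  move=> t tb; have tD := D_seg bD tb; have [_ f0] := yf tD.
  have eM i : W t i i <= M.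
    by apply: le_trans (ler_norm _) _; apply: le_trans (normr_entry_le _ _ _) (hM t tb).
  by rewrite gtr0_norm//; move: (fs t tD) (eM 0) (eM 1); lra.
Qed.

End Carousel.

Local Open Scope complex_scope.

Theorem proposition14 (R : realType) (T : \bar R) (x y f : R -> R)
  (u0 u1 : 'cV[R]_2) (W := dirac_weight x y f) :
  (0 < T)%E ->
  (forall t, hointerval T t -> 0 < y t /\ 0 < f t) ->
  u0 != 0 -> u1 != 0 -> ~ parallel u0 u1 ->
  conditionA T W -> conditionB T W -> conditionC T W ->
  (limit_point_case T W -> (sqnorm T W (fun=> u1) < +oo)%E) ->
  has_Hilbert_Schmidt_inverse T W u0 u1 ->
  let HC := carousel_point_set T (fun t => x t +i* y t)
              (boundary_pt u0) (boundary_pt u1) f in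
  (exists! L, HC L) /\
  (forall L, HC L -> [set l%:C | l in L] = spectrum T W u0 u1).
Proof.
move=> T0 yf u00 u10 npar cA cB _ lp hsinv HC.
have d0 : wedge u0 u1 != 0 by apply/eqP => h; apply: npar; exact: wedge_parallel.
have iB : lebesgue_measure.-integrable (hointerval T) (EFin \o (@coefB R W u0 u1)).
  apply: (itg_coefB T0 cA cB d0).
  by have [lc|nlc] := pselect (limit_circle_case T W); [left|right; exact: lp].
have hs := dirac_hs_system T0 cA cB d0 iB hsinv.
have [_ surj bd _] := hsinv.
have [N [Nlim Ncount]] := eigenvalue_counting hs.
have signedE phi : (forall l, carousel_angle T (fun t => x t +i* y t)%C (boundary_pt u0) f l (phi l)) ->
    forall l, signed_hits T (boundary_pt u1) phi m @[m --> l^'+] --> (N l)%:E.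
  move=> hphi l; rewrite (_ : signed_hits _ _ _ = fun m => ((Num.sg m)%:E *
    counting (@hits R T (@coefA R W u0) (@coefB R W u0 u1) (@coefC R W u0 u1) m))%E)//.
  by apply/funext => m; rewrite /signed_hits (carousel_hits T0 yf cA cB d0 (hphi m)).
have HCe : HC [set l | @eigenvalue R T (@coefA R W u0) (@coefB R W u0 u1) (@coefC R W u0 u1) l].
  exists N => //; split; first exact: dirac_carousel_data.
  have /choice[phi hphi] : forall l, exists ph,
      carousel_angle T (fun t => x t +i* y t)%C (boundary_pt u0) f l ph.
    by move=> l; exact: (carousel_angle_exists T0 yf cA cB l u00).
  by exists phi; split=> //; exact: signedE.
have HCu L : HC L -> L = [set l | @eigenvalue R T (@coefA R W u0) (@coefB R W u0 u1) (@coefC R W u0 u1) l].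
  (* By [carousel_hits] the visits do not depend on the chosen angles, so every admissible counting
     function has the right limits of [N], and the set is then determined by its counts. *)
  move=> [N' [_ [phi [hphi N'lim]]] N'count].
  have NN : N' = N.
    apply/funext => l; suff [//] : (N' l)%:E = (N l)%:E.
    exact: (cvg_unique (@ereal_hausdorff R) (N'lim l) (signedE phi hphi l)).
  rewrite NN in N'count.
  by apply/seteqP; split; [exact: counting_subset N'count Ncount|exact: counting_subset Ncount N'count].
split; first by eexists; split; [exact: HCe|move=> L /HCu ->].
by move=> L /HCu ->; rewrite (spectrumE T0 cA cB d0 hs surj bd).
Qed.
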